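(* Let $W:\mathbb{R}^d\to\mathbb{R}$ be of class $C^2$, symmetric ($W(z)=W(-z)$), with $\sup_{z,v\in\mathbb{R}^d,|v|=1}|v\cdot\nabla^2W(z)\cdot v|<+\infty$, and let $\mu^{\mathrm{in}},\mu^{\mathrm{fin}}\in\mathcal{P}_2(\mathbb{R}^d)$ satisfy $\tilde{\mathcal F}(\mu^{\mathrm{in}})<+\infty$ and $\tilde{\mathcal F}(\mu^{\mathrm{fin}})<+\infty$. Assume in addition that $\int_{\mathbb R^d}\exp(r|x|)\,\mu^{\mathrm{in}}(dx)<\infty$ for all $r>0$. For $N\in\mathbb N$ let $(X^{i,N})_{1\le i\le N}$ solve $$dX^{i,N}_t=-\frac1N\sum_{k=1}^N\nabla W(X^{i,N}_t-X^{k,N}_t)\,dt+dB^i_t,\qquad X^{i,N}_0\sim\mu^{\mathrm{in}},\quad i=1,\dots,N,\ t\in[0,T],$$ where $B^1,\dots,B^N$ are independent Brownian motions and $X_0^{1,N},\dots,X_0^{N,N}$ are independent of each other and of the Brownian motions. Then the sequence of empirical measures $\left\{\frac1N\sum_{i=1}^N\delta_{X^{i,N}}: N\in\mathbb N\right\}$ satisfies the large deviations principle (with speed $N$) on $\mathcal P_1(\Omega)$ equipped with the $\mathcal W_1$-topology, with good rate function $$\mathcal P_1(\Omega)\ni P\mapsto\mathscr I(P)=\begin{cases}\mathcal H(P|\Gamma(P)),& P\ll\Gamma(P),\\+\infty,&\text{otherwise.}\end{cases}$$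
   Context: Fix $d\ge1$, $T>0$. $\Omega=C([0,T];\mathbb{R}^d)$ with the uniform topology; $X$ is the canonical process. $P_t$ is the law of $X_t$ under $P$; $\mathcal P_1(\Omega)$ is the set of Borel probability measures $P$ on $\Omega$ with $\mathbb E_P[\sup_{t\le T}|X_t|]<\infty$, with $\mathcal W_1(P,Q)=\inf_{Y\sim P,Z\sim Q}\mathbb E[\sup_{t\le T}|Y_t-Z_t|]$. $\mathcal P_2(\mathbb R^d)$ is the set of Borel probability measures on $\mathbb R^d$ with finite second moment. A measure and its Lebesgue density are denoted by the same symbol. $\mathcal H(P|Q)=\mathbb E_P[\log\frac{dP}{dQ}]$ if $P\ll Q$ and $+\infty$ otherwise. $\nabla W*\mu(x)=\int\nabla W(x-y)\,\mu(dy)$, similarly $W*\mu$. $\tilde{\mathcal F}(\mu)=\int\log\mu(x)\,\mu(dx)+\int W*\mu(x)\,\mu(dx)$ if $\mu$ is absolutely continuous with respect to Lebesgue measure, and $+\infty$ otherwise. For $P\in\mathcal P_1(\Omega)$, $\Gamma(P)$ is the law of the unique strong solution of $dZ_t=-\nabla W*P_t(Z_t)\,dt+dB_t$, $Z_0\sim\mu^{\mathrm{in}}$, with $B$ a Brownian motion. *)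

(* Defs.v *)
From HB Require Import structures.
From mathcomp Require Import all_boot all_order all_algebra.
From mathcomp Require Import all_classical all_reals all_analysis.
From mathcomp Require Import measurable_realfun.

Set Implicit Arguments.
Unset Strict Implicit.
Unset Printing Implicit Defensive.
Import Order.TTheory GRing.Theory Num.Def Num.Theory.
Import numFieldNormedType.Exports.

Local Open Scope classical_set_scope.
Local Open Scope ring_scope.

(* Borel sigma-algebra of a space of matrices, in particular of R^d = 'rV[R]_d. *)
HB.instance Definition _ (R : realType) (m n : nat) :=
  Measurable.copy 'M[R]_(m, n) (g_sigma_algebraType (@open 'M[R]_(m, n))).

Section euclidean.
Context (R : realType) (d : nat).
Implicit Types (v : 'rV[R]_d) (W : 'rV[R]_d -> R).

(* The library norm `|v| on matrices is the sup norm. *)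
Definition enorm v : R := Num.sqrt (\sum_i (v ord0 i) ^+ 2).

Definition partial (i : 'I_d) W : 'rV[R]_d -> R :=
  'D_(delta_mx ord0 i) W.

Definition classC1 W : Prop := forall i : 'I_d,
  (forall x, derivable W x (delta_mx ord0 i)) /\ continuous (partial i W).

Definition classC2 W : Prop :=
  classC1 W /\ forall i : 'I_d, classC1 (partial i W).

Definition grad W (x : 'rV[R]_d) : 'rV[R]_d := \row_i partial i W x.

Definition hessian W (x : 'rV[R]_d) : 'M[R]_d :=
  \matrix_(i, j) partial i (partial j W) x.

End euclidean.

Section lebesgue_measure_rV.
Context (R : realType).

Lemma mx_open_measurable m n (U : set 'M[R]_(m, n)) : open U -> measurable U.
Proof. exact: sub_sigma_algebra. Qed.

Lemma continuous_mx_measurable m n (f : 'M[R]_(m, n) -> R) :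
  continuous f -> measurable_fun setT f.
Proof.
move=> cf; apply: (measurability _ (RGenOpens.measurableE R)).
move=> _ [_ [a [b ->]] <-]; rewrite setTI; apply: mx_open_measurable.
by move/continuousP: cf; apply; exact: interval_open.
Qed.

Lemma continuous_mx_mx_measurable m n p q (f : 'M[R]_(m, n) -> 'M[R]_(p, q)) :
  continuous f -> measurable_fun setT f.
Proof.
move=> cf; refine (@measurability _ _ 'M[R]_(m, n) 'M[R]_(p, q) _ f _ erefl _).
move=> _ [U oU <-]; rewrite setTI; apply: mx_open_measurable.
by move/continuousP: cf; exact.
Qed.

Definition consrV d (x : R * 'rV[R]_d) : 'rV[R]_d.+1 :=
  row_mx (\row_(_ < 1) x.1) x.2.

Definition unconsrV d (v : 'rV[R]_d.+1) : R * 'rV[R]_d :=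
  (v ord0 ord0, rsubmx (v : 'rV[R]_(1 + d))).

Lemma consrVK d : cancel (@consrV d) (@unconsrV d).
Proof.
move=> [a v]; rewrite /unconsrV /consrV /= row_mxKr; congr (_, _).
by rewrite mxE; case: splitP => [j _|//]; rewrite mxE.
Qed.

Lemma measurable_unconsrV d : measurable_fun setT (@unconsrV d).
Proof.
apply: measurable_fun_pair.
  by apply: continuous_mx_measurable; exact: coord_continuous.
apply: continuous_mx_mx_measurable.
exact: (@continuous_rsubmx _ 1 1 d).
Qed.

Lemma measurable_consrV d : measurable_fun setT (@consrV d).
Proof.
refine (@measurability _ _ (R * 'rV[R]_d)%type 'rV[R]_d.+1 _ _ _ erefl _).
move=> _ [U oU <-]; rewrite setTI.
pose box (k : rat * 'rV[rat]_d * nat) : set (R * 'rV[R]_d) :=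
  ball (ratr k.1.1 : R) k.2.+1%:R^-1 `*`
  ball (map_mx ratr k.1.2 : 'rV[R]_d) k.2.+1%:R^-1.
have mbox k : measurable (box k).
  apply: measurableX; first exact: measurable_ball.
  by apply: mx_open_measurable; exact: ball_open.
have -> : @consrV d @^-1` U =
    \bigcup_k (if `[< box k `<=` @consrV d @^-1` U >] then box k else set0).
  apply/seteqP; split; last first.
    by move=> x [k _]; case: ifPn => // /asboolP; exact.
  move=> [a v] /= Uav.
  have /nbhs_ballP[e /= e0 eU] : nbhs (consrV (a, v)) U by exact: open_nbhs_nbhs.
  have [n] : exists n, n.+1%:R^-1 < e / 2.
    have /ltr_add_invr[n] : 0 < e / 2 by rewrite divr_gt0.
    by rewrite add0r => ?; exists n.
  set r : R := n.+1%:R^-1 => re.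
  have r0 : 0 < r by rewrite invr_gt0.
  have appr (b : R) : exists q : rat, ball (ratr q : R) r b.
    have [q] : exists q, ratr q \in `]b - r, b + r[.
      by apply: rat_in_itvoo; rewrite ltrD2l (lt_trans _ r0)// oppr_lt0.
    rewrite in_itv/= => qb; exists q.
    by rewrite /ball/= distrC ltr_distlC.
  have [q qa] := appr a.
  have [w wv] := choice (fun i => appr (v ord0 i)).
  have inbox : box (q, \row_i w i, n) (a, v).
    split => //=; split => // i j.
    by rewrite !mxE (ord1 i).
  exists (q, \row_i w i, n) => //; case: asboolP => // -[].
  move=> [a' v'] [/= qa' wv']; apply: eU.
  have [/= iba ibv] := inbox.
  have close : ball a e a' /\ ball v e v'.
    have r2 : r + r <= e by rewrite (splitr e) lerD// ltW.
    split.
      by apply: (le_ball r2); apply: ball_triangle qa'; exact/ball_sym/iba.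
    apply: (le_ball r2); apply: ball_triangle wv'; apply: ball_sym.
    exact: ibv.
  split => // i j; rewrite /consrV !mxE; case: splitP => k _; rewrite ?mxE.
    exact: close.1.
  exact: close.2.2.
apply: countable_bigcupT_measurable; first exact: countableP.
by move=> k; case: ifPn.
Qed.

Section step.
Variables (d : nat) (m : {sigma_finite_measure set 'rV[R]_d -> \bar R}).

Definition lebesgue_step : set 'rV[R]_d.+1 -> \bar R :=
  pushforward (lebesgue_measure \x m)%E (@consrV d).

Let lebesgue_step0 : lebesgue_step set0 = 0%E.
Proof. by rewrite /lebesgue_step /pushforward preimage_set0 measure0. Qed.

Let lebesgue_step_ge0 A : (0 <= lebesgue_step A)%E.
Proof. by rewrite /lebesgue_step /pushforward measure_ge0. Qed.

Let lebesgue_step_sigma_additive : semi_sigma_additive lebesgue_step.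
Proof.
move=> F mF tF mUF; rewrite /lebesgue_step /pushforward preimage_bigcup.
have mc A : measurable A -> measurable (@consrV d @^-1` A).
  by move=> mA; rewrite -[X in measurable X]setTI; exact: measurable_consrV.
apply: measure_semi_sigma_additive.
- by move=> n; exact: mc.
- apply/trivIsetP => /= i j _ _ ij; rewrite -preimage_setI.
  by move/trivIsetP : tF => /(_ _ _ _ _ ij) ->//; rewrite preimage_set0.
- by rewrite -preimage_bigcup; exact: mc.
Qed.

HB.instance Definition _ := isMeasure.Build _ _ _ lebesgue_step
  lebesgue_step0 lebesgue_step_ge0 lebesgue_step_sigma_additive.

Let lebesgue_step_sigma_finite : sigma_finite setT lebesgue_step.
Proof.
have /sigma_finiteP[F [FT ndF Foo]] := sigma_finiteT (@lebesgue_measure R).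
have /sigma_finiteP[G [GT ndG Goo]] := sigma_finiteT m.
exists (fun n => @unconsrV d @^-1` (F n `*` G n)).
  rewrite -preimage_bigcup (_ : \bigcup_n _ = setT) ?preimage_setT//.
  apply/seteqP; split => // -[x y] _.
  have [n _ Fnx] : (\bigcup_n F n) x by rewrite -FT.
  have [k _ Gky] : (\bigcup_n G n) y by rewrite -GT.
  exists (maxn n k) => //; split => /=.
    by move: x Fnx; exact/subsetPset/ndF/leq_maxl.
  by move: y Gky; exact/subsetPset/ndG/leq_maxr.
move=> n; have [mF Fn] := Foo n; have [mG Gn] := Goo n; split.
  rewrite -[X in measurable X]setTI; apply: measurable_unconsrV => //.
  exact: measurableX.
rewrite /lebesgue_step /pushforward -comp_preimage.
rewrite (_ : _ \o _ = id) ?preimage_id; last first.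
  by apply/funext => x; exact: consrVK.
by rewrite product_measure1E// lte_mul_pinfty// ge0_fin_numE.
Qed.

HB.instance Definition _ :=
  Measure_isSigmaFinite.Build _ _ _ lebesgue_step lebesgue_step_sigma_finite.

End step.

(* Lebesgue measure on R^d, as an iterated product of the one on R. *)
Fixpoint lebesgue_rV d : {sigma_finite_measure set 'rV[R]_d -> \bar R} :=
  match d with
  | 0 => @dirac _ 'rV[R]_0 0 R
  | d'.+1 => lebesgue_step (lebesgue_rV d')
  end.

End lebesgue_measure_rV.

(* C([0, T]; R^d).  The value 0 imposed outside [0, T] makes the elements of
   this type the continuous functions on [0, T], up to Leibniz equality. *)
Record cpath (R : realType) (d : nat) (T : R) := CPath {
  path_fun :> R -> 'rV[R]_d;
  path_continuous : {within `[0, T], continuous path_fun};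
  path_out : forall t, ~ `[0, T]%classic t -> path_fun t = 0
}.

Section path_space.
Context (R : realType) (d : nat) (T : R).
Local Notation path := (cpath d T).

HB.instance Definition _ := gen_eqMixin path.
HB.instance Definition _ := gen_choiceMixin path.

Definition path0 : path.
Proof.
exists (fun=> 0) => //.
exact: (continuous_subspaceT (@cst_continuous _ _ (0 : 'rV[R]_d))).
Defined.

HB.instance Definition _ := isPointed.Build path path0.

(* Topology of uniform convergence on [0, T], and its Borel sigma-algebra. *)
HB.instance Definition _ := Topological.copy path
  (initial_topology (@path_fun R d T : path -> {uniform` `[0, T] -> 'rV[R]_d})).
HB.instance Definition _ :=
  Measurable.copy path (g_sigma_algebraType (@open path)).

Definition supnorm (x : path) : R := sup [set enorm (x t) | t in `[0, T]].

Definition supdist (x y : path) : R :=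
  sup [set enorm (x t - y t) | t in `[0, T]].

Definition at_time (t : R) (x : path) : 'rV[R]_d := x t.

Lemma continuous_at_time t : continuous (at_time t).
Proof.
have [tT|tT] := pselect (`[0, T]%classic t); last first.
  rewrite (_ : at_time t = cst 0); first exact: cst_continuous.
  by apply/funext => x; exact: path_out.
move=> x W; rewrite -[in X in X -> _]nbhs_entourageE => -[E entE EW].
have cx := @initial_continuous _ _
  (@path_fun R d T : path -> {uniform` `[0, T] -> 'rV[R]_d}) x.
apply: (cx [set h | W (h t)]); apply/uniform_nbhs; exists E; split => // h hE.
by apply: EW; apply/xsectionP; exact: hE.
Qed.

Lemma measurable_at_time t : measurable_fun setT (at_time t).
Proof.
refine (@measurability _ _ path 'rV[R]_d _ _ _ erefl _).
move=> _ [U oU <-]; rewrite setTI; apply: sub_sigma_algebra.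
by move/continuousP: (@continuous_at_time t); exact.
Qed.

HB.instance Definition _ t :=
  isMeasurableFun.Build _ _ _ _ (at_time t) (@measurable_at_time t).

Lemma continuous_enorm : continuous (@enorm R d).
Proof.
move=> v; apply: (@continuous_comp _ _ _ _ (@Num.sqrt R)).
  apply: continuous_big; first exact: add_continuous.
  move=> i _ w; apply: (@continuous_comp _ _ _ _ (fun r : R => r ^+ 2)).
    exact: coord_continuous.
  exact: exprn_continuous.
exact: sqrt_continuous.
Qed.

Lemma enorm_path_ub (x : path) : has_ubound [set enorm (x t) | t in `[0, T]].
Proof.
have : compact ((fun t => enorm (x t)) @` `[0, T]).
  apply: continuous_compact; last exact: segment_compact.
  move=> t; apply: continuous_comp; first exact: path_continuous.
  exact: continuous_enorm.
move=> /compact_bounded[M [_ /(_ (M + 1))]].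
rewrite ltrDl ltr01 => /(_ isT) Mx; exists (M + 1) => y xy.
exact: le_trans (ler_norm _) (Mx _ xy).
Qed.

Lemma supnorm_ge0 x : 0 <= supnorm x.
Proof.
rewrite /supnorm; have [->|/set0P[y xy]] := eqVneq [set enorm (x t) | t in `[0, T]] set0.
  by rewrite sup0.
rewrite (@le_trans _ _ y)//; first by case: xy => t _ <-; exact: sqrtr_ge0.
by apply: ub_le_sup => //; exact: enorm_path_ub.
Qed.

Lemma measurable_supnorm : measurable_fun setT supnorm.
Proof.
have [T0|T0] := pselect ([set enorm (path0 t) | t in `[0, T]] = set0).
  rewrite (_ : supnorm = cst 0)//; apply/funext => x.
  rewrite /supnorm (_ : [set _ | _ in _] = set0) ?sup0//.
  by move/image_set0_set0 : T0 => ->; rewrite image_set0.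
apply: (measurability _ (RGenOInfty.measurableE R)).
move=> _ [_ [a ->] <-]; rewrite setTI; apply: sub_sigma_algebra.
rewrite (_ : _ @^-1` _ =
    \bigcup_(t in `[0, T]) (at_time t @^-1` (@enorm R d @^-1` `]a, +oo[))).
  apply: bigcup_open => t _; move/continuousP: (@continuous_at_time t); apply.
  move/continuousP: continuous_enorm; apply; exact: interval_open.
apply/seteqP; split=> x.
  rewrite /= in_itv/= andbT => /sup_gt[].
    move/eqP/set0P : T0 => [_ [t tT _]]; by exists (enorm (x t)), t.
  by move=> _ [t tT <-] ax; exists t => //=; rewrite in_itv/= andbT.
move=> [t tT]; rewrite /= !in_itv/= !andbT => ax.
by apply: lt_le_trans ax _; apply: ub_le_sup; [exact: enorm_path_ub|exists t].
Qed.

End path_space.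

Section probability_notions.
Context (R : realType) (dS : measure_display) (S : measurableType dS).
Variable PP : probability S R.

Definition has_law dE (E : measurableType dE) (X : S -> E)
    (mu : set E -> \bar R) : Prop :=
  forall A, measurable A -> PP (X @^-1` A) = mu A.

(* The sigma-algebra generated by X. *)
Definition sigma_of dE (E : measurableType dE) (X : S -> E) : set (set S) :=
  preimage_set_system setT X measurable.

Definition mutually_independent (I : finType) (F : I -> set (set S)) : Prop :=
  forall (J : {set I}) (A : I -> set S), (forall i, i \in J -> F i (A i)) ->
    PP (\bigcap_(i in [set` J]) A i) = (\prod_(i in J) PP (A i))%E.

(* The standard Brownian motion of R^d on [0, T], started at 0; the second
   parameter of normal_prob is the standard deviation. *)
Definition brownian_motion d (T : R) (B : {mfun S >-> cpath d T}) : Prop :=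
  [/\ {ae PP, forall w, B w 0 = 0},
      forall s t, 0 <= s -> s < t -> t <= T ->
        forall A : 'I_d -> set R, (forall i, measurable (A i)) ->
        PP [set w | forall i, A i ((B w t - B w s) ord0 i)] =
        (\prod_i normal_prob 0 (Num.sqrt (t - s)) (A i))%E
    & forall (n : nat) (t : nat -> R), {homo t : i j / (i <= j)%N >-> i <= j} ->
        0 <= t 0%N -> t n <= T ->
        mutually_independent (fun k : 'I_n =>
          sigma_of (fun w => B w (t k.+1) - B w (t k)))].

(* dZ_t = b_t dt + dB_t on [0, T]: as the noise is additive, the integral form
   of the equation only involves a Lebesgue integral, taken coordinatewise. *)
Definition solves_sde d (T : R) (b : R -> S -> 'rV[R]_d)
    (B Z : {mfun S >-> cpath d T}) : Prop :=
  {ae PP, forall w, forall t, 0 <= t <= T ->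
    Z w t = Z w 0
      + \row_i (\int[lebesgue_measure]_(s in `[0%R, t]) (b s w ord0 i))%R
      + B w t}.

(* Adaptedness to the filtration generated by Z_0 and B, completed with the
   negligible sets. *)
Definition strongly_adapted d (T : R) (B Z : {mfun S >-> cpath d T}) : Prop :=
  forall t, 0 <= t <= T -> forall A : set 'rV[R]_d, measurable A ->
  exists2 C : set S,
    <<s sigma_of (fun w => Z w 0) `|`
        \bigcup_(s in `[0, t]) sigma_of (fun w => B w s) >> C &
    PP.-negligible ([set w | A (Z w t)] `+` C).

End probability_notions.

Section large_deviations.
Context (R : realType) (E : topologicalType).
Local Open Scope ereal_scope.

Definition good_rate_function (I : E -> \bar R) : Prop :=
  [/\ forall x, 0 <= I x,
      lower_semicontinuous I &
      forall a : R, compact [set x | I x <= a%:E]].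

(* Large deviations principle with speed a for the laws of the Y n under PP n;
   the first item makes these laws Borel measures on E. *)
Definition ldp (a : nat -> R) (dS : nat -> measure_display)
    (S : forall n, measurableType (dS n)) (PP : forall n, probability (S n) R)
    (Y : forall n, S n -> E) (I : E -> \bar R) : Prop :=
  [/\ forall n U, open U -> measurable (Y n @^-1` U),
      forall F, closed F ->
        limn_esup (fun n => (a n)^-1%:E * lne (PP n (Y n @^-1` F))) <=
        - ereal_inf [set I x | x in F]
    & forall G, open G ->
        - ereal_inf [set I x | x in G] <=
        limn_einf (fun n => (a n)^-1%:E * lne (PP n (Y n @^-1` G)))].

End large_deviations.

(* P_1(Omega).  Elements of the library type of probabilities are set functions
   on all sets, so two distinct elements of this type may coincide on the Borel
   sets; they are then at W_1-distance 0. *)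
Record prob1 (R : realType) (d : nat) (T : R) := Prob1 {
  prob1_law :> probability (cpath d T) R;
  prob1_moment : (\int[prob1_law]_x (supnorm x)%:E < +oo)%E
}.

Section wasserstein.
Context (R : realType) (d : nat) (T : R).
Local Notation path := (cpath d T).
Local Notation prob1 := (prob1 d T).

Definition W1 (P Q : probability path R) : \bar R :=
  ereal_inf [set e : \bar R |
    exists (dS : measure_display) (S : measurableType dS)
           (PP : probability S R) (Y Z : {mfun S >-> path}),
      [/\ has_law PP Y P, has_law PP Z Q &
          e = (\int[PP]_w (supdist (Y w) (Z w))%:E)%E]].

HB.instance Definition _ := gen_eqMixin prob1.
HB.instance Definition _ := gen_choiceMixin prob1.

(* The topology of the distance W1. *)
Definition W1_open (U : set prob1) : Prop :=
  forall P, U P -> exists2 e : R, 0 < e &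
    forall Q : prob1, (W1 P Q < e%:E)%E -> U Q.

Let W1_openT : W1_open setT.
Proof. by move=> P _; exists 1. Qed.

Let W1_openI : setI_closed W1_open.
Proof.
move=> U V oU oV P [/oU[e e0 eU] /oV[f f0 fV]].
exists (Num.min e f); first by rewrite lt_min e0.
move=> Q PQ; split; [apply: eU|apply: fV]; apply: lt_le_trans PQ _.
  by rewrite lee_fin ge_min lexx.
by rewrite lee_fin ge_min lexx orbT.
Qed.

Let W1_open_bigU (I : Type) (f : I -> set prob1) :
  (forall i, W1_open (f i)) -> W1_open (\bigcup_i f i).
Proof.
move=> fo P [i _ /fo[e e0 eP]]; exists e => // Q /eP fiQ; by exists i.
Qed.

HB.instance Definition _ :=
  isOpenTopological.Build prob1 W1_openT W1_openI W1_open_bigU.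

Section empirical.
Variables (n : nat) (x : 'I_n.+1 -> path).

(* (1/N) \sum_(i < N) \d_(x i) with N = n.+1. *)
Definition empirical : set path -> \bar R :=
  mscale (n.+1%:R^-1)%:nng (msum (fun k => \d_(x (inord k))) n.+1).

HB.instance Definition _ := Measure.on empirical.

Let empirical_setT : empirical setT = 1%E.
Proof.
have -> : empirical setT =
    ((n.+1%:R^-1)%:E * \sum_(k < n.+1) \d_(x (inord k)) setT)%E by [].
rewrite (eq_bigr (fun=> 1%:E)); last by move=> i _; rewrite diracT.
rewrite sumEFin sumr_const card_ord -EFinM.
by rewrite -mulr_natr mul1r mulVf// pnatr_eq0.
Qed.

HB.instance Definition _ :=
  Measure_isProbability.Build _ _ _ empirical empirical_setT.

Lemma empirical_moment : (\int[empirical]_y (supnorm y)%:E < +oo)%E.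
Proof.
have ms : measurable_fun setT (fun y : path => (supnorm y)%:E).
  by apply/measurable_EFinP; exact: measurable_supnorm.
rewrite ge0_integral_mscale//; last by move=> y _; rewrite lee_fin supnorm_ge0.
rewrite ge0_integral_measure_sum//; last first.
  by move=> y _; rewrite lee_fin supnorm_ge0.
rewrite (eq_bigr (fun i : 'I_n.+1 => (supnorm (x (inord i)))%:E)); last first.
  by move=> i _; rewrite integral_dirac// diracT mul1e.
by rewrite sumEFin -EFinM ltry.
Qed.

Definition empirical_prob1 : prob1 := Prob1 empirical_moment.

End empirical.
End wasserstein.

Section mean_field.
Local Open Scope charge_scope.
Context (R : realType) (d : nat) (T : R) (W : 'rV[R]_d -> R).
Local Notation path := (cpath d T).
Local Notation prob1 := (prob1 d T).

Definition conv_grad (mu : probability 'rV[R]_d R) (x : 'rV[R]_d) : 'rV[R]_d :=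
  \row_i (\int[mu]_y (grad W (x - y) ord0 i))%R.

Definition marginal (P : probability path R) (t : R) :
  probability 'rV[R]_d R := distribution P (@at_time R d T t).

(* Well-defined in ]-oo, +oo] when mu has a finite second moment and W grows at
   most quadratically; lne is the logarithm with lne 0 = -oo. *)
Definition free_energy (mu : probability 'rV[R]_d R) : \bar R :=
  if `[< mu `<< lebesgue_rV R d >] then
    ((\int[mu]_x lne ('d (charge_of_finite_measure mu) '/d (lebesgue_rV R d) x))
     + (\int[mu]_x \int[mu]_y (W (x - y))%:E))%E
  else +oo%E.

Definition rel_entropy (P Q : probability path R) : \bar R :=
  if `[< P `<< Q >] then
    (\int[P]_x lne ('d (charge_of_finite_measure P) '/d Q x))%E
  else +oo%E.

Definition law_of_nonlinear_sde (muin : probability 'rV[R]_d R) (P : prob1)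
    (Q : probability path R) : Prop :=
  exists (dS : measure_display) (S : measurableType dS) (PP : probability S R)
         (B Z : {mfun S >-> path}),
    [/\ brownian_motion PP B,
        mutually_independent PP (fun b : bool =>
          if b then sigma_of (fun w => Z w 0) else sigma_of B),
        has_law PP (fun w => Z w 0) muin,
        solves_sde PP (fun t w => - conv_grad (marginal P t) (Z w t)) B Z /\
        strongly_adapted PP B Z
      & has_law PP Z Q].

(* The law of the strong solution is unique, which makes this choice
   meaningful. *)
Definition Gamma (muin : probability 'rV[R]_d R) (P : prob1) :
    probability path R :=
  get (law_of_nonlinear_sde muin P).

Definition rate (muin : probability 'rV[R]_d R) (P : prob1) : \bar R :=
  if `[< P `<< Gamma muin P >] then rel_entropy P (Gamma muin P) else +oo%E.

Definition particle_system dS (S : measurableType dS) (PP : probability S R)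
    (muin : probability 'rV[R]_d R) (N : nat)
    (B X : 'I_N -> {mfun S >-> path}) : Prop :=
  [/\ forall i, brownian_motion PP (B i),
      mutually_independent PP (fun k : 'I_N + 'I_N =>
        match k with
        | inl i => sigma_of (fun w => X i w 0)
        | inr i => sigma_of (B i)
        end),
      forall i, has_law PP (fun w => X i w 0) muin
    & forall i, solves_sde PP
        (fun t w => - (N%:R^-1 *: \sum_k grad W (X i w t - X k w t)))
        (B i) (X i)].

End mean_field.

(* Main.v *)
(* Since the noise is additive, everything is pathwise.  For a law P on paths,
   the map forward P : x |-> x + int_0^. (grad W * P_s)(x_s) ds is a bi-Lipschitz
   bijection of the path space (Picard iteration), it turns the solution of the
   nonlinear equation with drift - grad W * P_t into its noise Z_0 + B, and it
   turns the particles into their noises X^i_0 + B^i when P is their empirical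
   measure.  Let Phi P be the image of P by forward P and let Q be the law of
   the noise.  Then

   - the image by Phi of the empirical measure of the particles is the empirical
     measure of independent paths of law Q;
   - Gamma P is the image of Q by the inverse of forward P, so that
     H(P | Gamma P) = H(Phi P | Q);
   - Phi is a bi-Lipschitz surjection for W_1, since the Lipschitz bounds on
     grad W close up in a norm weighted by exp(- lam t).

   The claim thus reduces to Sanov's theorem for Q in W_1, which follows from the
   existence of exponential moments of the supremum norm under Q: paths are
   replaced by the nearest of finitely many elements of a dense sequence, where
   the finite Sanov theorem applies, and the error is controlled by Chernoff's
   bound.  Compactness of the sublevel sets of H(. | Q) for W_1 is proved by
   taking limits of set functions along ultrafilters. *)

Require Import Defs.
From HB Require Import structures.
From mathcomp Require Import all_boot all_order all_algebra.
From mathcomp Require Import all_classical all_reals all_analysis.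
From mathcomp Require Import measurable_realfun ring lra.

Set Implicit Arguments.
Unset Strict Implicit.
Unset Printing Implicit Defensive.
Import Order.TTheory GRing.Theory Num.Def Num.Theory.
Import numFieldNormedType.Exports.

Local Open Scope classical_set_scope.
Local Open Scope ring_scope.

(** * The Euclidean norm and dyadic grids *)

(** Three obstacles shape the development. Couplings for [W1] live on arbitrary spaces, and joining
    two of them along a common marginal would call for disintegration; they are joined instead only
    up to a finite partition into cells, conditionally independently, at the price of a quantisation
    error. For laws with a first moment this error vanishes as the partition is refined, which
    yields the triangle inequality; the same device bounds [W1] by differences of finitely many cell
    probabilities, where finite combinatorics enters. Next, the entropy is handled in its dual form
    against bounded test functions: this form passes at once to images of measures and to setwise
    limits. Finally, [Phi] is never inverted as a map on laws: [W1] separates laws only by their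
    values on Borel sets, so a preimage is obtained up to these values, and the two-sided Lipschitz
    bound transports neighbourhoods. The exponential moments of the noise come from chaining over
    grids of mesh T / 4 ^ n, on which increments have standard deviation sqrt T / 2 ^ n. *)

Section enorm.
Context (R : realType) (d : nat).
Implicit Types (u v w : 'rV[R]_d).

Lemma enorm_ge0 v : 0 <= enorm v.
Proof. exact: sqrtr_ge0. Qed.

Lemma enorm0 : enorm (0 : 'rV[R]_d) = 0.
Proof.
by rewrite /enorm big1 ?sqrtr0// => i _; rewrite mxE expr0n.
Qed.

Lemma enormN v : enorm (- v) = enorm v.
Proof. by congr (Num.sqrt _); apply: eq_bigr => i _; rewrite mxE sqrrN. Qed.

Lemma enormZ (a : R) v : enorm (a *: v) = `|a| * enorm v.
Proof.
rewrite /enorm -sqrtr_sqr -sqrtrM ?sqr_ge0//; congr (Num.sqrt _).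
by rewrite mulr_sumr; apply: eq_bigr => i _; rewrite mxE exprMn.
Qed.

Lemma sqr_enorm v : enorm v ^+ 2 = \sum_i v ord0 i ^+ 2.
Proof. by rewrite sqr_sqrtr// sumr_ge0// => i _; exact: sqr_ge0. Qed.

Lemma enorm_cauchy_schwarz u v :
  \sum_i u ord0 i * v ord0 i <= enorm u * enorm v.
Proof.
rewrite (le_trans (ler_norm _))// -sqrtr_sqr /enorm -sqrtrM; last first.
  by apply: sumr_ge0 => i _; exact: sqr_ge0.
rewrite ler_wsqrtr//.
have : 0 <= \sum_i \sum_j (u ord0 i * v ord0 j - u ord0 j * v ord0 i) ^+ 2.
  by apply: sumr_ge0 => i _; apply: sumr_ge0 => j _; exact: sqr_ge0.
rewrite (_ : \sum_i _ = 2 * ((\sum_i u ord0 i ^+ 2) * (\sum_i v ord0 i ^+ 2))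
   - 2 * (\sum_i u ord0 i * v ord0 i) ^+ 2).
  by rewrite subr_ge0 ler_pM2l.
rewrite expr2 !big_distrlr/= !mulr_sumr.
have -> : \sum_i 2 * (\sum_j u ord0 i ^+ 2 * v ord0 j ^+ 2) =
  \sum_i \sum_j (u ord0 i ^+ 2 * v ord0 j ^+ 2 + u ord0 j ^+ 2 * v ord0 i ^+ 2).
  under [RHS]eq_bigr do rewrite big_split/=.
  rewrite big_split/= [X in _ + X]exchange_big/= -mulr_sumr.
  by rewrite mulr2n mulrDl mul1r.
rewrite -sumrB; apply: eq_bigr => i _; rewrite mulr_sumr -sumrB.
by apply: eq_bigr => j _; ring.
Qed.

Lemma enormD u v : enorm (u + v) <= enorm u + enorm v.
Proof.
rewrite -(ler_pXn2r (n := 2)) ?nnegrE ?addr_ge0 ?enorm_ge0//.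
rewrite sqrrD !sqr_enorm.
have -> : \sum_i (u + v) ord0 i ^+ 2 = \sum_i u ord0 i ^+ 2 +
    (\sum_i u ord0 i * v ord0 i) *+ 2 + \sum_i v ord0 i ^+ 2.
  rewrite -sumrMnl -!big_split; apply: eq_bigr => i _ /=.
  by rewrite mxE sqrrD.
by rewrite lerD2r lerD2l lerMn2r enorm_cauchy_schwarz orbT.
Qed.

Lemma enormB u v : enorm (u - v) = enorm (v - u).
Proof. by rewrite -enormN opprB. Qed.

Lemma enorm_triangle w u v : enorm (u - v) <= enorm (u - w) + enorm (w - v).
Proof. by rewrite (le_trans _ (enormD _ _))// addrA subrK. Qed.

Lemma coord_le_enorm v i : `|v ord0 i| <= enorm v.
Proof.
rewrite -sqrtr_sqr ler_wsqrtr// (bigD1 i)//= lerDl.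
by apply: sumr_ge0 => j _; exact: sqr_ge0.
Qed.

Lemma enorm_le_sum v : enorm v <= \sum_i `|v ord0 i|.
Proof.
rewrite -(ler_pXn2r (n := 2)) ?nnegrE ?enorm_ge0//; last exact: sumr_ge0.
rewrite sqr_enorm expr2 big_distrlr/=; apply: ler_sum => i _.
rewrite (bigD1 i)//= -normrM -expr2 ger0_norm ?sqr_ge0// lerDl.
by apply: sumr_ge0 => j _; rewrite mulr_ge0.
Qed.

Lemma enorm_le_coord v (M : R) : (forall i, `|v ord0 i| <= M) ->
  enorm v <= d%:R * M.
Proof.
move=> vM; rewrite (le_trans (enorm_le_sum _))//.
rewrite (le_trans (ler_sum _ (fun i _ => vM i)))//.
by rewrite sumr_const card_ord mulr_natl.
Qed.

Lemma norm_le_enorm v : `|v| <= enorm v.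
Proof.
rewrite /Num.norm/= mx_normrE; apply/bigmax_leP; split; first exact: enorm_ge0.
by move=> [i j] _ /=; rewrite (ord1 i) coord_le_enorm.
Qed.

Lemma enorm_le_norm v : enorm v <= d%:R * `|v|.
Proof.
apply: enorm_le_coord => i.
rewrite /Num.norm/= mx_normrE.
exact: (le_bigmax _ (fun i => `|v i.1 i.2|) (ord0, i)).
Qed.

Lemma enorm_eq0 v : enorm v = 0 -> v = 0.
Proof.
move=> v0; apply/rowP => i; apply/eqP; rewrite mxE -normr_le0 -v0.
exact: coord_le_enorm.
Qed.

End enorm.

Section grid.
Context (R : realType) (T : R).
Hypothesis T0 : 0 < T.

(** The base is 4 because a Brownian increment over one mesh then has standard deviation sqrt T / 2
    ^ n: the weights 2 ^ n.+1 of the chaining argument compensate it equally at every level. *)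
Definition mesh n : R := T / (4 ^ n)%:R.
Definition grid n k : R := k%:R * mesh n.

Lemma mesh_gt0 n : 0 < mesh n.
Proof. by rewrite divr_gt0// ltr0n expn_gt0. Qed.

Lemma grid_ge0 n k : 0 <= grid n k.
Proof. by rewrite mulr_ge0// ltW// mesh_gt0. Qed.

Lemma grid_end n : grid n (4 ^ n) = T.
Proof. by rewrite /grid mulrC divfK// pnatr_eq0 expn_eq0. Qed.

Lemma ler_grid n : {mono grid n : i j / (i <= j)%N >-> i <= j}.
Proof. by move=> i j; rewrite ler_pM2r ?mesh_gt0// ler_nat. Qed.

Lemma ltr_grid n : {mono grid n : i j / (i < j)%N >-> i < j}.
Proof. by move=> i j; rewrite ltr_pM2r ?mesh_gt0// ltr_nat. Qed.

Lemma grid_itv n k : (k <= 4 ^ n)%N -> 0 <= grid n k <= T.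
Proof. by move=> kn; rewrite grid_ge0 -[leRHS](grid_end n) ler_grid. Qed.

Lemma gridS n k : grid n k = grid n.+1 (4 * k)%N.
Proof.
rewrite /grid /mesh expnS !natrM; field.
by rewrite pnatr_eq0 expn_eq0.
Qed.

Lemma grid_diff n k : grid n k.+1 - grid n k = mesh n.
Proof. by rewrite /grid -mulrBl -natrB// subSn// subnn mul1r. Qed.

Lemma grid_approx n (t : R) : 0 <= t <= T ->
  exists2 k, (k <= 4 ^ n)%N & grid n k <= t <= grid n k + mesh n.
Proof.
move=> /andP[t0 tT]; exists (truncn (t / mesh n)).
  rewrite -(ler_nat R) (@le_trans _ _ (t / mesh n))//.
    by rewrite truncn_le divr_ge0// ltW// mesh_gt0.
  by rewrite ler_pdivrMr ?mesh_gt0// (le_trans tT)// -[leLHS](grid_end n).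
have /andP[h1 h2] := truncn_itv (divr_ge0 t0 (ltW (mesh_gt0 n))).
rewrite /grid -ler_pdivlMr ?mesh_gt0// h1/=.
by rewrite -[X in _ + X]mul1r -mulrDl -ler_pdivrMr ?mesh_gt0// natr1 ltW.
Qed.

Lemma mesh_small (e : R) : 0 < e -> \forall n \near \oo, mesh n < e.
Proof.
move=> e0; near=> n.
have h : T / e < n%:R by near: n; exact: nbhs_infty_gtr.
rewrite /mesh ltr_pdivrMr ?ltr0n ?expn_gt0// mulrC -ltr_pdivrMr//.
by rewrite (lt_le_trans h)// ler_nat ltnW// ltn_expl.
Unshelve. all: by end_near. Qed.

End grid.

(** * The space of paths *)

Section path_metric.
Context (R : realType) (d : nat) (T : R).
Local Notation path := (cpath d T).
Implicit Types (x y z : path).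

Lemma within_enormP (f : R -> 'rV[R]_d) :
  {within `[0, T], continuous f} <->
  forall t, 0 <= t <= T -> forall e : R, 0 < e -> exists2 r : R, 0 < r &
    forall s, 0 <= s <= T -> `|s - t| < r -> enorm (f s - f t) < e.
Proof.
rewrite subspace_continuousP; split => cf t.
  move=> tT e e0; have tT' : `[0, T]%classic t by rewrite /= in_itv.
  have /cvgrPdist_lt /(_ (e / d.+1%:R)) := cf t tT'.
  rewrite divr_gt0// => /(_ isT).
  rewrite /= near_withinE near_simpl => /nbhs_ballP[r /= r0 rP].
  exists r => // s sT st.
  rewrite enormB (le_lt_trans (enorm_le_norm _))//.
  have := rP s; rewrite /ball/= distrC => /(_ st); rewrite in_itv/= => /(_ sT).
  rewrite ltr_pdivlMr// mulrC; apply: le_lt_trans.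
  by rewrite ler_wpM2r// ler_nat.
rewrite /= in_itv/= => tT; apply/cvgrPdist_lt => e e0.
have [r r0 rP] := cf t tT e e0.
rewrite near_withinE; apply/nbhs_ballP; exists r => // s; rewrite /ball/= => st.
rewrite in_itv/= => sT; rewrite distrC in st.
by rewrite (le_lt_trans (norm_le_enorm _))// enormB rP.
Qed.

Lemma path_cts x t : 0 <= t <= T -> forall e : R, 0 < e -> exists2 r : R, 0 < r &
  forall s, 0 <= s <= T -> `|s - t| < r -> enorm (x s - x t) < e.
Proof. by move: t; apply/within_enormP; exact: path_continuous. Qed.

Lemma mkpath_proof (f : R -> 'rV[R]_d) :
  {within `[0, T], continuous f} ->
  {within `[0, T], continuous (fun t => if 0 <= t <= T then f t else 0)}.
Proof.
move=> /within_enormP cf; apply/within_enormP => t tT e e0.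
have [r r0 rP] := cf t tT e e0; exists r => // s sT st.
by rewrite sT tT; exact: rP.
Qed.

Definition mkpath (f : R -> 'rV[R]_d) (cf : {within `[0, T], continuous f}) : path.
Proof.
exists (fun t => if 0 <= t <= T then f t else 0); first exact: mkpath_proof.
by move=> t; rewrite /= in_itv/= => /negP/negbTE ->.
Defined.

Lemma mkpathE f cf t : 0 <= t <= T -> @mkpath f cf t = f t.
Proof. by move=> /= ->. Qed.

(** The value 0 imposed outside the interval determines the whole function, and proof irrelevance
    identifies the two remaining fields. *)
Lemma path_eq x y : (forall t, 0 <= t <= T -> x t = y t) -> x = y.
Proof.
move=> xy; have : path_fun x = path_fun y.
  apply/funext => t; have [tT|tT] := boolP (0 <= t <= T); first exact: xy.
  by rewrite !path_out//= in_itv/=; exact/negP.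
case: x y {xy} => [f cf of_] [g cg og]/= fg.
move: cf of_; rewrite fg => cf of_.
by rewrite (Prop_irrelevance cf cg) (Prop_irrelevance of_ og).
Qed.

Lemma supdist_has_ubound x y :
  has_ubound [set enorm (x t - y t) | t in `[0, T]].
Proof.
have [M1 hM1] := enorm_path_ub x; have [M2 hM2] := enorm_path_ub y.
exists (M1 + M2) => _ [t tT <-]; rewrite (le_trans (enormD _ _))// enormN.
by rewrite lerD//; [apply: hM1|apply: hM2]; exists t.
Qed.

Lemma enorm_le_supdist x y t : enorm (x t - y t) <= supdist x y.
Proof.
have [tT|tT] := boolP (0 <= t <= T).
  by apply: ub_le_sup; [exact: supdist_has_ubound|exists t; rewrite //= in_itv].
rewrite [x t]path_out ?[y t]path_out ?subrr ?enorm0/= ?in_itv/=; try exact/negP.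
rewrite /supdist; have [->|/set0P[e xe]] := eqVneq [set enorm (x t - y t) | t in `[0, T]] set0.
  by rewrite sup0.
apply: le_trans (ub_le_sup (supdist_has_ubound x y) xe).
by case: xe => s _ <-; exact: enorm_ge0.
Qed.

Lemma supdist_ge0 x y : 0 <= supdist x y.
Proof. by apply: le_trans (enorm_le_supdist x y 0); exact: enorm_ge0. Qed.

Lemma supdist_le x y (M : R) : 0 <= M ->
  (forall t, 0 <= t <= T -> enorm (x t - y t) <= M) -> supdist x y <= M.
Proof.
move=> M0 xyM.
have [h|/set0P xe] := eqVneq [set enorm (x t - y t) | t in `[0, T]] set0.
  by rewrite /supdist h sup0.
apply: ge_sup => // _ [t /= tT <-]; apply: xyM; by rewrite in_itv in tT.
Qed.

Lemma supdistC x y : supdist x y = supdist y x.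
Proof.
apply/eqP; rewrite eq_le; apply/andP; split; apply: supdist_le;
 rewrite ?supdist_ge0// => t _; rewrite enormB; exact: enorm_le_supdist.
Qed.

Lemma supdist_triangle y x z : supdist x z <= supdist x y + supdist y z.
Proof.
apply: supdist_le; first by rewrite addr_ge0 ?supdist_ge0.
move=> t _; rewrite (le_trans (enorm_triangle (y t) _ _))// lerD//;
  exact: enorm_le_supdist.
Qed.

Lemma supdistxx x : supdist x x = 0.
Proof.
apply/eqP; rewrite eq_le supdist_ge0 andbT; apply: supdist_le => // t _.
by rewrite subrr enorm0.
Qed.

Lemma supdistx0 x : supdist x (path0 d T) = supnorm x.
Proof. by congr sup; apply: eq_imagel => t _; rewrite /= subr0. Qed.

Lemma enorm_le_supnorm x t : enorm (x t) <= supnorm x.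
Proof. by rewrite -supdistx0 -[x t]subr0; exact: (enorm_le_supdist x (path0 d T)). Qed.

Lemma supnorm_le x (M : R) : 0 <= M ->
  (forall t, 0 <= t <= T -> enorm (x t) <= M) -> supnorm x <= M.
Proof.
move=> M0 xM; rewrite -supdistx0; apply: supdist_le => // t tT.
by rewrite subr0 xM.
Qed.

Lemma supnorm_le_dist x y : supnorm x <= supdist x y + supnorm y.
Proof. by rewrite -!supdistx0 supdist_triangle. Qed.

Lemma supdist_le_norm x y : supdist x y <= supnorm x + supnorm y.
Proof. by rewrite -!supdistx0 (supdistC y) supdist_triangle. Qed.

Lemma nbhs_supdistP x (U : set path) :
  nbhs x U <-> exists2 e : R, 0 < e & forall y, supdist x y < e -> U y.
Proof.
pose F := (@path_fun R d T : path -> {uniform` `[0, T] -> 'rV[R]_d}).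
have nb (y : path) (V : set path) : nbhs y V <-> exists2 V', nbhs (F y) V' & F @^-1` V' `<=` V.
  rewrite nbhsE; split.
    move=> [_ [[V' oV' <-]] V'y V'V]; exists V' => //; exact: open_nbhs_nbhs.
  move=> [V' + V'V]; rewrite nbhsE => -[V'' [oV'' V''y] V''V'].
  exists (F @^-1` V''); first by split => //; exists V''.
  by apply: subset_trans V'V => z /V''V'.
rewrite nb; split.
  move=> [V' /uniform_nbhs[E [entE EV']] V'U].
  move: entE; rewrite -entourage_ballE => -[e /= e0 eE].
  exists e => // y xy; apply: V'U; apply: EV' => t tT; apply: eE => /=.
  rewrite -ball_normE/= (le_lt_trans (norm_le_enorm _))//.
  exact: le_lt_trans (enorm_le_supdist x y t) xy.
(* A supremum of strict inequalities is only a weak one, hence e / 2; the factor d.+1 compares the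
   two norms and stays nonzero for d = 0. *)
move=> [e e0 eU]; exists [set h | forall t, `[0, T]%classic t -> ball (x t) (e / 2 / d.+1%:R) (h t)].
  apply/uniform_nbhs; exists [set ab | ball ab.1 (e / 2 / d.+1%:R) ab.2]; split => //.
  rewrite -entourage_ballE; exists (e / 2 / d.+1%:R) => //=.
  by rewrite !divr_gt0.
move=> y /= xy; apply: eU; apply: (@le_lt_trans _ _ (e / 2)); last first.
  by rewrite ltr_pdivrMr// mulr2n mulrDr mulr1 ltrDl.
apply: supdist_le; first by rewrite divr_ge0// ltW.
move=> t tT; rewrite (le_trans (enorm_le_norm _))//.
have := xy t; rewrite /= in_itv/= => /(_ tT).
rewrite -ball_normE/= ltr_pdivlMr// => /ltW; apply: le_trans.
by rewrite mulrC ler_wpM2l// ler_nat.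
Qed.

Lemma path_openP (U : set path) :
  open U <-> forall x, U x -> exists2 e : R, 0 < e & forall y, supdist x y < e -> U y.
Proof.
rewrite openE; split => oU x /oU; first by move=> /nbhs_supdistP.
by move=> ?; exact/nbhs_supdistP.
Qed.

Lemma lipschitz_path_measurable (C : R) (f : path -> path) :
  (forall x y, supdist (f x) (f y) <= C * supdist x y) -> measurable_fun setT f.
Proof.
move=> fC; refine (@measurability _ _ path path _ _ _ erefl _).
move=> _ [U /path_openP oU <-]; rewrite setTI; apply: sub_sigma_algebra.
apply/path_openP => x /= /oU[e e0 eU].
exists (e / (`|C| + 1)) => [|y]; first by rewrite divr_gt0// ltr_wpDl.
rewrite ltr_pdivlMr; last by rewrite ltr_wpDl.
move=> xy; apply: eU; rewrite (le_lt_trans (fC _ _))// (le_lt_trans _ xy)//.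
rewrite mulrC ler_wpM2l ?supdist_ge0//.
by rewrite (le_trans (ler_norm _))// lerDl.
Qed.

Lemma lipschitz_real_measurable (C : R) (f : path -> R) :
  (forall x y, `|f x - f y| <= C * supdist x y) -> measurable_fun setT f.
Proof.
move=> fC; apply: (measurability _ (RGenOpens.measurableE R)).
move=> _ [_ [a [b ->]] <-]; rewrite setTI; apply: sub_sigma_algebra.
apply/path_openP => x /= fx.
have : open (`]a, b[%classic : set R) by exact: interval_open.
rewrite openE => /(_ _ fx) /nbhs_ballP[e /= e0 eU].
exists (e / (`|C| + 1)) => [|y]; first by rewrite divr_gt0// ltr_wpDl.
rewrite ltr_pdivlMr; last by rewrite ltr_wpDl.
move=> xy; apply: eU; rewrite /ball/= (le_lt_trans (fC _ _))// (le_lt_trans _ xy)//.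
rewrite mulrC ler_wpM2l ?supdist_ge0//.
by rewrite (le_trans (ler_norm _))// lerDl.
Qed.

End path_metric.

(** * Separability of the path space *)

Section path_separable.
Context (R : realType) (d : nat) (T : R).
Local Notation path := (cpath d T).
Implicit Types (x y z : path).
Hypothesis T0 : 0 < T.

(** Uniform continuity, by compactness of the segment. The modulus is expressed by a grid level, so
    that finitely many grid values describe a path up to e. *)
Lemma path_osc x (e : R) : 0 < e -> exists n, forall s t,
  0 <= s <= T -> 0 <= t <= T -> `|s - t| <= mesh T n -> enorm (x s - x t) <= e.
Proof.
move=> e0; have e20 : 0 < e / 2 by rewrite divr_gt0.
have /compact_near_coveringP/near_covering_withinP := @segment_compact R 0 T.
move=> /(_ nat \oo (fun n t => forall s, 0 <= s <= T -> `|s - t| <= mesh T n ->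
  enorm (x s - x t) <= e) _) [].
  move=> t; rewrite /= in_itv/= => tT.
  have [r r0 rP] := path_cts x tT e20.
  have r20 : 0 < r / 2 by rewrite divr_gt0.
  exists ([set t' | `|t' - t| < r / 2], [set n | mesh T n < r / 2]).
    split => /=; last exact: (mesh_small T r20).
    by apply/nbhs_ballP; exists (r / 2) => // t'; rewrite /ball/= distrC.
  move=> [t' n]/= [tt' nr]; rewrite in_itv/= => t'T s sT st'.
  rewrite (le_trans (enorm_triangle (x t) _ _))// (splitr e) lerD//; last first.
    by rewrite enormB ltW// rP// (lt_le_trans tt')// ler_pdivrMr// ler_peMr ?ler1n// ltW.
  rewrite ltW// rP// (le_lt_trans (ler_distD t' _ _))// (splitr r) ltrD//.
  exact: le_lt_trans nr.
move=> n _ nP; exists n => s t sT tT st.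
by apply: (nP n) => //=; rewrite in_itv.
Qed.

(** One-sided control of [f] near each time carries a bound from the grids, whose union is dense, to
    the whole interval. *)
Lemma grid_sup (f : R -> R) (M : R) :
  (forall t, 0 <= t <= T -> forall e : R, 0 < e -> exists2 r : R, 0 < r &
    forall s, 0 <= s <= T -> `|s - t| < r -> f t <= f s + e) ->
  (forall n k, (k <= 4 ^ n)%N -> f (grid T n k) <= M) ->
  forall t, 0 <= t <= T -> f t <= M.
Proof.
move=> cf fM t tT; apply/ler_addgt0Pr => e e0.
have [r r0 rP] := cf t tT e e0.
have [n _ /(_ n (leqnn n)) nr] := mesh_small T r0.
have [k kn /andP[k1 k2]] := grid_approx T0 n tT.
rewrite (le_trans (rP (grid T n k) _ _))//.
- exact: grid_itv.
- by rewrite distrC ger0_norm ?subr_ge0// (le_lt_trans _ nr)// lerBlDl.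
- by rewrite lerD2r fM.
Qed.

Lemma supdist_grid_le x y (M : R) : 0 <= M ->
  (forall n k, (k <= 4 ^ n)%N -> enorm (x (grid T n k) - y (grid T n k)) <= M) ->
  supdist x y <= M.
Proof.
move=> M0 xyM; apply: supdist_le => //; apply: grid_sup => //.
move=> t tT e e0; have e20 : 0 < e / 2 by rewrite divr_gt0.
have [r r0 rP] := path_cts x tT e20; have [r' r'0 r'P] := path_cts y tT e20.
exists (Num.min r r'); first by rewrite lt_min r0.
move=> s sT; rewrite lt_min => /andP[sr sr'].
rewrite (le_trans (enorm_triangle (x s) _ _))// addrC.
rewrite (le_trans (lerD (enorm_triangle (y s) _ _) (lexx _)))// -addrA lerD2l.
by rewrite (splitr e) lerD// ltW//; [exact: r'P|rewrite enormB; exact: rP].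
Qed.

(** An index consists of a grid level, rational approximations of the values on that grid and a
    precision. For each precision, countably many such cells, of diameter at most twice the
    precision, cover the path space. *)
Definition path_cell (i : nat * seq 'rV[rat]_d * nat) : set path :=
  [set x | forall k t, (k <= 4 ^ i.1.1)%N -> 0 <= t <= T ->
    `|t - grid T i.1.1 k| <= mesh T i.1.1 ->
    enorm (x t - map_mx ratr (nth 0 i.1.2 k)) <= i.2.+1%:R^-1].

Lemma enorm_rat_dense (v : 'rV[R]_d) (e : R) : 0 < e ->
  exists q : 'rV[rat]_d, enorm (v - map_mx ratr q) <= e.
Proof.
move=> e0; have ed : 0 < e / d.+1%:R by rewrite divr_gt0.
have appr (b : R) : exists q : rat, `|b - ratr q| <= e / d.+1%:R.
  have [q] : exists q, ratr q \in `]b - e / d.+1%:R, b + e / d.+1%:R[.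
    by apply: rat_in_itvoo; rewrite ltrD2l (lt_trans _ ed)// oppr_lt0.
  by rewrite in_itv/= -ltr_distlC => qb; exists q; rewrite ltW.
have [w wv] := choice (fun i => appr (v ord0 i)).
exists (\row_i w i); apply: (@le_trans _ _ (d%:R * (e / d.+1%:R))).
  by apply: enorm_le_coord => i; rewrite !mxE.
rewrite mulrA ler_pdivrMr// mulrC ler_wpM2l ?ler_nat//.
exact: ltW.
Qed.

Lemma path_cell_cover x m : exists i, i.2 = m /\ path_cell i x.
Proof.
have e0 : 0 < (m.+1%:R^-1 : R) / 2 by rewrite divr_gt0// invr_gt0.
have [n nP] := path_osc x e0.
have [w wP] := choice (fun k => enorm_rat_dense (x (grid T n k)) e0).
exists (n, mkseq w (4 ^ n).+1, m); split => // k t /= kn tT tk.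
rewrite nth_mkseq ?ltnS// (le_trans (enorm_triangle (x (grid T n k)) _ _))//.
rewrite (splitr m.+1%:R^-1) lerD// nP//.
exact: grid_itv.
Qed.

Lemma path_cell_dist i x y : path_cell i x -> path_cell i y ->
  supdist x y <= 2 * i.2.+1%:R^-1.
Proof.
move=> ix iy; apply: supdist_le => [|t tT]; first by rewrite mulr_ge0// invr_ge0.
have [k kn /andP[k1 k2]] := grid_approx T0 i.1.1 tT.
have tk : `|t - grid T i.1.1 k| <= mesh T i.1.1.
  by rewrite ger0_norm ?subr_ge0// lerBlDl.
rewrite (le_trans (enorm_triangle (map_mx ratr (nth 0 i.1.2 k)) _ _))//.
rewrite mulr2n mulrDl mul1r lerD//; first exact: ix.
by rewrite enormB; exact: iy.
Qed.

(** One path is chosen in each nonempty cell. Index 0 is reserved for the zero path: the distance to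
    the first elements of the sequence is then bounded by the supremum norm, which dominates in the
    later passages to the limit. *)
Lemma path_dense_subproof : {e : nat -> path | e 0%N = path0 d T /\
  forall x (r : R), 0 < r -> exists j, supdist x (e j) < r}.
Proof.
apply: cid; exists (fun j => if j is j'.+1 then
  if unpickle j' is Some i then xget (path0 d T) (path_cell i) else path0 d T
  else path0 d T); split => // x r r0.
have r20 : 0 < r / 2 by rewrite divr_gt0.
have [m _ /(_ m (leqnn m)) /= mr] := near_infty_natSinv_lt (PosNum r20).
have [i [im ix]] := path_cell_cover x m.
exists (pickle i).+1; rewrite pickleK; case: xgetP; last by move=> /(_ x).
move=> y _ /(path_cell_dist ix) /le_lt_trans; apply.
by rewrite im -ltr_pdivlMl// mulrC.
Qed.

Definition path_dense : nat -> path := sval path_dense_subproof.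

Lemma path_dense0 : path_dense 0 = path0 d T.
Proof. by have [] := svalP path_dense_subproof. Qed.

Lemma path_denseP x (r : R) : 0 < r -> exists j, supdist x (path_dense j) < r.
Proof. by have [_] := svalP path_dense_subproof; apply. Qed.

End path_separable.

Section countable_quantifiers.
Context d (S : measurableType d) (I : countType) (A : I -> set S).

Lemma measurable_exists : (forall i, measurable (A i)) ->
  measurable [set w | exists i, A i w].
Proof.
move=> mA; rewrite (_ : [set w | _] = \bigcup_i A i).
  by apply: countable_bigcupT_measurable; first exact: countableP.
by apply/seteqP; split => [w [i Aiw]|w [i _ Aiw]]; exists i.
Qed.

End countable_quantifiers.

Lemma measurable_forall d (S : measurableType d) (I : countType)
    (A : I -> set S) : (forall i, measurable (A i)) ->
  measurable [set w | forall i, A i w].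
Proof.
move=> mA; rewrite -[X in measurable X]setCK; apply: measurableC.
rewrite (_ : ~` _ = [set w | exists i, (~` A i) w]).
  by apply: measurable_exists => i; exact: measurableC.
by apply/seteqP; split => w /=; [move/existsNP|move=> h; exact/existsNP].
Qed.

Section level_sets.
Context d (S : measurableType d) (R : realType) (f : S -> R).
Hypothesis mf : measurable_fun setT f.

Lemma measurable_le_level (a : R) : measurable [set w | f w <= a].
Proof.
rewrite (_ : [set w | _] = setT `&` f @^-1` `]-oo, a]%classic).
  exact: mf.
by rewrite setTI; apply/seteqP; split => w; rewrite /= in_itv.
Qed.

Lemma measurable_gt_level (a : R) : measurable [set w | a < f w].
Proof.
rewrite (_ : [set w | _] = setT `&` f @^-1` `]a, +oo[%classic).
  exact: mf.
by rewrite setTI; apply/seteqP; split => w; rewrite /= in_itv/= andbT.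
Qed.

Lemma measurable_ge_level (a : R) : measurable [set w | a <= f w].
Proof.
rewrite (_ : [set w | _] = setT `&` f @^-1` `[a, +oo[%classic).
  exact: mf.
by rewrite setTI; apply/seteqP; split => w; rewrite /= in_itv/= andbT.
Qed.

End level_sets.

(** * Measurability of path-valued maps *)

Section path_measurable.
Context (R : realType) (d : nat) (T : R).
Local Notation path := (cpath d T).
Hypothesis T0 : 0 < T.
Context dS (S : measurableType dS).

(** The sigma-algebra is generated by open sets rather than by coordinates; an open set is a
    countable union of rational boxes, each a finite intersection of conditions on coordinates. *)
Lemma measurable_rVP (f : S -> 'rV[R]_d) :
  measurable_fun setT f <-> forall i, measurable_fun setT (fun w => f w ord0 i).
Proof.
split=> [mf i|mf].
  apply: (measurableT_comp (f := fun v : 'rV[R]_d => v ord0 i)) => //.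
  by apply: continuous_mx_measurable; exact: coord_continuous.
refine (@measurability _ _ S 'rV[R]_d _ _ _ erefl _).
move=> _ [U oU <-]; rewrite setTI.
pose box (k : 'rV[rat]_d * nat) : set S := [set w | forall i,
  ((fun w => f w ord0 i) @^-1` ball (ratr (k.1 ord0 i) : R) k.2.+1%:R^-1) w].
have mbox k : measurable (box k).
  apply: measurable_forall => i.
  by rewrite -[X in measurable X]setTI; apply: mf => //; exact: measurable_ball.
have -> : f @^-1` U = [set w | exists k,
    (if `[< box k `<=` f @^-1` U >] then box k else set0) w].
  apply/seteqP; split; last first.
    by move=> w [k]; case: ifPn => // /asboolP; exact.
  move=> w /= Ufw.
  have /nbhs_ballP[e /= e0 eU] : nbhs (f w) U by exact: open_nbhs_nbhs.
  have e20 : 0 < e / 2 by rewrite divr_gt0.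
  have [n _ /(_ n (leqnn n)) /= re] := near_infty_natSinv_lt (PosNum e20).
  set r : R := n.+1%:R^-1 in re *.
  have r0 : 0 < r by rewrite invr_gt0.
  have r20 : 0 < r / 2 by rewrite divr_gt0.
  have [q wq] := enorm_rat_dense (f w) r20.
  have qw i : ball (ratr (q ord0 i) : R) r (f w ord0 i).
    rewrite /ball/= distrC; have := coord_le_enorm (f w - map_mx ratr q) i.
    rewrite !mxE => /le_lt_trans; apply; rewrite (le_lt_trans wq)//.
    by rewrite ltr_pdivrMr// ltr_pMr// ltr1n.
  exists (q, n); case: asboolP; first by move=> _ i; exact: qw.
  case=> w' ww'; apply: eU; split => // i j; rewrite (ord1 i).
  have /ball_sym h1 := qw j.
  by apply: le_ball (ball_triangle h1 (ww' j)); rewrite (splitr e) lerD// ltW.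
apply: measurable_exists => k; by case: ifPn.
Qed.

Lemma measurable_enormB (f g : S -> 'rV[R]_d) : measurable_fun setT f ->
  measurable_fun setT g -> measurable_fun setT (fun w => enorm (f w - g w)).
Proof.
move=> /measurable_rVP mf /measurable_rVP mg.
apply: (measurableT_comp (f := @Num.sqrt R)).
  by apply: continuous_measurable_fun; exact: sqrt_continuous.
apply: measurable_sum => i; apply: measurable_funX.
under eq_fun do rewrite mxE [X in _ + X]mxE.
exact: measurable_funB.
Qed.

(** By continuity a closed ball is cut out by countably many conditions on grid values, and
    separability makes every open set a countable union of such balls. Hence grid evaluations
    generate the Borel sigma-algebra of the path space. *)
Lemma measurable_pathP (Y : S -> path) :
  (forall n k, (k <= 4 ^ n)%N -> measurable_fun setT (fun w => Y w (grid T n k))) ->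
  measurable_fun setT Y.
Proof.
move=> mY; refine (@measurability _ _ S path _ _ _ erefl _).
move=> _ [U /path_openP oU <-]; rewrite setTI.
pose cball (i : nat * nat) : set path :=
  [set y | supdist y (path_dense d T0 i.1) <= i.2.+1%:R^-1].
have mball i : measurable (Y @^-1` cball i).
  rewrite (_ : _ @^-1` _ = [set w | forall nk : nat * nat, (if (nk.2 <= 4 ^ nk.1)%N then
      [set w | enorm (Y w (grid T nk.1 nk.2) - path_dense d T0 i.1 (grid T nk.1 nk.2)) <= i.2.+1%:R^-1]
      else setT) w]).
    apply: measurable_forall => -[n k] /=; case: ifPn => // kn.
    apply: (measurable_le_level (f := fun w => enorm (Y w _ - path_dense d T0 i.1 _))).
    exact: (measurable_enormB (mY n k kn) (measurable_cst _)).
  apply/seteqP; split => w /=.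
    move=> h [n k]/=; case: ifPn => //= _; apply: le_trans h; exact: enorm_le_supdist.
  move=> h; apply: supdist_grid_le => //.
  by move=> n k kn; have := h (n, k); rewrite /= kn.
rewrite (_ : Y @^-1` U = [set w | exists i,
    (if `[< cball i `<=` U >] then Y @^-1` cball i else set0) w]).
  by apply: measurable_exists => i; case: ifPn.
apply/seteqP; split; last by move=> w [i]; case: ifPn => // /asboolP; exact.
move=> w /= /oU[e e0 eU].
have e20 : 0 < e / 2 by rewrite divr_gt0.
have [n _ /(_ n (leqnn n)) /= re] := near_infty_natSinv_lt (PosNum e20).
have r0 : 0 < (n.+1%:R^-1 : R) by rewrite invr_gt0.
have [j jr] := path_denseP T0 (Y w) r0.
exists (j, n); case: asboolP => [_|]; first exact: ltW.
case=> y yj; apply: eU; rewrite (le_lt_trans (supdist_triangle (path_dense d T0 j) _ _))//.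
rewrite (splitr e) ltrD//; first exact: lt_trans re.
by rewrite supdistC (le_lt_trans yj).
Qed.

Lemma measurable_path_eval (Y : S -> path) t :
  measurable_fun setT Y -> measurable_fun setT (fun w => Y w t).
Proof. by move=> mY; exact: (measurableT_comp (measurable_at_time t)). Qed.

Lemma measurable_supdist (Y Z : S -> path) : measurable_fun setT Y ->
  measurable_fun setT Z -> measurable_fun setT (fun w => supdist (Y w) (Z w)).
Proof.
move=> mY mZ; apply: (measurability _ (RGenOInfty.measurableE R)).
move=> _ [_ [a ->] <-]; rewrite setTI.
have [a0|a0] := ltP a 0.
  rewrite (_ : _ @^-1` _ = setT)//; apply/seteqP; split => // w _.
  by rewrite /= in_itv/= andbT (lt_le_trans a0)// supdist_ge0.
rewrite (_ : _ @^-1` _ = [set w | exists nk : nat * nat,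
    enorm (Y w (grid T nk.1 nk.2) - Z w (grid T nk.1 nk.2)) > a]).
  apply: measurable_exists => -[n k] /=.
  apply: measurable_gt_level.
  exact: (measurable_enormB (measurable_path_eval _ mY) (measurable_path_eval _ mZ)).
apply/seteqP; split => w /=; rewrite in_itv/= andbT; last first.
  by move=> [[n k] /=] /lt_le_trans; apply; exact: enorm_le_supdist.
move=> aYZ; apply: contrapT => /forallNP h; move: aYZ; rewrite ltNge => /negP; apply.
apply: supdist_grid_le => // n k _; rewrite leNgt; apply/negP.
exact: (h (n, k)).
Qed.

End path_measurable.

Definition mfun_of d d' (S : measurableType d) (E : measurableType d')
  (f : S -> E) (mf : measurable_fun setT f) : {mfun S >-> E} :=
  mfun_Sub (mem_set mf).

Definition prob_of d (S : measurableType d) (R : realType)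
  (mu : {measure set S -> \bar R}) (mu1 : mu setT = 1%E) : set S -> \bar R := mu.

(** * Couplings and the topology of W_1 *)

Section prob_of.
Context d (S : measurableType d) (R : realType).
Variables (mu : {measure set S -> \bar R}) (mu1 : mu setT = 1%E).
HB.instance Definition _ := Measure.on (prob_of mu1).
HB.instance Definition _ :=
  Measure_isProbability.Build _ _ _ (prob_of mu1) mu1.
End prob_of.

Section finite_sum_of_measures.
Context d (S : measurableType d) (R : realType) (I : finType).
Variable m : I -> {measure set S -> \bar R}.

Definition fmsum : set S -> \bar R :=
  msum (fun n => nth (mzero : {measure set S -> \bar R}) [seq m i | i <- enum I] n) #|I|.

HB.instance Definition _ := Measure.on fmsum.

Lemma fmsumE A : fmsum A = (\sum_i m i A)%E.
Proof.
have -> : (\sum_i m i A = \sum_(mi <- [seq m i | i <- enum I]) mi A)%E.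
  by rewrite big_map big_enum.
by rewrite (big_nth (mzero : {measure set S -> \bar R})) big_mkord size_map -cardE.
Qed.

End finite_sum_of_measures.

Lemma measure_partition d (S : measurableType d) (R : realType) (I : finType)
    (mu : {measure set S -> \bar R}) (k : S -> I) (A : set S) :
  (forall i, measurable [set w | k w = i]) -> measurable A ->
  mu A = (\sum_i mu (A `&` [set w | k w = i]))%E.
Proof.
move=> mk mA.
have -> : (\sum_i mu (A `&` [set w | k w = i]))%E =
    (\sum_(i \in [set: I]) mu (A `&` [set w | k w = i]))%E.
  rewrite (fsbigE (enum I)) ?enum_uniq//=; last by move=> i _; rewrite mem_enum.
  by rewrite big_enum_cond/=; apply: eq_bigl => i; rewrite in_setT.
rewrite -measure_fin_bigcup//.
- congr (mu _); apply/seteqP; split => [w Aw|w [i _ []]//].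
  by exists (k w).
- exact: finite_finset.
- by apply/trivIsetP => i j _ _ ij; apply/seteqP; split => // w [[_ /= h1] [_ /= h2]]; rewrite -h1 -h2 eqxx in ij.
- by move=> i _; exact: measurableI.
Qed.

Section cell_coupling.
Context (R : realType) d1 d2 (S1 : measurableType d1) (S2 : measurableType d2).
Variables (P1 : probability S1 R) (P2 : probability S2 R) (m : nat).
Variables (k1 : S1 -> 'I_m) (k2 : S2 -> 'I_m) (c : 'I_m -> 'I_m -> R).
Hypothesis mk1 : forall i, measurable [set w | k1 w = i].
Hypothesis mk2 : forall i, measurable [set w | k2 w = i].
Hypothesis c_ge0 : forall i j, 0 <= c i j.
Hypothesis c1 : forall i, P1 [set w | k1 w = i] = (\sum_j c i j)%:E.
Hypothesis c2 : forall j, P2 [set w | k2 w = j] = (\sum_i c i j)%:E.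

Let p1 i := \sum_j c i j.
Let p2 j := \sum_i c i j.

Let rect (ij : 'I_m * 'I_m) : set (S1 * S2) :=
  [set w | k1 w = ij.1] `*` [set w | k2 w = ij.2].

Let mrect ij : measurable (rect ij).
Proof. exact: measurableX. Qed.

Let coef_ge0 (ij : 'I_m * 'I_m) : 0 <= c ij.1 ij.2 / (p1 ij.1 * p2 ij.2).
Proof. by rewrite divr_ge0// mulr_ge0// sumr_ge0. Qed.

(** On each rectangle of cells the product measure is rescaled to the prescribed mass [c i j]. A
    quotient by zero is harmless, since [c i j] vanishes with either marginal ([cell0]). *)
Let piece (ij : 'I_m * 'I_m) : {measure set (S1 * S2) -> \bar R} :=
  mscale (NngNum (coef_ge0 ij)) (mrestr (P1 \x P2)%E (mrect ij)).

Let glued := fmsum piece.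

Let glued_rect A B : measurable A -> measurable B ->
  glued (A `*` B) = (\sum_(ij : 'I_m * 'I_m)
    (c ij.1 ij.2 / (p1 ij.1 * p2 ij.2))%:E *
    (P1 (A `&` [set w | k1 w = ij.1]) * P2 (B `&` [set w | k2 w = ij.2])))%E.
Proof.
move=> mA mB; rewrite /glued fmsumE; apply: eq_bigr => ij _.
transitivity ((c ij.1 ij.2 / (p1 ij.1 * p2 ij.2))%:E * (P1 \x P2) ((A `*` B) `&` rect ij))%E => //.
rewrite /rect -setXI.
by rewrite product_measure1E//; exact: measurableI.
Qed.

Let cell0 i j : p1 i * p2 j = 0 -> c i j = 0.
Proof.
move/eqP; rewrite mulf_eq0 => /orP[|] /eqP h; apply/eqP; rewrite eq_le c_ge0 andbT.
  by rewrite -h /p1 (bigD1 j)//= lerDl sumr_ge0.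
by rewrite -h /p2 (bigD1 i)//= lerDl sumr_ge0.
Qed.

Let glued_marg1 A : measurable A -> glued (A `*` setT) = P1 A.
Proof.
move=> mA; rewrite glued_rect//.
rewrite -(pair_bigA _ (fun i j => (c i j / (p1 i * p2 j))%:E *
    (P1 (A `&` [set w | k1 w = i]) * P2 (setT `&` [set w | k2 w = j])))%E)/=.
rewrite (measure_partition P1 mk1 mA); apply: eq_bigr => i _.
rewrite (eq_bigr (fun j => (c i j / p1 i)%:E * P1 (A `&` [set w | k1 w = i]))%E).
  rewrite -ge0_sume_distrl; last by move=> j _; rewrite lee_fin divr_ge0// sumr_ge0.
  rewrite sumEFin -mulr_suml -/(p1 i).
  have [pi0|pi0] := eqVneq (p1 i) 0; last by rewrite divff// mul1e.
  have h0 : P1 [set w | k1 w = i] = 0%E by rewrite c1 -/(p1 i) pi0.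
  rewrite [X in (_ * X)%E](_ : _ = 0%E) ?mule0.
    apply/esym/eqP; rewrite eq_le measure_ge0 andbT -[leRHS]h0.
    by apply: le_measure; rewrite ?inE//; exact: measurableI.
  apply/eqP; rewrite eq_le measure_ge0 andbT -[leRHS]h0.
  by apply: le_measure; rewrite ?inE//; exact: measurableI.
move=> j _; rewrite setTI c2 -/(p2 j) muleCA muleC -EFinM; congr (_%:E * _)%E.
have [pj0|pj0] := eqVneq (p1 i * p2 j) 0; first by rewrite cell0// !mul0r.
rewrite mulf_eq0 negb_or in pj0; case/andP: pj0 => ? ?.
by field; apply/andP.
Qed.

Let glued_marg2 B : measurable B -> glued (setT `*` B) = P2 B.
Proof.
move=> mB; rewrite glued_rect//.
rewrite -(pair_bigA _ (fun i j => (c i j / (p1 i * p2 j))%:E *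
    (P1 (setT `&` [set w | k1 w = i]) * P2 (B `&` [set w | k2 w = j])))%E)/=.
rewrite exchange_big/=.
rewrite (measure_partition P2 mk2 mB); apply: eq_bigr => j _.
rewrite (eq_bigr (fun i => (c i j / p2 j)%:E * P2 (B `&` [set w | k2 w = j]))%E).
  rewrite -ge0_sume_distrl; last by move=> i _; rewrite lee_fin divr_ge0// sumr_ge0.
  rewrite sumEFin -mulr_suml -/(p2 j).
  have [pi0|pi0] := eqVneq (p2 j) 0; last by rewrite divff// mul1e.
  have h0 : P2 [set w | k2 w = j] = 0%E by rewrite c2 -/(p2 j) pi0.
  rewrite [X in (_ * X)%E](_ : _ = 0%E) ?mule0.
    apply/esym/eqP; rewrite eq_le measure_ge0 andbT -[leRHS]h0.
    by apply: le_measure; rewrite ?inE//; exact: measurableI.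
  apply/eqP; rewrite eq_le measure_ge0 andbT -[leRHS]h0.
  by apply: le_measure; rewrite ?inE//; exact: measurableI.
move=> i _; rewrite setTI c1 -/(p1 i) muleA -EFinM; congr (_%:E * _)%E.
have [pj0|pj0] := eqVneq (p1 i * p2 j) 0; first by rewrite cell0// !mul0r.
rewrite mulf_eq0 negb_or in pj0; case/andP: pj0 => ? ?.
by field; apply/andP.
Qed.

Let glued_cell i j : glued (rect (i, j)) = (c i j)%:E.
Proof.
rewrite glued_rect// (bigD1 (i, j))//= big1 => [|[i' j'] /=].
  rewrite !setIid c1 c2 adde0 -!EFinM; congr (_%:E); rewrite -/(p1 i) -/(p2 j).
  have [pj0|pj0] := eqVneq (p1 i * p2 j) 0; first by rewrite cell0// !mul0r.
  by rewrite divfK.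
rewrite xpair_eqE negb_and => /orP[] ij.
  rewrite (_ : _ `&` [set w | k1 w = i'] = set0) ?measure0 ?mul0e ?mule0//.
  by apply/seteqP; split => // w [/= -> h]; rewrite h eqxx in ij.
rewrite (_ : _ `&` [set w | k2 w = j'] = set0) ?measure0 ?mule0//.
by apply/seteqP; split => // w [/= -> h]; rewrite h eqxx in ij.
Qed.

Let glued1 : glued setT = 1%E.
Proof. by rewrite -setXTT glued_marg1// probability_setT. Qed.

(* Conditionally on the pair of cells, the two coordinates are independent. *)
Lemma cell_coupling : exists PP : probability (S1 * S2)%type R,
  [/\ has_law PP fst P1, has_law PP snd P2 &
      forall h : 'I_m -> 'I_m -> R, (forall i j, 0 <= h i j) ->
      (\int[PP]_w (h (k1 w.1) (k2 w.2))%:E = (\sum_i \sum_j c i j * h i j)%:E)%E].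
Proof.
exists (prob_of glued1); split.
- move=> A mA; rewrite -glued_marg1//; congr (glued _).
  by apply/seteqP; split => [w ?|w []].
- move=> A mA; rewrite -glued_marg2//; congr (glued _).
  by apply/seteqP; split => [w ?|w []].
move=> h h0.
rewrite (eq_integral (fun w => \sum_(ij : 'I_m * 'I_m)
    (h ij.1 ij.2)%:E * (\1_(rect ij) w)%:E)%E); last first.
  move=> w _; rewrite (bigD1 (k1 w.1, k2 w.2))//= big1 => [|[i j] /=].
    by rewrite indicE mem_set// mule1 adde0.
  rewrite xpair_eqE negb_and => ij; rewrite indicE memNset ?mule0//.
  by move=> [/= h1 h2]; rewrite h1 h2 !eqxx in ij.
rewrite ge0_integral_sum//; last 2 first.
  by move=> ij; apply/measurable_EFinP; apply: measurable_funM => //; exact: measurable_indic.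
  by move=> ij w _; rewrite mule_ge0// lee_fin.
rewrite pair_big/= -sumEFin; apply: eq_bigr => -[i j] _ /=.
rewrite ge0_integralZl//; last 2 first.
  by apply/measurable_EFinP; exact: measurable_indic.
  by rewrite lee_fin.
rewrite integral_indic// setIT EFinM muleC; congr (_ * _)%E.
exact: glued_cell.
Qed.

End cell_coupling.

Lemma has_law_integral (R : realType) d1 d2 (S : measurableType d1)
    (E : measurableType d2) (PP : probability S R) (Y : {mfun S >-> E})
    (P : {measure set E -> \bar R}) (f : E -> \bar R) :
  has_law PP Y P -> measurable_fun setT f -> (forall x, 0 <= f x)%E ->
  (\int[PP]_w f (Y w) = \int[P]_x f x)%E.
Proof.
move=> YP mf f0; rewrite -[LHS](ge0_integral_distribution Y mf f0).
by apply: eq_measure_integral => A mA _; exact: YP.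
Qed.

(** * Quantisation by a dense sequence *)

Section nearest.
Context (R : realType) (d : nat) (T : R).
Local Notation path := (cpath d T).
Hypothesis T0 : 0 < T.
Local Notation e_ := (path_dense d T0).

Lemma measurable_supdist_cst (a : path) : measurable_fun setT (fun x : path => supdist x a).
Proof.
apply: (@lipschitz_real_measurable R d T 1) => x y; rewrite mul1r ler_norml.
rewrite lerBrDl -lerBrDr opprK addrC lerBlDl.
by rewrite (supdistC x y) supdist_triangle /= addrC (supdistC y x) supdist_triangle.
Qed.

(** Ties go to the smaller index, so that the cells of this quantisation are Boolean combinations of
    comparisons between measurable distances. *)
Fixpoint nearest (k : nat) (x : path) : nat :=
  if k is k'.+1 then
    if supdist x (e_ k) < supdist x (e_ (nearest k' x)) then k
    else nearest k' x
  else 0.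

Definition near_dist k x : R := supdist x (e_ (nearest k x)).

Lemma nearest_le k x : (nearest k x <= k)%N.
Proof. by elim: k => //= k IH; case: ifPn => // _; exact: leqW. Qed.

Definition near_cell k x : 'I_k.+1 := Ordinal (nearest_le k x : (_ < k.+1)%N).

Lemma near_dist_ge0 k x : 0 <= near_dist k x.
Proof. exact: supdist_ge0. Qed.

Lemma near_distS k x :
  near_dist k.+1 x = Num.min (near_dist k x) (supdist x (e_ k.+1)).
Proof.
by rewrite /near_dist /=; case: ltP.
Qed.

Lemma near_dist_le k j x : (j <= k)%N -> near_dist k x <= supdist x (e_ j).
Proof.
elim: k => [|k IH]; first by rewrite leqn0 => /eqP ->.
rewrite leq_eqVlt ltnS near_distS => /orP[/eqP ->|/IH jk].
  by rewrite ge_min lexx orbT.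
by rewrite ge_min jk.
Qed.

Lemma near_dist_le_norm k x : near_dist k x <= supnorm x.
Proof.
by rewrite (le_trans (near_dist_le x (leq0n k)))// path_dense0 supdistx0.
Qed.

Lemma cvg_near_dist x : near_dist k x @[k --> \oo] --> (0 : R).
Proof.
apply/cvgrPdist_lt => e e0; have [j xj] := path_denseP T0 x e0.
near=> k; rewrite sub0r normrN ger0_norm ?near_dist_ge0//.
rewrite (le_lt_trans _ xj)// near_dist_le//; near: k; exact: nbhs_infty_ge.
Unshelve. all: by end_near. Qed.

Lemma measurable_near_dist k : measurable_fun setT (near_dist k).
Proof.
elim: k => [|k IH].
  rewrite (_ : near_dist 0 = fun x => supdist x (e_ 0%N)) //.
  exact: measurable_supdist_cst.
rewrite (_ : near_dist k.+1 = (near_dist k) \min (fun x => supdist x (e_ k.+1))).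
  by apply: measurable_minr => //; exact: measurable_supdist_cst.
by apply/funext => x; rewrite near_distS.
Qed.

Lemma measurable_nearest k i : measurable [set x | nearest k x = i].
Proof.
have mlt j : measurable [set x | supdist x (e_ j.+1) < near_dist j x].
  rewrite (_ : [set x | _] = [set x | 0 < near_dist j x - supdist x (e_ j.+1)]).
    apply: measurable_gt_level; apply: measurable_funB; first exact: measurable_near_dist.
    exact: measurable_supdist_cst.
  by apply/seteqP; split => x /=; rewrite subr_gt0.
elim: k i => [|k IH] i /=.
  have [->|i0] := eqVneq i 0%N; first by rewrite (_ : [set x | _] = setT)//; apply/seteqP.
  rewrite (_ : [set x | _] = set0)//; apply/seteqP; split => // x /= h.
  by rewrite h eqxx in i0.
rewrite (_ : [set x | _] =
  ([set x | supdist x (e_ k.+1) < near_dist k x] `&` (if i == k.+1 then setT else set0))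
  `|` ([set x | nearest k x = i] `\` [set x | supdist x (e_ k.+1) < near_dist k x])).
  apply: measurableU; first by apply: measurableI => //; case: ifP.
  exact: measurableD.
apply/seteqP; split => x /=.
  by case: ifPn => h <-; [left; rewrite eqxx|right; split => //; exact/negP].
move=> [[h]|[<-] /negP/negbTE ->//].
by rewrite h; case: ifPn => // /eqP ->.
Qed.

Lemma measurable_near_cell k i : measurable [set x | near_cell k x = i].
Proof.
rewrite (_ : [set x | _] = [set x | nearest k x = i]); first exact: measurable_nearest.
by apply/seteqP; split => x /= h; [rewrite -h|apply: val_inj].
Qed.

(** Dominated convergence; the supremum norm dominates because the zero path sits at index 0. *)
Lemma cvg_mean_near_dist (P : probability path R) :
  (\int[P]_x (supnorm x)%:E < +oo)%E ->
  (\int[P]_x (near_dist k x)%:E)%E @[k --> \oo] --> 0%E.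
Proof.
move=> Pfin.
have mk k : measurable_fun setT (fun x => (near_dist k x)%:E).
  by apply/measurable_EFinP; exact: measurable_near_dist.
have := @dominated_convergence _ _ _ P _ measurableT
  (fun k x => (near_dist k x)%:E) (cst 0%E) (fun x => (supnorm x)%:E) mk
  (measurable_cst _).
case.
- by apply: aeW => x _; apply/cvg_EFin; [exact: nearW|exact: cvg_near_dist].
- apply/integrableP; split.
    by apply/measurable_EFinP; exact: measurable_supnorm.
  under eq_integral do rewrite gee0_abs ?lee_fin ?supnorm_ge0//.
  exact: Pfin.
- apply: aeW => x k _; rewrite gee0_abs ?lee_fin ?near_dist_ge0//.
  exact: near_dist_le_norm.
by move=> _ _; rewrite integral0.
Qed.

End nearest.

Section wasserstein.
Context (R : realType) (d : nat) (T : R).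
Local Notation path := (cpath d T).
Hypothesis T0 : 0 < T.
Implicit Types (P Q V : probability path R).
Local Open Scope ereal_scope.

Lemma W1_le dS (S : measurableType dS) (PP : probability S R)
    (Y Z : {mfun S >-> path}) P Q : has_law PP Y P -> has_law PP Z Q ->
  W1 P Q <= \int[PP]_w (supdist (Y w) (Z w))%:E.
Proof. by move=> YP ZQ; apply: ereal_inf_lbound; exists dS, S, PP, Y, Z. Qed.

Lemma W1_lt P Q (e : \bar R) : W1 P Q < e ->
  exists dS (S : measurableType dS) (PP : probability S R)
    (Y Z : {mfun S >-> path}), [/\ has_law PP Y P, has_law PP Z Q &
    \int[PP]_w (supdist (Y w) (Z w))%:E < e].
Proof.
move=> /ereal_inf_lt[_ [dS [S [PP [Y [Z [YP ZQ ->]]]]]] lte].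
by exists dS, S, PP, Y, Z.
Qed.

Lemma W1_ge0 P Q : 0 <= W1 P Q.
Proof.
apply: le_ereal_inf_tmp => _ [dS [S [PP [Y [Z [_ _ ->]]]]]].
by apply: integral_ge0 => w _; rewrite lee_fin supdist_ge0.
Qed.

Lemma W1_sym P Q : W1 P Q = W1 Q P.
Proof.
suff h P' Q' : W1 P' Q' <= W1 Q' P' by apply/eqP; rewrite eq_le !h.
apply: le_ereal_inf_tmp => _ [dS [S [PP [Y [Z [YQ ZP ->]]]]]].
under eq_integral do rewrite supdistC.
exact: W1_le.
Qed.

Definition path_id : {mfun path >-> path} := mfun_of (@measurable_id _ path setT).

Lemma has_law_id P : has_law P path_id P.
Proof. by []. Qed.

Lemma W1_eq0 P Q : (forall A, measurable A -> P A = Q A) -> W1 P Q = 0.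
Proof.
move=> PQ; apply/eqP; rewrite eq_le W1_ge0 andbT.
rewrite (le_trans (W1_le (Y := path_id) (Z := path_id) (@has_law_id P) _))//.
by rewrite integral0_eq// => x _; rewrite supdistxx.
Qed.

Lemma near_dist_fin P k : \int[P]_x (supnorm x)%:E < +oo ->
  \int[P]_x (near_dist T0 k x)%:E < +oo.
Proof.
move=> /(le_lt_trans _); apply; apply: ge0_le_integral => //.
- by move=> x _; rewrite lee_fin near_dist_ge0.
- by apply/measurable_EFinP; exact: measurable_near_dist.
- by apply/measurable_EFinP; exact: measurable_supnorm.
- by move=> x _; rewrite lee_fin near_dist_le_norm.
Qed.

(** Two couplings are joined along cells rather than points: the inner variables [Z1] and [Y2] are
    only asked to fall into cells distributed according to [c], and triangle inequalities through
    the centres of these cells give the bound. *)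
Lemma W1_glue (k : nat) d1 d2 (S1 : measurableType d1) (S2 : measurableType d2)
  (P1 : probability S1 R) (P2 : probability S2 R)
  (Y1 Z1 : {mfun S1 >-> path}) (Y2 Z2 : {mfun S2 >-> path}) P Q
  (c : 'I_k.+1 -> 'I_k.+1 -> R) :
  (forall i j, (0 <= c i j)%R) ->
  (forall i, P1 [set w | near_cell T0 k (Z1 w) = i] = (\sum_j c i j)%:E) ->
  (forall j, P2 [set w | near_cell T0 k (Y2 w) = j] = (\sum_i c i j)%:E) ->
  has_law P1 Y1 P -> has_law P2 Z2 Q ->
  W1 P Q <= (\int[P1]_w (supdist (Y1 w) (Z1 w))%:E +
             \int[P1]_w (near_dist T0 k (Z1 w))%:E) +
     (\sum_i \sum_j c i j * supdist (path_dense d T0 i) (path_dense d T0 j))%:E +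
            (\int[P2]_w (near_dist T0 k (Y2 w))%:E +
             \int[P2]_w (supdist (Y2 w) (Z2 w))%:E).
Proof.
move=> c0 c1 c2 YP ZQ.
have mk d' (S : measurableType d') (Z : {mfun S >-> path}) i :
    measurable [set w | near_cell T0 k (Z w) = i].
  rewrite (_ : [set w | _] = setT `&` Z @^-1` [set x | near_cell T0 k x = i]).
    by apply: measurable_funPT => //; exact: measurable_near_cell.
  by rewrite setTI.
have [PP [PP1 PP2 PPc]] := cell_coupling (mk _ _ Z1) (mk _ _ Y2) c0 c1 c2.
have mfst (f : {mfun S1 >-> path}) : measurable_fun setT (f \o @fst S1 S2).
  exact: measurableT_comp.
have msnd (f : {mfun S2 >-> path}) : measurable_fun setT (f \o @snd S1 S2).
  exact: measurableT_comp.
rewrite (le_trans (W1_le (PP := PP) (Y := mfun_of (mfst Y1)) (Z := mfun_of (msnd Z2)) _ _))//.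
- by move=> A mA; rewrite -YP// -PP1// -[X in measurable X]setTI; exact: measurable_funPT.
- by move=> A mA; rewrite -ZQ// -PP2// -[X in measurable X]setTI; exact: measurable_funPT.
pose h1 w := (supdist (Y1 w) (Z1 w) + near_dist T0 k (Z1 w))%R.
pose h2 w := (near_dist T0 k (Y2 w) + supdist (Y2 w) (Z2 w))%R.
pose h (i j : 'I_k.+1) := supdist (path_dense d T0 i) (path_dense d T0 j).
have msd d' (S : measurableType d') (Y Z : {mfun S >-> path}) :
    measurable_fun setT (fun w => supdist (Y w) (Z w)).
  exact: measurable_supdist.
have mnd d' (S : measurableType d') (Y : {mfun S >-> path}) :
    measurable_fun setT (fun w => near_dist T0 k (Y w)).
  apply: measurableT_comp => //; exact: measurable_near_dist.
have mh1 : measurable_fun setT h1.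
  exact: measurable_funD.
have mh2 : measurable_fun setT h2.
  exact: measurable_funD.
have mh : measurable_fun setT
    (fun w => (h (near_cell T0 k (Z1 w.1)) (near_cell T0 k (Y2 w.2)))%:E).
  apply/measurable_EFinP.
  rewrite (_ : (fun w => _) = (fun w => \sum_(ij : 'I_k.+1 * 'I_k.+1) h ij.1 ij.2 *
    \1_([set w | near_cell T0 k (Z1 w) = ij.1] `*` [set w | near_cell T0 k (Y2 w) = ij.2]) w)%R).
    apply: measurable_sum => ij; apply: measurable_funM => //.
    by apply: measurable_indic; apply: measurableX; exact: mk.
  apply/funext => w; rewrite (bigD1 (near_cell T0 k (Z1 w.1), near_cell T0 k (Y2 w.2)))//=.
  rewrite big1 => [|[i j] /=]; first by rewrite indicE mem_set// mulr1 addr0.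
  rewrite xpair_eqE negb_and => ij; rewrite indicE memNset ?mulr0//.
  by move=> [/= h1' h2']; rewrite h1' h2' !eqxx in ij.
have h0 i j : (0 <= h i j)%R by exact: supdist_ge0.
apply: (@le_trans _ _ (\int[PP]_w ((h1 w.1)%:E + (h (near_cell T0 k (Z1 w.1)) (near_cell T0 k (Y2 w.2)))%:E
    + (h2 w.2)%:E))).
  apply: ge0_le_integral => //.
  - by move=> w _; rewrite lee_fin supdist_ge0.
  - by apply/measurable_EFinP; exact: (measurable_supdist T0 (mfst Y1) (msnd Z2)).
  - apply: emeasurable_funD; first apply: emeasurable_funD => //.
      by apply/measurable_EFinP; exact: measurableT_comp.
    by apply/measurable_EFinP; exact: measurableT_comp.
  - move=> w _; rewrite -!EFinD lee_fin /h1 /h2 /h -!addrA /=.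
    rewrite (le_trans (supdist_triangle (Z1 w.1) _ _))// lerD2l.
    rewrite (le_trans (supdist_triangle (path_dense d T0 (near_cell T0 k (Z1 w.1))) _ _))// lerD2l.
    rewrite (le_trans (supdist_triangle (path_dense d T0 (near_cell T0 k (Y2 w.2))) _ _))// lerD2l.
    by rewrite (le_trans (supdist_triangle (Y2 w.2) _ _))// lerD2r supdistC.
have mh1' : measurable_fun setT (fun w : S1 * S2 => (h1 w.1)%:E).
  by apply/measurable_EFinP; exact: measurableT_comp.
have mh2' : measurable_fun setT (fun w : S1 * S2 => (h2 w.2)%:E).
  by apply/measurable_EFinP; exact: measurableT_comp.
have h10 w : (0 <= h1 w)%R by rewrite addr_ge0 ?supdist_ge0 ?near_dist_ge0.
have h20 w : (0 <= h2 w)%R by rewrite addr_ge0 ?supdist_ge0 ?near_dist_ge0.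
rewrite ge0_integralD//=; [|by move=> w _; rewrite -EFinD lee_fin addr_ge0
  |exact: emeasurable_funD|by move=> w _; rewrite lee_fin].
rewrite ge0_integralD//=; [|by move=> w _; rewrite lee_fin|by move=> w _; rewrite lee_fin].
have mf1 : measurable_fun setT (@fst S1 S2) by exact: measurable_fst.
have mf2 : measurable_fun setT (@snd S1 S2) by exact: measurable_snd.
have -> : \int[PP]_w (h1 w.1)%:E = \int[P1]_w (h1 w)%:E.
  apply: (has_law_integral (Y := mfun_of mf1) (f := fun w => (h1 w)%:E)) => //.
  by apply/measurable_EFinP.
have -> : \int[PP]_w (h2 w.2)%:E = \int[P2]_w (h2 w)%:E.
  apply: (has_law_integral (Y := mfun_of mf2) (f := fun w => (h2 w)%:E)) => //.
  by apply/measurable_EFinP.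
rewrite PPc// /h1 /h2.
under eq_integral do rewrite EFinD.
rewrite ge0_integralD//; last 4 first.
  by move=> w _; rewrite lee_fin supdist_ge0.
  exact/measurable_EFinP.
  by move=> w _; rewrite lee_fin near_dist_ge0.
  exact/measurable_EFinP.
rewrite (eq_integral (mu := P2) (fun w => (near_dist T0 k (Y2 w))%:E + (supdist (Y2 w) (Z2 w))%:E))//.
rewrite ge0_integralD//.
- by move=> w _; rewrite lee_fin near_dist_ge0.
- exact/measurable_EFinP.
- by move=> w _; rewrite lee_fin supdist_ge0.
- exact/measurable_EFinP.
Qed.

(** [W1_glue] with a diagonal matrix [c], which puts both copies of the middle variable in the same
    cell and kills the term between centres. The moment of the middle law makes the quantisation
    error arbitrarily small. *)
Lemma W1_triangle Q P V : \int[Q]_x (supnorm x)%:E < +oo ->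
  W1 P V <= W1 P Q + W1 Q V.
Proof.
move=> Qfin; have [PQoo|PQoo] := eqVneq (W1 P Q) +oo.
  by rewrite PQoo addye ?leey// gt_eqF// (lt_le_trans _ (W1_ge0 _ _)).
have [QVoo|QVoo] := eqVneq (W1 Q V) +oo.
  by rewrite QVoo addey ?leey// gt_eqF// (lt_le_trans _ (W1_ge0 _ _)).
have fPQ : W1 P Q \is a fin_num by rewrite ge0_fin_numE ?W1_ge0// ltey.
have fQV : W1 Q V \is a fin_num by rewrite ge0_fin_numE ?W1_ge0// ltey.
(* Four errors share e: two couplings that are nearly optimal and two quantisation errors. *)
apply/lee_addgt0Pr => e e0; have e40 : (0 < e / 4)%R by rewrite divr_gt0.
have [|d1 [S1 [P1 [Y1 [Z1 [YP ZQ I1]]]]]] := @W1_lt P Q (W1 P Q + (e / 4)%:E).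
  by rewrite lteDl// lte_fin.
have [|d2 [S2 [P2 [Y2 [Z2 [YQ ZV I2]]]]]] := @W1_lt Q V (W1 Q V + (e / 4)%:E).
  by rewrite lteDl// lte_fin.
have /fine_cvgP[_ /cvgrPdist_lt /(_ _ e40)] := cvg_mean_near_dist T0 Qfin.
move=> [k _ /(_ k (leqnn k))]; rewrite sub0r normrN /= => ndk.
have {}ndk : \int[Q]_x (near_dist T0 k x)%:E <= (e / 4)%:E.
  rewrite -[leLHS]fineK; first by rewrite lee_fin ltW// (le_lt_trans (ler_norm _)).
  rewrite ge0_fin_numE; first exact: near_dist_fin.
  by apply: integral_ge0 => x _; rewrite lee_fin near_dist_ge0.
pose q i := fine (Q [set x | near_cell T0 k x = i]).
have qE i : Q [set x | near_cell T0 k x = i] = (q i)%:E.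
  by rewrite fineK// fin_num_measure//; exact: measurable_near_cell.
have q0 i : (0 <= q i)%R by rewrite fine_ge0.
pose c i j := ((i == j)%:R * q i)%R.
have c0 i j : (0 <= c i j)%R by rewrite mulr_ge0.
apply: (le_trans (@W1_glue k _ _ S1 S2 P1 P2 Y1 Z1 Y2 Z2 P V c c0 _ _ YP ZV)).
- move=> i; rewrite /c (bigD1 i)//= eqxx mul1r big1 ?addr0 -?qE; last first.
    by move=> j /negbTE; rewrite eq_sym => ->; rewrite mul0r.
  by rewrite -ZQ//; exact: measurable_near_cell.
- move=> j; rewrite /c (bigD1 j)//= eqxx mul1r big1 ?addr0 -?qE; last first.
    by move=> i /negbTE ->; rewrite mul0r.
  by rewrite -YQ//; exact: measurable_near_cell.
have mnd : measurable_fun setT (fun x : path => (near_dist T0 k x)%:E).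
  by apply/measurable_EFinP; exact: measurable_near_dist.
have nd0 (x : path) : 0 <= (near_dist T0 k x)%:E by rewrite lee_fin near_dist_ge0.
rewrite (has_law_integral (f := fun x => (near_dist T0 k x)%:E) ZQ mnd nd0).
rewrite (has_law_integral (f := fun x => (near_dist T0 k x)%:E) YQ mnd nd0).
rewrite [X in _ + X%:E + _]big1; last first.
  move=> i _; rewrite big1// => j _; rewrite /c.
  by have [->|_] := eqVneq i j; rewrite ?supdistxx ?mulr0// mul0r mul0r.
rewrite adde0.
have -> : W1 P Q + W1 Q V + e%:E = (W1 P Q + (e / 4)%:E + (e / 4)%:E) + ((e / 4)%:E + (W1 Q V + (e / 4)%:E)).
  by rewrite -(fineK fPQ) -(fineK fQV) -!EFinD; congr (_%:E); field.
by apply: leeD; apply: leeD => //; exact: ltW.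
Qed.

(** Maximal coupling of the two vectors of cell probabilities: the common part [Num.min (p i) (q i)]
    stays in its cell, while the excesses [u] and [v], of equal total mass [t], are matched
    independently and alone pay the distance between centres. *)
Lemma W1_cells k P Q : W1 P Q <=
  \int[P]_x (near_dist T0 k x)%:E + \int[Q]_x (near_dist T0 k x)%:E +
  (\sum_(i < k.+1) \sum_(j < k.+1) supdist (path_dense d T0 i) (path_dense d T0 j))%:E *
  \sum_(i < k.+1) `|P [set x | near_cell T0 k x = i] - Q [set x | near_cell T0 k x = i]|.
Proof.
pose p i := fine (P [set x | near_cell T0 k x = i]).
pose q i := fine (Q [set x | near_cell T0 k x = i]).
have pE i : P [set x | near_cell T0 k x = i] = (p i)%:E.
  by rewrite fineK// fin_num_measure//; exact: measurable_near_cell.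
have qE i : Q [set x | near_cell T0 k x = i] = (q i)%:E.
  by rewrite fineK// fin_num_measure//; exact: measurable_near_cell.
have sum1 (P' : probability path R) : (\sum_i P' [set x | near_cell T0 k x = i] = 1)%E.
  rewrite -(@probability_setT _ _ _ P') (measure_partition (A := setT) P' (measurable_near_cell T0 (k := k)))//.
  by apply: eq_bigr => i _; rewrite setTI.
have p1 : (\sum_i p i = 1)%R.
  by apply: EFin_inj; rewrite -sumEFin -(sum1 P); apply: eq_bigr => i _; rewrite pE.
have q1 : (\sum_i q i = 1)%R.
  by apply: EFin_inj; rewrite -sumEFin -(sum1 Q); apply: eq_bigr => i _; rewrite qE.
have p0 i : (0 <= p i)%R by rewrite fine_ge0.
have q0 i : (0 <= q i)%R by rewrite fine_ge0.
pose u i := (p i - Num.min (p i) (q i))%R.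
pose v i := (q i - Num.min (p i) (q i))%R.
have u0 i : (0 <= u i)%R by rewrite subr_ge0 ge_min lexx.
have v0 i : (0 <= v i)%R by rewrite subr_ge0 ge_min lexx orbT.
pose t := (\sum_i u i)%R.
have tv : (t = \sum_i v i)%R by rewrite /t /u /v !sumrB p1 q1.
have t0 : (0 <= t)%R by apply: sumr_ge0.
pose c i j := ((i == j)%:R * Num.min (p i) (q i) + u i * v j / t)%R.
have c0 i j : (0 <= c i j)%R.
  rewrite addr_ge0//; first by rewrite mulr_ge0// le_min p0 q0.
  by rewrite divr_ge0// mulr_ge0.
have c1 i : (\sum_j c i j = p i)%R.
  rewrite /c big_split/= (bigD1 i)//= eqxx mul1r big1 ?addr0; last first.
    by move=> j /negbTE; rewrite eq_sym => ->; rewrite mul0r.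
  rewrite -mulr_suml -mulr_sumr -tv.
  have [tz|tz] := eqVneq t 0%R; last by rewrite mulfK// /u addrC subrK.
  rewrite tz mulr0 mul0r addr0.
  have : (u i <= 0)%R by rewrite -tz /t (bigD1 i)//= lerDl sumr_ge0.
  by rewrite /u subr_le0 => h; apply/eqP; rewrite eq_le h ge_min lexx.
have c2 j : (\sum_i c i j = q j)%R.
  rewrite /c big_split/= (bigD1 j)//= eqxx mul1r big1 ?addr0; last first.
    by move=> i /negbTE ->; rewrite mul0r.
  under eq_bigr do rewrite -mulrA.
  rewrite -mulr_suml -/t.
  have [tz|tz] := eqVneq t 0%R; last by rewrite mulrCA divff// mulr1 /v addrC subrK.
  rewrite tz mul0r addr0.
  have : (v j <= 0)%R by rewrite -tz tv (bigD1 j)//= lerDl sumr_ge0.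
  by rewrite /v subr_le0 => h; apply/eqP; rewrite eq_le h ge_min lexx orbT.
have := @W1_glue k _ _ path path P Q path_id path_id path_id path_id P Q c c0.
have c1' i : P [set w | near_cell T0 k w = i] = (\sum_j c i j)%:E by rewrite c1 pE.
have c2' i : Q [set w | near_cell T0 k w = i] = (\sum_j c j i)%:E by rewrite c2 qE.
move=> /(_ c1' c2' (@has_law_id P) (@has_law_id Q)) /le_trans; apply.
rewrite [X in (X + _ + _ + _)]integral0_eq; last by move=> x _; rewrite supdistxx.
rewrite [X in (_ + (_ + X))]integral0_eq; last by move=> x _; rewrite supdistxx.
rewrite add0e adde0 -addeA [X in _ + X]addeC addeA; apply: leeD => //.
under [X in _ <= _ * X]eq_bigr do rewrite pE qE -EFinB abse_EFin.
rewrite sumEFin -EFinM lee_fin mulr_suml; apply: ler_sum => i _.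
rewrite mulr_suml; apply: ler_sum => j _.
have [->|ij] := eqVneq i j; first by rewrite supdistxx mulr0 mul0r.
rewrite /c (negbTE ij) mul0r add0r mulrC ler_wpM2l ?supdist_ge0//.
(* A crude bound: each entry [u i * v j / t] is at most [t], itself below the sum of the
   differences. For t = 0 the quotient reads 0. *)
apply: (@le_trans _ _ t).
  have [->|tz] := eqVneq t 0%R; first by rewrite invr0 mulr0.
  rewrite ler_pdivrMr ?lt_def ?tz//; apply: ler_pM => //.
    by rewrite /t (bigD1 i)//= lerDl sumr_ge0.
  by rewrite tv (bigD1 j)//= lerDl sumr_ge0.
apply: ler_sum => l _; rewrite /u minEle; case: ifPn => h; first by rewrite subrr.
exact: ler_norm.
Qed.

Lemma W1_cell_small (P : probability path R) (e : R) : (0 < e)%R ->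
  \int[P]_x (supnorm x)%:E < +oo ->
  \forall k \near \oo, \int[P]_x (near_dist T0 k x)%:E <= e%:E.
Proof.
move=> e0 Pfin.
have /fine_cvgP[_ /cvgrPdist_lt /(_ _ e0)] := cvg_mean_near_dist T0 Pfin.
apply: filterS => k; rewrite sub0r normrN /= => ndk.
rewrite -[leLHS]fineK; first by rewrite lee_fin ltW// (le_lt_trans (ler_norm _)).
rewrite ge0_fin_numE; first exact: near_dist_fin.
by apply: integral_ge0 => x _; rewrite lee_fin near_dist_ge0.
Qed.

End wasserstein.

Section wasserstein_topology.
Context (R : realType) (d : nat) (T : R).
Local Notation prob1 := (prob1 d T).
Hypothesis T0 : 0 < T.

Lemma W1_openP (U : set prob1) : open U <-> W1_open U.
Proof. by []. Qed.

Lemma W1_ball_open (P : prob1) (e : R) :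
  open [set Q : prob1 | (W1 P Q < e%:E)%E].
Proof.
move=> Q /= PQ.
have fPQ : W1 P Q \is a fin_num by rewrite ge0_fin_numE ?W1_ge0// (lt_trans PQ)// ltry.
exists (e - fine (W1 P Q)).
  by rewrite subr_gt0 -lte_fin fineK.
move=> V QV; rewrite (le_lt_trans (W1_triangle T0 (Q := Q) P V (@prob1_moment _ _ _ Q)))//.
by rewrite EFinB fineK// lteBrDl// in QV.
Qed.

(** The topology is given by its open sets; that balls are open, and hence form a basis of
    neighbourhoods, rests on the triangle inequality. *)
Lemma nbhs_W1P (P : prob1) (U : set prob1) :
  nbhs P U <-> exists2 e : R, 0 < e & forall Q : prob1, (W1 P Q < e%:E)%E -> U Q.
Proof.
rewrite nbhsE; split.
  move=> [V [/W1_openP oV VP] VU]; have [e e0 eV] := oV _ VP.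
  by exists e => // Q /eV /VU.
move=> [e e0 eU]; exists [set Q : prob1 | (W1 P Q < e%:E)%E] => //.
split; first exact: W1_ball_open.
by rewrite /= W1_eq0// lte_fin.
Qed.

End wasserstein_topology.

(** * Relative entropy in dual form *)

Section donsker_varadhan.
Context (R : realType).

Definition bounded_real (E : Type) (g : E -> R) := exists M : R, forall x, `|g x| <= M.

(* P has relative entropy at most a with respect to Q, in the dual form of
   Donsker and Varadhan: E_P[g] - a <= ln E_Q[exp g]. *)
Definition entropy_le d (E : measurableType d) (P Q : probability E R) (a : R) :=
  forall g : E -> R, measurable_fun setT g -> bounded_real g ->
  expR (\int[P]_x g x - a) <= \int[Q]_x expR (g x).

Lemma bounded_integrable d (E : measurableType d) (P : probability E R)
    (g : E -> R) :
  measurable_fun setT g -> bounded_real g -> P.-integrable setT (EFin \o g).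
Proof.
move=> mg [M gM]; apply: measurable_bounded_integrable => //.
  by rewrite (le_lt_trans (probability_le1 _ _))// ltry.
exists M; split; first exact: num_real.
by move=> y My x _ /=; rewrite (le_trans (gM x))// ltW.
Qed.

(** Monotone convergence along truncations, by which the bounded test functions of [entropy_le]
    control unbounded integrands. *)
Lemma integral_le_truncation d (E : measurableType d) (P : {measure set E -> \bar R})
    (f : E -> R) (c : \bar R) :
  measurable_fun setT f -> (forall x, 0 <= f x) ->
  (\forall n \near \oo, (\int[P]_x (Num.min (f x) n%:R)%:E <= c)%E) ->
  (\int[P]_x (f x)%:E <= c)%E.
Proof.
move=> mf f0 fc; pose h n x : R := Num.min (f x) n%:R.
have h0 n x : setT x -> (0 <= (h n x)%:E)%E by rewrite lee_fin le_min f0 ler0n.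
have mh n : measurable_fun setT (fun x => (h n x)%:E).
  by apply/measurable_EFinP; exact: measurable_minr.
have hh x : setT x -> {homo (fun n => (h n x)%:E) : n m / (n <= m)%N >-> (n <= m)%E}.
  move=> _ n m nm; rewrite lee_fin /h le_min ge_min lexx /= ge_min.
  by rewrite ler_nat nm orbT.
have lim_h x : limn (fun n => (h n x)%:E) = (f x)%:E.
  apply: lim_near_cst => //; near=> n.
  rewrite /h min_l//; near: n; exact: nbhs_infty_ger.
under eq_integral do rewrite -lim_h.
have cvh := @cvg_monotone_convergence _ _ _ P _ measurableT _ mh h0 hh.
rewrite -(cvg_lim _ cvh)//; apply: lime_le => //.
by apply/cvg_ex; eexists; exact: cvh.
Unshelve. all: by end_near. Qed.

Section integrable_real.
Context d (E : measurableType d) (P : probability E R).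

Lemma integrableR_cst (c : R) : P.-integrable setT (EFin \o (fun=> c)).
Proof. by apply: bounded_integrable => //; exists `|c|. Qed.

Lemma integrableRD (f g : E -> R) : P.-integrable setT (EFin \o f) ->
  P.-integrable setT (EFin \o g) ->
  P.-integrable setT (EFin \o (fun x => f x + g x)).
Proof. by move=> If Ig; exact: (integrableD _ If Ig). Qed.

Lemma integrableRB (f g : E -> R) : P.-integrable setT (EFin \o f) ->
  P.-integrable setT (EFin \o g) ->
  P.-integrable setT (EFin \o (fun x => f x - g x)).
Proof. by move=> If Ig; exact: (integrableB _ If Ig). Qed.

Lemma integrableR_sum (I : Type) (s : seq I) (f : I -> E -> R) :
  (forall i, P.-integrable setT (EFin \o f i)) ->
  P.-integrable setT (EFin \o (fun x => \sum_(i <- s) f i x)).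
Proof.
move=> If; elim: s => [|i s IH].
  under eq_fun do rewrite big_nil.
  exact: integrableR_cst.
under eq_fun do rewrite big_cons.
exact: integrableRD.
Qed.

Lemma Rintegral_sum (I : Type) (s : seq I) (f : I -> E -> R) :
  (forall i, P.-integrable setT (EFin \o f i)) ->
  \int[P]_x (\sum_(i <- s) f i x) = \sum_(i <- s) \int[P]_x f i x.
Proof.
move=> If; elim: s => [|i s IH].
  rewrite big_nil; under eq_Rintegral do rewrite big_nil.
  by rewrite Rintegral_cst// mul0r.
rewrite big_cons -IH; under eq_Rintegral do rewrite big_cons.
by rewrite RintegralD//; exact: integrableR_sum.
Qed.

End integrable_real.

Lemma bounded_expR (E : Type) (g : E -> R) :
  bounded_real g -> bounded_real (expR \o g).
Proof.
move=> [M gM]; exists (expR M) => x; rewrite /= ger0_norm ?expR_ge0// ler_expR.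
exact: le_trans (ler_norm _) (gM x).
Qed.

Lemma bounded_comp (E F : Type) (g : F -> R) (f : E -> F) :
  bounded_real g -> bounded_real (g \o f).
Proof. by move=> [M gM]; exists M => x; exact: gM. Qed.

Section basic.
Context d (E : measurableType d).
Implicit Types P Q : probability E R.

Lemma entropy_le_mono P Q (a b : R) : a <= b ->
  entropy_le P Q a -> entropy_le P Q b.
Proof.
move=> ab h g mg bg; apply: le_trans (h g mg bg).
by rewrite ler_expR lerB.
Qed.

Lemma prob_indic P (A : set E) : measurable A ->
  P A = (\int[P]_x (\1_A x)%:E)%E.
Proof. by move=> mA; rewrite integral_indic// setIT. Qed.

Lemma Rintegral_prob P (c : R) : \int[P]_x c = c.
Proof. by rewrite Rintegral_cst//= probability_setT mulr1. Qed.

Lemma entropy_le_ge0 P Q (a : R) : entropy_le P Q a -> 0 <= a.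
Proof.
move=> /(_ (cst 0) (measurable_cst _)); rewrite !Rintegral_prob//=.
rewrite expR0 Rintegral_prob sub0r -[X in _ <= X]expR0 ler_expR oppr_le0; apply.
by exists 0 => x; rewrite normr0.
Qed.

Lemma indic_bounded (A : set E) (c : R) : bounded_real (fun x => c * \1_A x).
Proof.
exists `|c| => x; rewrite normrM ler_piMr// indicE.
by case: (x \in A); rewrite ?normr1 ?normr0.
Qed.

Lemma Rintegral_indicZ P (A : set E) (c : R) : measurable A ->
  \int[P]_x (c * \1_A x) = c * fine (P A).
Proof.
move=> mA; rewrite RintegralZl//; last first.
  apply: bounded_integrable; first exact: measurable_indic.
  by have [M hM] := indic_bounded A 1; exists M => x; rewrite -[\1_A x]mul1r.
by rewrite /Rintegral integral_indic// setIT.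
Qed.

(** The test function is c * \1_A, and the exponential on the left is bounded below by its tangent
    at 0. Letting c vary gives absolute continuity, uniformly over an entropy sublevel set. *)
Lemma entropy_le_set P Q (a c : R) (A : set E) : measurable A ->
  entropy_le P Q a ->
  c * fine (P A) - a <= (expR c - 1) * fine (Q A).
Proof.
move=> mA h; have mcA : measurable_fun setT (fun x => c * \1_A x).
  by apply: measurable_funM => //; exact: measurable_indic.
have := h _ mcA (indic_bounded A c).
rewrite Rintegral_indicZ//.
have -> : \int[Q]_x expR (c * \1_A x) = 1 + (expR c - 1) * fine (Q A).
  rewrite -Rintegral_indicZ//.
  rewrite -[X in _ = X + _](_ : \int[Q]_x (cst 1 x) = 1 :> R); last first.
    exact: Rintegral_prob.
  rewrite -RintegralD//; last 2 first.
    by apply: bounded_integrable => //; exists 1 => x; rewrite normr1.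
    apply: bounded_integrable; last exact: indic_bounded.
    by apply: measurable_funM => //; exact: measurable_indic.
  apply: eq_Rintegral => x _; rewrite indicE.
  by case: (x \in A); rewrite ?mulr1 ?mulr0 ?expR0 ?addr0// addrC subrK.
move=> h'; rewrite -(lerD2l 1); apply: le_trans h'; exact: expR_ge1Dx.
Qed.

Lemma entropy_le_dominates P Q (a : R) : entropy_le P Q a -> P `<< Q.
Proof.
move=> h; apply/null_content_dominatesP => A mA QA0.
have PA c : c * fine (P A) <= a.
  by have := entropy_le_set c mA h; rewrite QA0 /= mulr0 subr_le0.
suff PA0 : fine (P A) = 0.
  by rewrite -[P A]fineK ?PA0// fin_num_measure.
apply/eqP; rewrite eq_le fine_ge0// andbT leNgt; apply/negP => PA0.
have := PA ((a + 1) / fine (P A)); rewrite divfK ?gt_eqF//.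
by rewrite leNgt ltrDl ltr01.
Qed.

End basic.

Lemma has_law_Rintegral d1 d2 (S : measurableType d1) (E : measurableType d2)
    (PP : probability S R) (Y : {mfun S >-> E}) (P : probability E R) (f : E -> R) :
  has_law PP Y P -> measurable_fun setT f -> bounded_real f ->
  \int[PP]_w f (Y w) = \int[P]_x f x.
Proof.
move=> YP mf bf; congr fine.
have -> : (\int[P]_x (f x)%:E = \int[distribution PP Y]_x (f x)%:E)%E.
  by apply: eq_measure_integral => A mA _; rewrite -[LHS]YP.
rewrite integral_distribution//; first by apply/measurable_EFinP.
apply: (@bounded_integrable _ S PP (f \o Y)); last exact: bounded_comp.
exact: measurableT_comp.
Qed.

(** Test functions on the image pull back along [Y]: this is the data processing inequality. Applied
    to a bijection and to its inverse it becomes an equivalence. *)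
Lemma entropy_le_map d1 d2 (S : measurableType d1) (E : measurableType d2)
    (P Q : probability S R) (Y : {mfun S >-> E}) (P' Q' : probability E R) (a : R) :
  has_law P Y P' -> has_law Q Y Q' -> entropy_le P Q a -> entropy_le P' Q' a.
Proof.
move=> YP YQ h g mg bg; rewrite -(has_law_Rintegral YP)//.
rewrite -(has_law_Rintegral (f := expR \o g) YQ)//; last exact: bounded_expR.
  by apply: h; [exact: measurableT_comp|exact: bounded_comp].
exact: measurableT_comp.
Qed.

Lemma entropy_le_ext d1 (S : measurableType d1)
    (P Q P' Q' : probability S R) (a : R) :
  (forall A, measurable A -> P A = P' A) -> (forall A, measurable A -> Q A = Q' A) ->
  entropy_le P Q a -> entropy_le P' Q' a.
Proof.
move=> PP' QQ' h g mg bg; have := h g mg bg.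
rewrite /Rintegral (eq_measure_integral P'); last by move=> A mA _; exact: PP'.
rewrite (@eq_measure_integral _ _ _ setT Q' Q)// => A mA _; exact: QQ'.
Qed.

End donsker_varadhan.

Section density.
Context (R : realType) d (E : measurableType d) (P Q : probability E R).
Hypothesis PQ : P `<< Q.
Local Open Scope charge_scope.

(** The Radon-Nikodym derivative is nonnegative only almost everywhere; the maximum makes it so
    everywhere. *)
Definition density (x : E) : R :=
  Num.max (fine ('d (charge_of_finite_measure P) '/d Q x)) 0.

Let RN_fin x : 'd (charge_of_finite_measure P) '/d Q x \is a fin_num.
Proof. exact: Radon_Nikodym_fin_num. Qed.

Let mRN : measurable_fun setT ('d (charge_of_finite_measure P) '/d Q).
Proof. by apply: measurable_int; exact: Radon_Nikodym_integrable. Qed.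

Lemma density_ge0 x : 0 <= density x.
Proof. by rewrite le_max lexx orbT. Qed.

Lemma measurable_density : measurable_fun setT density.
Proof.
apply: measurable_maxr => //.
exact: (measurableT_comp (@fine_measurable _ _ measurableT)).
Qed.

Lemma lne_density x : lne ('d (charge_of_finite_measure P) '/d Q x) = lne (density x)%:E.
Proof.
rewrite -(fineK (RN_fin x)) /density.
set r := fine _; have [r0|//] := leP r 0.
by rewrite !le0_lneNy// lee_fin.
Qed.

Lemma integral_density (f : E -> \bar R) : measurable_fun setT f ->
  (forall x, 0 <= f x)%E ->
  (\int[P]_x f x = \int[Q]_x (f x * (density x)%:E))%E.
Proof.
move=> mf f0; rewrite -(Radon_Nikodym_SigmaFinite.change_of_variables PQ f0 measurableT mf).
have F0 := Radon_Nikodym_SigmaFinite.f_ge0 PQ.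
have FT := Radon_Nikodym_SigmaFinite.f_fin_num PQ.
have mF := measurable_int _ (Radon_Nikodym_SigmaFinite.f_integrable PQ).
apply: ge0_ae_eq_integral => //.
- exact: emeasurable_funM.
- by apply: emeasurable_funM => //; apply/measurable_EFinP; exact: measurable_density.
- by move=> x _; rewrite mule_ge0.
- by move=> x _; rewrite mule_ge0// lee_fin density_ge0.
apply: ae_eqe_mul2l; apply: filterS (ae_eq_Radon_Nikodym_SigmaFinite PQ measurableT) => x /= FRN xT.
have := FRN xT => h; rewrite h -(fineK (RN_fin x)) /density /= max_l//.
by apply: fine_ge0; rewrite -h.
Qed.

(** [lne] is -oo at 0 whereas [ln] is 0 there; the two integrands differ only where the density
    vanishes, which is a [P]-null set. *)
Lemma integral_lne_density :
  (\int[P]_x lne ('d (charge_of_finite_measure P) '/d Q x) =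
   \int[P]_x (ln (density x))%:E)%E.
Proof.
have mln : measurable_fun setT (fun x => (ln (density x))%:E).
  apply/measurable_EFinP; apply: measurableT_comp; first exact: measurable_ln.
  exact: measurable_density.
rewrite (eq_integral (fun x => if 0 < density x then (ln (density x))%:E else -oo%E)); last first.
  move=> x _; rewrite lne_density; case: ltP => r0; first by rewrite lne_EFin.
  by rewrite le0_lneNy.
have mpos : measurable [set x | 0 < density x].
  exact: (measurable_gt_level measurable_density).
apply: ae_eq_integral => //.
  apply: measurable_fun_ifT => //.
  by apply: measurable_fun_ltr => //; exact: measurable_density.
exists (~` [set x | 0 < density x]); split.
- exact: measurableC.
- etransitivity; first by apply: prob_indic; exact: measurableC.
  rewrite integral_density; last 2 first.
    by apply/measurable_EFinP; apply: measurable_indic; exact: measurableC.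
    by move=> x; rewrite lee_fin.
  rewrite integral0_eq// => x _; rewrite -EFinM indicE.
  have [r0|r0] := ltP 0 (density x).
    by rewrite memNset ?mul0r// => /(_ r0).
  suff -> : density x = 0 by rewrite mulr0.
  by apply/eqP; rewrite eq_le r0 density_ge0.
- by move=> x /= h r0; apply: h => _; rewrite r0.
Qed.

End density.

Section entropy_dual.
Context (R : realType) d (E : measurableType d) (P Q : probability E R).
Hypothesis PQ : P `<< Q.
Local Notation r := (density P Q).

Let r0 := density_ge0 P Q.
Let mr : measurable_fun setT r.
Proof. exact: measurable_density. Qed.
Let mlnr : measurable_fun setT (@ln R \o r).
Proof. by apply: measurableT_comp => //; exact: measurable_ln. Qed.

Let lnm x : R := Num.max (- ln (r x)) 0.
Let lnp x : R := Num.max (ln (r x)) 0.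

Let mlnm : measurable_fun setT lnm.
Proof. by apply: measurable_maxr => //; exact: measurableT_comp. Qed.
Let mlnp : measurable_fun setT lnp.
Proof. by apply: measurable_maxr => //; exact: measurableT_comp. Qed.
Let lnm0 x : 0 <= lnm x. Proof. by rewrite le_max lexx orbT. Qed.
Let lnp0 x : 0 <= lnp x. Proof. by rewrite le_max lexx orbT. Qed.

(** Under [Q] the integrand becomes r times the positive part of - ln r, at most r * r^-1 = 1
    because ln y < y. The negative part of ln r is thus always integrable, and the entropy integral
    is never a difference of two infinities. *)
Let int_lnm : (\int[P]_x (lnm x)%:E <= 1)%E.
Proof.
rewrite (integral_density PQ)//; last exact/measurable_EFinP.
rewrite (@le_trans _ _ (\int[Q]_x cst 1 x)%E)//; last first.
  by rewrite integral_cst//= probability_setT mul1e.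
apply: ge0_le_integral => //.
- by move=> x _; rewrite mule_ge0// lee_fin.
- by apply/measurable_EFinP; exact: measurable_funM.
move=> x _; rewrite -EFinM lee_fin.
have := r0 x; rewrite le_eqVlt => /predU1P[<-|rx]; first by rewrite mulr0.
rewrite /lnm; have [_|_] := leP (- ln (r x)) 0; first by rewrite mul0r.
rewrite -lnV ?posrE//.
have rV : 0 < (r x)^-1 by rewrite invr_gt0.
by rewrite -[leRHS](mulVf (lt0r_neq0 rx)) ler_pM2r// ltW// ln_sublinear.
Qed.

Let int_ln : (\int[P]_x (ln (r x))%:E =
  \int[P]_x (lnp x)%:E - \int[P]_x (lnm x)%:E)%E.
Proof.
rewrite integralE; congr (_ - _)%E; apply: eq_integral => x _.
  by rewrite funeposE /lnp EFin_max.
by rewrite funenegE /lnm EFin_max.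
Qed.

(** Jensen's inequality for exp under [P], in the form of its tangent at [ln c]: the function u =
    exp g / r integrates to at most c, because r cancels in the change of measure. *)
Lemma entropy_le_of_integral (a : R) :
  (\int[P]_x (ln (r x))%:E <= a%:E)%E -> entropy_le P Q a.
Proof.
move=> Ha g mg bg.
have lnm_fin : (\int[P]_x (lnm x)%:E)%E \is a fin_num.
  rewrite ge0_fin_numE; first by rewrite (le_lt_trans int_lnm)// ltry.
  by apply: integral_ge0 => x _; rewrite lee_fin.
have lnp_fin : (\int[P]_x (lnp x)%:E < +oo)%E.
  move: Ha; rewrite int_ln leeBlDr// => /le_lt_trans; apply.
  by rewrite -(fineK lnm_fin) -EFinD ltry.
have iln : P.-integrable setT (EFin \o (@ln R \o r)).
  apply/integrableP; split; first exact/measurable_EFinP.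
  rewrite (eq_integral (fun x => (lnp x)%:E + (lnm x)%:E)%E); last first.
    move=> x _; rewrite -EFinD /= /lnp /lnm; congr (_%:E).
    have [h|h] := leP 0 (ln (r x)).
      by rewrite max_r ?oppr_le0// addr0 ger0_norm.
    by rewrite max_l ?oppr_ge0 ?ltW// add0r ltr0_norm.
  rewrite ge0_integralD//; last 4 first.
    by move=> x _; rewrite lee_fin.
    exact/measurable_EFinP.
    by move=> x _; rewrite lee_fin.
    exact/measurable_EFinP.
  by rewrite lte_add_pinfty// ltey_eq lnm_fin.
have ig := bounded_integrable P mg bg.
have iQ := bounded_integrable Q (measurableT_comp (@measurable_expR R) mg) (bounded_expR bg).
set c := \int[Q]_x expR (g x).
have c0 : 0 < c.
  have [M gM] := bg; apply: (@lt_le_trans _ _ (expR (- M))); first exact: expR_gt0.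
  rewrite -(Rintegral_prob Q (expR (- M))); apply: le_Rintegral => //.
    exact: integrableR_cst.
  by move=> x _; rewrite ler_expR lerNl (le_trans _ (gM x))// -normrN ler_norm.
pose u x := expR (g x - ln (r x)).
have mu : measurable_fun setT u.
  by apply: measurableT_comp => //; exact: measurable_funB.
have u0 x : 0 <= u x by exact: expR_ge0.
have uc : (\int[P]_x (u x)%:E <= c%:E)%E.
  rewrite (integral_density PQ)//; last exact/measurable_EFinP.
  rewrite /c /Rintegral fineK; last exact: integrable_fin_num.
  apply: ge0_le_integral => //.
  - by move=> x _; rewrite mule_ge0// lee_fin.
  - by apply/measurable_EFinP; exact: measurable_funM.
  - by apply/measurable_EFinP; exact: (measurableT_comp (@measurable_expR R) mg).
  move=> x _; rewrite -EFinM lee_fin /u.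
  have := r0 x; rewrite le_eqVlt => /predU1P[<-|rx]; first by rewrite mulr0 expR_ge0.
  by rewrite expRB lnK ?posrE// divfK// gt_eqF.
have iu : P.-integrable setT (EFin \o u).
  apply/integrableP; split; first exact/measurable_EFinP.
  under eq_integral do rewrite /= ger0_norm//.
  by rewrite (le_lt_trans uc)// ltry.
have main : \int[P]_x (g x - ln (r x) - (ln c - 1)) <= \int[P]_x (c^-1 * u x).
  apply: le_Rintegral => //.
  - by apply: integrableRB (integrableR_cst _ _); exact: integrableRB.
  - rewrite (_ : EFin \o _ = (fun x => c^-1%:E * (EFin \o u) x)%E); first exact: integrableZl.
    by apply/funext => x; rewrite /= EFinM.
  move=> x _; rewrite opprB addrA lerBlDl.
  have := expR_ge1Dx (g x - ln (r x) - ln c); rewrite expRB lnK ?posrE// -/(u x).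
  by rewrite [c^-1 * _]mulrC; set uc' := u x / c; lra.
rewrite RintegralZl// in main.
have {}main : \int[P]_x (g x - ln (r x) - (ln c - 1)) <= 1.
  apply: (le_trans main); rewrite mulrC ler_pdivrMr// mul1r -lee_fin /Rintegral fineK//.
  exact: integrable_fin_num.
rewrite RintegralB// in main; last 2 first.
- exact: integrableRB.
- exact: integrableR_cst.
rewrite RintegralB// Rintegral_prob in main.
have Hr : \int[P]_x ln (r x) <= a.
  by rewrite -lee_fin /Rintegral fineK//; exact: integrable_fin_num.
rewrite -[leRHS]lnK ?posrE// ler_expR; lra.
Qed.

(** The optimal test function is ln r. It is truncated to [-n, n], with value -n where r vanishes;
    then exp g is at most r + exp (- n), whose [Q]-integral is 1 + exp (- n), and the error
    disappears as n grows. *)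
Lemma integral_of_entropy_le (a : R) :
  entropy_le P Q a -> (\int[P]_x (ln (r x))%:E <= a%:E)%E.
Proof.
move=> H.
have lnm_fin : (\int[P]_x (lnm x)%:E)%E \is a fin_num.
  rewrite ge0_fin_numE; first by rewrite (le_lt_trans int_lnm)// ltry.
  by apply: integral_ge0 => x _; rewrite lee_fin.
rewrite int_ln leeBlDr// -(fineK lnm_fin).
set M := fine _.
have ir : Q.-integrable setT (EFin \o r).
  apply/integrableP; split; first exact/measurable_EFinP.
  under eq_integral do rewrite /= ger0_norm//.
  have := integral_density PQ (@measurable_cst _ _ E (\bar R) setT 1%E) (fun=> lee01).
  under [X in _ = X -> _]eq_integral do rewrite mul1e.
  by move=> <-; rewrite integral_cst//= probability_setT mul1e ltry.
have r1 : \int[Q]_x r x = 1.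
  have := integral_density PQ (@measurable_cst _ _ E (\bar R) setT 1%E) (fun=> lee01).
  under [X in _ = X -> _]eq_integral do rewrite mul1e.
  by rewrite /Rintegral => <-; rewrite integral_cst//= probability_setT mul1e.
pose h n x : R := Num.min (lnp x) n%:R.
have h0 n x : 0 <= h n x by rewrite le_min lnp0 ler0n.
have mh n : measurable_fun setT (h n) by apply: measurable_minr.
have hM (n : nat) : (\int[P]_x (h n x)%:E <= (a + M + expR (- n%:R))%:E)%E.
  pose g x : R := if 0 < r x then Num.max (- n%:R) (Num.min n%:R (ln (r x))) else - n%:R.
  have mg : measurable_fun setT g.
    apply: measurable_fun_ifT => //; first exact: measurable_fun_ltr.
    by apply: measurable_maxr => //; exact: measurable_minr.
  have bg : bounded_real g.
    exists n%:R => x; rewrite /g; case: ifPn => _; last by rewrite normrN normr_nat.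
    rewrite ler_norml le_max lexx/= ge_max ge_min lexx/= andbT.
    by rewrite (@le_trans _ _ 0)// oppr_le0.
  have := H g mg bg.
  have := bounded_integrable P mg bg => ig.
  have Qg : \int[Q]_x expR (g x) <= 1 + expR (- n%:R).
    rewrite -{1}r1 -(Rintegral_prob Q (expR (- n%:R))) -RintegralD//; last first.
      exact: integrableR_cst.
    apply: le_Rintegral => //.
    - apply: (bounded_integrable Q (measurableT_comp (@measurable_expR R) mg)); exact: bounded_expR.
    - by apply: integrableRD => //; exact: integrableR_cst.
    move=> x _; rewrite /g; case: ifPn => rx; last by rewrite lerDr.
    have [_|_] := leP (- n%:R) (Num.min n%:R (ln (r x))); last by rewrite lerDr.
    rewrite (@le_trans _ _ (r x)) ?lerDl ?expR_ge0//.
    by rewrite -[leRHS](lnK rx) ler_expR ge_min lexx orbT.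
  move=> /le_trans /(_ Qg); rewrite -ler_ln ?posrE ?expR_gt0 ?addr_gt0 ?ltr01 ?expR_gt0//.
  rewrite expRK => hg.
  have {}hg : \int[P]_x g x <= a + expR (- n%:R).
    rewrite -lerBlDl (le_trans hg)// le_ln1Dx// (lt_trans _ (expR_gt0 _))//.
  have mz : measurable [set x | r x <= 0] by exact: (measurable_le_level mr).
  have Pz : P [set x | r x <= 0] = 0%E.
    etransitivity; first exact: prob_indic.
    rewrite (integral_density PQ); last 2 first.
      by apply/measurable_EFinP; exact: measurable_indic.
      by move=> x; rewrite lee_fin.
    rewrite integral0_eq// => x _; rewrite -EFinM indicE.
    have [rx|rx] := ltP 0 (r x).
      by rewrite memNset ?mul0r//= leNgt rx.
    suff -> : r x = 0 by rewrite mulr0.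
    by apply/eqP; rewrite eq_le rx r0.
  have bh : bounded_real (h n).
    by exists n%:R => x; rewrite ger0_norm// ge_min lexx orbT.
  have ih := bounded_integrable P (mh n) bh.
  have ilnm : P.-integrable setT (EFin \o lnm).
    apply/integrableP; split; first exact/measurable_EFinP.
    under eq_integral do rewrite /= ger0_norm//.
    by rewrite (le_lt_trans int_lnm)// ltry.
  have iz : P.-integrable setT (EFin \o (fun x => n%:R * \1_[set x | r x <= 0] x)).
    apply: bounded_integrable; last exact: indic_bounded.
    by apply: measurable_funM => //; exact: measurable_indic.
  have igl : P.-integrable setT (EFin \o (fun x => g x + lnm x)).
    exact: integrableRD.
  (* Adding [lnm] cancels the negative part of g, and the last term acts only on a [P]-null set. *)
  have : \int[P]_x h n x <= \int[P]_x (g x + lnm x + n%:R * \1_[set x | r x <= 0] x).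
    apply: le_Rintegral => //.
      exact: integrableRD.
    move=> x _; rewrite /g indicE; case: ifPn => rx; last first.
      rewrite -leNgt in rx; rewrite mem_set// mulr1 addrAC addNr add0r.
      have rx0 : r x = 0 by apply/eqP; rewrite eq_le rx r0.
      by rewrite /h /lnp /lnm rx0 ln0// oppr0 maxxx ge_min lexx.
    rewrite memNset ?mulr0 ?addr0; last by rewrite /= leNgt rx.
    rewrite /h /lnp /lnm.
    have [l0|l0] := leP 0 (ln (r x)).
      by rewrite [X in _ + X]max_r ?oppr_le0// addr0 le_max [Num.min n%:R _]minC lexx orbT.
    rewrite [X in _ + X]max_l; last by rewrite oppr_ge0 ltW.
    apply: (@le_trans _ _ 0); first by rewrite ge_min lexx.
    rewrite subr_ge0 le_max; apply/orP; right.
    by rewrite le_min lexx andbT (le_trans (ltW l0)).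
  rewrite !RintegralD// Rintegral_indicZ// Pz/= mulr0 addr0 => hh.
  rewrite -[leLHS]fineK; last exact: integrable_fin_num.
  rewrite lee_fin (le_trans hh)// addrAC lerD2r//.
apply/lee_addgt0Pr => e e0; apply: integral_le_truncation => //.
near=> n; rewrite (le_trans (hM n))// -EFinD lee_fin lerD2l.
have ne : e^-1 < n%:R by near: n; exact: nbhs_infty_gtr.
rewrite expRN -[leRHS]invrK lef_pV2 ?posrE ?invr_gt0 ?expR_gt0//.
by rewrite (le_trans (ltW ne))// (le_trans _ (expR_ge1Dx _))// lerDr.
Unshelve. all: by end_near. Qed.

End entropy_dual.

Section entropy_consequences.
Context (R : realType) d (E : measurableType d) (P Q : probability E R).

(** With c = 2 (|a| + 1) / e and Q A < exp (- c), [entropy_le_set] leaves c * P A at most |a| + 1,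
    which is half of c * e. The threshold does not depend on P, and this uniformity is what makes
    limits countably additive. *)
Lemma entropy_le_unif_ac (a e : R) : 0 < e -> exists2 t : R, 0 < t &
  forall (P Q : probability E R) (A : set E), measurable A ->
    entropy_le P Q a -> fine (Q A) < t -> fine (P A) < e.
Proof.
move=> e0; pose c := 2 * (`|a| + 1) / e.
have a1 : 0 < `|a| + 1 by rewrite ltr_wpDl.
have c0 : 0 < c by rewrite divr_gt0// mulr_gt0.
exists (expR c)^-1; first by rewrite invr_gt0 expR_gt0.
move=> P' Q' A mA PQ QA; have := entropy_le_set c mA PQ.
rewrite lerBlDr => h.
have {}h : c * fine (P' A) <= `|a| + 1.
  rewrite (le_trans h)// addrC lerD ?ler_norm//.
  rewrite (@le_trans _ _ (expR c * fine (Q' A)))//.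
    by rewrite ler_wpM2r ?fine_ge0// lerBlDr lerDl.
  by rewrite -ler_pdivlMl ?expR_gt0// mulr1 ltW.
rewrite -(ltr_pM2l c0) (le_lt_trans h)// /c divfK ?gt_eqF//.
by rewrite mulr2n mulrDl mul1r ltrDl.
Qed.

(** The dual inequality with [f] as test function; as [f] may be unbounded, it is truncated
    first. *)
Lemma entropy_le_exp_moment (a l : R) (f : E -> R) :
  measurable_fun setT f -> (forall x, 0 <= f x) ->
  (\int[Q]_x (expR (f x))%:E <= (expR l)%:E)%E ->
  entropy_le P Q a -> (\int[P]_x (f x)%:E <= (a + l)%:E)%E.
Proof.
move=> mf f0 fl PQ.
apply: integral_le_truncation => //; near=> n.
pose h x : R := Num.min (f x) n%:R.
have mh : measurable_fun setT h by exact: measurable_minr.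
have bh : bounded_real h.
  by exists n%:R => x; rewrite ger0_norm ?ge_min ?lexx ?orbT// le_min f0 ler0n.
have ih := bounded_integrable P mh bh.
have ie := bounded_integrable Q (measurableT_comp (@measurable_expR R) mh) (bounded_expR bh).
rewrite -[leLHS]fineK; last exact: integrable_fin_num.
rewrite lee_fin -lerBlDl -ler_expR (le_trans (PQ _ mh bh))//.
rewrite -lee_fin /Rintegral fineK; last exact: integrable_fin_num.
apply: le_trans fl; apply: ge0_le_integral => //.
- apply/measurable_EFinP; exact: (measurableT_comp (@measurable_expR R) mh).
- apply/measurable_EFinP; exact: (measurableT_comp (@measurable_expR R) mf).
- by move=> x _; rewrite lee_fin ler_expR ge_min lexx.
Unshelve. all: by end_near. Qed.

End entropy_consequences.

Section rel_entropy.
Context (R : realType) (d : nat) (T : R).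
Local Notation path := (cpath d T).
Implicit Types P Q : probability path R.

(** Donsker-Varadhan duality, stated on finite levels, which determine the extended value. Outside
    absolute continuity both sides fail, the right one by [entropy_le_dominates]. *)
Lemma rel_entropy_leP P Q (a : R) :
  (rel_entropy P Q <= a%:E)%E <-> entropy_le P Q a.
Proof.
rewrite /rel_entropy; case: asboolP => PQ; last first.
  by split => [|/entropy_le_dominates//]; rewrite leye_eq.
rewrite (integral_lne_density PQ); split; first exact: entropy_le_of_integral.
exact: integral_of_entropy_le.
Qed.

Lemma rel_entropy_ge0 P Q : (0 <= rel_entropy P Q)%E.
Proof.
rewrite leNgt; apply/negP => H.
have [a a0 Ha] : exists2 a : R, a < 0 & (rel_entropy P Q <= a%:E)%E.
  move: H; case: (rel_entropy P Q) => [r| |]//; last by exists (-1) => //; rewrite ?ltrN10 ?leNye.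
  by rewrite lte_fin => r0; exists r.
by have /rel_entropy_leP/entropy_le_ge0 := Ha; rewrite leNgt a0.
Qed.

Lemma rate_rel_entropy (W : 'rV[R]_d -> R) (muin : probability 'rV[R]_d R)
    (P : prob1 d T) :
  rate W muin P = rel_entropy P (Gamma W muin P).
Proof. by rewrite /rate /rel_entropy; case: asboolP => // h; case: asboolP. Qed.

End rel_entropy.

(** The sum is the integer part of y: every positive integer up to y counts once. *)
Lemma layer_cake_approx (R : realType) (n : nat) (y : R) : 0 <= y <= n%:R ->
  `|y - \sum_(k < n) (if (k.+1%:R : R) <= y then 1 else 0)| <= 1.
Proof.
move=> /andP[y0 yn].
have jn : (truncn y <= n)%N by rewrite -(ler_nat R) (le_trans _ yn)// truncn_le.
have -> : \sum_(k < n) (if (k.+1%:R : R) <= y then 1 else 0) = (truncn y)%:R :> R.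
  under eq_bigr do rewrite -truncn_gt_nat.
  rewrite -[X in _ = X%:R](minn_idPr jn); elim: n {yn jn} => [|n IH].
    by rewrite big_ord0 min0n.
  rewrite big_ord_recr/= IH; case: ltnP => h.
    by rewrite (minn_idPl h) natr1.
  by rewrite addr0 (minn_idPr (leqW h)).
have /andP[h1 h2] := truncn_itv y0.
by rewrite ger0_norm ?subr_ge0// lerBlDl natr1 ltW.
Qed.

(** * Compactness of entropy sublevel sets *)

Section ultrafilter_limit.
Context (R : realType) d (E : measurableType d) (X : Type).
Variables (p : X -> probability E R) (Q : probability E R) (a : R).
Variables (U : set_system X) (UU : UltraFilter U).
Hypothesis Uent : U [set x | entropy_le (p x) Q a].

Let UF : ProperFilter U := @ultra_proper _ _ UU.

(** This is the limit of the numbers P(A) along the ultrafilter, written as a supremum so that it is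
    defined for every set A. *)
Definition ultra_lim (A : set E) : R := sup [set r | U [set x | r <= fine (p x A)]].

Let p01 x A : measurable A -> 0 <= fine (p x A) <= 1.
Proof.
move=> mA; rewrite fine_ge0//= -lee_fin fineK; first exact: probability_le1.
exact: fin_num_measure.
Qed.

Let S_has_sup A : measurable A -> has_sup [set r | U [set x | r <= fine (p x A)]].
Proof.
move=> mA; split; first by exists 0; apply: filterE => x /=; case/andP: (p01 x mA).
exists 1 => r /= Ur; rewrite leNgt; apply/negP => r1.
have [x /= rx] := filter_ex Ur.
by have /andP[_] := p01 x mA; rewrite leNgt (lt_le_trans r1).
Qed.

Lemma ultra_limP A (e : R) : measurable A -> 0 < e ->
  U [set x | `|fine (p x A) - ultra_lim A| < e].
Proof.
move=> mA e0.
have Uge : U [set x | ultra_lim A - e < fine (p x A)].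
  have := sup_adherent e0 (S_has_sup mA) => -[r Ur er].
  by apply: filterS Ur => x /=; exact: lt_le_trans.
have Ult : U [set x | fine (p x A) < ultra_lim A + e].
  (* Maximality of the ultrafilter: otherwise the opposite inequality holds on a set of [U], and the
     supremum would exceed itself. *)
  have [//|h] := @in_ultra_setVsetC _ _ [set x | fine (p x A) < ultra_lim A + e] UU.
  exfalso.
  have : ultra_lim A + e <= ultra_lim A.
    apply: ub_le_sup; first by case: (S_has_sup mA).
    by apply: filterS h => x /= /negP; rewrite -leNgt.
  by rewrite leNgt ltrDl e0.
apply: filterS (filterI Uge Ult) => x /= [h1 h2].
by rewrite ltr_distl h1 h2.
Qed.

Lemma ultra_lim_unique A (l : R) : measurable A ->
  (forall e : R, 0 < e -> U [set x | `|fine (p x A) - l| < e]) -> ultra_lim A = l.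
Proof.
move=> mA h; apply/eqP; rewrite eq_sym -subr_eq0 -normr_le0.
apply/ler_addgt0Pr => e e0; rewrite add0r.
have e20 : 0 < e / 2 by rewrite divr_gt0.
have [x /= [h1 h2]] := filter_ex (filterI (h _ e20) (ultra_limP mA e20)).
rewrite (le_trans (ler_distD (fine (p x A)) _ _))// (splitr e).
by rewrite lerD// ltW// distrC.
Qed.

Let lim_ge0 A : 0 <= ultra_lim A.
Proof.
have [hs|hs] := pselect (has_sup [set r | U [set x | r <= fine (p x A)]]); last first.
  by rewrite /ultra_lim sup_out.
apply: ub_le_sup; first by case: hs.
by apply: filterE => x /=; exact: fine_ge0.
Qed.

Let lim0 : ultra_lim set0 = 0.
Proof.
apply: ultra_lim_unique => // e e0; apply: filterE => x /=.
by rewrite measure0/= subrr normr0.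
Qed.

Let limT : ultra_lim setT = 1.
Proof.
apply: ultra_lim_unique => // e e0; apply: filterE => x /=.
by rewrite probability_setT/= subrr normr0.
Qed.

Let limU A B : measurable A -> measurable B -> A `&` B = set0 ->
  ultra_lim (A `|` B) = ultra_lim A + ultra_lim B.
Proof.
move=> mA mB AB; apply: ultra_lim_unique; first exact: measurableU.
move=> e e0; have e20 : 0 < e / 2 by rewrite divr_gt0.
apply: filterS (filterI (ultra_limP mA e20) (ultra_limP mB e20)) => x /= [h1 h2].
rewrite measureU// fineD ?fin_num_measure//.
rewrite opprD addrACA (le_lt_trans (ler_normD _ _))// (splitr e).
exact: ltrD.
Qed.

(** Limits along ultrafilters are in general only finitely additive; the uniform absolute continuity
    of the entropy sublevel set survives in the limit and restores countable additivity. *)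
Let lim_small (e : R) : 0 < e -> exists2 t : R, 0 < t &
  forall A, measurable A -> fine (Q A) < t -> ultra_lim A <= e.
Proof.
move=> e0; have e20 : 0 < e / 2 by rewrite divr_gt0.
have [t t0 tP] := @entropy_le_unif_ac R d E a _ e20; exists t => // A mA QA.
have [x /= [h1 h2]] := filter_ex (filterI Uent (ultra_limP mA e20)).
have h3 := tP _ _ _ mA h1 QA.
by rewrite distrC in h2; have h4 := ltr_normlW h2; lra.
Qed.

Let mu A : \bar R := (ultra_lim A)%:E.

Let mu_sigma_additive : semi_sigma_additive mu.
Proof.
move=> F mF tF mUF.
have additive n : ultra_lim (\bigcup_i F i) =
    \sum_(0 <= i < n) ultra_lim (F i) + ultra_lim (\bigcup_(i in [set i | (n <= i)%N]) F i).
  elim: n => [|n IH].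
    by rewrite big_nil add0r; congr ultra_lim; apply/seteqP; split => w [i _ Fw]; exists i.
  rewrite IH big_nat_recr//= -addrA; congr (_ + _); rewrite -limU//.
  - congr ultra_lim; apply/seteqP; split => w.
      move=> [i /= ni Fw]; move: ni; rewrite leq_eqVlt => /predU1P[->|ni]; first by left.
      by right; exists i.
    by move=> [Fw|[i /= ni Fw]]; [exists n => /=|exists i => //=; exact: ltnW].
  - by apply: bigcup_measurable.
  - apply/seteqP; split => // w [Fn [i /= ni Fi]].
    have : (F n `&` F i) w by [].
    by move/trivIsetP : tF => ->//; rewrite ltn_eqF.
(* By finite additivity it remains to make the tails small, and their [Q]-mass decreases to 0 by
   continuity from above. *)
have tail0 : fine (Q (\bigcup_(i in [set i | (n <= i)%N]) F i)) @[n --> \oo] --> (0 : R).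
  have mtail n : measurable (\bigcup_(i in [set i | (n <= i)%N]) F i).
    exact: bigcup_measurable.
  have := @nonincreasing_cvg_mu _ _ _ Q (fun n => \bigcup_(i in [set i | (n <= i)%N]) F i).
  have -> : \bigcap_n \bigcup_(i in [set i | (n <= i)%N]) F i = set0.
    apply/seteqP; split => // w h; have [i /= _ Fi] := h 0%N I.
    have [j /= ij Fj] := h i.+1 I.
    have : (F i `&` F j) w by [].
    by move/trivIsetP : tF => ->//; rewrite ltn_eqF.
  rewrite measure0 => /(_ _ mtail) h; apply: fine_cvg; apply: h => //.
    by rewrite (le_lt_trans (probability_le1 _ _))// ltry.
  move=> n m nm; apply/subsetPset => w [i /= mi Fi]; exists i => //=.
  exact: leq_trans mi.
rewrite /mu; have -> : (fun n => \sum_(0 <= i < n) (ultra_lim (F i))%:E)%E =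
   EFin \o (fun n => \sum_(0 <= i < n) ultra_lim (F i)).
  by apply/funext => n; rewrite /= sumEFin.
apply/cvg_EFin; first exact: nearW.
apply/cvgrPdist_le => e e0; have [t t0 tP] := lim_small e0.
move/cvgrPdist_lt : tail0 => /(_ _ t0); apply: filterS => n /=; rewrite sub0r normrN => h.
rewrite (additive n) addrAC subrr add0r ger0_norm//; apply: tP.
  exact: bigcup_measurable.
exact: le_lt_trans (ler_norm _) h.
Qed.

HB.instance Definition _ := isMeasure.Build _ _ _ mu
  (congr1 EFin lim0) (fun A => lim_ge0 A : (0 <= (ultra_lim A)%:E)%E) mu_sigma_additive.

Definition ultra_prob := prob_of (congr1 EFin limT : mu setT = 1%E).

(** Convergence holds on every measurable set, so it extends to bounded measurable functions by
    uniform approximation with n level sets. Three errors of at most c = 2 M / n occur, and 4 * c <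
    e leaves room for a strict inequality. *)
Lemma ultra_prob_Rintegral (g : E -> R) (e : R) : measurable_fun setT g ->
  bounded_real g -> 0 < e ->
  U [set x | `|\int[p x]_y g y - \int[ultra_prob]_y g y| < e].
Proof.
move=> mg bg e0.
have [M M0 gM] : exists2 M : R, 0 < M & forall x, `|g x| <= M.
  have [M gM] := bg; exists (`|M| + 1); first by rewrite ltr_wpDl.
  by move=> x; rewrite (le_trans (gM x))// (le_trans (ler_norm _))// lerDl.
have [n n0 nM] : exists2 n : nat, (0 < n)%N & 8 * M / n%:R < e.
  have [n _ /(_ n.+1 (leqnSn n))/= h] := nbhs_infty_gtr (8 * M / e).
  by exists n.+1 => //; rewrite ltr_pdivrMr// [e * _]mulrC -ltr_pdivrMr.
pose c : R := 2 * M / n%:R.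
have nR : 0 < n%:R :> R by rewrite ltr0n.
have c0 : 0 < c by rewrite divr_gt0// mulr_gt0.
pose A (k : 'I_n) := [set x | k.+1%:R <= (g x + M) / c].
have mA k : measurable (A k).
  rewrite (_ : A k = [set x | c * k.+1%:R - M <= g x]); first exact: measurable_ge_level.
  by apply/seteqP; split => x; rewrite /A /= ler_pdivlMr// mulrC lerBlDr.
pose h x := - M + c * \sum_(k < n) (1 * \1_(A k) x).
have gh x : `|g x - h x| <= c.
  have y0n : 0 <= (g x + M) / c <= n%:R.
    have := gM x; rewrite ler_norml => /andP[g1 g2].
    rewrite divr_ge0 ?(ltW c0)//=; last by rewrite -lerBlDr sub0r.
    rewrite ler_pdivrMr// /c mulrC divfK ?gt_eqF//.
    by rewrite mulr2n mulrDl mul1r lerD2r.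
  have := layer_cake_approx y0n.
  have -> : g x - h x = c * ((g x + M) / c - \sum_(k < n) (if k.+1%:R <= (g x + M) / c then 1 else 0)).
    rewrite mulrBr mulrC divfK ?gt_eqF// /h opprD opprK addrA; congr (_ - _ * _).
    apply: eq_bigr => k _; rewrite mul1r indicE; case: ifPn => hk.
      by rewrite mem_set.
    by rewrite memNset//; exact/negP.
  by rewrite normrM gtr0_norm// => hc; rewrite -[leRHS]mulr1 ler_pM2l.
have isum (P : probability E R) : P.-integrable setT (EFin \o (fun x => c * \sum_(k < n) (1 * \1_(A k) x))).
  apply: bounded_integrable.
    by apply: measurable_funM => //; apply: measurable_sum => k; apply: measurable_funM.
  exists (c * \sum_(k < n) 1) => x; rewrite normrM gtr0_norm// ler_pM2l//.
  rewrite (le_trans (ler_norm_sum _ _ _))//; apply: ler_sum => k _.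
  by rewrite mul1r indicE; case: (_ \in _); rewrite ?normr1 ?normr0.
have ih (P : probability E R) : P.-integrable setT (EFin \o h).
  by apply: integrableRD => //; exact: integrableR_cst.
have Eh (P : probability E R) : \int[P]_x h x = - M + c * \sum_(k < n) fine (P (A k)).
  rewrite (_ : \int[P]_x h x = \int[P]_x (- M) + \int[P]_x (c * \sum_(k < n) (1 * \1_(A k) x))); last first.
    exact: (RintegralD measurableT (integrableR_cst P (- M)) (isum P)).
  rewrite Rintegral_prob; congr (_ + _).
  have isum' (k : 'I_n) : P.-integrable setT (EFin \o (fun x => 1 * \1_(A k) x)).
    apply: bounded_integrable; last exact: indic_bounded.
    by apply: measurable_funM => //; exact: measurable_indic.
  rewrite RintegralZl//; last exact: integrableR_sum.
  rewrite Rintegral_sum//; congr (_ * _); apply: eq_bigr => k _.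
  by rewrite Rintegral_indicZ// mul1r.
have close (P : probability E R) : `|\int[P]_x g x - \int[P]_x h x| <= c.
  have ig := bounded_integrable P mg bg.
  rewrite -(RintegralB measurableT ig (ih P)).
  apply: (le_trans (le_normr_Rintegral measurableT (integrableRB ig (ih P)))).
  rewrite -[leRHS](Rintegral_prob P); apply: le_Rintegral => //.
    by have := integrable_norm (integrableRB ig (ih P)).
  exact: integrableR_cst.
have Uall : U [set x | forall k, `|fine (p x (A k)) - ultra_lim (A k)| < n%:R^-1].
  apply: filter_forall => k; apply: ultra_limP => //.
  by rewrite invr_gt0.
apply: filterS Uall => x /= hx.
have hh : `|\int[p x]_y h y - \int[ultra_prob]_y h y| <= c.
  rewrite !Eh opprD addrACA subrr add0r -mulrBr normrM gtr0_norm// -[leRHS]mulr1 ler_pM2l//.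
  rewrite -sumrB (le_trans (ler_norm_sum _ _ _))//.
  rewrite (@le_trans _ _ (\sum_(k < n) n%:R^-1))//.
    by apply: ler_sum => k _; exact: ltW.
  by rewrite sumr_const card_ord -(mulr_natr n%:R^-1) mulVf// gt_eqF.
rewrite (le_lt_trans (ler_distD (\int[p x]_y h y) _ _))//.
rewrite (le_lt_trans (lerD (close _) (ler_distD (\int[ultra_prob]_y h y) _ _)))//.
have h4c : 4 * c < e.
  rewrite (_ : 4 * c = 8 * M / n%:R)// /c; field; exact: lt0r_neq0.
have h3 := close ultra_prob; rewrite distrC in h3.
apply: le_lt_trans (lerD (lexx c) (lerD hh h3)) _.
apply: le_lt_trans h4c; rewrite (_ : c + (c + c) = 3 * c); last by ring.
by rewrite ler_pM2r// ler_nat.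
Qed.

Lemma ultra_prob_entropy_le : entropy_le ultra_prob Q a.
Proof.
move=> g mg bg.
have C0 : 0 < \int[Q]_y expR (g y).
  have [x Ux] := filter_ex Uent.
  by apply: lt_le_trans (Ux g mg bg); exact: expR_gt0.
rewrite -[leRHS]lnK ?posrE// ler_expR.
apply/ler_addgt0Pr => e e0.
have [x /= [h1 h2]] := filter_ex (filterI Uent (ultra_prob_Rintegral mg bg e0)).
have := h1 g mg bg; rewrite -[X in _ <= X -> _]lnK ?posrE// ler_expR => h3.
by rewrite distrC in h2; have h4 := ltr_normlW h2; lra.
Qed.

End ultrafilter_limit.

(** * Entropy sublevel sets in W_1 under exponential moments *)

Section exponential_moments.
Context (R : realType) (d : nat) (T : R).
Local Notation path := (cpath d T).
Hypothesis T0 : 0 < T.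
Variable Q : probability path R.
Hypothesis Qexp : forall l : R, 0 < l ->
  (\int[Q]_x (expR (l * supnorm x))%:E < +oo)%E.

Lemma measurable_exp_supnorm (l : R) :
  measurable_fun setT (fun x : path => (expR (l * supnorm x))%:E).
Proof.
apply/measurable_EFinP; apply: (measurableT_comp (@measurable_expR R)).
by apply: measurable_funM => //; exact: measurable_supnorm.
Qed.

Lemma measurable_exp_near_dist k (l : R) :
  measurable_fun setT (fun x : path => (expR (l * near_dist T0 k x))%:E).
Proof.
apply/measurable_EFinP; apply: (measurableT_comp (@measurable_expR R)).
by apply: measurable_funM => //; exact: measurable_near_dist.
Qed.

(** Dominated convergence under exp (l * supnorm). Having this for every l is what makes the
    quantisation error negligible at every exponential rate. *)
Lemma cvg_exp_near_dist (l : R) : 0 < l ->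
  (\int[Q]_x (expR (l * near_dist T0 k x))%:E)%E @[k --> \oo] --> 1%E.
Proof.
move=> l0.
have := @dominated_convergence _ _ _ Q _ measurableT
  (fun k x => (expR (l * near_dist T0 k x))%:E) (cst 1%E)
  (fun x => (expR (l * supnorm x))%:E) (fun k => measurable_exp_near_dist k l)
  (measurable_cst _).
case.
- apply: aeW => x _; apply/cvg_EFin; first exact: nearW.
  rewrite -[X in _ --> X](@expR0 R); apply: continuous_cvg; first exact: continuous_expR.
  by rewrite -[X in _ --> X](mulr0 l); apply: cvgMr; exact: cvg_near_dist.
- apply/integrableP; split; first exact: measurable_exp_supnorm.
  under eq_integral do rewrite gee0_abs ?lee_fin ?expR_ge0//.
  exact: Qexp.
- apply: aeW => x k _; rewrite gee0_abs ?lee_fin ?expR_ge0// ler_expR ler_pM2l//.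
  exact: near_dist_le_norm.
by move=> _ _; rewrite integral_cst//= probability_setT mule1.
Qed.

Lemma exp_near_dist_small (l e : R) : 0 < l -> 0 < e -> \forall k \near \oo,
  (\int[Q]_x (expR (l * near_dist T0 k x))%:E <= (expR e)%:E)%E.
Proof.
move=> l0 e0; have e1 : (1 < (expR e)%:E)%E by rewrite lte_fin expR_gt1.
have := cvg_exp_near_dist l0.
move=> /(_ [set y | (y < (expR e)%:E)%E]) h.
have {}h : \forall k \near \oo, (\int[Q]_x (expR (l * near_dist T0 k x))%:E < (expR e)%:E)%E.
  by apply: h; apply: open_nbhs_nbhs; split => //; exact: lray_open.
by apply: filterS h => k /ltW.
Qed.

Lemma entropy_le_moment (P : probability path R) (a : R) :
  entropy_le P Q a -> (\int[P]_x (supnorm x)%:E < +oo)%E.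
Proof.
move=> PQ; have Q1 := Qexp ltr01.
have fin : (\int[Q]_x (expR (1 * supnorm x))%:E)%E \is a fin_num.
  by rewrite ge0_fin_numE//; apply: integral_ge0 => x _; rewrite lee_fin expR_ge0.
have := @entropy_le_exp_moment _ _ _ P Q a (fine (\int[Q]_x (expR (1 * supnorm x))%:E)%E)
  (@supnorm R d T) (@measurable_supnorm R d T) (@supnorm_ge0 R d T).
move=> H; apply: le_lt_trans (H _ PQ) _; last by rewrite ltry.
apply: (@le_trans _ _ (\int[Q]_x (expR (1 * supnorm x))%:E)%E).
  by under eq_integral do rewrite -[supnorm _]mul1r.
rewrite -[leLHS](fineK fin) lee_fin.
by rewrite (le_trans _ (expR_ge1Dx _))// lerDr.
Qed.

(** The entropy inequality for [l * near_dist] bounds the mean by (a + 1) / l for all laws of the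
    sublevel set at once, and l is chosen so that this is at most e. *)
Lemma entropy_le_near_dist (a e : R) : 0 < e -> \forall k \near \oo,
  forall P : probability path R, entropy_le P Q a ->
  (\int[P]_x (near_dist T0 k x)%:E <= e%:E)%E.
Proof.
move=> e0; pose l := (`|a| + 1) / e.
have a1 : 0 < `|a| + 1 by rewrite ltr_wpDl.
have l0 : 0 < l by rewrite divr_gt0.
apply: filterS (exp_near_dist_small l0 ltr01) => k hk P PQ.
have mf : measurable_fun setT (fun x : path => l * near_dist T0 k x).
  by apply: measurable_funM => //; exact: measurable_near_dist.
have f0 (x : path) : 0 <= l * near_dist T0 k x by rewrite mulr_ge0 ?near_dist_ge0// ltW.
have := entropy_le_exp_moment mf f0 hk PQ.
under eq_integral do rewrite EFinM.
rewrite ge0_integralZl//; last 3 first.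
  by apply/measurable_EFinP; exact: measurable_near_dist.
  by move=> x _; rewrite lee_fin near_dist_ge0.
  by rewrite lee_fin ltW.
rewrite -lee_pdivlMl// => /le_trans; apply.
rewrite -EFinM lee_fin /l invf_div mulrAC ler_pdivrMr// ler_pM2l//.
by rewrite lerD2r ler_norm.
Qed.

(** Setwise convergence is upgraded to [W1] through [W1_cells]: the quantisation errors are
    uniformly small on the sublevel set, so that finitely many cell probabilities remain to be
    compared. *)
Lemma ultra_W1_limit (X : Type) (p : X -> probability path R) (a : R)
    (U : set_system X) : UltraFilter U -> U [set x | entropy_le (p x) Q a] ->
  exists2 P : prob1 d T, entropy_le P Q a &
    forall e : R, 0 < e -> U [set x | (W1 (p x) P < e%:E)%E].
Proof.
move=> UU Uent; have UF : ProperFilter U := @ultra_proper _ _ UU.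
have Pent := ultra_prob_entropy_le UU Uent.
pose P := ultra_prob UU Uent.
exists (Prob1 (entropy_le_moment Pent)) => //= e e0.
have e40 : 0 < e / 4 by rewrite divr_gt0.
have [k _ /(_ k (leqnn k)) hk] := entropy_le_near_dist a e40.
pose D := \sum_(i < k.+1) \sum_(j < k.+1) supdist (path_dense d T0 i) (path_dense d T0 j).
have D0 : 0 <= D by apply: sumr_ge0 => i _; apply: sumr_ge0 => j _; exact: supdist_ge0.
(* An error t in each of the k.+1 cells, weighted by D, contributes at most e / 4; D + 1 keeps the
   denominator positive. *)
pose t := e / 4 / (D + 1) / k.+1%:R.
have D1 : 0 < D + 1 by rewrite ltr_wpDl.
have t0 : 0 < t by rewrite !divr_gt0.
have mc := @measurable_near_cell R d T T0 k.
have Uall : U [set x | forall i : 'I_k.+1,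
    `|fine (p x [set y | near_cell T0 k y = i]) - ultra_lim p U [set y | near_cell T0 k y = i]| < t].
  by apply: filter_forall => i; apply: ultra_limP.
apply: filterS (filterI Uent Uall) => x /= [h1 h2].
apply: le_lt_trans (W1_cells T0 k _ _) _.
have := leeD (hk _ h1) (hk _ Pent) => h.
apply: (@le_lt_trans _ _ ((e / 4)%:E + (e / 4)%:E + (e / 4)%:E)%E); last first.
  by rewrite -!EFinD lte_fin; lra.
apply: leeD => //; apply: (@le_trans _ _ (D%:E * (\sum_(i < k.+1) t)%:E)%E).
  apply: lee_wpmul2l; first by rewrite lee_fin.
  rewrite -sumEFin; apply: lee_sum => i _.
  have /fineK <- : p x [set y | near_cell T0 k y = i] \is a fin_num.
    exact: fin_num_measure.
  rewrite -[X in (`|_ - X|)%E]/((ultra_lim p U [set y | near_cell T0 k y = i])%:E).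
  by rewrite -EFinB abse_EFin lee_fin ltW.
have tk : t * k.+1%:R = e / 4 / (D + 1) by rewrite /t divfK ?pnatr_eq0.
rewrite -EFinM lee_fin sumr_const card_ord -[t *+ _]mulr_natr tk.
rewrite mulrCA ler_piMr ?(ltW e40)//.
by rewrite ler_pdivrMr// mul1r lerDl.
Qed.

End exponential_moments.

(** * Sanov's theorem in W_1 *)

Section finite_sanov.
Context (R : realType) (J : finType) (N : nat).
Hypothesis N0 : (0 < N)%N.
Implicit Types (p q : J -> R) (s : {ffun 'I_N -> J}).

(** Relative entropy on a finite set. A term with p j = 0 reads 0 as usual, but so does one with q j
    = 0 < p j; absolute continuity is therefore carried as a separate condition. *)
Definition ent_sum p q : R := \sum_j p j * ln (p j / q j).

Definition count_of s (j : J) : nat := #|[pred i | s i == j]|.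

Definition type_of s (j : J) : R := (count_of s j)%:R / N%:R.

Let NR0 : 0 < N%:R :> R. Proof. by rewrite ltr0n. Qed.

Lemma sum_count s (f : J -> R) :
  \sum_i f (s i) = \sum_j (count_of s j)%:R * f j.
Proof.
rewrite (partition_big s xpredT)//=; apply: eq_bigr => j _.
rewrite (eq_bigr (fun=> f j)) => [|i /eqP ->//].
by rewrite sumr_const mulr_natl.
Qed.

Lemma sum_type s (f : J -> R) : \sum_i f (s i) = N%:R * \sum_j type_of s j * f j.
Proof.
rewrite sum_count mulr_sumr; apply: eq_bigr => j _.
by rewrite /type_of mulrA [N%:R * _]mulrC divfK ?gt_eqF.
Qed.

Lemma type_of_ge0 s j : 0 <= type_of s j.
Proof. by rewrite divr_ge0. Qed.

Lemma sum_type1 s : \sum_j type_of s j = 1.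
Proof.
apply: (@mulfI _ N%:R); first by rewrite gt_eqF.
have := sum_type s (fun=> 1); under [in X in _ = X -> _]eq_bigr do rewrite mulr1.
by move=> <-; rewrite mulr1 sumr_const card_ord.
Qed.

Lemma type_of_gt0 s i : 0 < type_of s (s i).
Proof.
rewrite divr_gt0// ltr0n; apply/card_gt0P; exists i; by rewrite inE.
Qed.

Lemma prod_expR_sum (f : 'I_N -> R) : (forall i, 0 < f i) ->
  \prod_i f i = expR (\sum_i ln (f i)).
Proof.
move=> f0; rewrite expR_sum; apply: eq_bigr => i _.
by rewrite lnK// posrE.
Qed.

Lemma sum_prod_ffun (F : 'I_N -> J -> R) :
  \sum_(s : {ffun 'I_N -> J}) \prod_i F i (s i) = \prod_i \sum_j F i j.
Proof. by rewrite bigA_distr_bigA. Qed.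

Lemma sum_prod1 p : \sum_j p j = 1 -> \sum_(s : {ffun 'I_N -> J}) \prod_i p (s i) = 1.
Proof. by move=> p1; rewrite (sum_prod_ffun (fun=> p)) big1. Qed.

(** The basic identity of the method of types: the ratio of the two likelihoods of a sequence
    depends only on its letter counts. *)
Lemma prod_type q s : (forall i, 0 < q (s i)) ->
  \prod_i q (s i) = (\prod_i type_of s (s i)) * expR (- (N%:R * ent_sum (type_of s) q)).
Proof.
move=> q0; rewrite !prod_expR_sum//; last by move=> i; exact: type_of_gt0.
rewrite -expRD; congr expR; rewrite /ent_sum -sum_type.
rewrite -sumrB; apply: eq_bigr => i _.
by rewrite ln_div ?posrE ?type_of_gt0// opprB addrC subrK.
Qed.

Let counts s : {ffun J -> 'I_N.+1} := [ffun j => inord (count_of s j)].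

(** Sequences are grouped by their counts. A group shares one type, which is a probability vector,
    so its likelihoods add up to at most 1, and each count takes N.+1 values. *)
Lemma sum_prod_type_le :
  \sum_(s : {ffun 'I_N -> J}) \prod_i type_of s (s i) <= (N.+1%:R) ^+ #|J|.
Proof.
rewrite (partition_big counts xpredT)//=.
have countsE s n : counts s == n -> type_of s =1 (fun j => (n j)%:R / N%:R).
  move=> /eqP <- j; rewrite /type_of ffunE inordK// ltnS.
  by rewrite (leq_trans (max_card _))// card_ord.
rewrite (@le_trans _ _ (\sum_(n : {ffun J -> 'I_N.+1}) 1))//; last first.
  by rewrite sumr_const card_ffun card_ord natrX.
apply: ler_sum => n _.
have [/existsP[s0 hs0]|/existsPn h] := boolP [exists s, counts s == n]; last first.
  by rewrite big1// => s hs; move: (h s); rewrite hs.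
rewrite -[leRHS](@sum_prod1 (fun j => (n j)%:R / N%:R)); last first.
  rewrite -[RHS](sum_type1 s0); apply: eq_bigr => j _; by rewrite (countsE _ _ hs0).
rewrite [leRHS](bigID (fun s => counts s == n))/= -[leLHS]addr0 lerD//.
  apply: ler_sum => s hs; apply: ler_prod => i _.
  by rewrite type_of_ge0/= (countsE _ _ hs).
by apply: sumr_ge0 => s _; apply: prodr_ge0 => i _; rewrite divr_ge0.
Qed.

Lemma finite_sanov_upper q (a : R) (S : pred {ffun 'I_N -> J}) :
  (forall j, 0 <= q j) ->
  (forall s, S s -> (forall i, 0 < q (s i)) -> a <= ent_sum (type_of s) q) ->
  \sum_(s : {ffun 'I_N -> J} | S s) \prod_i q (s i) <= N.+1%:R ^+ #|J| * expR (- (N%:R * a)).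
Proof.
move=> q0 Sa.
apply: (@le_trans _ _ (\sum_(s : {ffun 'I_N -> J}) (\prod_i type_of s (s i)) * expR (- (N%:R * a)))).
  rewrite big_mkcond/=; apply: ler_sum => s _.
  have p0 : 0 <= \prod_i type_of s (s i) by apply: prodr_ge0 => i _; exact: type_of_ge0.
  case: ifPn => Ss; last by rewrite mulr_ge0// expR_ge0.
  have [/forallP qs|/forallPn[i]] := boolP [forall i, 0 < q (s i)].
    rewrite prod_type// ler_wpM2l// ler_expR lerN2 ler_pM2l//; exact: Sa.
  rewrite -leNgt => qi; have qi0 : q (s i) = 0 by apply/eqP; rewrite eq_le qi q0.
  by rewrite (bigD1 i)//= qi0 mul0r mulr_ge0// expR_ge0.
by rewrite -mulr_suml ler_wpM2r ?expR_ge0// sum_prod_type_le.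
Qed.

(** The square is expanded; each of the N diagonal terms is at most v, and an off-diagonal product
    contains a factor of mean zero. *)
Lemma sum_prod_var p (y : J -> R) (v : R) : (forall j, 0 <= p j) -> \sum_j p j = 1 ->
  \sum_j p j * y j = 0 -> \sum_j p j * y j ^+ 2 <= v ->
  \sum_(s : {ffun 'I_N -> J}) (\prod_i p (s i)) * (\sum_i y (s i)) ^+ 2 <= N%:R * v.
Proof.
move=> p0 p1 y0 yv.
under eq_bigr do rewrite expr2 big_distrlr/= mulr_sumr.
rewrite exchange_big/=.
under eq_bigr do under eq_bigr do rewrite mulr_sumr.
under eq_bigr do rewrite exchange_big/=.
rewrite -[N in N%:R](card_ord N) mulr_natl -sumr_const; apply: ler_sum => i _.
rewrite (bigD1 i)//= [X in _ + X]big1 ?addr0 => [|i' ii'].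
  rewrite (eq_bigr (fun s : {ffun 'I_N -> J} => \prod_k (p (s k) * (if k == i then y (s k) ^+ 2 else 1)))).
    rewrite (sum_prod_ffun (fun k j => p j * (if k == i then y j ^+ 2 else 1))) (bigD1 i)//= eqxx [X in _ * X]big1 ?mulr1//.
    by move=> k /negbTE ->; under eq_bigr do rewrite mulr1.
  move=> s _; rewrite big_split/=; congr (_ * _).
  by rewrite (bigD1 i)//= eqxx big1 ?mulr1 ?expr2// => k /negbTE ->.
rewrite (eq_bigr (fun s : {ffun 'I_N -> J} => \prod_k (p (s k) *
    (if k == i then y (s k) else if k == i' then y (s k) else 1)))).
  by rewrite (sum_prod_ffun (fun k j => p j * (if k == i then y j else if k == i' then y j else 1))) (bigD1 i)//= eqxx y0 mul0r.
move=> s _; rewrite big_split/=; congr (_ * _).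
rewrite (bigD1 i)//= eqxx (bigD1 i')//= (negbTE ii') eqxx big1 ?mulr1// => k /andP[/negbTE -> /negbTE ->//].
Qed.

Lemma type_deviation p (j : J) (h : R) : 0 < h ->
  (forall j, 0 <= p j) -> \sum_j p j = 1 ->
  \sum_(s : {ffun 'I_N -> J} | h < `|type_of s j - p j|) \prod_i p (s i) <= (N%:R * h ^+ 2)^-1.
Proof.
move=> h0 p0 p1; pose y j' : R := (j' == j)%:R - p j.
have pj1 : p j <= 1 by rewrite -p1 (bigD1 j)//= lerDl sumr_ge0.
have ty s : N%:R * (type_of s j - p j) = \sum_i y (s i).
  rewrite sumrB sumr_const card_ord mulrBr -[p j *+ N]mulr_natl; congr (_ - _).
  by rewrite /type_of mulrC divfK ?gt_eqF// /count_of -sum1_card natr_sum big_mkcond/=;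
    apply: eq_bigr => i _; rewrite inE; case: eqP.
have V : \sum_(s : {ffun 'I_N -> J}) (\prod_i p (s i)) * (\sum_i y (s i)) ^+ 2 <= N%:R * 1.
  apply: sum_prod_var => //.
    under eq_bigr do rewrite mulrBr.
    rewrite sumrB -mulr_suml p1 mul1r (bigD1 j)//= eqxx mulr1 big1 ?addr0 ?subrr//.
    by move=> k /negbTE ->; rewrite mulr0.
  rewrite -[leRHS]p1; apply: ler_sum => k _; rewrite ler_piMr// /y.
  rewrite -real_normK ?num_real// expr_le1//.
  have pj0 := p0 j.
  by case: (k == j); rewrite ler_norml /= ?mulr1n ?mulr0n; lra.
rewrite mulr1 in V.
have pr0 s : 0 <= \prod_i p (s i) by apply: prodr_ge0 => i _.
have Nh : 0 < N%:R * h ^+ 2 by rewrite mulr_gt0// exprn_gt0.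
rewrite -[leRHS]mulr1 -ler_pdivrMl ?invr_gt0// invrK.
have : (N%:R * h) ^+ 2 * \sum_(s : {ffun 'I_N -> J} | h < `|type_of s j - p j|) \prod_i p (s i) <= N%:R.
  apply: le_trans V; rewrite mulr_sumr [leLHS]big_mkcond/=; apply: ler_sum => s _.
  case: ifPn => hs; last by rewrite mulr_ge0// sqr_ge0.
  rewrite mulrC ler_wpM2l// -ty -[leRHS]real_normK ?num_real// ler_pXn2r ?nnegrE ?mulr_ge0 ?(ltW h0)//.
  by rewrite normrM (ger0_norm (ltW NR0)) ler_pM2l// ltW.
rewrite exprMn expr2 -!mulrA -[leRHS]mulr1 ler_pM2l//.
Qed.

(** Change of measure from p to q. For a type within h of p the log-likelihood ratio is at most N
    times the bracket in the exponent, and Chebyshev's inequality gives such types [p]-probability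
    at least 1 - #|J| / (N h^2). *)
Lemma finite_sanov_lower p q (h : R) (S : pred {ffun 'I_N -> J}) : 0 < h ->
  (forall j, 0 <= p j) -> \sum_j p j = 1 -> (forall j, 0 <= q j) ->
  (forall j, q j = 0 -> p j = 0) ->
  (forall s, (forall j, `|type_of s j - p j| <= h) -> S s) ->
  expR (- (N%:R * (ent_sum p q + h * \sum_j `|ln (p j / q j)|))) *
    (1 - #|J|%:R / (N%:R * h ^+ 2)) <= \sum_(s : {ffun 'I_N -> J} | S s) \prod_i q (s i).
Proof.
move=> h0 p0 p1 q0 pq SS.
pose S0 s := [forall j, `|type_of s j - p j| <= h].
have S0S s : S0 s -> S s by move=> /forallP; exact: SS.
have pr0 s : 0 <= \prod_i p (s i) by apply: prodr_ge0 => i _.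
have qr0 s : 0 <= \prod_i q (s i) by apply: prodr_ge0 => i _.
set c := expR _.
have c0 : 0 < c by exact: expR_gt0.
have step1 : c * \sum_(s : {ffun 'I_N -> J} | S0 s) \prod_i p (s i) <= \sum_(s : {ffun 'I_N -> J} | S s) \prod_i q (s i).
  rewrite mulr_sumr big_mkcond [leRHS]big_mkcond/=; apply: ler_sum => s _.
  case: ifPn => hs; last by case: ifPn.
  rewrite S0S//.
  have [/forallP ps|/forallPn[i]] := boolP [forall i, 0 < p (s i)]; last first.
    rewrite -leNgt => pi; have pi0 : p (s i) = 0 by apply/eqP; rewrite eq_le pi p0.
    by rewrite (bigD1 i)//= pi0 mul0r mulr0.
  have qs i : 0 < q (s i).
    by rewrite lt_def q0 andbT; apply/eqP => /pq h'; have := ps i; rewrite h' ltxx.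
  rewrite [X in c * X]prod_expR_sum// [leRHS]prod_expR_sum// /c -expRD ler_expR.
  rewrite -lerBrDr -[X in _ <= X]opprK lerN2 opprB -sumrB.
  rewrite (eq_bigr (fun i => ln (p (s i) / q (s i)))); last first.
    by move=> i _; rewrite ln_div ?posrE.
  rewrite (sum_type s (fun j => ln (p j / q j))) ler_pM2l//.
  rewrite /ent_sum -lerBlDl -sumrB mulr_sumr; apply: ler_sum => j _.
  rewrite -mulrBl (le_trans (ler_norm _))// normrM ler_wpM2r//.
  by move/forallP : hs.
apply: le_trans step1; rewrite ler_pM2l//.
rewrite lerBlDr -[leLHS](sum_prod1 p1) (bigID S0)/= lerD2l.
apply: (@le_trans _ _ (\sum_j \sum_(s : {ffun 'I_N -> J} | h < `|type_of s j - p j|) \prod_i p (s i))).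
  rewrite (exchange_big_dep xpredT)//= big_mkcond/=; apply: ler_sum => s _.
  case: ifPn => [/forallPn[j]|_]; last exact: sumr_ge0.
  by rewrite -ltNge => hj; rewrite (bigD1 j)//= lerDl sumr_ge0.
rewrite mulr_natl -sumr_const; apply: ler_sum => j _.
exact: type_deviation.
Qed.

End finite_sanov.

Lemma ge0_integral_mrestr d (E : measurableType d) (R : realType)
    (Q : {measure set E -> \bar R}) (D : set E) (mD : measurable D) (f : E -> \bar R) :
  measurable_fun setT f -> (forall x, 0 <= f x)%E ->
  (\int[mrestr Q mD]_x f x = \int[Q]_(x in D) f x)%E.
Proof.
move=> mf f0.
have -> : (\int[mrestr Q mD]_x f x = \int[mrestr Q mD]_(x in D) f x)%E.
  rewrite -(setUv D) ge0_integral_setU//.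
  - rewrite [X in (_ + X)%E]null_set_integral ?adde0//.
    + exact: measurableC.
    + exact: measurable_funTS.
    + by rewrite /= /mrestr setICl measure0.
  - exact: measurableC.
  - by rewrite setUv.
  - by apply/disj_setPS => x [].
apply: eq_measure_integral => A mA AD.
by rewrite /mrestr; congr (Q _); apply/setIidPl.
Qed.

Lemma ge0_integral_fmsum d (E : measurableType d) (R : realType) (I : finType)
    (m : I -> {measure set E -> \bar R}) (f : E -> \bar R) :
  measurable_fun setT f -> (forall x, 0 <= f x)%E ->
  (\int[fmsum m]_x f x = \sum_i \int[m i]_x f x)%E.
Proof.
move=> mf f0; rewrite /fmsum ge0_integral_measure_sum//.
have -> : (\sum_i \int[m i]_x f x =
    \sum_(mi <- [seq m i | i <- enum I]) \int[mi]_x f x)%E.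
  by rewrite big_map big_enum.
by rewrite (big_nth (mzero : {measure set E -> \bar R})) big_mkord size_map -cardE.
Qed.

(** * Entropy and finite partitions *)

Section cells.
Context (R : realType) d (E : measurableType d) (J : finType) (c : E -> J).
Hypothesis mc : forall j, measurable [set x | c x = j].
Implicit Types P Q : probability E R.

Definition cell_prob P (j : J) : R := fine (P [set x | c x = j]).

Lemma cell_prob_ge0 P j : 0 <= cell_prob P j.
Proof. exact: fine_ge0. Qed.

Lemma cell_probE P j : P [set x | c x = j] = (cell_prob P j)%:E.
Proof. by rewrite /cell_prob fineK// fin_num_measure. Qed.

Lemma measurable_cell (f : J -> R) : measurable_fun setT (f \o c).
Proof.
move=> _ B mB; rewrite setTI.
rewrite (_ : _ @^-1` B = [set x | exists j, ([set x | c x = j] `&` [set x | B (f j)]) x]).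
  apply: measurable_exists => j.
  have [Bj|nBj] := pselect (B (f j)).
    by rewrite (_ : [set x | B (f j)] = setT) ?setIT//; apply/seteqP; split.
  rewrite [X in measurable X](_ : _ = set0); first exact: measurable0.
  by apply/seteqP; split => // x [].
apply/seteqP; split => [x /= Bx|x /= [j [<-]]//]; by exists (c x).
Qed.

Lemma bounded_cell (f : J -> R) : bounded_real (f \o c).
Proof.
exists (\sum_j `|f j|) => x /=; rewrite (bigD1 (c x))//= lerDl.
by apply: sumr_ge0.
Qed.

Lemma sum_cell (f : J -> R) x : f (c x) = \sum_j f j * \1_[set x | c x = j] x.
Proof.
rewrite (bigD1 (c x))//= big1 ?addr0 => [|j jx].
  by rewrite indicE mem_set// mulr1.
by rewrite indicE memNset ?mulr0// => /= h; rewrite h eqxx in jx.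
Qed.

Lemma integral_cell P (f : J -> R) : \int[P]_x f (c x) = \sum_j cell_prob P j * f j.
Proof.
under eq_Rintegral do rewrite sum_cell.
rewrite Rintegral_sum => [|j].
  by apply: eq_bigr => j _; rewrite Rintegral_indicZ// mulrC.
apply: bounded_integrable; last exact: indic_bounded.
by apply: measurable_funM => //; exact: measurable_indic.
Qed.

Lemma cell_prob_sum P : \sum_j cell_prob P j = 1.
Proof.
have := integral_cell P (fun=> 1); rewrite Rintegral_prob => ->.
by under [RHS]eq_bigr do rewrite mulr1.
Qed.

(** The test function is ln (p / q) on the cells, replaced where p vanishes by the finite value ln
    (e / 2), so that those cells add at most e / 2 to the exponential integral. An entropy equal to
    a + e would then give 1 + e <= 1 + e / 2. *)
Lemma entropy_le_cells P Q (a : R) : entropy_le P Q a ->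
  (forall j, cell_prob Q j = 0 -> cell_prob P j = 0) /\
  ent_sum (cell_prob P) (cell_prob Q) <= a.
Proof.
move=> h.
have ac j : cell_prob Q j = 0 -> cell_prob P j = 0.
  move=> qj; have /null_content_dominatesP PQ := entropy_le_dominates h.
  by rewrite /cell_prob (PQ [set x | c x = j])//; have := cell_probE Q j; rewrite qj.
split => //; apply: contrapT => /negP; rewrite -ltNge => ha.
set p := cell_prob P in ac ha *; set q := cell_prob Q in ac ha *.
pose e := ent_sum p q - a; have e0 : 0 < e by rewrite subr_gt0.
pose f j : R := if p j == 0 then ln (e / 2) else ln (p j / q j).
have := h (f \o c) (measurable_cell f) (bounded_cell f).
rewrite (integral_cell P f) (integral_cell Q (expR \o f)).
have -> : \sum_j cell_prob P j * f j = ent_sum p q.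
  apply: eq_bigr => j _; rewrite -/p /f.
  by have [->|//] := eqVneq (p j) 0; rewrite !mul0r.
have p0 j : 0 <= p j := cell_prob_ge0 P j.
have q0 j : 0 <= q j := cell_prob_ge0 Q j.
have : \sum_j cell_prob Q j * (expR \o f) j <= \sum_j (p j + e / 2 * q j).
  apply: ler_sum => j _; rewrite -/q /= /f.
  have [->|pj] := eqVneq (p j) 0.
    by rewrite add0r lnK ?posrE ?divr_gt0// mulrC.
  have qj : 0 < q j by rewrite lt_def q0 andbT; apply: contra_neq pj; exact: ac.
  rewrite lnK ?posrE ?divr_gt0// ?lt_def ?pj ?p0//.
  by rewrite mulrC divfK ?gt_eqF// lerDl mulr_ge0// divr_ge0// ltW.
rewrite big_split/= -mulr_sumr !cell_prob_sum -/e => h1 h2.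
by have := expR_ge1Dx e; lra.
Qed.

End cells.

Lemma integrableRZ (R : realType) d (E : measurableType d) (P : probability E R)
    (c : R) (f : E -> R) : P.-integrable setT (EFin \o f) ->
  P.-integrable setT (EFin \o (fun x => c * f x)).
Proof. by move=> If; exact: (integrableZl measurableT c If). Qed.

Section bounded_density.
Context (R : realType) d (E : measurableType d) (P Q : probability E R) (r : E -> R).
Hypothesis mr : measurable_fun setT r.
Hypothesis r0 : forall x, 0 <= r x.
Hypothesis br : bounded_real r.
Hypothesis Pr : forall f : E -> R, measurable_fun setT f -> bounded_real f ->
  (forall x, 0 <= f x) -> (\int[P]_x (f x)%:E = \int[Q]_x (f x * r x)%:E)%E.

Let bM (f g : E -> R) : bounded_real f -> bounded_real g -> bounded_real (fun x => f x * g x).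
Proof.
move=> [M fM] [N gN]; exists (M * N) => x; rewrite normrM ler_pM//.
Qed.

Lemma Rintegral_bounded_density (g : E -> R) : measurable_fun setT g ->
  bounded_real g -> \int[P]_x g x = \int[Q]_x (g x * r x).
Proof.
move=> mg bg; have [M gM] := bg.
have M0 x : 0 <= g x + M by have := gM x; rewrite ler_norml; lra.
have H : forall h : E -> R, measurable_fun setT h -> bounded_real h ->
    (forall x, 0 <= h x) -> \int[P]_x h x = \int[Q]_x (h x * r x).
  by move=> h mh bh h0; rewrite /Rintegral Pr.
have := H (fun x => g x + M); rewrite RintegralD//; last 2 first.
  exact: bounded_integrable.
  exact: integrableR_cst.
move=> H1.
have Igr : Q.-integrable setT (EFin \o (fun x => g x * r x)).
  by apply: bounded_integrable; [exact: measurable_funM|exact: bM].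
have Ir : Q.-integrable setT (EFin \o r) by exact: bounded_integrable.
have r1 : \int[Q]_x r x = 1.
  have := H (cst 1); rewrite Rintegral_prob => ->//.
    by apply: eq_Rintegral => x _; rewrite mul1r.
  by exists 1 => x; rewrite normr1.
have H2 : \int[Q]_x ((g x + M) * r x) = \int[Q]_x (g x * r x) + M.
  under eq_Rintegral do rewrite mulrDl.
  rewrite RintegralD//; last first.
    by apply: bounded_integrable; [exact: measurable_funM|apply: bM => //; exists `|M|].
  by rewrite RintegralZl// r1 mulr1.
apply: (@addIr _ M); rewrite -H2 -H1//.
- by rewrite Rintegral_prob.
- exact: measurable_funD.
- by exists (M + M) => x; rewrite ger0_norm ?M0// lerD2r (le_trans (ler_norm _)).
Qed.

(** The inequality ln y <= y - 1 at y = exp g / (r Z), integrated against r. Working with an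
    explicit bounded density makes every integral finite. *)
Lemma entropy_le_bounded_density (a : R) :
  \int[Q]_x (r x * ln (r x)) <= a -> bounded_real (fun x => r x * ln (r x)) ->
  entropy_le P Q a.
Proof.
move=> ra brl g mg bg.
rewrite (Rintegral_bounded_density mg bg).
have Ieg : Q.-integrable setT (EFin \o (expR \o g)).
  apply: bounded_integrable; last exact: bounded_expR.
  by apply: measurableT_comp => //; exact: measurable_expR.
have mrl : measurable_fun setT (fun x => r x * ln (r x)).
  apply: measurable_funM => //; apply: measurableT_comp => //; exact: measurable_ln.
have Irl : Q.-integrable setT (EFin \o (fun x => r x * ln (r x))).
  exact: bounded_integrable.
have Ir : Q.-integrable setT (EFin \o r) by exact: bounded_integrable.
have Igr : Q.-integrable setT (EFin \o (fun x => g x * r x)).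
  by apply: bounded_integrable; [exact: measurable_funM|exact: bM].
have r1 : \int[Q]_x r x = 1.
  have b1 : bounded_real (fun _ : E => 1 : R) by exists 1 => x; rewrite normr1.
  have := Rintegral_bounded_density (measurable_cst _) b1.
  by rewrite Rintegral_prob => ->; apply: eq_Rintegral => x _; rewrite mul1r.
set Z := \int[Q]_x expR (g x).
have [M gM] := bg.
have Z0 : 0 < Z.
  apply: (@lt_le_trans _ _ (expR (- M))); first exact: expR_gt0.
  rewrite -[leLHS](Rintegral_prob Q); apply: le_Rintegral => //.
  - exact: integrableR_cst.
  - by move=> x _; rewrite ler_expR; have := gM x; rewrite ler_norml => /andP[].
rewrite -[leRHS]lnK ?posrE// ler_expR lerBlDr.
apply: (@le_trans _ _ (\int[Q]_x (Z^-1 * expR (g x) + (r x * ln (r x) + (ln Z - 1) * r x)))).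
  apply: le_Rintegral => //.
    apply: integrableRD; first exact: integrableRZ.
    apply: integrableRD => //; exact: integrableRZ.
  move=> x _; have [->|rx] := eqVneq (r x) 0.
    by rewrite !mulr0 mul0r !addr0 mulr_ge0 ?invr_ge0 ?expR_ge0// ltW.
  have rx0 : 0 < r x by rewrite lt_def rx r0.
  have t0 : 0 < expR (g x) / (r x * Z) by rewrite divr_gt0 ?expR_gt0// mulr_gt0.
  have := @le_ln1Dx R (expR (g x) / (r x * Z) - 1).
  rewrite addrCA subrr addr0 ltrBDr addrC subrr => /(_ t0).
  rewrite ln_div ?posrE ?expR_gt0 ?mulr_gt0// expRK lnM ?posrE//.
  rewrite -(ler_pM2r rx0) => h.
  have -> : Z^-1 * expR (g x) = expR (g x) / (r x * Z) * r x.
    by rewrite invfM mulrA mulrAC divfK ?gt_eqF// mulrC.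
  by move: h; rewrite !mulrBl; lra.
rewrite RintegralD//; last 2 first.
  exact: integrableRZ.
  by apply: integrableRD => //; exact: integrableRZ.
rewrite RintegralD//; last exact: integrableRZ.
rewrite !RintegralZl// r1 mulr1 -/Z mulVf ?gt_eqF//.
lra.
Qed.

End bounded_density.

Section lift.
Context (R : realType) d (E : measurableType d) (J : finType) (c : E -> J).
Hypothesis mc : forall j, measurable [set x | c x = j].
Variables (Q : probability E R) (p : J -> R).
Hypothesis p0 : forall j, 0 <= p j.
Hypothesis p1 : \sum_j p j = 1.
Hypothesis pQ : forall j, cell_prob c Q j = 0 -> p j = 0.

Local Notation q := (cell_prob c Q).
Let w j : R := p j / q j.
Let w0 j : 0 <= w j. Proof. by rewrite divr_ge0// cell_prob_ge0. Qed.
Let qw j : q j * w j = p j.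
Proof.
have [qj|qj] := eqVneq (q j) 0; last by rewrite mulrC divfK.
by rewrite qj mul0r pQ.
Qed.

Let piece j : {measure set E -> \bar R} := mscale (NngNum (w0 j)) (mrestr Q (mc j)).
Let glued := fmsum piece.

Let gluedE A : glued A = (\sum_j (w j)%:E * Q (A `&` [set x | c x = j]))%E.
Proof. by rewrite /glued fmsumE. Qed.

Let glued_cell j : glued [set x | c x = j] = (p j)%:E.
Proof.
rewrite gluedE (bigD1 j)//= setIid cell_probE// -EFinM mulrC qw.
rewrite big1 ?adde0// => i ij.
rewrite (_ : _ `&` _ = set0) ?measure0 ?mule0//.
by apply/seteqP; split => // x [/= -> ji]; rewrite ji eqxx in ij.
Qed.

Let glued1 : glued setT = 1%E.
Proof.
rewrite gluedE -[X in _ = X%:E]p1 -sumEFin; apply: eq_bigr => j _.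
by rewrite setTI cell_probE// -EFinM mulrC qw.
Qed.

Let gluedI (f : E -> R) : measurable_fun setT f -> (forall x, 0 <= f x) ->
  (\int[glued]_x (f x)%:E = \int[Q]_x (f x * w (c x))%:E)%E.
Proof.
move=> mf f0; have mf' : measurable_fun setT (EFin \o f) by exact/measurable_EFinP.
have f0' x : (0 <= (EFin \o f) x)%E by rewrite lee_fin.
rewrite (ge0_integral_fmsum _ mf')//.
transitivity (\sum_j \int[Q]_x ((f x * (w j * \1_[set x | c x = j] x))%:E))%E.
  apply: eq_bigr => j _; rewrite ge0_integral_mscale// ge0_integral_mrestr//.
  rewrite integral_mkcond -ge0_integralZl_EFin//.
  - apply: eq_integral => x _; rewrite patchE indicE.
    by case: ifPn; rewrite ?mulr1 ?mulr0 ?mule0// => _; rewrite -EFinM mulrC.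
  - by move=> x _; rewrite patchE; case: ifPn.
  - by apply/(measurable_restrictT _ _).1 => //; exact: measurable_funTS.
rewrite -ge0_integral_sum//.
- apply: eq_integral => x _; rewrite sumEFin; congr EFin.
  by rewrite -mulr_sumr (sum_cell c w).
- move=> j; apply/measurable_EFinP; apply: measurable_funM => //.
  by apply: measurable_funM => //; exact: measurable_indic.
- by move=> j x _; rewrite lee_fin mulr_ge0// mulr_ge0.
Qed.

(** [Q] is reweighted on each cell by the constant p / q: the density depends on the cell only, so
    the path space adds no entropy to that of the finite model. This is the converse of
    [entropy_le_cells]. *)
Lemma entropy_lift : exists P : probability E R,
  cell_prob c P =1 p /\ entropy_le P Q (ent_sum p q).
Proof.
exists (prob_of glued1); split => [j|].
  by rewrite /cell_prob [X in fine X]glued_cell.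
pose wl j := w j * ln (w j).
apply: (@entropy_le_bounded_density _ _ _ _ _ (w \o c)).
- exact: measurable_cell.
- by move=> x; exact: w0.
- exact: bounded_cell.
- by move=> f mf bf f0; exact: gluedI.
- rewrite (integral_cell mc Q wl) /ent_sum ler_sum// => j _.
  by rewrite /wl mulrA qw.
- exact: (bounded_cell c wl).
Qed.

End lift.

(** * Independent samples and Chernoff's bound *)

Section iid.
Context (R : realType) d (E : measurableType d) (Q : probability E R).
Context dS (S : measurableType dS) (PP : probability S R).
Variables (n : nat) (Y : 'I_n.+1 -> {mfun S >-> E}).

Definition iid := forall A : 'I_n.+1 -> set E, (forall i, measurable (A i)) ->
  PP [set w | forall i, A i (Y i w)] = (\prod_i Q (A i))%E.

Hypothesis Yiid : iid.

Definition cells_of (J : finType) (c : E -> J) w : {ffun 'I_n.+1 -> J} :=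
  [ffun i => c (Y i w)].

Lemma measurable_mfun_preimage d' (F : measurableType d') (f : {mfun S >-> F}) (A : set F) :
  measurable A -> measurable [set w | A (f w)].
Proof. by move=> mA; rewrite -[X in measurable X]setTI; exact: (measurable_funPT f). Qed.

Section iid_cells.
Variables (J : finType) (c : E -> J).
Hypothesis mc : forall j, measurable [set x | c x = j].

Lemma measurable_cells_of s : measurable [set w | cells_of c w = s].
Proof.
rewrite (_ : [set w | _] = [set w | forall i, [set x | c x = s i] (Y i w)]).
  by apply: measurable_forall => i; apply: measurable_mfun_preimage.
apply/seteqP; split => w /= h; first by move=> i; rewrite -h ffunE.
by apply/ffunP => i; rewrite ffunE.
Qed.

Lemma measurable_cells_of_pred (P : pred {ffun 'I_n.+1 -> J}) :
  measurable [set w | P (cells_of c w)].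
Proof.
rewrite (_ : [set w | _] = [set w | exists s,
    (if P s then [set w | cells_of c w = s] else set0) w]).
  apply: measurable_exists => s; case: (P s); last exact: measurable0.
  exact: measurable_cells_of.
apply/seteqP; split => w /= h; first by exists (cells_of c w); rewrite h.
by case: h => s; case: ifPn => // Ps /= ->.
Qed.

Lemma iid_cells_of (P : pred {ffun 'I_n.+1 -> J}) :
  PP [set w | P (cells_of c w)] =
  (\sum_(s : {ffun 'I_n.+1 -> J} | P s) \prod_i cell_prob c Q (s i))%:E.
Proof.
rewrite (measure_partition PP measurable_cells_of (measurable_cells_of_pred P)).
rewrite -sumEFin [RHS]big_mkcond/=; apply: eq_bigr => s _.
case: ifPn => Ps; last first.
  rewrite (_ : _ `&` _ = set0) ?measure0//.
  by apply/seteqP; split => // w [/= h hs]; rewrite hs (negbTE Ps) in h.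
rewrite (_ : _ `&` _ = [set w | forall i, [set x | c x = s i] (Y i w)]).
  rewrite (Yiid (A := fun i => [set x | c x = s i]))// -prodEFin.
  by apply: eq_bigr => i _; rewrite cell_probE.
apply/seteqP; split => w /=; first by move=> [_ <-] i; rewrite ffunE.
move=> h; have -> : cells_of c w = s by apply/ffunP => i; rewrite ffunE.
by [].
Qed.

End iid_cells.

(** [iid] gives the probabilities of rectangles, so the exponential moment of the sum is computed on
    a finite alphabet: [f] is cut at N * t and rounded down to multiples of h = t / 2. Rounding
    loses at most N * h, whence the factor 1 / 2 in the rate. *)
Lemma iid_chernoff (f : E -> R) (l b t : R) : measurable_fun setT f ->
  (forall x, 0 <= f x) -> 0 < l -> 0 < t ->
  (\int[Q]_x (expR (l * f x))%:E <= (expR b)%:E)%E ->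
  (PP [set w | (n.+1%:R * t <= \sum_i f (Y i w))%R] <=
    (expR (- (n.+1%:R * (l * t / 2 - b))))%:E)%E.
Proof.
move=> mf f0 l0 t0 hb; set N : R := n.+1%:R.
have N0 : 0 < N by rewrite ltr0n.
pose h := t / 2; have h0 : 0 < h by rewrite divr_gt0.
pose y x := Num.min (f x) (N * t) / h.
have y0 x : 0 <= y x by rewrite divr_ge0 ?(ltW h0)// le_min f0/= mulr_ge0// ltW.
have my : measurable_fun setT y.
  by apply: measurable_funM => //; exact: measurable_minr.
(* The cut N * t divided by the step t / 2 is 2 N. *)
pose m := n.+1.*2.
have ym x : y x <= m%:R.
  rewrite ler_pdivrMr// ge_min; apply/orP; right.
  by rewrite /m -mul2n natrM -/N /h; nra.
have trm x : (Num.trunc (y x) < m.+1)%N.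
  rewrite ltnS -(ler_nat R); apply: le_trans (ym x).
  by have /andP[] := truncn_itv (y0 x).
pose c x : 'I_m.+1 := Ordinal (trm x).
have cy x : (c x)%:R <= y x < (c x).+1%:R.
  by rewrite /=; apply: truncn_itv.
have mc j : measurable [set x | c x = j].
  rewrite (_ : [set x | _] = [set x | j%:R <= y x] `&` ~` [set x | j.+1%:R <= y x]).
    by apply: measurableI; [|apply: measurableC]; exact: measurable_ge_level.
  apply/seteqP; split => x /=.
    by move=> <-; have /andP[c1 c2] := cy x; split => //; apply/negP; rewrite -ltNge.
  move=> [j1 /negP]; rewrite -ltNge => j2; apply: val_inj => /=.
  by apply/truncn_def; rewrite j1.
pose P (s : {ffun 'I_n.+1 -> 'I_m.+1}) := N * (t - h) <= \sum_i h * (s i)%:R.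
have sub : [set w | N * t <= \sum_i f (Y i w)] `<=` [set w | P (cells_of c w)].
  move=> w /= hw; rewrite /P.
  (* A single value above the cut already brings the rounded sum above N * t - h, which is at least
     N * (t - h). *)
  have [/existsP[i hi]|/existsPn hn] := boolP [exists i, N * t <= f (Y i w)].
    rewrite (bigD1 i)//= ler_wpDr//.
      by apply: sumr_ge0 => k _; rewrite mulr_ge0// ltW.
    have /andP[_] := cy (Y i w); rewrite /y min_r// ltr_pdivrMr// ffunE.
    rewrite -natr1 /= => h1.
    have N1 : 1 <= N by rewrite ler1n.
    by move: h1; rewrite -/N; nra.
  have : \sum_i f (Y i w) <= \sum_i (h * (c (Y i w))%:R + h).
    apply: ler_sum => i _; have := hn i; rewrite -ltNge => hi.
    have /andP[_] := cy (Y i w); rewrite /y min_l ?(ltW hi)// ltr_pdivrMr//.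
    by rewrite -natr1 => h1; lra.
  rewrite big_split/= sumr_const card_ord -mulr_natl -/N => h1.
  under eq_bigr do rewrite ffunE.
  by lra.
apply: le_trans (_ : PP [set w | P (cells_of c w)] <= _)%E.
  apply: le_measure => //; rewrite inE.
    rewrite (_ : [set w | _] = [set w | N * t <= (fun w => \sum_i f (Y i w)) w])//.
    apply: measurable_ge_level; apply: measurable_sum => i.
    by apply: measurableT_comp.
  exact: measurable_cells_of_pred.
rewrite iid_cells_of// lee_fin.
have q0 := cell_prob_ge0 c Q.
(* Markov's inequality for the exponential of l times the rounded sum, written on sequences of
   cells, where the sum of products factorises. *)
apply: (@le_trans _ _ (\sum_(s : {ffun 'I_n.+1 -> 'I_m.+1})
   expR (- (l * (N * (t - h)))) * \prod_i (cell_prob c Q (s i) * expR (l * (h * (s i)%:R))))).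
  rewrite big_mkcond/=; apply: ler_sum => s _.
  rewrite big_split/= -expR_sum mulrCA.
  have pr0 : 0 <= \prod_i cell_prob c Q (s i) by apply: prodr_ge0 => i _.
  case: ifPn => Ps; last by rewrite mulr_ge0// mulr_ge0 ?expR_ge0.
  by rewrite ler_peMr// -expRD -mulr_sumr -[leLHS]expR0 ler_expR addrC subr_ge0 ler_pM2l.
rewrite -mulr_sumr (sum_prod_ffun (fun _ j => cell_prob c Q j * expR (l * (h * j%:R)))).
rewrite -(integral_cell mc Q (fun j => expR (l * (h * j%:R)))) prodr_const card_ord.
have le1 : \int[Q]_x expR (l * (h * (c x)%:R)) <= expR b.
  rewrite -lee_fin; apply: le_trans hb.
  have bc := bounded_cell c (fun j => expR (l * (h * j%:R))).
  have mc' := measurable_cell mc (fun j : 'I_m.+1 => expR (l * (h * j%:R))).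
  have Ic := bounded_integrable Q mc' bc.
  rewrite /Rintegral fineK; last exact: integrable_fin_num.
  apply: ge0_le_integral => //.
  - exact/measurable_EFinP.
  - apply/measurable_EFinP; apply: measurableT_comp; first exact: measurable_expR.
    exact: measurable_funM.
  - move=> x _; rewrite lee_fin ler_expR ler_pM2l//.
    have /andP[+ _] := cy x; rewrite /y ler_pdivlMr// => h1.
    by rewrite mulrC (le_trans h1)// ge_min lexx.
apply: (@le_trans _ _ (expR (- (l * (N * (t - h)))) * expR b ^+ n.+1)).
  rewrite ler_pM2l ?expR_gt0// lerXn2r// nnegrE ?expR_ge0//.
  by apply: Rintegral_ge0 => x _; exact: expR_ge0.
rewrite -expRM_natl -expRD ler_expR -/N /h.
nra.
Qed.

End iid.

Section empirical_lemmas.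
Context (R : realType) (d : nat) (T : R) (n : nat).
Local Notation path := (cpath d T).
Implicit Types x y : 'I_n.+1 -> path.

Lemma integral_empirical x (f : path -> R) : measurable_fun setT f ->
  (forall z, 0 <= f z) ->
  (\int[empirical x]_z (f z)%:E = (n.+1%:R^-1 * \sum_i f (x i))%:E)%E.
Proof.
move=> mf f0.
have mf' : measurable_fun setT (fun z : path => (f z)%:E) by exact/measurable_EFinP.
rewrite ge0_integral_mscale//; last by move=> y _; rewrite lee_fin.
rewrite ge0_integral_measure_sum//; last by move=> y _; rewrite lee_fin.
rewrite (eq_bigr (fun i : 'I_n.+1 => (f (x i))%:E)); last first.
  by move=> i _; rewrite integral_dirac// diracT mul1e inord_val.
by rewrite sumEFin -EFinM.
Qed.

Lemma empiricalE x (A : set path) : measurable A ->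
  empirical x A = (n.+1%:R^-1 * \sum_i \1_A (x i))%:E.
Proof.
move=> mA; rewrite -integral_empirical.
- by rewrite integral_indic// setIT.
- exact: measurable_indic.
- by move=> y; rewrite indicE.
Qed.

Definition uniform_nat : set nat -> \bar R :=
  mscale (n.+1%:R^-1)%:nng (msum (fun k => \d_k) n.+1).

HB.instance Definition _ := Measure.on uniform_nat.

Lemma uniform_nat1 : uniform_nat setT = 1%E.
Proof.
have -> : uniform_nat setT = ((n.+1%:R^-1)%:E * \sum_(k < n.+1) \d_(k : nat) setT)%E by [].
rewrite (eq_bigr (fun=> 1%:E)); last by move=> i _; rewrite diracT.
by rewrite sumEFin sumr_const card_ord -EFinM -mulr_natr mul1r mulVf// pnatr_eq0.
Qed.

(** The coupling draws one common index uniformly; [uniform_nat] is its probability space. *)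
Lemma W1_empirical x y :
  (W1 (empirical x) (empirical y) <=
   (n.+1%:R^-1 * \sum_i supdist (x i) (y i))%:E)%E.
Proof.
have mz (z : 'I_n.+1 -> path) : measurable_fun setT (fun k : nat => z (inord k)) by [].
pose mkf (z : 'I_n.+1 -> path) : {mfun nat >-> path} :=
  mfun_of (mz z).
have lawz z : has_law (prob_of uniform_nat1) (mkf z) (empirical z) by [].
apply: le_trans (W1_le (lawz x) (lawz y)) _.
rewrite ge0_integral_mscale//; last by move=> k _; rewrite lee_fin supdist_ge0.
rewrite ge0_integral_measure_sum//; last by move=> k _; rewrite lee_fin supdist_ge0.
rewrite (eq_bigr (fun i : 'I_n.+1 => (supdist (x i) (y i))%:E)); last first.
  by move=> i _; rewrite integral_dirac// diracT mul1e /= inord_val.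
by rewrite sumEFin -EFinM.
Qed.

Lemma empirical_cell_prob (J : finType) (c : path -> J) x :
  (forall j, measurable [set z | c z = j]) ->
  cell_prob c (empirical x) =1 type_of R [ffun i => c (x i)].
Proof.
move=> mc j; rewrite /cell_prob [X in fine X]empiricalE//= /type_of mulrC; congr (_ / _).
rewrite /count_of -sum1_card natr_sum [RHS]big_mkcond/=; apply: eq_bigr => i _.
rewrite inE ffunE indicE; have [<-|ij] := eqVneq; first by rewrite mem_set.
by rewrite memNset//= => h; rewrite h eqxx in ij.
Qed.

(** By [W1_empirical] the empirical measure depends continuously on the paths, so the preimage of an
    open set is a countable union of products of balls centred in the dense sequence. *)
Lemma measurable_empirical dS (S : measurableType dS) (T0 : 0 < T)
    (X : 'I_n.+1 -> {mfun S >-> path}) (U : set (prob1 d T)) : open U ->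
  measurable [set w | U (empirical_prob1 (fun i => X i w))].
Proof.
move=> /W1_openP oU.
pose V (k : {ffun 'I_n.+1 -> nat} * nat) (x : 'I_n.+1 -> path) :=
  forall i, supdist (x i) (path_dense d T0 (k.1 i)) < k.2.+1%:R^-1.
pose good k := `[< forall x, V k x -> U (empirical_prob1 x) >].
rewrite (_ : [set w | _] = [set w | exists k,
    (if good k then [set w | V k (fun i => X i w)] else set0) w]).
  apply: measurable_exists => k; case: ifP => // _.
  apply: measurable_forall => i; rewrite (_ : (fun w => _) =
      ~` [set w | k.2.+1%:R^-1 <= supdist (X i w) (path_dense d T0 (k.1 i))]).
    apply/measurableC/measurable_ge_level.
    by apply: measurable_supdist.
  by apply/funext => w /=; apply/propext; split => [|/negP]; rewrite -?ltNge// => h; apply/negP; rewrite -ltNge.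
apply/seteqP; split => w /= h; last first.
  by case: h => k; case: ifPn => // /asboolP; exact.
have [e e0 eU] := oU _ h.
have [m] : exists m, m.+1%:R^-1 < e / 2.
  have /ltr_add_invr[m] : 0 < e / 2 by rewrite divr_gt0.
  by rewrite add0r => ?; exists m.
set r : R := m.+1%:R^-1 => re.
have r0 : 0 < r by rewrite invr_gt0.
have [j hj] := choice (fun i => path_denseP T0 (X i w) r0).
exists ([ffun i => j i], m); case: ifPn => [_ i|/asboolP[]].
  by rewrite /= ffunE; exact: hj.
move=> x Vx; apply: eU.
apply: le_lt_trans (W1_empirical _ _) _; rewrite lte_fin.
rewrite mulrC ltr_pdivrMr ?ltr0n//.
apply: (@lt_le_trans _ _ (\sum_(i < n.+1) e)); last by rewrite sumr_const card_ord mulr_natr.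
apply: ltr_sum => [|i _]; first by apply/hasP; exists ord0; rewrite ?mem_index_enum.
apply: le_lt_trans (supdist_triangle (path_dense d T0 (j i)) _ _) _.
have := Vx i; rewrite supdistC /= ffunE -/r => h1; have := hj i; lra.
Qed.

End empirical_lemmas.

(** * Sanov bounds for empirical measures of paths *)

Section sanov.
Context (R : realType) (d : nat) (T : R).
Hypothesis T0 : 0 < T.
Variable Q : probability (cpath d T) R.
Hypothesis Qexp : forall l : R, 0 < l ->
  (\int[Q]_x (expR (l * supnorm x))%:E < +oo)%E.
Local Notation path := (cpath d T).
Local Notation prob1 := (prob1 d T).

Let mnc k := @measurable_near_cell R d T T0 k.

(** Chernoff's bound with l = 2 (a + 1) / t: once the partition is fine enough for the exponential
    moment of order l to be at most exp 1, the rate l t / 2 - 1 equals a. Every prescribed rate is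
    thus reached by refining. *)
Lemma near_dist_mean_large (a t : R) : 0 <= a -> 0 < t -> \forall k \near \oo,
  forall n dS (S : measurableType dS) (PP : probability S R)
    (Y : 'I_n.+1 -> {mfun S >-> path}), iid Q PP Y ->
  (PP [set w | (n.+1%:R * t <= \sum_i near_dist T0 k (Y i w))%R] <=
    (expR (- (n.+1%:R * a)))%:E)%E.
Proof.
move=> a0 t0.
have l0 : 0 < 2 * (a + 1) / t by rewrite divr_gt0// mulr_gt0// ltr_wpDl.
near=> k => n dS S PP Y Yiid.
have hk : (\int[Q]_x (expR ((2 * (a + 1) / t) * near_dist T0 k x))%:E <= (expR 1)%:E)%E.
  by near: k; exact: exp_near_dist_small.
have := iid_chernoff Yiid (measurable_near_dist T0 k) (near_dist_ge0 T0 k) l0 t0 hk.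
rewrite (_ : 2 * (a + 1) / t * t / 2 - 1 = a)//.
by rewrite divfK ?gt_eqF// mulrAC divff ?gt_eqF//; lra.
Unshelve. all: by end_near. Qed.

Lemma W1_empirical_cells k n (x : 'I_n.+1 -> path) (P : probability path R)
    (e f h : R) : 
  \sum_i near_dist T0 k (x i) <= n.+1%:R * e ->
  (\int[P]_y (near_dist T0 k y)%:E <= f%:E)%E ->
  (forall j, `|type_of R [ffun i => near_cell T0 k (x i)] j -
     cell_prob (near_cell T0 k) P j| <= h) ->
  (W1 (empirical x) P <= (e + f + (\sum_(i < k.+1) \sum_(j < k.+1)
     supdist (path_dense d T0 i) (path_dense d T0 j)) * (k.+1%:R * h))%:E)%E.
Proof.
move=> xe Pf hh.
apply: le_trans (W1_cells T0 k _ _) _; rewrite !EFinD; apply: leeD; first apply: leeD => //.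
  rewrite integral_empirical; last 2 first.
    exact: measurable_near_dist.
    exact: near_dist_ge0.
  by rewrite lee_fin mulrC ler_pdivrMr ?ltr0n// mulrC.
rewrite EFinM; apply: lee_wpmul2l.
  by rewrite lee_fin; apply: sumr_ge0 => i _; apply: sumr_ge0 => j _; exact: supdist_ge0.
rewrite -[k.+1 in X in (_ <= X)%E](card_ord k.+1) mulr_natl -sumr_const -sumEFin.
apply: lee_sum => i _.
have H (P' Q' : probability path R) : (`|P' [set y | near_cell T0 k y = i] -
    Q' [set y | near_cell T0 k y = i]| =
    `|cell_prob (near_cell T0 k) P' i - cell_prob (near_cell T0 k) Q' i|%:E)%E.
  by rewrite !(cell_probE (@mnc k)) -EFinB abse_EFin.
by rewrite (H (empirical x) P) lee_fin (empirical_cell_prob x (@mnc k)).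
Qed.

(** When the mean quantisation error is below e / 3, the lift of the observed type lies within 2 e /
    3 of the empirical measure, so on D this type has entropy above a. Counting types gives the
    polynomial, with m the number of cells; the summand 1 pays for a large quantisation error. *)
Lemma sanov_upper (a e : R) : 0 <= a -> 0 < e -> exists m : nat,
  forall n dS (S : measurableType dS) (PP : probability S R)
    (Y : 'I_n.+1 -> {mfun S >-> path}), iid Q PP Y ->
  forall D, measurable D ->
  (forall w, D w -> forall P : prob1, entropy_le P Q a ->
     (e%:E <= W1 (empirical (fun i => Y i w)) P)%E) ->
  (PP D <= (((n.+2%:R) ^+ m + 1) * expR (- (n.+1%:R * a)))%:E)%E.
Proof.
move=> a0 e0; have e30 : 0 < e / 3 by rewrite divr_gt0.
have [k [h1 h2]] : exists k, (forall n dS (S : measurableType dS) (PP : probability S R)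
    (Y : 'I_n.+1 -> {mfun S >-> path}), iid Q PP Y ->
    (PP [set w | (n.+1%:R * (e / 3) <= \sum_i near_dist T0 k (Y i w))%R] <=
    (expR (- (n.+1%:R * a)))%:E)%E) /\
    (forall P : probability path R, entropy_le P Q a ->
    (\int[P]_x (near_dist T0 k x)%:E <= (e / 3)%:E)%E).
  apply: (@filter_ex _ \oo).
  apply: filterI; [exact: near_dist_mean_large a0 e30|].
  exact: (entropy_le_near_dist T0 Qexp a e30).
exists k.+1 => n dS S PP Y Yiid D mD HD.
pose q := cell_prob (near_cell T0 k) Q.
pose s w := cells_of Y (near_cell T0 k) w.
(* The implication lets in all sequences that visit a cell of [Q]-mass zero, which have probability
   zero. *)
pose P (s : {ffun 'I_n.+1 -> 'I_k.+1}) :=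
  [forall i, 0 < q (s i)] ==> (a < ent_sum (type_of R s) q).
have sub : D `<=` [set w | (n.+1%:R * (e / 3) <= \sum_i near_dist T0 k (Y i w))%R] `|`
    [set w | P (s w)].
  move=> w Dw; have [|hw] := leP (n.+1%:R * (e / 3)) (\sum_i near_dist T0 k (Y i w)).
    by left.
  right; apply/implyP => /forallP qs; rewrite ltNge; apply/negP => ha.
  have pq j : q j = 0 -> type_of R (s w) j = 0.
    move=> qj; apply: contrapT => /eqP; rewrite /type_of mulf_eq0 negb_or => /andP[+ _].
    rewrite pnatr_eq0 -lt0n => /card_gt0P[i]; rewrite inE => /eqP sj.
    by have := qs i; rewrite sj qj ltxx.
  have [P' [P'c P'e]] := entropy_lift (@mnc k)
    (type_of_ge0 R (s w)) (sum_type1 R (ltn0Sn n) (s w)) pq.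
  have P'e' := entropy_le_mono ha P'e.
  have := HD w Dw (Prob1 (entropy_le_moment Qexp P'e')) P'e'.
  apply/negP; rewrite -ltNge.
  apply: (@le_lt_trans _ _ ((e / 3 + e / 3 + (\sum_(i < k.+1) \sum_(j < k.+1)
     supdist (path_dense d T0 i) (path_dense d T0 j)) * (k.+1%:R * 0))%:E)%E).
    apply: W1_empirical_cells; [exact: ltW|exact: h2|] => j.
    by rewrite P'c subrr normr0.
  by rewrite !mulr0 addr0 lte_fin; lra.
have m1 : measurable [set w | (n.+1%:R * (e / 3) <= \sum_i near_dist T0 k (Y i w))%R].
  apply: (measurable_ge_level (f := fun w => \sum_i near_dist T0 k (Y i w))).
  apply: measurable_sum => i; apply: measurableT_comp => //.
  exact: measurable_near_dist.
have m2 : measurable [set w | P (s w)] by apply: measurable_cells_of_pred; exact: (@mnc k).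
apply: (@le_trans _ _ (PP ([set w | (n.+1%:R * (e / 3) <= \sum_i near_dist T0 k (Y i w))%R] `|`
    [set w | P (s w)]))%E).
  by apply: le_measure => //; rewrite inE//; exact: measurableU.
apply: le_trans (measureU2 _ m1 m2) _.
rewrite addrC mulrDl mul1r EFinD addeC [X in (_ <= X)%E]addeC leeD ?h1//.
rewrite [X in (X <= _)%E](iid_cells_of Yiid (@mnc k) P) lee_fin.
have := @finite_sanov_upper R _ n.+1 (ltn0Sn n) q a P.
rewrite card_ord; apply; first exact: cell_prob_ge0.
by move=> t /implyP Pt ht; apply/ltW/Pt/forallP.
Qed.

(** Types close to the cell probabilities of P have probability at least exp (- N (a + f / 2)) / 2,
    and they lead into D outside the event of a large quantisation error. *)
Lemma sanov_lower (a e f : R) (P : prob1) : entropy_le P Q a -> 0 < e -> 0 < f ->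
  \forall n \near \oo,
  forall dS (S : measurableType dS) (PP : probability S R)
    (Y : 'I_n.+1 -> {mfun S >-> path}), iid Q PP Y ->
  forall D, measurable D ->
  (forall w, (W1 (empirical (fun i => Y i w)) P < e%:E)%E -> D w) ->
  ((expR (- (n.+1%:R * (a + f))))%:E <= PP D)%E.
Proof.
(* With f <= 1 the event of a large quantisation error, at rate a + 1, is at most as likely as the
   target exp (- N (a + f)). *)
move=> Pa e0; wlog f1 : f / f <= 1.
  move=> H f0; have [/H/(_ f0)//|f1] := leP f 1.
  have := H 1 (lexx 1) ltr01; apply: filterS => n Hn dS S PP Y Yiid D mD HD.
  apply: le_trans (Hn _ _ _ _ Yiid _ mD HD).
  by rewrite lee_fin ler_expR lerN2 ler_pM2l ?ltr0n// lerD2l ltW.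
move=> f0; have e40 : 0 < e / 4 by rewrite divr_gt0.
have a0 := entropy_le_ge0 Pa.
have a10 : 0 <= a + 1 by rewrite addr_ge0.
have [k [h1 h2]] : exists k, (forall n dS (S : measurableType dS) (PP : probability S R)
    (Y : 'I_n.+1 -> {mfun S >-> path}), iid Q PP Y ->
    (PP [set w | (n.+1%:R * (e / 4) <= \sum_i near_dist T0 k (Y i w))%R] <=
    (expR (- (n.+1%:R * (a + 1))))%:E)%E) /\
    (\int[P]_x (near_dist T0 k x)%:E <= (e / 4)%:E)%E.
  apply: (@filter_ex _ \oo).
  apply: filterI; [exact: near_dist_mean_large a10 e40|].
  exact: (W1_cell_small T0 e40 (prob1_moment P)).
have [pq pe] := entropy_le_cells (@mnc k) Pa.
set p := cell_prob (near_cell T0 k) P in pq pe.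
set q := cell_prob (near_cell T0 k) Q in pq pe.
pose L := \sum_j `|ln (p j / q j)|.
have L0 : 0 <= L by apply: sumr_ge0.
pose C := \sum_(i < k.+1) \sum_(j < k.+1) supdist (path_dense d T0 i) (path_dense d T0 j).
have C0 : 0 <= C by apply: sumr_ge0 => i _; apply: sumr_ge0 => j _; exact: supdist_ge0.
(* The first bound keeps the cost of the cell discrepancy in [W1] below e / 4, the second keeps the
   entropy loss h * L below f / 2. *)
pose h := Num.min (e / 4 / (C * k.+1%:R + 1)) (f / 2 / (L + 1)).
have Ck0 : 0 < C * k.+1%:R + 1 by rewrite ltr_wpDl// mulr_ge0.
have L10 : 0 < L + 1 by rewrite ltr_wpDl.
have h0 : 0 < h by rewrite lt_min !divr_gt0.
have hC : C * (k.+1%:R * h) <= e / 4.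
  have : h <= e / 4 / (C * k.+1%:R + 1) by rewrite ge_min lexx.
  rewrite ler_pdivlMr// mulrDr mulr1; lra.
have hL : h * L <= f / 2.
  have : h <= f / 2 / (L + 1) by rewrite ge_min lexx orbT.
  by rewrite ler_pdivlMr// mulrDr mulr1; lra.
near=> n => dS S PP Y Yiid D mD HD.
set N : R := n.+1%:R.
have N0 : 0 < N by rewrite ltr0n.
pose s w := cells_of Y (near_cell T0 k) w.
pose V (s : {ffun 'I_n.+1 -> 'I_k.+1}) := [forall j, `|type_of R s j - p j| <= h].
set M := [set w | (N * (e / 4) <= \sum_i near_dist T0 k (Y i w))%R].
have mM : measurable M.
  apply: (measurable_ge_level (f := fun w => \sum_i near_dist T0 k (Y i w))).
  apply: measurable_sum => i; apply: measurableT_comp => //.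
  exact: measurable_near_dist.
have mV : measurable [set w | V (s w)] by apply: measurable_cells_of_pred; exact: (@mnc k).
have sub : [set w | V (s w)] `<=` D `|` M.
  move=> w /= /forallP Vw.
  have [|hw] := leP (N * (e / 4)) (\sum_i near_dist T0 k (Y i w)); first by right.
  left; apply: HD; apply: le_lt_trans (W1_empirical_cells (ltW hw) h2 Vw) _.
  by rewrite lte_fin -/C; lra.
have VDM : (PP [set w | V (s w)] <= PP D + PP M)%E.
  apply: le_trans (measureU2 _ mD mM).
  by apply: le_measure => //; rewrite inE//; exact: measurableU.
rewrite (iid_cells_of Yiid (@mnc k) V) in VDM.
have low := @finite_sanov_lower R _ n.+1 (ltn0Sn n) p q h V h0 (cell_prob_ge0 _ _)
  (cell_prob_sum (@mnc k) P) (cell_prob_ge0 _ _) pq (fun s hs => introT forallP hs).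
have PDfin : PP D \is a fin_num by exact: fin_num_measure.
have PMfin : PP M \is a fin_num by exact: fin_num_measure.
have hM := h1 _ _ _ _ _ Yiid.
rewrite -/N -/M in hM.
rewrite -(fineK PDfin) -(fineK PMfin) -EFinD lee_fin in VDM.
rewrite -(fineK PMfin) lee_fin in hM.
rewrite -(fineK PDfin) lee_fin.
have {}low : expR (- (N * (a + f / 2))) / 2 <= \sum_(s | V s) \prod_i q (s i).
  apply: le_trans low; rewrite -/N ler_pM ?expR_ge0 ?invr_ge0//.
    rewrite ler_expR lerN2 ler_pM2l// -/L; lra.
  rewrite card_ord (_ : 2^-1 = 1 - 2^-1); last by lra.
  rewrite lerD2l lerN2 ler_pdivrMr ?mulr_gt0 ?exprn_gt0//.
  rewrite mulrC -ler_pdivrMr// mulrC -ler_pdivrMr ?exprn_gt0// ltW//.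
  apply: lt_le_trans (_ : n%:R <= _); last by rewrite /N ler_nat.
  by near: n; exact: nbhs_infty_gtr.
(* The factor 4 pays for the division by 2 in [low] and for the mass of [M]. *)
have big : 4 <= expR (N * (f / 2)).
  apply: le_trans (expR_ge1Dx _); rewrite -lerBlDl mulrC -ler_pdivrMl ?divr_gt0//.
  apply: ltW; apply: lt_le_trans (_ : n%:R <= _); last by rewrite /N ler_nat.
  by near: n; exact: nbhs_infty_gtr.
have e1 : expR (- (N * (a + f / 2))) = expR (- (N * (a + f))) * expR (N * (f / 2)).
  by rewrite -expRD; congr expR; lra.
have e2 : expR (- (N * (a + 1))) <= expR (- (N * (a + f))).
  by rewrite ler_expR lerN2 ler_pM2l// lerD2l.
have p0 : 0 < expR (- (N * (a + f))) by exact: expR_gt0.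
rewrite e1 in low; move: low VDM hM; rewrite -/q.
have : expR (- (N * (a + f))) * 4 <= expR (- (N * (a + f))) * expR (N * (f / 2)).
  by rewrite ler_pM2l.
lra.
Unshelve. all: by end_near. Qed.

End sanov.

(** * Lipschitz gradients *)

Section C1_functions.
Context (R : realType) (d : nat).
Implicit Types (F W : 'rV[R]_d -> R) (x h k v : 'rV[R]_d).

Lemma MVT_between (f df : R -> R) (b : R) : (forall t : R, is_derive t 1 f (df t)) ->
  exists2 c, `|c| <= `|b| & f b - f 0 = df c * b.
Proof.
move=> fd; have cf (a c : R) : {within `[a, c], continuous f}.
  apply: continuous_subspaceT => t.
  by apply/differentiable_continuous/derivable1_diffP; have [] := fd t.
have [b0|b0] := leP 0 b.
  have [c] := MVT_segment b0 (fun t _ => fd t) (cf 0 b).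
  rewrite in_itv/= subr0 => /andP[c0 cb] ->; exists c => //.
  by rewrite !ger0_norm// (le_trans c0).
have [c] := MVT_segment (ltW b0) (fun t _ => fd t) (cf b 0).
rewrite in_itv/= sub0r mulrN => /andP[bc c0] h; exists c.
  by rewrite !ler0_norm ?(ltW b0)// lerN2.
by rewrite -[LHS]opprB h opprK.
Qed.

Lemma is_derive_line F x v : (forall y, derivable F y v) ->
  forall t : R, is_derive t 1 (fun s => F (x + s *: v)) ('D_v F (x + t *: v)).
Proof.
move=> dF t; have E : (fun h : R => h^-1 *: ((fun s => F (x + s *: v)) (h *: 1 + t) - F (x + t *: v))) =
    (fun h : R => h^-1 *: (F (h *: v + (x + t *: v)) - F (x + t *: v))).
  by apply/funext => h; rewrite /= [h *: 1]mulr1 scalerDl addrCA.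
split; first by rewrite /derivable /= E; exact: dF.
by rewrite /derive /= E.
Qed.

Definition dot x h : R := \sum_i x ord0 i * h ord0 i.

Definition trunc_rV (m : nat) k : 'rV[R]_d := \row_i (if (i < m)%N then k ord0 i else 0).

(** [classC1] only speaks of partial derivatives; joint differentiability is recovered by moving one
    coordinate at a time through [trunc_rV], with the mean value theorem for each move. *)
Lemma C1_increment F x (e : R) : classC1 F -> 0 < e -> exists2 r : R, 0 < r &
  forall k, (forall i, `|k ord0 i| < r) ->
  `|F (x + k) - F x - dot (grad F x) k| <= e * \sum_i `|k ord0 i|.
Proof.
move=> cF e0.
have [r r0 hr] : exists2 r : R, 0 < r & forall y : 'rV[R]_d, (forall i, `|y ord0 i - x ord0 i| < r) ->
    forall i, `|partial i F y - partial i F x| <= e.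
  have H i : \forall y \near x, `|partial i F y - partial i F x| <= e.
    have [_ /(_ x)] := cF i.
    by move=> /cvgrPdist_le /(_ _ e0); apply: filterS => y; rewrite distrC.
  have := @filter_forall _ _ _ _ (nbhs_filter x) H.
  move=> /nbhs_ballP[r /= r0 hr]; exists r => // y hy; apply: hr.
  by split => // i j; rewrite (ord1 i) /ball/= distrC.
exists r => // k hk.
have step m : (m <= d)%N ->
    `|F (x + trunc_rV m k) - F x - \sum_(i < d | (i < m)%N) grad F x ord0 i * k ord0 i| <=
    e * \sum_(i < d | (i < m)%N) `|k ord0 i|.
  elim: m => [_|m IH md].
    rewrite (_ : trunc_rV 0 k = 0); last by apply/rowP => i; rewrite !mxE.
    by rewrite addr0 subrr !big_pred0// mulr0 subr0 normr0.
  pose i0 := Ordinal md.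
  have tS : trunc_rV m.+1 k = trunc_rV m k + k ord0 i0 *: delta_mx ord0 i0.
    apply/rowP => i; rewrite !mxE eqxx/= -val_eqE/= ltnS leq_eqVlt.
    have [im|im] := eqVneq (i : nat) m.
      by rewrite /= im ltnn add0r mulr1 (_ : i0 = i)//; exact: val_inj.
    by rewrite mulr0 addr0.
  have [c cb] := MVT_between (k ord0 i0) (is_derive_line (x + trunc_rV m k) (proj1 (cF i0))).
  rewrite scale0r addr0 -addrA -tS => hc.
  have sumS (f : 'I_d -> R) : \sum_(i < d | (i < m.+1)%N) f i =
      f i0 + \sum_(i < d | (i < m)%N) f i.
    rewrite (bigD1 i0)//=; congr (_ + _); apply: eq_bigl => i.
    rewrite -val_eqE/= ltnS leq_eqVlt; case: (ltngtP (i : nat) m) => //.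
  rewrite !sumS mulrDr; apply: le_trans (lerD _ (IH (ltnW md))); last first.
    exact: lexx.
  set A := F (x + trunc_rV m k) in hc *; set B := \sum_(i < d | _) _.
  rewrite (_ : _ - _ = ('D_(delta_mx ord0 i0) F (x + trunc_rV m k + c *: delta_mx ord0 i0) -
      grad F x ord0 i0) * k ord0 i0 + (A - F x - B)); last first.
    by rewrite mulrBl -hc; ring.
  apply: le_trans (ler_normD _ _) _; rewrite lerD2r normrM ler_wpM2r//.
  rewrite mxE; apply: hr => i; rewrite -[_ + c *: _]addrA mxE addrAC subrr add0r.
  rewrite !mxE eqxx/=; case: ifPn => im.
    rewrite (_ : (i == i0) = false) ?mulr0 ?addr0 ?hk//.
    by apply/negbTE; rewrite -val_eqE/=; rewrite neq_ltn im.
  rewrite add0r; case: eqP => _; last by rewrite mulr0 normr0.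
  by rewrite mulr1 (le_lt_trans cb).
have := step d (leqnn d).
rewrite (_ : trunc_rV d k = k); last by apply/rowP => i; rewrite mxE ltn_ord.
by rewrite /dot; under eq_bigl do rewrite ltn_ord; under [in X in _ <= X -> _]eq_bigl do rewrite ltn_ord.
Qed.

Lemma is_derive_C1 F x h : classC1 F -> forall t : R,
  is_derive t 1 (fun s => F (x + s *: h)) (dot (grad F (x + t *: h)) h).
Proof.
move=> cF t.
have cv : (fun s : R => s^-1 *: ((fun s => F (x + s *: h)) (s *: 1 + t) - F (x + t *: h)))
    @ 0^' --> dot (grad F (x + t *: h)) h.
  apply/cvgrPdist_le => e e0.
  pose H := \sum_i `|h ord0 i| + 1.
  have H0 : 0 < H by rewrite ltr_wpDl// sumr_ge0.
  have [r r0 hr] := C1_increment (x + t *: h) cF (divr_gt0 e0 H0).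
  have rH : 0 < r / H by rewrite divr_gt0.
  have quotient (D A s : R) : s != 0 -> D - s^-1 * A = - s^-1 * (A - s * D).
    by move=> s0; field.
  have A : \forall s \near (0 : R)^', s != 0 by exact: nbhs_dnbhs_neq.
  have B : \forall s \near (0 : R)^', `|s| < r / H by exact: dnbhs0_lt.
  apply: filterS2 A B => s s0 sr.
  rewrite [s *: 1]mulr1 scalerDl addrCA [s *: h + _]addrC.
  have := hr (s *: h).
  have -> : dot (grad F (x + t *: h)) (s *: h) = s * dot (grad F (x + t *: h)) h.
    by rewrite /dot mulr_sumr; apply: eq_bigr => i _; rewrite [(s *: h) _ _]mxE mulrCA.
  have -> : \sum_i `|(s *: h) ord0 i| = `|s| * \sum_i `|h ord0 i|.
    by rewrite mulr_sumr; apply: eq_bigr => i _; rewrite mxE normrM.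
  set A := F _ - F _ => hA.
  have -> : dot (grad F (x + t *: h)) h - s^-1 *: A =
      - s^-1 * (A - s * dot (grad F (x + t *: h)) h).
    exact: quotient.
  rewrite normrM normrN normfV -ler_pdivlMl ?invr_gt0 ?normr_gt0// invrK.
  apply: le_trans (hA _) _.
    move=> i; rewrite mxE normrM; apply: le_lt_trans (_ : `|s| * H < _).
      by rewrite ler_wpM2l// /H (bigD1 i)//= -addrA lerDl addr_ge0// sumr_ge0.
    by rewrite -ltr_pdivlMr.
  by rewrite mulrCA ler_wpM2l// mulrAC ler_pdivrMr// ler_pM2l// lerDl ler01.
split; first by apply/cvg_ex; eexists; exact: cv.
by apply/cvg_lim.
Qed.

Section second_order.
Variables (W : 'rV[R]_d -> R) (L : R).
Hypothesis cW : classC2 W.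
Hypothesis HL : forall x v, enorm v = 1 -> `|(v *m hessian W x *m v^T) ord0 ord0| <= L.

Let quad x h := \sum_i h ord0 i * dot (grad (partial i W) x) h.

Let quad_le x h : `|quad x h| <= L * enorm h ^+ 2.
Proof.
have [/enorm_eq0 ->|h0] := eqVneq (enorm h) 0.
  rewrite enorm0 expr0n mulr0 /quad big1 ?normr0// => i _; by rewrite mxE mul0r.
pose v := (enorm h)^-1 *: h.
have hp : 0 < enorm h by rewrite lt_def h0 enorm_ge0.
have v1 : enorm v = 1.
  by rewrite enormZ normfV ger0_norm ?enorm_ge0// mulVf.
have qv : quad x h = enorm h ^+ 2 * quad x v.
  rewrite /quad mulr_sumr; apply: eq_bigr => i _.
  rewrite /dot !mulr_sumr; apply: eq_bigr => j _; rewrite !mxE.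
  by field.
rewrite qv normrM ger0_norm ?sqr_ge0// mulrC ler_pM2r ?exprn_gt0//.
have -> : quad x v = (v *m hessian W x *m v^T) ord0 ord0.
  rewrite mxE; apply: eq_bigr => j _; rewrite !mxE [RHS]mulrC; congr (_ * _).
  by apply: eq_bigr => i _; rewrite !mxE mulrC.
exact: HL.
Qed.

(** Two mean value theorems along the segment; the second derivative along a line is the quadratic
    form of the Hessian, bounded on unit vectors and then everywhere by homogeneity. *)
Lemma taylor2_C2 x h : `|W (x + h) - W x - dot (grad W x) h| <= L * enorm h ^+ 2.
Proof.
have [c1 W2] := cW.
have [c cb] := MVT_between 1 (is_derive_C1 x h c1).
rewrite scale1r scale0r addr0 mulr1 => ->.
have dg (t : R) : is_derive t 1 (fun s => dot (grad W (x + s *: h)) h) (quad (x + t *: h) h).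
  have -> : (fun s => dot (grad W (x + s *: h)) h) =
      \sum_i (fun s : R => h ord0 i * partial i W (x + s *: h)).
    apply/funext => s; rewrite fct_sumE; apply: eq_bigr => i _.
    by rewrite mxE mulrC.
  apply: is_derive_sum => i.
  have := is_derive_C1 x h (W2 i) t => D.
  exact: is_deriveZ.
have [c' c'b] := MVT_between c dg.
rewrite scale0r addr0 => ->; rewrite normrM.
apply: le_trans (_ : L * enorm h ^+ 2 * 1 <= _); last by rewrite mulr1.
rewrite ler_pM// ?quad_le//.
by rewrite normr1 in cb.
Qed.

(** Only the quadratic form of the Hessian is bounded, so the mixed terms are recovered by
    polarisation. For v parallel to D with |v| = |u|, the Taylor remainders at (y, v), (x, u + v)
    and (x, u) are at most 1, 4 and 1 times L |u|^2, whence 6. *)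
Lemma grad_lipschitz x y : enorm (grad W y - grad W x) <= 6 * L * enorm (y - x).
Proof.
set D := grad W y - grad W x; set u := y - x.
have [->|D0] := eqVneq (enorm D) 0.
  have := taylor2_C2 x u; move/(le_trans (normr_ge0 _)) => h.
  have [->|u0] := eqVneq (enorm u) 0; first by rewrite mulr0.
  have up : 0 < enorm u by rewrite lt_def u0 enorm_ge0.
  rewrite !mulr_ge0 ?enorm_ge0//.
  by move: h; rewrite pmulr_lge0// exprn_gt0.
have Dp : 0 < enorm D by rewrite lt_def D0 enorm_ge0.
pose v := (enorm u / enorm D) *: D.
have vu : enorm v = enorm u.
  by rewrite enormZ ger0_norm ?divr_ge0 ?enorm_ge0// divfK.
have Dv : dot D v = enorm D * enorm u.
  have -> : dot D v = enorm u / enorm D * enorm D ^+ 2.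
    rewrite sqr_enorm /dot mulr_sumr; apply: eq_bigr => i _.
    by rewrite [v ord0 i]mxE; ring.
  by field.
have L0 : 0 <= L * enorm u ^+ 2.
  by have := taylor2_C2 x u; move/(le_trans (normr_ge0 _)).
have h1 := taylor2_C2 y v; have h2 := taylor2_C2 x (u + v); have h3 := taylor2_C2 x u.
have uv : L * enorm (u + v) ^+ 2 <= 4 * (L * enorm u ^+ 2).
  have [u0|u0] := eqVneq (enorm u) 0.
    have : enorm (u + v) = 0.
      by apply/eqP; rewrite eq_le enorm_ge0 andbT (le_trans (enormD _ _))// vu u0 addr0.
    by move=> ->; rewrite u0 !expr0n/= !mulr0.
  have Lp : 0 <= L by rewrite -(pmulr_lge0 (x := enorm u ^+ 2)) ?exprn_gt0 ?lt_def ?u0 ?enorm_ge0.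
  rewrite [leRHS]mulrCA ler_wpM2l//.
  have := enormD u v; rewrite vu => h; have := enorm_ge0 (u + v); have := enorm_ge0 u; nra.
have dD : dot (grad W x) (u + v) = dot (grad W x) u + dot (grad W x) v.
  by rewrite /dot -big_split/=; apply: eq_bigr => i _; rewrite [(u + v) _ _]mxE mulrDr.
have dB : dot D v = dot (grad W y) v - dot (grad W x) v.
  by rewrite /dot -sumrB; apply: eq_bigr => i _; rewrite !mxE mulrBl.
have xu : x + u = y by rewrite addrC subrK.
rewrite addrA xu in h2; rewrite xu in h3; rewrite vu in h1.
move: h1 h2 h3; rewrite !ler_norml => /andP[h1 h1'] /andP[h2 h2'] /andP[h3 h3'].
have : enorm D * enorm u <= 6 * (L * enorm u ^+ 2).
  by rewrite -Dv; lra.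
have [u0|u0] := eqVneq (enorm u) 0.
  move=> _; have : D = 0.
    by rewrite /D; have := enorm_eq0 u0 => /eqP; rewrite subr_eq0 => /eqP ->; rewrite subrr.
  by move=> ->; rewrite u0 enorm0 mulr0.
rewrite expr2 !mulrA ler_pM2r// lt_def u0 enorm_ge0//.
Qed.

End second_order.

Lemma grad_lipschitz_of_hessian W : classC2 W ->
  (ereal_sup [set (`| (v *m hessian W z *m v^T) ord0 ord0 |)%:E |
      z in [set: 'rV[R]_d] & v in [set v : 'rV[R]_d | enorm v = 1%R]]
    < +oo)%E ->
  exists2 L : R, 0 <= L & forall x y,
    enorm (grad W x - grad W y) <= L * enorm (x - y).
Proof.
move=> cW supW; have [L L0 HL] : exists2 L : R, 0 <= L & forall x v, enorm v = 1 ->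
    `|(v *m hessian W x *m v^T) ord0 ord0| <= L.
  set s := ereal_sup _ in supW.
  have sL x v : enorm v = 1 -> (`|(v *m hessian W x *m v^T) ord0 ord0|%:E <= s)%E.
    by move=> v1; apply: ereal_sup_ubound; exists x => //; exists v.
  (* In dimension 0 there is no unit vector and the supremum is -oo, hence the maximum with 0. *)
  exists (Num.max 0 (fine s)) => [|x v v1]; first by rewrite le_max lexx.
  rewrite le_max; move: (sL x v v1) supW; case: (s) => [r||] //=.
  by rewrite lee_fin => -> _; rewrite orbT.
exists (6 * L) => [|x y]; first by rewrite mulr_ge0.
exact: (grad_lipschitz cW HL).
Qed.

End C1_functions.

(** * The McKean-Vlasov flow *)

Section time_integral.
Context (R : realType) (T : R).
Implicit Types (f g h : R -> R) (t s : R).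

Definition tint f t : R := \int[lebesgue_measure]_(s in `[0, t]) f s.

Definition tcts f := {within `[0, T], continuous f}.

Lemma tcts_integrable f t : tcts f -> t <= T ->
  (@lebesgue_measure R).-integrable `[0, t] (EFin \o f).
Proof.
move=> cf tT; apply: continuous_compact_integrable; first exact: segment_compact.
apply: continuous_subspaceW cf => s /=; rewrite !in_itv/= => /andP[-> st].
exact: le_trans tT.
Qed.

Lemma continuous_tcts f : continuous f -> tcts f.
Proof. exact: continuous_subspaceT. Qed.

Lemma le_tint f g h t : tcts f -> tcts g -> tcts h -> t <= T ->
  (forall s, 0 <= s <= t -> `|f s - g s| <= h s) ->
  `|tint f t - tint g t| <= tint h t.
Proof.
move=> cf cg ch tT fgh; have If := tcts_integrable cf tT.
have Ig := tcts_integrable cg tT; have Ih := tcts_integrable ch tT.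
have Ifg : (@lebesgue_measure R).-integrable `[0, t] (EFin \o (fun s => f s - g s)).
  exact: (integrableB _ If Ig).
rewrite /tint -RintegralB//.
apply: le_trans (le_normr_Rintegral _ Ifg) _ => //.
apply: le_Rintegral => //; first exact: (integrable_norm Ifg).
Qed.

Lemma continuous_scale_expR (K l : R) : continuous (fun s : R => K * expR (l * s)).
Proof.
by move=> s; apply/differentiable_continuous/derivable1_diffP; exact: ex_derive.
Qed.

Lemma tint_expR (K l t : R) : 0 < l -> 0 <= t ->
  tint (fun s => K * expR (l * s)) t = K / l * (expR (l * t) - 1).
Proof.
move=> l0; rewrite le_eqVlt => /predU1P[<-|t0].
  rewrite mulr0 expR0 subrr mulr0 /tint.
  by rewrite set_itv1 Rintegral_set1.
have dF (s : R) : is_derive s 1 (fun s => K / l * expR (l * s)) (K * expR (l * s)).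
  apply: is_derive_eq.
  rewrite [LHS](_ : _ = K / l * (expR (l * s) * (l * 1)))//.
  by field; rewrite gt_eqF.
have cF : continuous (fun s => K / l * expR (l * s)).
  move=> s; apply/differentiable_continuous/derivable1_diffP.
  by have [] := dF s.
have cE := @continuous_scale_expR K l.
rewrite /tint /Rintegral (continuous_FTC2 (F := fun s => K / l * expR (l * s)))//=.
- by rewrite mulr0 expR0 mulrBr.
- exact: continuous_subspaceT.
- split.
  + by move=> s _; have [] := dF s.
  + by apply: cvg_at_right_filter; exact: cF.
  + by apply: cvg_at_left_filter; exact: cF.
- by move=> s _; rewrite derive1E; have [_ ->] := dF s.
Qed.

(** Integration in time divides the weight exp (l s) by l: this gain turns a Lipschitz drift into a
    contraction for large l. *)
Lemma tint_le_expR f g (K l t : R) : tcts f -> tcts g -> 0 < l -> 0 <= K -> 0 <= t <= T ->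
  (forall s, 0 <= s <= t -> `|f s - g s| <= K * expR (l * s)) ->
  `|tint f t - tint g t| <= K / l * expR (l * t).
Proof.
move=> cf cg l0 K0 /andP[t0 tT] h.
apply: le_trans (_ : tint (fun s => K * expR (l * s)) t <= _).
  by apply: le_tint => //; apply: continuous_tcts; exact: continuous_scale_expR.
by rewrite tint_expR// ler_wpM2l ?divr_ge0 ?(ltW l0)// gerBl.
Qed.

Lemma tint_lipschitz f (M t s : R) : tcts f -> (forall s, 0 <= s <= T -> `|f s| <= M) ->
  0 <= s -> s <= t -> t <= T -> `|tint f t - tint f s| <= M * (t - s).
Proof.
move=> cf fM s0 st tT.
have If := tcts_integrable cf tT.
have t0 : 0 <= t by exact: le_trans st.
have -> : tint f t - tint f s = \int[lebesgue_measure]_(x in `]s, t]) f x.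
  rewrite /tint; apply: (Rintegral_itvB (x := s) If); first by rewrite bnd_simp.
  by rewrite bnd_simp.
have Ist : (@lebesgue_measure R).-integrable `]s, t] (EFin \o f).
  apply: integrableS If => //; apply: subset_itv; rewrite bnd_simp//.
apply: le_trans (le_normr_Rintegral _ Ist) _ => //.
apply: le_trans (_ : \int[lebesgue_measure]_(x in `]s, t]) M <= _).
  apply: le_Rintegral => //; first exact: (integrable_norm Ist).
    apply: measurable_bounded_integrable => //.
      by rewrite /= lebesgue_measure_itv/=; case: ifP => _; rewrite ?ltry// -EFinD ltry.
    by exists `|M|; split; [exact: num_real|move=> ? ? ? _ /=; exact: ltW].
  move=> x; rewrite /= in_itv/= => /andP[sx xt]; apply: fM.
  by rewrite (le_trans s0 (ltW sx)) (le_trans xt).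
rewrite Rintegral_cst//= lebesgue_measure_itv/= lte_fin.
case: ifP => _ /=; first exact: lexx.
by rewrite mulr0 mulr_ge0 ?subr_ge0// (le_trans _ (fM s _))// s0 (le_trans st).
Qed.

Lemma tintN f t : tcts f -> t <= T -> tint (fun s => - f s) t = - tint f t.
Proof.
move=> cf tT; rewrite /tint.
under eq_Rintegral do rewrite -mulN1r.
by rewrite RintegralZl ?mulN1r//; exact: tcts_integrable.
Qed.

End time_integral.

Lemma ler_Rintegral_dist (R : realType) d (S : measurableType d) (PP : probability S R)
    (f g h : S -> R) : PP.-integrable setT (EFin \o f) ->
  PP.-integrable setT (EFin \o g) -> PP.-integrable setT (EFin \o h) ->
  (forall w, `|f w - g w| <= h w) ->
  `|\int[PP]_w f w - \int[PP]_w g w| <= \int[PP]_w h w.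
Proof.
move=> If Ig Ih fgh; have Ifg := integrableRB If Ig.
rewrite -RintegralB//; apply: le_trans (le_normr_Rintegral measurableT Ifg) _.
by apply: le_Rintegral => //; exact: (integrable_norm Ifg).
Qed.

Lemma integrableR_le (R : realType) d (S : measurableType d) (PP : probability S R)
    (f g : S -> R) : measurable_fun setT f -> PP.-integrable setT (EFin \o g) ->
  (forall w, `|f w| <= g w) -> PP.-integrable setT (EFin \o f).
Proof.
move=> mf Ig fg; apply: (le_integrable measurableT _ _ Ig).
  exact/measurable_EFinP.
by move=> w _; rewrite /= lee_fin (le_trans (fg w))// ler_norm.
Qed.

Lemma subrB_swap (V : zmodType) (a b c e : V) : a - b - (c - e) = (a - c) - (b - e).
Proof. by rewrite !opprB [e - c]addrC [e - b]addrC addrACA. Qed.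

Section lipschitz_vector.
Context (R : realType) (d : nat).

Lemma lipschitz_rV_continuous (f : 'rV[R]_d -> R) (C : R) :
  (forall x y, `|f x - f y| <= C * enorm (x - y)) -> continuous f.
Proof.
move=> fC x; apply/(@cvgrPdist_le _ _ _ (nbhs x) _ f (f x)) => e e0.
pose K := `|C| * d%:R + 1; have K0 : 0 < K by rewrite ltr_wpDl// mulr_ge0.
have : \forall y \near x, `|x - y| < e / K.
  by apply/nbhs_normP; exists (e / K); rewrite //= divr_gt0.
apply: filterS => y xy; apply: le_trans (fC x y) _.
apply: le_trans (_ : `|C| * (d%:R * `|x - y|) <= _).
  apply: le_trans (_ : `|C| * enorm (x - y) <= _).
    by rewrite ler_wpM2r ?enorm_ge0 ?ler_norm.
  by rewrite ler_wpM2l// enorm_le_norm.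
rewrite mulrA; apply: le_trans (_ : K * (e / K) <= _).
  by rewrite ler_pM ?mulr_ge0 ?lerDl ?(ltW xy).
by rewrite mulrC divfK ?gt_eqF.
Qed.

End lipschitz_vector.

Section mean_field_drift.
Context (R : realType) (d : nat) (T : R).
Hypothesis T0 : 0 < T.
Variables (W : 'rV[R]_d -> R) (L : R).
Hypothesis L0 : 0 <= L.
Hypothesis gradL : forall x y, enorm (grad W x - grad W y) <= L * enorm (x - y).
Local Notation path := (cpath d T).
Local Notation prob1 := (prob1 d T).

Lemma grad_coord_lip i x y :
  `|grad W x ord0 i - grad W y ord0 i| <= L * enorm (x - y).
Proof.
apply: le_trans (gradL x y).
by apply: le_trans (coord_le_enorm _ i); rewrite !mxE.
Qed.

Lemma grad_coord_le i x : `|grad W x ord0 i| <= `|grad W 0 ord0 i| + L * enorm x.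
Proof.
have := grad_coord_lip i x 0; rewrite subr0 => h.
have := ler_normD (grad W x ord0 i - grad W 0 ord0 i) (grad W 0 ord0 i).
by rewrite subrK; lra.
Qed.

Lemma measurable_grad_coord i x :
  measurable_fun setT (fun y : 'rV[R]_d => grad W (x - y) ord0 i).
Proof.
apply: continuous_mx_measurable; apply: (@lipschitz_rV_continuous _ _ _ L) => y z.
apply: le_trans (grad_coord_lip _ _ _) _.
by rewrite subrB_swap subrr sub0r enormN.
Qed.

Section random_vector.
Context dS (S : measurableType dS) (PP : probability S R).
Implicit Types (U V : {mfun S >-> 'rV[R]_d}) (mu nu : probability 'rV[R]_d R)
  (x y : 'rV[R]_d) (i : 'I_d).

Lemma measurable_enorm (U : S -> 'rV[R]_d) : measurable_fun setT U ->
  measurable_fun setT (fun w => enorm (U w)).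
Proof.
move=> mU; apply: (measurableT_comp (f := @enorm R d) _ mU).
by apply: continuous_mx_measurable; exact: continuous_enorm.
Qed.

Lemma integrable_grad_coord i x U : PP.-integrable setT (EFin \o (fun w => enorm (U w))) ->
  PP.-integrable setT (EFin \o (fun w => grad W (x - U w) ord0 i)).
Proof.
move=> IU; apply: (@integrableR_le _ _ _ _ _
  (fun w => (`|grad W 0 ord0 i| + L * enorm x) + L * enorm (U w))).
- exact: (measurableT_comp (measurable_grad_coord i x) (measurable_funPT U)).
- by apply: integrableRD; [exact: integrableR_cst|exact: integrableRZ].
- move=> w; apply: le_trans (grad_coord_le _ _) _.
  by rewrite -addrA lerD2l -mulrDr ler_wpM2l// -[enorm (U w)]enormN enormD.
Qed.

Lemma conv_gradE U mu x i : has_law PP U mu ->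
  PP.-integrable setT (EFin \o (fun w => enorm (U w))) ->
  conv_grad W mu x ord0 i = \int[PP]_w grad W (x - U w) ord0 i.
Proof.
move=> Umu IU; rewrite mxE; congr fine.
rewrite (eq_measure_integral (distribution PP U)); last first.
  by move=> A mA _; rewrite /= -Umu.
rewrite integral_distribution//.
  by apply/measurable_EFinP; exact: measurable_grad_coord.
exact: integrable_grad_coord.
Qed.

(** Both convolutions are expectations over the same coupling, so that the bound involves a distance
    of random variables; optimising over couplings is left to the estimates on [W1]. *)
Lemma conv_grad_lip U V mu nu x y : has_law PP U mu -> has_law PP V nu ->
  PP.-integrable setT (EFin \o (fun w => enorm (U w))) ->
  PP.-integrable setT (EFin \o (fun w => enorm (V w))) ->
  forall i, `|conv_grad W mu x ord0 i - conv_grad W nu y ord0 i| <=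
  L * (enorm (x - y) + \int[PP]_w enorm (U w - V w)).
Proof.
move=> Umu Vnu IU IV i; rewrite (conv_gradE _ _ Umu)// (conv_gradE _ _ Vnu)//.
have IUV : PP.-integrable setT (EFin \o (fun w => enorm (U w - V w))).
  apply: (@integrableR_le _ _ _ _ _ (fun w => enorm (U w) + enorm (V w))).
  - exact: measurable_enormB.
  - exact: integrableRD.
  - move=> w; rewrite ger0_norm ?enorm_ge0// (le_trans (enormD _ _))//.
    by rewrite enormN.
have -> : L * (enorm (x - y) + \int[PP]_w enorm (U w - V w)) =
    \int[PP]_w (L * (enorm (x - y) + enorm (U w - V w))).
  rewrite RintegralZl//; last by apply: integrableRD => //; exact: integrableR_cst.
  rewrite RintegralD//; last exact: integrableR_cst.
  by rewrite Rintegral_prob.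
apply: ler_Rintegral_dist.
- exact: integrable_grad_coord.
- exact: integrable_grad_coord.
- by apply: integrableRZ; apply: integrableRD => //; exact: integrableR_cst.
- move=> w; apply: le_trans (grad_coord_lip _ _ _) _; rewrite ler_wpM2l//.
  rewrite (_ : _ - _ = (x - y) - (U w - V w)).
    by apply: le_trans (enormD _ _) _; rewrite enormN.
  exact: subrB_swap.
Qed.

End random_vector.

Implicit Types (P : prob1) (x z : path) (s : R) (i : 'I_d).

Lemma integrable_supnorm (P : prob1) : P.-integrable setT (EFin \o (@supnorm R d T)).
Proof.
apply/integrableP; split; first by apply/measurable_EFinP; exact: measurable_supnorm.
under eq_integral do rewrite /= ger0_norm ?supnorm_ge0//.
exact: prob1_moment.
Qed.

Lemma integrable_at_time (P : prob1) s :
  P.-integrable setT (EFin \o (fun z : path => enorm (at_time s z))).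
Proof.
apply: (integrableR_le _ (integrable_supnorm P)).
  by apply: measurable_enorm; exact: measurable_at_time.
by move=> z; rewrite ger0_norm ?enorm_ge0//; exact: enorm_le_supnorm.
Qed.

Definition mean_drift (P : prob1) (x : path) (s : R) : 'rV[R]_d :=
  conv_grad W (marginal P s) (x s).

Lemma mean_driftE P x s i : mean_drift P x s ord0 i =
  \int[P]_z grad W (x s - z s) ord0 i.
Proof.
apply: (conv_gradE (U := [the {mfun _ >-> _} of at_time s])) => //.
exact: integrable_at_time.
Qed.

Definition drift_bound (P : prob1) (x : path) : R :=
  enorm (grad W 0) + L * supnorm x + L * \int[P]_z supnorm z.

Lemma grad_path_le x (z : path) s i : `|grad W (x s - z s) ord0 i| <=
  enorm (grad W 0) + L * supnorm x + L * supnorm z.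
Proof.
apply: le_trans (grad_coord_le _ _) _; rewrite -addrA -mulrDr lerD ?coord_le_enorm//.
rewrite ler_wpM2l// (le_trans (enormD _ _))// enormN lerD//; exact: enorm_le_supnorm.
Qed.

Lemma integrable_drift_bound P x : P.-integrable setT
  (EFin \o (fun z : path => enorm (grad W 0) + L * supnorm x + L * supnorm z)).
Proof.
apply: integrableRD; first exact: integrableR_cst.
by apply: integrableRZ; exact: integrable_supnorm.
Qed.

Lemma mean_drift_le P x s i : `|mean_drift P x s ord0 i| <= drift_bound P x.
Proof.
rewrite mean_driftE; have Ig := integrable_grad_coord (PP := P) i (x s) (integrable_at_time P s).
apply: le_trans (le_normr_Rintegral measurableT Ig) _.
have -> : drift_bound P x = \int[P]_z (enorm (grad W 0) + L * supnorm x + L * supnorm z).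
  rewrite RintegralD//; last 2 first.
    exact: integrableR_cst.
    by apply: integrableRZ; exact: integrable_supnorm.
  by rewrite Rintegral_prob RintegralZl//; exact: integrable_supnorm.
apply: le_Rintegral => //.
- exact: (integrable_norm Ig).
- exact: integrable_drift_bound.
- by move=> z _; exact: grad_path_le.
Qed.

(** Paths are continuous only within [0, T], while continuity under the integral sign is applied on
    the open interval ]-1, T + 1[; composing with this projection extends the integrand there. *)
Definition clamp (s : R) : R := if s < 0 then 0 else if T < s then T else s.

Lemma clamp_itv s : 0 <= clamp s <= T.
Proof.
by apply/andP; rewrite /clamp; case: ltP => h; [|case: ltP => h']; split; move: T0; lra.
Qed.

Lemma clamp_id s : 0 <= s <= T -> clamp s = s.
Proof. by move=> sT; rewrite /clamp; case: ltP => h; [|case: ltP => h']; lra. Qed.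

Lemma clamp_dist s t : `|clamp s - clamp t| <= `|s - t|.
Proof.
have h5 := ler_norm (s - t); have := ler_norm (t - s); rewrite distrC => h6.
rewrite ler_norml /clamp; case: ltP => h1; case: (ltP t 0) => h2;
  repeat (case: ltP => ?); apply/andP; split; move: T0; lra.
Qed.

Lemma clamp_near (x : path) (s e : R) : 0 < e ->
  \forall u \near s, enorm (x (clamp u) - x (clamp s)) < e.
Proof.
move=> e0; have [r r0 hr] := path_cts x (clamp_itv s) e0.
have : \forall u \near s, `|s - u| < r by apply/nbhs_normP; exists r.
apply: filterS => u su; apply: hr; first exact: clamp_itv.
by rewrite (le_lt_trans (clamp_dist _ _))// distrC.
Qed.

Lemma mean_drift_tcts P x i : tcts T (fun s => mean_drift P x s ord0 i).
Proof.
have cF : {in (`](-1), (T + 1)[%classic : set R), continuous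
    (fun s => \int[P]_z grad W (x (clamp s) - z (clamp s)) ord0 i)}.
  apply: (@continuity_under_integral _ _ _ P
    (fun s (z : path) => grad W (x (clamp s) - z (clamp s)) ord0 i) setT measurableT
    (-1) (T + 1) _ _ (fun z : path =>
    enorm (grad W 0) + L * supnorm x + L * supnorm z)) => //.
  - by move=> s _; exact: (integrable_grad_coord (PP := P) i (x (clamp s)) (integrable_at_time P (clamp s))).
  - apply: aeW => z _ s _.
    apply/cvgrPdist_le => e e0; pose k := e / (2 * (L + 1)).
    have k0 : 0 < k by rewrite divr_gt0// mulr_gt0// ltr_wpDl.
    apply: filterS2 (clamp_near x s k0) (clamp_near z s k0) => u hx hz.
    apply: le_trans (grad_coord_lip _ _ _) _.
    have ek : e = 2 * (L + 1) * k by rewrite /k mulrC divfK// gt_eqF// mulr_gt0// ltr_wpDl.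
    have : enorm (x (clamp s) - z (clamp s) - (x (clamp u) - z (clamp u))) <= k + k.
      rewrite (_ : _ - _ = (x (clamp s) - x (clamp u)) - (z (clamp s) - z (clamp u))).
        apply: le_trans (enormD _ _) _; rewrite enormN lerD// enormB; exact: ltW.
      exact: subrB_swap.
    by move/(ler_wpM2l L0) => h; rewrite ek; nra.
  - exact: integrable_drift_bound.
  - by move=> s _; apply: aeW => z _; exact: grad_path_le.
have cF' : {within `[0, T], continuous
    (fun s => \int[P]_z grad W (x (clamp s) - z (clamp s)) ord0 i)}.
  apply: continuous_in_subspaceT => s; rewrite inE/= in_itv/= => /andP[s0 sT].
  by apply: cF; rewrite inE/= in_itv/=; apply/andP; split; lra.
apply: subspace_eq_continuous cF' => s; rewrite inE/= in_itv/= => sT.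
have e : \int[P]_z grad W (x (clamp s) - z (clamp s)) ord0 i = mean_drift P x s ord0 i.
  by rewrite mean_driftE clamp_id.
exact: e.
Qed.

Lemma drift_continuous P x : {within `[0, T], continuous
  (fun t => \row_i tint (fun s => mean_drift P x s ord0 i) t)}.
Proof.
apply/within_enormP => t tT e e0.
pose M := drift_bound P x.
have hi i u v : 0 <= u <= T -> 0 <= v <= T ->
   `|tint (fun s => mean_drift P x s ord0 i) u - tint (fun s => mean_drift P x s ord0 i) v| <= `|M| * `|u - v|.
  move=> /andP[u0 uT] /andP[v0 vT]; wlog uv : u v u0 uT v0 vT / v <= u.
    move=> H; have [/H|/ltW/H] := leP v u; first exact.
    by rewrite distrC [X in _ <= _ * X]distrC; apply.
  rewrite [X in _ <= _ * X]ger0_norm ?subr_ge0//; apply: (tint_lipschitz (T := T)) => //.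
    exact: mean_drift_tcts.
  by move=> s _; rewrite (le_trans (mean_drift_le _ _ _ _))// ler_norm.
have K0 : 0 < d%:R * `|M| + 1 by rewrite ltr_wpDl// mulr_ge0.
exists (e / (d%:R * `|M| + 1)); first by rewrite divr_gt0.
move=> s sT st; apply: le_lt_trans (_ : d%:R * (`|M| * `|s - t|) < e).
  by apply: enorm_le_coord => i; rewrite !mxE; exact: hi.
rewrite mulrA; apply: le_lt_trans (_ : (d%:R * `|M| + 1) * `|s - t| < e).
  by rewrite ler_wpM2r// lerDl.
by rewrite mulrC -ltr_pdivlMr.
Qed.

Lemma drift_subproof : {D : prob1 -> path -> path | forall P x t, 0 <= t <= T ->
  D P x t = \row_i tint (fun s => mean_drift P x s ord0 i) t}.
Proof. by exists (fun P x => mkpath (@drift_continuous P x)) => P x t; exact: mkpathE. Qed.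

(* \int_0^t (grad W * P_s)(x_s) ds, as a path in t. *)
Definition drift : prob1 -> path -> path := sval drift_subproof.

Lemma driftE P x t : 0 <= t <= T ->
  drift P x t = \row_i tint (fun s => mean_drift P x s ord0 i) t.
Proof. exact: (svalP drift_subproof). Qed.

Definition drift_const : R := d%:R * L.

Lemma drift_const_ge0 : 0 <= drift_const. Proof. by rewrite mulr_ge0. Qed.

(* The exponential weight makes the drift a contraction for large l. *)
Lemma drift_lip dS (S : measurableType dS) (PP : probability S R)
    (Y Y' : {mfun S >-> path}) (P P' : prob1) (x x' : path) (l K1 K2 t0 : R) :
  has_law PP Y P -> has_law PP Y' P' -> 0 < l -> 0 <= K1 -> 0 <= K2 -> 0 <= t0 <= T ->
  (forall s, 0 <= s <= t0 -> enorm (x s - x' s) <= K1 * expR (l * s)) ->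
  (forall s, 0 <= s <= t0 -> \int[PP]_w enorm (Y w s - Y' w s) <= K2 * expR (l * s)) ->
  enorm (drift P x t0 - drift P' x' t0) <= drift_const / l * (K1 + K2) * expR (l * t0).
Proof.
move=> YP YP' l0 K10 K20 tT hx hY.
have lawt (Z : {mfun S >-> path}) (Q : prob1) s : has_law PP Z Q ->
    has_law PP (mfun_of (measurable_path_eval s (measurable_funPT Z))) (marginal Q s).
  move=> ZQ A mA; apply: (ZQ (at_time s @^-1` A)).
  by rewrite -[X in measurable X]setTI; exact: measurable_at_time.
have It (Z : {mfun S >-> path}) (Q : prob1) s : has_law PP Z Q ->
    PP.-integrable setT (EFin \o (fun w => enorm (Z w s))).
  move=> ZQ; apply/integrableP; split.
    by apply/measurable_EFinP/measurable_enorm/measurable_path_eval; exact: measurable_funPT.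
  apply: le_lt_trans (prob1_moment Q).
  rewrite -(has_law_integral (f := fun z => (supnorm z)%:E) ZQ); last 2 first.
    by apply/measurable_EFinP; exact: measurable_supnorm.
    by move=> z; rewrite lee_fin supnorm_ge0.
  apply: ge0_le_integral => //.
  - apply/measurable_EFinP; apply: measurableT_comp => //.
    by apply/measurable_enorm/measurable_path_eval; exact: measurable_funPT.
  - apply/measurable_EFinP; apply: measurableT_comp; first exact: measurable_supnorm.
    exact: measurable_funPT.
  - move=> w _; rewrite /= lee_fin ger0_norm ?enorm_ge0//; exact: enorm_le_supnorm.
have B i : `|tint (fun s => mean_drift P x s ord0 i) t0 -
    tint (fun s => mean_drift P' x' s ord0 i) t0| <= L * (K1 + K2) / l * expR (l * t0).
  apply: (@tint_le_expR _ T) => //.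
  - exact: mean_drift_tcts.
  - exact: mean_drift_tcts.
  - by rewrite mulr_ge0// addr_ge0.
  - move=> s st.
    apply: le_trans (conv_grad_lip _ _ (lawt _ _ s YP) (lawt _ _ s YP') (It _ _ s YP) (It _ _ s YP') i) _.
    rewrite -mulrA ler_wpM2l// mulrDl lerD//; [exact: hx|exact: hY].
have -> : drift_const / l * (K1 + K2) * expR (l * t0) =
    d%:R * (L * (K1 + K2) / l * expR (l * t0)).
  by rewrite /drift_const; field; rewrite gt_eqF.
rewrite (driftE P x tT) (driftE P' x' tT).
by apply: enorm_le_coord => i; rewrite !mxE; exact: B.
Qed.

End mean_field_drift.

(** * Picard iteration on the path space *)

Section path_algebra.
Context (R : realType) (d : nat) (T : R).
Local Notation path := (cpath d T).
Implicit Types x y z : path.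

Lemma path_out0 x t : ~~ (0 <= t <= T) -> x t = 0.
Proof. by move=> h; apply: path_out; rewrite /= in_itv/=; exact/negP. Qed.

Lemma pathD_subproof x y : {z : path | forall t, z t = x t + y t}.
Proof.
have c : {within `[0, T], continuous (fun t => x t + y t)}.
  apply/within_enormP => t tT e e0; have e20 : 0 < e / 2 by rewrite divr_gt0.
  have [r r0 hr] := path_cts x tT e20; have [q q0 hq] := path_cts y tT e20.
  exists (Num.min r q) => [|s sT]; first by rewrite lt_min r0.
  rewrite lt_min => /andP[sr sq]; rewrite opprD addrACA (le_lt_trans (enormD _ _))//.
  by have := hr s sT sr; have := hq s sT sq; lra.
exists (mkpath c) => t; have [tT|tT] := boolP (0 <= t <= T); first exact: mkpathE.
by rewrite !path_out0// addr0.
Qed.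

Definition pathD x y : path := sval (pathD_subproof x y).

Lemma pathDE x y t : pathD x y t = x t + y t.
Proof. exact: (svalP (pathD_subproof x y)). Qed.

Lemma pathN_subproof x : {z : path | forall t, z t = - x t}.
Proof.
have c : {within `[0, T], continuous (fun t => - x t)}.
  apply/within_enormP => t tT e e0; have [r r0 hr] := path_cts x tT e0.
  by exists r => // s sT sr; rewrite -opprD enormN; exact: hr.
exists (mkpath c) => t; have [tT|tT] := boolP (0 <= t <= T); first exact: mkpathE.
by rewrite !path_out0// oppr0.
Qed.

Definition pathN x : path := sval (pathN_subproof x).

Lemma pathNE x t : pathN x t = - x t.
Proof. exact: (svalP (pathN_subproof x)). Qed.

Lemma path_complete (x : nat -> path) (C : R) :
  (forall n m, (n <= m)%N -> supdist (x m) (x n) <= C / (2 ^ n)%:R) ->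
  exists y : path, forall n, supdist (x n) y <= d%:R * (C / (2 ^ n)%:R).
Proof.
move=> h.
have C0 : 0 <= C by have := h 0 0 (leqnn _); rewrite supdistxx expn0 divr1.
have small (e : R) : 0 < e -> exists n, C / (2 ^ n)%:R < e.
  move=> e0; have [N hN] : exists N, C / e < N%:R.
    exists (Num.truncn (C / e)).+1; have /andP[] := truncn_itv (divr_ge0 C0 (ltW e0)).
    by [].
  exists N; rewrite ltr_pdivrMr ?ltr0n ?expn_gt0// mulrC -ltr_pdivrMr//.
  by rewrite (lt_le_trans hN)// ler_nat ltnW// ltn_expl.
have cau i t n m : (n <= m)%N -> `|x m t ord0 i - x n t ord0 i| <= C / (2 ^ n)%:R.
  move=> nm; apply: le_trans (h n m nm); apply: le_trans (enorm_le_supdist _ _ t).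
  by apply: le_trans (coord_le_enorm _ i); rewrite !mxE.
have cv i t : cvg ((fun n => x n t ord0 i) @ \oo).
  apply: cauchy_cvg; apply: cauchy_exP => e e0.
  have [n hn] := small e e0; exists (x n t ord0 i); rewrite /fmapE -ball_normE.
  by exists n => // m /= nm; rewrite distrC; exact: le_lt_trans (cau i t n m nm) hn.
pose f t : 'rV[R]_d := \row_i lim ((fun n => x n t ord0 i) @ \oo).
have fx n t : enorm (x n t - f t) <= d%:R * (C / (2 ^ n)%:R).
  apply: enorm_le_coord => i; rewrite !mxE distrC.
  have l : (fun m => `|x m t ord0 i - x n t ord0 i|) @ \oo -->
      `|lim ((fun n => x n t ord0 i) @ \oo) - x n t ord0 i|.
    by apply: cvg_norm; apply: cvgB; [exact: cv|exact: cvg_cst].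
  rewrite -(cvg_lim _ l)//; apply: limr_le; first by apply/cvg_ex; eexists; exact: l.
  by near=> m; apply: cau; near: m; exact: nbhs_infty_ge.
have cf : {within `[0, T], continuous f}.
  apply/within_enormP => t tT e e0.
  have [n hn] : exists n, d%:R * (C / (2 ^ n)%:R) < e / 3.
    have [n hn] := small (e / 3 / (d%:R + 1)) ltac:(by rewrite divr_gt0 ?divr_gt0// ltr_wpDl).
    exists n; move: hn; rewrite ltr_pdivlMr ?ltr_wpDl//.
    by have := @divr_ge0 _ C (2 ^ n)%:R C0 (ler0n _ _); nra.
  have e30 : 0 < e / 3 by rewrite divr_gt0.
  have [r r0 hr] := path_cts (x n) tT e30.
  exists r => // s sT sr; have := hr s sT sr; have := fx n s; have := fx n t.
  have := enorm_triangle (x n s) (f s) (f t).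
  have := enorm_triangle (x n t) (x n s) (f t); have := enormB (f s) (x n s); lra.
exists (mkpath cf) => n; apply: supdist_le => [|t tT].
  by rewrite mulr_ge0// divr_ge0.
by rewrite mkpathE.
Unshelve. all: by end_near. Qed.

(** 2 * D is the fixed point of the map sending K to D + K / 2, approached by iterating the
    self-improving bound from any K. In the weighted norms this takes the part of Gronwall's
    inequality. *)
Lemma halving_le (Z : Type) (u e : Z -> R) (D : R) : (forall c, 0 <= e c) -> 0 <= D ->
  (exists2 K, 0 <= K & forall c, u c <= K * e c) ->
  (forall K, 0 <= K -> (forall c, u c <= K * e c) -> forall c, u c <= (D + K / 2) * e c) ->
  forall c, u c <= 2 * D * e c.
Proof.
move=> e0 D0 [K K0 uK] H z.
have it n : forall c, u c <= (2 * D + K / (2 ^ n)%:R) * e c.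
  elim: n => [|n IH] {}z.
    by rewrite expn0 divr1 (le_trans (uK z))// ler_wpM2r// lerDr mulr_ge0.
  have := H _ _ IH z; rewrite expnS natrM invfM; set q := (2 ^ n)%:R^-1.
  have q0 : 0 <= q by rewrite invr_ge0.
  rewrite (_ : D + (2 * D + K * q) / 2 = 2 * D + K * (2^-1 * q)); last by field.
  by apply; rewrite addr_ge0 ?mulr_ge0.
apply/ler_addgt0Pr => r r0.
have Ke0 : 0 <= K * e z by rewrite mulr_ge0.
pose N := (Num.truncn (K * e z / r)).+1.
have hN : K * e z / r < N%:R.
  by have /andP[] := truncn_itv (divr_ge0 Ke0 (ltW r0)).
apply: le_trans (it N z) _; rewrite mulrDl lerD2l mulrAC ler_pdivrMr ?ltr0n ?expn_gt0//.
rewrite -ler_pdivrMl// mulrC ltW// (lt_le_trans hN)// ler_nat ltnW//.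
exact: ltn_expl.
Qed.

Section picard.
Variables (I A : Type) (ev : A -> I -> path) (w : I -> R) (l : R) (Psi : A -> A).
Hypothesis T0 : 0 < T.
Hypothesis w0 : forall i, 0 <= w i.
Hypothesis l0 : 0 < l.

Definition wle (K : R) (X Y : I -> path) := forall i t, 0 <= t <= T ->
  enorm (X i t - Y i t) <= K * w i * expR (l * t).

Hypothesis Psi_contr : forall a b K, 0 <= K -> wle K (ev a) (ev b) ->
  wle (K / 2) (ev (Psi a)) (ev (Psi b)).
Hypothesis A_complete : forall (a : nat -> A) (x : I -> path),
  (forall i (e : R), 0 < e -> \forall n \near \oo, supdist (ev (a n) i) (x i) <= e) ->
  exists b, forall i, ev b i = x i.

(** The iteration runs on whole families of paths indexed by I, inside an abstract class A: all maps
    of paths for [backward], the Lipschitz ones for [Phi_surj]. The weight w absorbs the growth of a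
    family in its index. *)
Lemma picard (a0 : A) (K0 : R) : 0 <= K0 -> wle K0 (ev (Psi a0)) (ev a0) ->
  exists b, forall i, ev (Psi b) i = ev b i.
Proof.
move=> K00 h0; pose a n := iter n Psi a0.
have step n : wle (K0 / (2 ^ n)%:R) (ev (a n.+1)) (ev (a n)).
  elim: n => [|n IH]; first by rewrite expn0 divr1.
  by rewrite expnS mulnC natrM invfM mulrA; apply: Psi_contr IH; rewrite divr_ge0.
have far n k : wle (2 * K0 / (2 ^ n)%:R * (1 - (2 ^ k)%:R^-1)) (ev (a (n + k)%N)) (ev (a n)).
  elim: k => [|k IH] i t tT.
    by rewrite addn0 subrr enorm0 expn0 invr1 subrr mulr0 !mul0r.
  apply: le_trans (enorm_triangle (ev (a (n + k)%N) i t) _ _) _.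
  rewrite addnS; apply: le_trans (lerD (step _ i t tT) (IH i t tT)) _.
  rewrite expnD expnS !natrM !invfM le_eqVlt; apply/orP; left; apply/eqP.
  have p2 j : (2 ^ j)%:R != 0 :> R by rewrite pnatr_eq0 -lt0n expn_gt0.
  by field; rewrite !p2.
have sd i n m : (n <= m)%N ->
    supdist (ev (a m) i) (ev (a n) i) <= 2 * K0 * w i * expR (l * T) / (2 ^ n)%:R.
  move=> nm; rewrite -(subnKC nm); apply: supdist_le => [|t tT].
    by rewrite divr_ge0 ?mulr_ge0 ?expR_ge0.
  apply: le_trans (far n (m - n)%N i t tT) _.
  have tl : expR (l * t) <= expR (l * T).
    by rewrite ler_expR ler_pM2l//; case/andP: tT.
  set c : R := 1 - _.
  have c0 : 0 <= c by rewrite subr_ge0 invf_le1 ?ltr0n ?expn_gt0// ler1n expn_gt0.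
  have c1 : c <= 1 by rewrite gerBl invr_ge0.
  rewrite (_ : _ * expR (l * t) = 2 * K0 * w i / (2 ^ n)%:R * (c * expR (l * t))); last by ring.
  rewrite (_ : _ * expR (l * T) / _ = 2 * K0 * w i / (2 ^ n)%:R * (1 * expR (l * T))); last by ring.
  by rewrite ler_wpM2l ?divr_ge0 ?mulr_ge0// ler_pM ?expR_ge0.
have [x hx] := choice (fun i => path_complete (sd i)).
have [|b hb] := @A_complete a x.
  move=> i e e0; set C := 2 * K0 * w i * expR (l * T) in hx.
  pose M := d%:R * C; have M0 : 0 <= M by rewrite !mulr_ge0 ?expR_ge0.
  near=> n; apply: le_trans (hx i n) _; rewrite -/C mulrA -/M.
  rewrite ler_pdivrMr ?ltr0n ?expn_gt0// -ler_pdivrMl// mulrC.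
  apply: le_trans (_ : n%:R <= _); last by rewrite ler_nat ltnW// ltn_expl.
  by near: n; exact: nbhs_infty_ger.
exists b => i; apply: path_eq => t tT.
apply/eqP; rewrite -subr_eq0; apply/eqP/enorm_eq0.
pose M := d%:R * (2 * K0 * expR (l * T)).
have M0 : 0 <= M by rewrite !mulr_ge0 ?expR_ge0.
have bn n : wle (M / (2 ^ n)%:R) (ev (a n)) (ev b).
  move=> j s sT; apply: le_trans (enorm_le_supdist _ _ s) _; rewrite hb.
  apply: le_trans (hx j n) _.
  have e1 : 1 <= expR (l * s) by rewrite -[leLHS]expR0 ler_expR mulr_ge0 ?(ltW l0)//; case/andP: sT.
  apply: le_trans (_ : M / (2 ^ n)%:R * w j * 1 <= _).
    by rewrite mulr1 /M le_eqVlt; apply/orP; left; apply/eqP; ring.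
  by rewrite ler_wpM2l ?mulr_ge0 ?invr_ge0.
apply/eqP; rewrite eq_le enorm_ge0 andbT; apply/ler_addgt0Pr => e e0; rewrite add0r.
pose B := M * w i * expR (l * t).
have B0 : 0 <= B by rewrite !mulr_ge0 ?expR_ge0.
pose N := (Num.truncn (B / e)).+1.
have hN : B / e < N%:R by have /andP[] := truncn_itv (divr_ge0 B0 (ltW e0)).
(* The iterate a N.+1 = Psi (a N) is close to Psi b by contraction and close to b by convergence. *)
have h1 := Psi_contr (divr_ge0 M0 (ler0n _ (2 ^ N))) (bn N) i tT.
have h2 := bn N.+1 i t tT.
apply: le_trans (enorm_triangle (ev (a N.+1) i t) _ _) _; rewrite enormB.
apply: le_trans (lerD h1 h2) _.
apply: le_trans (_ : B / (2 ^ N)%:R <= _).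
  rewrite expnS natrM invfM le_eqVlt; apply/orP; left; apply/eqP; rewrite /B.
  by field; rewrite pnatr_eq0 -lt0n expn_gt0.
rewrite ler_pdivrMr ?ltr0n ?expn_gt0// -ler_pdivrMl// mulrC ltW//.
by rewrite (lt_le_trans hN)// ler_nat ltnW// ltn_expl.
Unshelve. all: by end_near. Qed.

End picard.
End path_algebra.

Section push.
Context (R : realType) (d : nat) (T : R).
Hypothesis T0 : 0 < T.
Local Notation path := (cpath d T).
Local Notation prob1 := (prob1 d T).

Definition lipschitz_map (f : path -> path) :=
  exists C : R, forall x y, supdist (f x) (f y) <= C * supdist x y.

Lemma measurable_lipschitz_map f : lipschitz_map f -> measurable_fun setT f.
Proof. by move=> [C fC]; exact: lipschitz_path_measurable fC. Qed.

Lemma integrable_supnorm_law dS (S : measurableType dS) (PP : probability S R)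
    (Y : {mfun S >-> path}) (P : prob1) : has_law PP Y P ->
  PP.-integrable setT (EFin \o (fun w => supnorm (Y w))).
Proof.
move=> YP; have mY : measurable_fun setT (fun w => supnorm (Y w)).
  by apply: measurableT_comp; [exact: measurable_supnorm|exact: measurable_funPT].
apply/integrableP; split; first exact/measurable_EFinP.
under eq_integral do rewrite /= ger0_norm ?supnorm_ge0//.
rewrite (has_law_integral (f := fun z => (supnorm z)%:E) YP).
- exact: prob1_moment.
- by apply/measurable_EFinP; exact: measurable_supnorm.
- by move=> z; rewrite lee_fin supnorm_ge0.
Qed.

Lemma integrable_supdist dS (S : measurableType dS) (PP : probability S R)
    (Y Z : {mfun S >-> path}) (P Q : prob1) : has_law PP Y P -> has_law PP Z Q ->
  PP.-integrable setT (EFin \o (fun w => supdist (Y w) (Z w))).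
Proof.
move=> YP ZQ; apply: (@integrableR_le _ _ _ _ _ (fun w => supnorm (Y w) + supnorm (Z w))).
- by apply: measurable_supdist => //; exact: measurable_funPT.
- by apply: integrableRD; [exact: integrable_supnorm_law YP|exact: integrable_supnorm_law ZQ].
- by move=> w; rewrite ger0_norm ?supdist_ge0// supdist_le_norm.
Qed.

Lemma push_moment f (lf : lipschitz_map f) (P : prob1) :
  (\int[distribution P (mfun_of (measurable_lipschitz_map lf))]_x (supnorm x)%:E < +oo)%E.
Proof.
have [C fC] := lf.
rewrite ge0_integral_distribution//; last 2 first.
- by apply/measurable_EFinP; exact: measurable_supnorm.
- by move=> x; rewrite lee_fin supnorm_ge0.
have If : P.-integrable setT (EFin \o (fun x => supnorm (f x))).
  apply: (@integrableR_le _ _ _ _ _ (fun x => supnorm (f (path0 d T)) + C * supnorm x)).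
  - apply: measurableT_comp; first exact: measurable_supnorm.
    exact: measurable_lipschitz_map.
  - apply: integrableRD; first exact: integrableR_cst.
    by apply: integrableRZ; exact: integrable_supnorm.
  - move=> x; rewrite ger0_norm ?supnorm_ge0// addrC.
    apply: le_trans (supnorm_le_dist (f x) (f (path0 d T))) _.
    by rewrite lerD2r -supdistx0.
have /integrableP[_] := If.
by under eq_integral do rewrite /= ger0_norm ?supnorm_ge0//.
Qed.

Definition push f (lf : lipschitz_map f) (P : prob1) : prob1 := Prob1 (push_moment lf P).

Lemma pushE f (lf : lipschitz_map f) (P : prob1) A : push lf P A = P (f @^-1` A).
Proof. by []. Qed.

Lemma W1_scale (a : \bar R) (C : R) (P Q : probability path R) : 0 < C ->
  (forall dS (S : measurableType dS) (PP : probability S R) (Y Z : {mfun S >-> path}),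
    has_law PP Y P -> has_law PP Z Q ->
    (a <= C%:E * \int[PP]_w (supdist (Y w) (Z w))%:E)%E) ->
  (a <= C%:E * W1 P Q)%E.
Proof.
move=> C0 H; rewrite -lee_pdivrMl//; apply: le_ereal_inf_tmp => _ [dS [S [PP [Y [Z [YP ZQ ->]]]]]].
by rewrite lee_pdivrMl//; exact: H.
Qed.

End push.

Lemma opaque_value (A : Type) (x : A) : {y | y = x}.
Proof. by exists x. Qed.

(** * The forward map and its action on laws *)

Section flow.
Context (R : realType) (d : nat) (T : R).
Hypothesis T0 : 0 < T.
Variables (W : 'rV[R]_d -> R) (L : R).
Hypothesis L0 : 0 <= L.
Hypothesis gradL : forall x y, enorm (grad W x - grad W y) <= L * enorm (x - y).
Local Notation path := (cpath d T).
Local Notation prob1 := (prob1 d T).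
Local Notation drift := (drift T0 L0 gradL).
Implicit Types (P Q : prob1) (x y z : path).

(** Large enough for [drift_const / lam] to be at most 1 / 4; the summand 1 keeps it positive when
    the drift constant vanishes. *)
Definition lam : R := 4 * drift_const d L + 1.

Lemma lam_gt0 : 0 < lam.
Proof. by rewrite ltr_wpDl// mulr_ge0// drift_const_ge0. Qed.

Lemma drift_lam : drift_const d L / lam <= 1 / 4.
Proof.
rewrite ler_pdivrMr ?lam_gt0// /lam; have := @drift_const_ge0 _ d _ L0; lra.
Qed.

Lemma expR_lam_ge1 t : 0 <= t -> 1 <= expR (lam * t).
Proof. by move=> t0; rewrite -[leLHS]expR0 ler_expR mulr_ge0// ltW// lam_gt0. Qed.

Lemma expR_lam_le t : t <= T -> expR (lam * t) <= expR (lam * T).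
Proof. by move=> tT; rewrite ler_expR ler_pM2l ?lam_gt0. Qed.

Lemma drift_coupling dS (S : measurableType dS) (PP : probability S R)
    (Y Y' : {mfun S >-> path}) P P' x x' (K1 K2 t : R) :
  has_law PP Y P -> has_law PP Y' P' -> 0 <= K1 -> 0 <= K2 -> 0 <= t <= T ->
  (forall s, 0 <= s <= t -> enorm (x s - x' s) <= K1 * expR (lam * s)) ->
  (forall s, 0 <= s <= t -> \int[PP]_w enorm (Y w s - Y' w s) <= K2 * expR (lam * s)) ->
  enorm (drift P x t - drift P' x' t) <= (K1 + K2) / 4 * expR (lam * t).
Proof.
move=> YP YP' K10 K20 tT hx hY.
apply: le_trans (drift_lip T0 L0 gradL YP YP' lam_gt0 K10 K20 tT hx hY) _.
rewrite ler_wpM2r ?expR_ge0// mulrC ler_wpM2l ?addr_ge0//.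
by have := drift_lam; rewrite div1r.
Qed.

Lemma integral_enorm0 P (s : R) : \int[P]_w enorm (path_id d T w s - path_id d T w s) = 0 :> R.
Proof.
by under eq_Rintegral do rewrite subrr enorm0; rewrite Rintegral_prob.
Qed.

Lemma drift_same P x x' (K t : R) : 0 <= K -> 0 <= t <= T ->
  (forall s, 0 <= s <= t -> enorm (x s - x' s) <= K * expR (lam * s)) ->
  enorm (drift P x t - drift P x' t) <= K / 4 * expR (lam * t).
Proof.
move=> K0 tT hx; rewrite -[K in leRHS]addr0.
apply: (drift_coupling (has_law_id P) (has_law_id P)) => // s _.
by rewrite integral_enorm0 mul0r.
Qed.

Definition forward P x := pathD x (drift P x).

Lemma forwardE P x : forward P x = pathD x (drift P x).
Proof. by []. Qed.

(** The drift returns only a quarter of the error in the path, so [halving_le] closes the estimate.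
    The law may vary together with the path, and the horizon t0 keeps the estimate local in time. *)
Lemma forward_compare dS (S : measurableType dS) (PP : probability S R)
    (Y Y' : {mfun S >-> path}) P P' x x' (D K2 t0 : R) :
  has_law PP Y P -> has_law PP Y' P' -> 0 <= D -> 0 <= K2 -> t0 <= T ->
  (forall s, 0 <= s <= t0 -> enorm (forward P x s - forward P' x' s) <= D) ->
  (forall s, 0 <= s <= t0 -> \int[PP]_w enorm (Y w s - Y' w s) <= K2 * expR (lam * s)) ->
  forall t, 0 <= t <= t0 -> enorm (x t - x' t) <= 2 * (D + K2 / 4) * expR (lam * t).
Proof.
move=> YP YP' D0 K20 t0T hD hY.
pose Z := {t : R | 0 <= t <= t0}.
suff H : forall z : Z, enorm (x (sval z) - x' (sval z)) <= 2 * (D + K2 / 4) * expR (lam * sval z).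
  by move=> t tT; exact: (H (exist _ t tT)).
apply: halving_le => [z||| K K0 hK].
- exact: expR_ge0.
- by rewrite addr_ge0// divr_ge0.
- exists (supdist x x') => [|[t /andP[t0' tt]]/=]; first exact: supdist_ge0.
  apply: le_trans (enorm_le_supdist _ _ _) _.
  by rewrite ler_peMr ?supdist_ge0// expR_lam_ge1.
- move=> [t tt] /=; have /andP[tp tt0] := tt.
  have tT : 0 <= t <= T by rewrite tp (le_trans tt0).
  have hdr : enorm (drift P x t - drift P' x' t) <= (K + K2) / 4 * expR (lam * t).
    apply: (drift_coupling YP YP') => // s /andP[s0 st]; last first.
      by apply: hY; rewrite s0 (le_trans st).
    have sz : 0 <= s <= t0 by rewrite s0 (le_trans st).
    exact: (hK (exist _ s sz)).
  have -> : x t - x' t = (forward P x t - forward P' x' t) - (drift P x t - drift P' x' t).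
    by rewrite !pathDE subrB_swap !addrK.
  apply: le_trans (enormD _ _) _; rewrite enormN.
  have e1 := expR_lam_ge1 tp; have := hD t tt.
  set e := expR _ in e1 hdr *; nra.
Qed.

(** With t0 < T this says that [backward P] is nonanticipative, on which adaptedness of the solution
    rests. *)
Lemma forward_inj P x x' (t0 : R) : t0 <= T ->
  (forall s, 0 <= s <= t0 -> forward P x s = forward P x' s) ->
  forall t, 0 <= t <= t0 -> x t = x' t.
Proof.
move=> t0T h t tt; apply/eqP; rewrite -subr_eq0; apply/eqP/enorm_eq0/eqP.
rewrite eq_le enorm_ge0 andbT.
have := @forward_compare _ _ _ _ _ P P x x' 0 0 t0 (has_law_id P) (has_law_id P)
   (lexx _) (lexx _) t0T.
rewrite mul0r addr0 mulr0 => H; rewrite -[leRHS](mul0r (expR (lam * t))); apply: H => // s ss.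
  by rewrite h// subrr enorm0.
by rewrite integral_enorm0 mul0r.
Qed.

(** All targets y are treated at once, starting from the identity. The first correction at y is the
    drift along y, so the weight 1 + supnorm (drift P y) makes the initial error at most 1. *)
Lemma backward_subproof P : {F : path -> path | forall y, forward P (F y) = y}.
Proof.
apply: cid.
pose Psi (X : path -> path) y := pathD y (pathN (drift P (X y))).
pose w y : R := 1 + supnorm (drift P y).
have w0 y : 0 <= w y by rewrite addr_ge0// supnorm_ge0.
have contr X X' K : 0 <= K -> wle w lam K X X' -> wle w lam (K / 2) (Psi X) (Psi X').
  move=> K0 h y t tT; rewrite !pathDE !pathNE subrB_swap subrr sub0r enormN.
  apply: le_trans (@drift_same P (X y) (X' y) (K * w y) t _ tT _) _.
  - by rewrite mulr_ge0.
  - move=> s /andP[s0 st]; apply: h; rewrite s0 (le_trans st)//; by case/andP: tT.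
  - rewrite ler_wpM2r ?expR_ge0//; have := mulr_ge0 K0 (w0 y); lra.
have [|||b hb] := @picard _ _ _ path (path -> path) id w lam Psi w0 lam_gt0 contr _ id 1.
- by move=> a x _; exists x.
- by [].
- move=> y t tT; rewrite /Psi /= pathDE pathNE addrC addKr enormN mul1r.
  apply: le_trans (enorm_le_supnorm _ _) _; rewrite -[leLHS]mulr1 ler_pM ?supnorm_ge0//.
    by rewrite lerDr.
  by apply: expR_lam_ge1; case/andP: tT.
exists b => y; apply: path_eq => t tT.
by rewrite /forward pathDE -{1}(hb y) /Psi pathDE pathNE subrK.
Qed.

Definition backward P : path -> path := sval (backward_subproof P).

Lemma backwardK P : cancel (backward P) (forward P).
Proof. exact: (svalP (backward_subproof P)). Qed.

Lemma forwardK P : cancel (forward P) (backward P).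
Proof.
move=> x; apply: path_eq => t tT; apply: (@forward_inj P _ _ T) => // s _.
by rewrite backwardK.
Qed.

Lemma backward_lip P y y' :
  supdist (backward P y) (backward P y') <= 2 * expR (lam * T) * supdist y y'.
Proof.
apply: supdist_le => [|t tT]; first by rewrite !mulr_ge0 ?expR_ge0 ?supdist_ge0.
have := @forward_compare _ _ _ _ _ P P (backward P y) (backward P y') (supdist y y') 0 T
  (has_law_id P) (has_law_id P) (supdist_ge0 _ _) (lexx _) (lexx _).
rewrite mul0r addr0 !backwardK => H.
apply: le_trans (H _ _ t tT) _ => [s _|s _|].
- exact: enorm_le_supdist.
- by rewrite integral_enorm0 mul0r.
- rewrite mulrAC ler_wpM2r ?supdist_ge0// ler_pM2l//.
  by apply: expR_lam_le; case/andP: tT.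
Qed.

Lemma backward_lipschitz P : lipschitz_map (backward P).
Proof. by exists (2 * expR (lam * T)); exact: backward_lip. Qed.

Lemma forward_coupling dS (S : measurableType dS) (PP : probability S R)
    (Y Y' : {mfun S >-> path}) P P' x x' : has_law PP Y P -> has_law PP Y' P' ->
  supdist (forward P x) (forward P' x') <= supdist x x' +
    expR (lam * T) * (supdist x x' + \int[PP]_w supdist (Y w) (Y' w)).
Proof.
move=> YP YP'; set m := \int[PP]_w _.
have m0 : 0 <= m by apply: Rintegral_ge0 => w _; exact: supdist_ge0.
have x0 := supdist_ge0 x x'; have e0 := expR_ge0 (lam * T).
apply: supdist_le => [|t tT]; first by rewrite addr_ge0// mulr_ge0// addr_ge0.
have /andP[tp tT'] := tT.
have hdr : enorm (drift P x t - drift P' x' t) <= (supdist x x' + m) / 4 * expR (lam * t).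
  apply: (drift_coupling YP YP') => // s /andP[s0 st].
    apply: le_trans (enorm_le_supdist _ _ _) _.
    by rewrite ler_peMr// expR_lam_ge1.
  apply: le_trans (_ : m <= _); last by rewrite ler_peMr// expR_lam_ge1.
  have I := integrable_supdist T0 YP YP'; apply: le_Rintegral => //.
    apply: integrableR_le I _.
      by apply: measurable_enormB; apply: measurable_path_eval; exact: measurable_funPT.
    by move=> w; rewrite ger0_norm ?enorm_ge0// enorm_le_supdist.
  by move=> w _; exact: enorm_le_supdist.
rewrite /forward !pathDE opprD addrACA; apply: le_trans (enormD _ _) _.
apply: lerD; first exact: enorm_le_supdist.
apply: le_trans hdr _; rewrite mulrC.
apply: ler_pM.
- exact: expR_ge0.
- by rewrite divr_ge0// addr_ge0.
- exact: expR_lam_le.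
- by rewrite ler_pdivrMr//; nra.
Qed.

Lemma forward_lip P x x' :
  supdist (forward P x) (forward P x') <= (1 + expR (lam * T)) * supdist x x'.
Proof.
have := forward_coupling x x' (has_law_id P) (has_law_id P).
under eq_Rintegral do rewrite supdistxx.
by rewrite [\int[P]__ 0]Rintegral_prob addr0 [(1 + _) * _]mulrDl mul1r.
Qed.

Lemma forward_lipschitz P : lipschitz_map (forward P).
Proof. by exists (1 + expR (lam * T)); exact: forward_lip. Qed.

Definition Phi P : prob1 := push (forward_lipschitz P) P.

Lemma integral_supdist_EFin dS (S : measurableType dS) (PP : probability S R)
    (Y Z : {mfun S >-> path}) P Q : has_law PP Y P -> has_law PP Z Q ->
  (\int[PP]_w (supdist (Y w) (Z w))%:E = (\int[PP]_w supdist (Y w) (Z w))%:E)%E.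
Proof.
move=> YP ZQ; rewrite /Rintegral fineK//; apply: integrable_fin_num => //.
exact: (integrable_supdist T0 YP ZQ).
Qed.

Lemma Phi_lip P P' :
  (W1 (Phi P) (Phi P') <= (1 + 2 * expR (lam * T))%:E * W1 P P')%E.
Proof.
apply: W1_scale; first by rewrite ltr_wpDr// mulr_ge0// expR_ge0.
move=> dS S PP Y Y' YP YP'.
have mf Q (Z : {mfun S >-> path}) : measurable_fun setT (forward Q \o Z).
  exact: (measurableT_comp (measurable_lipschitz_map (forward_lipschitz Q)) (measurable_funPT Z)).
have lawf Q (Z : {mfun S >-> path}) : has_law PP Z Q -> has_law PP (mfun_of (mf Q Z)) (Phi Q).
  move=> ZQ A mA; rewrite pushE -ZQ//.
  rewrite -[X in measurable X]setTI; apply: measurable_lipschitz_map => //.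
  exact: forward_lipschitz.
apply: le_trans (W1_le (lawf _ _ YP) (lawf _ _ YP')) _.
rewrite (integral_supdist_EFin (lawf _ _ YP) (lawf _ _ YP')) (integral_supdist_EFin YP YP').
rewrite -EFinM lee_fin; set m := \int[PP]_w supdist (Y w) (Y' w).
have I := integrable_supdist T0 YP YP'.
apply: le_trans (_ : \int[PP]_w ((1 + expR (lam * T)) * supdist (Y w) (Y' w) +
    expR (lam * T) * m) <= _).
  apply: le_Rintegral => //.
  - exact: (integrable_supdist T0 (lawf _ _ YP) (lawf _ _ YP')).
  - by apply: integrableRD; [exact: integrableRZ|exact: integrableR_cst].
  - move=> w _; apply: le_trans (forward_coupling _ _ YP YP') _.
    by rewrite [(1 + _) * _]mulrDl mul1r [_ * (_ + _)]mulrDr addrA.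
rewrite RintegralD//; [|exact: integrableRZ|exact: integrableR_cst].
by rewrite Rintegral_prob RintegralZl// -/m; lra.
Qed.

(** A coupling of the images is pulled back by [backward P] and [backward P']. The pathwise estimate
    involves the mean distance of the pulled-back paths, so [halving_le] first bounds these means by
    4 m exp (lam s); the pathwise bound 2 (supdist + m) exp (lam T) then integrates to 4 m exp (lam
    T). *)
Lemma Phi_expansive P P' :
  (W1 P P' <= (4 * expR (lam * T))%:E * W1 (Phi P) (Phi P'))%E.
Proof.
apply: W1_scale; first by rewrite mulr_gt0// expR_gt0.
have num1 (s m e eT : R) : 0 <= s -> 0 <= m -> e <= eT ->
    2 * (s + 2 * (2 * m) / 4) * e <= 2 * eT * s + 2 * eT * m by nra.
have num2 (s K e : R) : 2 * (s + K / 4) * e <= 2 * e * s + K / 2 * e by lra.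
have num3 (m K e : R) : 2 * e * m + K / 2 * e <= (2 * m + K / 2) * e by lra.
have num4 (m e : R) : 2 * e * m + 2 * e * m <= 4 * e * m by lra.
move=> dS S PP Y Y' YP YP'.
have mb Q (Z : {mfun S >-> path}) : measurable_fun setT (backward Q \o Z).
  exact: (measurableT_comp (measurable_lipschitz_map (backward_lipschitz Q)) (measurable_funPT Z)).
have lawb Q (Z : {mfun S >-> path}) : has_law PP Z (Phi Q) -> has_law PP (mfun_of (mb Q Z)) Q.
  move=> ZQ A mA; have mbA : measurable (backward Q @^-1` A).
    rewrite -[X in measurable X]setTI; apply: measurable_lipschitz_map => //.
    exact: backward_lipschitz.
  rewrite (ZQ _ mbA) pushE; congr (prob1_law Q _).
  by apply/seteqP; split => x; rewrite /= forwardK.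
have [X XE lX] : exists2 X : {mfun S >-> path}, (forall w, X w = backward P (Y w)) & has_law PP X P.
  by exists (mfun_of (mb P Y)) => //; exact: lawb.
have [X' XE' lX'] : exists2 X : {mfun S >-> path}, (forall w, X w = backward P' (Y' w)) & has_law PP X P'.
  by exists (mfun_of (mb P' Y')) => //; exact: lawb.
move=> {lawb mb}.
apply: le_trans (W1_le lX lX') _.
rewrite (integral_supdist_EFin lX lX') (integral_supdist_EFin YP YP') -EFinM lee_fin.
have [m mE] := opaque_value (\int[PP]_w supdist (Y w) (Y' w)).
rewrite -mE; have m0 : 0 <= m by rewrite mE; apply: Rintegral_ge0 => w _; exact: supdist_ge0.
have I := integrable_supdist T0 YP YP'; have IX := integrable_supdist T0 lX lX'.
have [mX mXE] := opaque_value (\int[PP]_w supdist (X w) (X' w)).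
have mX0 : 0 <= mX by rewrite mXE; apply: Rintegral_ge0 => w _; exact: supdist_ge0.
have Is s : PP.-integrable setT (EFin \o (fun w => enorm (X w s - X' w s))).
  apply: integrableR_le IX _.
    by apply: measurable_enormB; apply: measurable_path_eval; exact: measurable_funPT.
  by move=> w; rewrite ger0_norm ?enorm_ge0// enorm_le_supdist.
have pointwise K : 0 <= K ->
    (forall s, 0 <= s <= T -> \int[PP]_w enorm (X w s - X' w s) <= K * expR (lam * s)) ->
    forall w t, 0 <= t <= T ->
    enorm (X w t - X' w t) <= 2 * (supdist (Y w) (Y' w) + K / 4) * expR (lam * t).
  move=> K0 hK w; apply: (forward_compare (x := X w) (x' := X' w) lX lX') => //.
    exact: supdist_ge0.
  by move=> s _; rewrite XE XE' !backwardK; exact: enorm_le_supdist.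
have hs : forall s, 0 <= s <= T -> \int[PP]_w enorm (X w s - X' w s) <= 2 * (2 * m) * expR (lam * s).
  suff H : forall z : {t : R | 0 <= t <= T}, \int[PP]_w enorm (X w (sval z) - X' w (sval z)) <=
      2 * (2 * m) * expR (lam * sval z).
    by move=> t tT; exact: (H (exist _ t tT)).
  apply: halving_le => [z||| K K0 hK].
  - exact: expR_ge0.
  - by rewrite mulr_ge0.
  - exists mX => // -[t /andP[t0 tT]] /=.
    apply: le_trans (_ : mX <= _); last by rewrite -[leLHS]mulr1 ler_wpM2l// expR_lam_ge1.
    by rewrite mXE; apply: le_Rintegral => // w _; exact: enorm_le_supdist.
  - move=> [t tT] /=.
    have hK' s : 0 <= s <= T -> \int[PP]_w enorm (X w s - X' w s) <= K * expR (lam * s).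
      by move=> sT; exact: (hK (exist _ s sT)).
    apply: le_trans (_ : \int[PP]_w (2 * expR (lam * t) * supdist (Y w) (Y' w) +
        K / 2 * expR (lam * t)) <= _).
      apply: le_Rintegral => //.
        by apply: integrableRD; [exact: integrableRZ|exact: integrableR_cst].
      move=> w _; apply: le_trans (pointwise K K0 hK' w t tT) _.
      exact: num2.
    rewrite RintegralD//; [|exact: integrableRZ|exact: integrableR_cst].
    by rewrite Rintegral_prob RintegralZl// -mE; exact: num3.
have m4 : 0 <= 2 * (2 * m) by rewrite !mulr_ge0.
apply: le_trans (_ : \int[PP]_w (2 * expR (lam * T) * supdist (Y w) (Y' w) +
    2 * expR (lam * T) * m) <= _).
  apply: le_Rintegral => //.
    by apply: integrableRD; [exact: integrableRZ|exact: integrableR_cst].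
  move=> w _; have y0 := supdist_ge0 (Y w) (Y' w); have e0 := expR_ge0 (lam * T).
  apply: supdist_le => [|t tT]; first by rewrite addr_ge0 ?mulr_ge0.
  apply: le_trans (pointwise _ m4 hs w t tT) _.
  have /andP[_ /expR_lam_le e1] := tT.
  exact: num1.
rewrite RintegralD//; [|exact: integrableRZ|exact: integrableR_cst].
by rewrite Rintegral_prob RintegralZl// -mE; exact: num4.
Qed.

(* Picard iteration on the flow maps y |-> X(y) of the McKean-Vlasov equation
   driven by the paths y distributed according to Q. *)
Lemma Phi_surj Q : exists P, forall A, measurable A -> Phi P A = Q A.
Proof.
(* Lipschitz maps carry Q to a law with a finite first moment. One iteration reproduces the
   constant: 1 + (2 / 4) exp (lam t) is at most 2 exp (lam t). *)
pose lip (X : path -> path) := forall z z' t, 0 <= t <= T ->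
  enorm (X z t - X z' t) <= 2 * supdist z z' * expR (lam * t).
have lipP X : lip X -> lipschitz_map X.
  move=> lX; exists (2 * expR (lam * T)) => z z'.
  apply: supdist_le => [|t tT]; first by rewrite !mulr_ge0 ?expR_ge0 ?supdist_ge0.
  apply: le_trans (lX z z' t tT) _; rewrite mulrAC ler_wpM2r ?supdist_ge0// ler_pM2l//.
  by apply: expR_lam_le; case/andP: tT.
pose A := {X : path -> path | lip X}.
pose law (a : A) : prob1 := push (lipP _ (svalP a)) Q.
pose flow (a : A) z := pathD z (pathN (drift (law a) (sval a z))).
have flow_lip a : lip (flow a).
  move=> z z' t tT; have h := svalP a; rewrite /flow !pathDE !pathNE subrB_swap.
  have s0 := supdist_ge0 z z'; have /andP[tp tT'] := tT.
  apply: le_trans (enormD _ _) _; rewrite enormN.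
  apply: le_trans (lerD (enorm_le_supdist z z' t) (drift_same (law a) (x := sval a z)
    (x' := sval a z') (K := 2 * supdist z z') _ tT _)) _.
  - by rewrite mulr_ge0.
  - by move=> s /andP[s0' st]; apply: h; rewrite s0' (le_trans st).
  - have := expR_lam_ge1 tp; set e := expR _; nra.
pose Psi (a : A) : A := exist _ (flow a) (flow_lip a).
have Iw := integrable_supnorm Q.
have [m mE] := opaque_value (\int[Q]_w supnorm w).
have m0 : 0 <= m by rewrite mE; apply: Rintegral_ge0 => w _; exact: supnorm_ge0.
pose w (z : path) : R := 1 + supnorm z.
have w1 z : 1 <= w z by rewrite lerDl supnorm_ge0.
have w0 z : 0 <= w z by rewrite (le_trans _ (w1 z)).
pose c := drift_const d L; have c0 : 0 <= c by exact: drift_const_ge0.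
(* The weight w has mean 1 + m under Q; since w >= 1, this l makes c / l * (w + 1 + m) at most w /
   2. *)
pose l := 2 * c * (2 + m) + 1.
have cm0 : 0 <= 2 * c * (2 + m) by rewrite !mulr_ge0// addr_ge0.
have l0 : 0 < l by rewrite ltr_wpDl.
have num (K y : R) : 0 <= K -> 1 <= y -> c / l * (K * y + K * (1 + m)) <= K / 2 * y.
  move=> K0 y1; rewrite mulrAC ler_pdivrMr//.
  apply: le_trans (_ : c * (K * y * (2 + m)) <= _).
    rewrite ler_wpM2l//; have : 0 <= K * ((y - 1) * (1 + m)) by rewrite !mulr_ge0 ?subr_ge0 ?addr_ge0.
    lra.
  have Ky : 0 <= K * y by rewrite mulr_ge0// (le_trans _ y1).
  rewrite /l; nra.
have contr (a b : A) K : 0 <= K -> wle w l K (sval a) (sval b) ->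
    wle w l (K / 2) (sval (Psi a)) (sval (Psi b)).
  move=> K0 h z t tT; rewrite /= /flow !pathDE !pathNE subrB_swap subrr sub0r enormN.
  pose mf (a : A) := mfun_of (measurable_lipschitz_map (lipP _ (svalP a))).
  have Kw : 0 <= K * w z by rewrite mulr_ge0.
  have Km : 0 <= K * (1 + m) by rewrite mulr_ge0// addr_ge0.
  have la b' : has_law Q (mf b') (law b') by [].
  apply: le_trans (drift_lip T0 L0 gradL (la a) (la b) l0 Kw Km tT _ _) _.
  - by move=> s /andP[s0 st]; apply: h; rewrite s0 (le_trans st)//; case/andP: tT.
  - move=> s /andP[s0 st].
    have sT : 0 <= s <= T by rewrite s0 (le_trans st)//; case/andP: tT.
    have Iww : Q.-integrable setT (EFin \o (fun z => K * expR (l * s) * w z)).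
      by apply: integrableRZ; apply: integrableRD => //; exact: integrableR_cst.
    have -> : K * (1 + m) * expR (l * s) = \int[Q]_z (K * expR (l * s) * w z).
      rewrite RintegralZl//; last by apply: integrableRD => //; exact: integrableR_cst.
      rewrite RintegralD//; last exact: integrableR_cst.
      by rewrite Rintegral_prob -mE mulrAC.
    have hs z' : enorm (mf a z' s - mf b z' s) <= K * expR (l * s) * w z'.
      by apply: le_trans (h z' s sT) _; rewrite mulrAC.
    apply: le_Rintegral => //.
    apply: integrableR_le Iww _.
      by apply: measurable_enormB; apply: measurable_path_eval; exact: measurable_funPT.
    by move=> z'; rewrite ger0_norm ?enorm_ge0.
  - by rewrite ler_wpM2r ?expR_ge0// num.
have lip_id : lip id.
  move=> z z' t /andP[tp tT]; apply: le_trans (enorm_le_supdist z z' t) _.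
  have := expR_lam_ge1 tp; have := supdist_ge0 z z'; set e := expR _; nra.
pose a0 : A := exist _ id lip_id.
(* The first correction at z is the drift along z: its size at the zero path plus, by the Lipschitz
   estimate, a multiple of supnorm z. *)
pose K0 := supnorm (drift (law a0) (path0 d T)) + expR (lam * T).
have K00 : 0 <= K0 by rewrite addr_ge0 ?supnorm_ge0 ?expR_ge0.
have [||b hb] := @picard _ _ _ path A (fun a => sval a) w l Psi w0 l0 contr _ a0 K0 K00.
- move=> a x ax; suff lx : lip x by exists (exist _ x lx).
  move=> z z' t tT; apply/ler_addgt0Pr => e e0.
  have e20 : 0 < e / 2 by rewrite divr_gt0.
  have [n [h1 h2]] := @filter_ex _ \oo _ _ (filterI (ax z _ e20) (ax z' _ e20)).
  have h := svalP (a n) z z' t tT.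
  apply: le_trans (enorm_triangle (sval (a n) z t) _ _) _.
  apply: le_trans (lerD (lexx _) (enorm_triangle (sval (a n) z' t) _ _)) _.
  rewrite enormB; have := le_trans (enorm_le_supdist _ _ t) h1.
  have := le_trans (enorm_le_supdist _ _ t) h2; lra.
- move=> z t tT; rewrite /= /flow pathDE pathNE addrC addKr enormN /=.
  have /andP[tp tT'] := tT.
  apply: le_trans (_ : K0 * w z <= _); last first.
    rewrite -[leLHS]mulr1 ler_wpM2l ?mulr_ge0// -[leLHS]expR0 ler_expR mulr_ge0//.
    exact: ltW.
  apply: le_trans (_ : supnorm (drift (law a0) (path0 d T)) + supnorm z / 4 * expR (lam * t) <= _).
    rewrite -[X in enorm X](subrK (drift (law a0) (path0 d T) t)) addrC.
    apply: le_trans (enormD _ _) _; apply: lerD; first exact: enorm_le_supnorm.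
    apply: drift_same => // [|s /andP[s0 _]]; first exact: supnorm_ge0.
    apply: le_trans (enorm_le_supdist _ _ _) _; rewrite supdistx0.
    by rewrite ler_peMr ?supnorm_ge0// expR_lam_ge1.
  have := expR_lam_le tT'; have := expR_ge0 (lam * t).
  have := supnorm_ge0 z; have := supnorm_ge0 (drift (law a0) (path0 d T)).
  rewrite /K0 /w; set e := expR _; set e' := expR _; set D := supnorm _; nra.
exists (law b) => A' mA'.
rewrite pushE pushE; congr (prob1_law Q _).
apply/seteqP; split => z /=.
  suff -> : forward (law b) (sval b z) = z by [].
  by apply: path_eq => t tT; rewrite /forward pathDE -{1}(hb z) /= /flow pathDE pathNE subrK.
suff -> : forward (law b) (sval b z) = z by [].
by apply: path_eq => t tT; rewrite /forward pathDE -{1}(hb z) /= /flow pathDE pathNE subrK.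
Qed.

End flow.

(** Dynkin's argument for finite measures; the total masses are compared separately because the
    whole space may lie outside G. *)
Lemma measure_eq_g_sigma d (E : measurableType d) (R : realType)
    (m1 m2 : {measure set E -> \bar R}) (G : set (set E)) :
  G `<=` measurable -> setI_closed G -> m1 setT = m2 setT -> (m1 setT < +oo)%E ->
  (forall A, G A -> m1 A = m2 A) ->
  forall A, <<s G >> A -> m1 A = m2 A.
Proof.
move=> Gm GI mT moo mG.
have fin (m : {measure set E -> \bar R}) : (m setT < +oo)%E -> forall A, measurable A -> (m A < +oo)%E.
  by move=> mT' A mA; apply: le_lt_trans mT'; apply: le_measure; rewrite ?inE//; exact: measurableT.
have m2oo : (m2 setT < +oo)%E by rewrite -mT.
have : <<s G >> `<=` [set A | measurable A /\ m1 A = m2 A].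
  apply: lambda_system_subset; [by []| | |by []].
  - apply/dynkin_lambda_system; split => //.
    + move=> A [mA mE]; split; first exact: measurableC.
      by rewrite -setTD !measureD ?setTI//; congr (_ - _)%E.
    + move=> F tF mF; have mF' i : measurable (F i) by have [] := mF i.
      split; first exact: bigcup_measurable.
      rewrite !measure_semi_bigcup//.
      * by apply: eq_eseriesr => i _; have [] := mF i.
      * exact: bigcup_measurable.
      * exact: bigcup_measurable.
  - by move=> A GA; split; [exact: Gm|exact: mG].
by move=> H A /H[].
Qed.

(** * The law of the noise *)

Section independence.
Context (R : realType) dS (S : measurableType dS) (PP : probability S R).

(** Generators are replaced by sigma-algebras one index at a time: with the other events fixed, both
    sides are finite measures in the event of index i0 that agree on the pi-system F i0. *)
Lemma indep_g_sigma (I : finType) (F : I -> set (set S)) :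
  (forall i, F i `<=` measurable) -> (forall i, setI_closed (F i)) ->
  (forall i, F i setT) ->
  (forall A : I -> set S, (forall i, F i (A i)) ->
    PP [set w | forall i, A i w] = (\prod_i PP (A i))%E) ->
  forall A : I -> set S, (forall i, <<s F i >> (A i)) ->
    PP [set w | forall i, A i w] = (\prod_i PP (A i))%E.
Proof.
move=> Fm FI FT F0 A sA.
have sFm i : <<s F i >> `<=` measurable.
  by apply: smallest_sub (Fm i); exact: sigma_algebra_measurable.
suff H : forall (s : seq I) (A : I -> set S),
    (forall i, if i \in s then <<s F i >> (A i) else F i (A i)) ->
    PP [set w | forall i, A i w] = (\prod_i PP (A i))%E.
  by apply: (H (enum I)) => i; rewrite mem_enum; exact: sA.
elim => {A sA} [|i0 s IH] A sA; first by apply: F0 => i; exact: sA.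
have sA' i : <<s F i >> (A i).
  by have := sA i; case: ifP => // _; exact: sub_sigma_algebra.
have mA i : measurable (A i) by exact: sFm.
pose C := [set w | forall i, i != i0 -> A i w].
have mC : measurable C.
  have -> : C = [set w | forall i, (if i != i0 then A i else setT) w].
    apply/seteqP; split => w /= h i; first by case: ifP => // /h.
    by move=> ii0; have := h i; rewrite ii0.
  by apply: measurable_forall => i; case: ifP.
pose c := \prod_(i | i != i0) fine (PP (A i)).
have c0 : 0 <= c by apply: prodr_ge0 => i _; exact: fine_ge0.
have cE : (\prod_(i | i != i0) PP (A i) = c%:E)%E.
  rewrite -prodEFin; apply: eq_bigr => i _; rewrite fineK// fin_num_measure//.
have CE D : D `&` C = [set w | forall i, (if i == i0 then D else A i) w].
  apply/seteqP; split => w /=.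
    by move=> [Dw Cw] i; case: ifPn => // /Cw.
  move=> h; split; first by have := h i0; rewrite eqxx.
  by move=> i /negbTE ii0; have := h i; rewrite ii0.
pose m1 : {measure set S -> \bar R} := mrestr PP mC.
pose m2 : {measure set S -> \bar R} := mscale (NngNum c0) PP.
have agree D : F i0 D -> m1 D = m2 D.
  move=> FD; rewrite /m1 /m2 /= /mrestr /mscale /= CE IH.
    rewrite (bigD1 i0)//= eqxx -cE muleC; congr (_ * _)%E.
    by apply: eq_bigr => i /negbTE ->.
  move=> i; have [->|ii0] := eqVneq i i0.
    by case: ifP => // _; exact: sub_sigma_algebra.
  by have := sA i; rewrite inE (negbTE ii0).
have : m1 (A i0) = m2 (A i0).
  apply: (measure_eq_g_sigma (Fm i0) (FI i0)) => //.
  - exact: agree.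
  - by rewrite /m1 /= /mrestr setTI (le_lt_trans (probability_le1 _ _))// ltry.
rewrite /m1 /m2 /= /mrestr /mscale /= CE.
rewrite (_ : [set w | _] = [set w | forall i, A i w]); last first.
  by apply/seteqP; split => w /= h i; have := h i; case: eqP => // ->.
by move=> ->; rewrite -cE [RHS](bigD1 i0)//= muleC.
Qed.

End independence.

(** * Noise paths and uniqueness of their law *)

Section start_path.
Context (R : realType) (d : nat) (T : R).
Hypothesis T0 : 0 < T.
Local Notation path := (cpath d T).

Lemma start_path_subproof (v : 'rV[R]_d) (x : path) :
  {y : path | forall t, 0 <= t <= T -> y t = v + (x t - x 0)}.
Proof.
have c : {within `[0, T], continuous (fun t => v + (x t - x 0))}.
  apply/within_enormP => t tT e e0; have [r r0 hr] := path_cts x tT e0.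
  exists r => // s sT sr.
  by rewrite opprD addrACA subrr add0r opprB addrA subrK; exact: hr.
by exists (mkpath c) => t; exact: mkpathE.
Qed.

(** [x 0] is subtracted because a Brownian motion starts at 0 only almost surely; the resulting path
    starts at v without exception. *)
Definition start_path v x : path := sval (start_path_subproof v x).

Lemma start_pathE v x t : 0 <= t <= T -> start_path v x t = v + (x t - x 0).
Proof. exact: (svalP (start_path_subproof v x)). Qed.

Lemma itv0T : 0 <= (0 : R) <= T. Proof. by rewrite lexx ltW. Qed.

Lemma start_path0 v x : start_path v x 0 = v.
Proof. by rewrite start_pathE ?itv0T// subrr addr0. Qed.

(** Stated for any sigma-algebra on S and for each time separately, so as to apply to generated
    sigma-algebras in the proofs of independence and adaptedness. *)
Lemma measurable_start_path dS (S : measurableType dS) (Z : S -> 'rV[R]_d) (B : S -> path) :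
  measurable_fun setT Z ->
  (forall t, 0 <= t <= T -> measurable_fun setT (fun w => B w t)) ->
  measurable_fun setT (fun w => start_path (Z w) (B w)).
Proof.
move=> mZ mB; apply: (measurable_pathP T0) => n k kn.
have kT := grid_itv T0 kn.
apply/measurable_rVP => i.
have -> : (fun w => start_path (Z w) (B w) (grid T n k) ord0 i) =
    (fun w => Z w ord0 i + (B w (grid T n k) ord0 i - B w 0 ord0 i)).
  by apply/funext => w; rewrite start_pathE// !mxE.
apply: measurable_funD; first by move/measurable_rVP : mZ.
apply: measurable_funB.
  by move/measurable_rVP : (mB _ kT); exact.
by move/measurable_rVP : (mB _ itv0T); exact.
Qed.

End start_path.

Section initialised_brownian_motion.
Context (R : realType) (d : nat) (T : R).
Hypothesis T0 : 0 < T.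
Variable muin : probability 'rV[R]_d R.
Local Notation path := (cpath d T).

Definition initialised_bm dS (S : measurableType dS) (PP : probability S R)
    (Z : S -> 'rV[R]_d) (B : {mfun S >-> path}) : Prop :=
  [/\ measurable_fun setT Z, has_law PP Z muin, brownian_motion PP B &
    forall A C, measurable A -> measurable C ->
      PP (Z @^-1` A `&` B @^-1` C) = (PP (Z @^-1` A) * PP (B @^-1` C))%E].

(** Start and increments of one level are independent under the noise, so these events have explicit
    product probabilities. *)
Definition incr_box n (A0 : set 'rV[R]_d) (A : 'I_(4 ^ n) -> 'I_d -> set R) : set path :=
  [set x | A0 (x 0) /\ forall k i, A k i ((x (grid T n k.+1) - x (grid T n k)) ord0 i)].

Lemma grid0 n : grid T n 0 = 0.
Proof. by rewrite /grid mul0r. Qed.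

Lemma measurable_increment n k i : measurable_fun setT
  (fun x : path => (x (grid T n k.+1) - x (grid T n k)) ord0 i).
Proof.
have h j : measurable_fun setT (fun x : path => x (grid T n j) ord0 i).
  have := @measurable_at_time R d T (grid T n j).
  by move/measurable_rVP; apply.
rewrite (_ : (fun x => _) = (fun x : path => x (grid T n k.+1) ord0 i - x (grid T n k) ord0 i)).
  exact: measurable_funB.
by apply/funext => x; rewrite !mxE.
Qed.

Lemma measurable_incr_box n A0 A : measurable A0 -> (forall k i, measurable (A k i)) ->
  measurable (@incr_box n A0 A).
Proof.
move=> mA0 mA; apply: measurableI.
  rewrite -[X in measurable X]setTI; exact: (@measurable_at_time R d T 0).
apply: measurable_forall => k; apply: measurable_forall => i.
rewrite -[X in measurable X]setTI; exact: measurable_increment.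
Qed.

Section law_of_boxes.
Context dS (S : measurableType dS) (PP : probability S R).
Variables (Z : S -> 'rV[R]_d) (B : {mfun S >-> path}).
Hypothesis ZB : initialised_bm PP Z B.

Definition noise_path w : path := start_path (Z w) (B w).

Lemma measurable_noise_path : measurable_fun setT noise_path.
Proof.
have [mZ _ _ _] := ZB; apply: measurable_start_path => // t _.
by apply: measurable_path_eval; exact: measurable_funPT.
Qed.

Lemma noise_path_box n A0 A : measurable A0 -> (forall k i, measurable (A k i)) ->
  PP (noise_path @^-1` @incr_box n A0 A) =
  (muin A0 * \prod_k \prod_i normal_prob 0 (Num.sqrt (mesh T n)) (A k i))%E.
Proof.
move=> mA0 mA; have [mZ Zmu [_ Bnormal Bindep] ZBindep] := ZB.
pose C : set path := [set x : path | forall (k : 'I_(4 ^ n)) i,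
  A k i ((x (grid T n k.+1) - x (grid T n k)) ord0 i)].
have mC : measurable C.
  apply: measurable_forall => k; apply: measurable_forall => i.
  rewrite -[X in measurable X]setTI; exact: measurable_increment.
have -> : noise_path @^-1` @incr_box n A0 A = Z @^-1` A0 `&` B @^-1` C.
  have E w (k : 'I_(4 ^ n)) : noise_path w (grid T n k.+1) - noise_path w (grid T n k) =
      B w (grid T n k.+1) - B w (grid T n k).
    rewrite /noise_path !start_pathE; last 2 first.
    - by apply: grid_itv => //; exact: ltnW.
    - by apply: grid_itv.
    by rewrite opprD addrACA subrr add0r opprB addrA subrK.
  have E0 w : noise_path w 0 = Z w by exact: start_path0.
  apply/seteqP; split => w [h1 h2].
    by split => [|k i]; [rewrite /= -E0|rewrite -E; exact: h2].
  by split => [|k i]; [rewrite E0|rewrite E; exact: h2].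
rewrite ZBindep// Zmu//; congr (_ * _)%E.
have -> : B @^-1` C = \bigcap_(k in [set` [set: 'I_(4 ^ n)]%SET])
    [set w | forall i, A k i ((B w (grid T n k.+1) - B w (grid T n k)) ord0 i)].
  by apply/seteqP; split => w /= h k; [move=> _ i; exact: h|exact: (h k (finset.in_setT k))].
have gmono : {homo grid T n : i j / (i <= j)%N >-> i <= j}.
  by move=> i j ij; rewrite ler_grid.
rewrite (Bindep _ _ gmono).
- apply: eq_big => [k|k _]; first by rewrite inE.
  have g0 : 0 <= grid T n k by exact: grid_ge0.
  have g1 : grid T n k < grid T n k.+1 by rewrite ltr_grid.
  have g2 : grid T n k.+1 <= T by have /andP[] := grid_itv T0 (ltn_ord k : (k.+1 <= _)%N).
  by have := Bnormal _ _ g0 g1 g2 (A k) (mA k); rewrite grid_diff => ->.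
- by rewrite grid0.
- by rewrite grid_end.
- move=> k _; exists [set v : 'rV[R]_d | forall i, A k i (v ord0 i)].
    apply: measurable_forall => i; rewrite -[X in measurable X]setTI.
    have mid : measurable_fun setT (fun v : 'rV[R]_d => v) by exact: measurable_id.
    by move/measurable_rVP : mid; apply.
  by rewrite setTI.
Qed.

End law_of_boxes.

Definition boxes n : set (set path) := [set U | exists A0 A,
  [/\ measurable A0, forall k i, measurable (A k i) & U = @incr_box n A0 A]].

Lemma boxesI n : setI_closed (boxes n).
Proof.
move=> _ _ [A0 [A [mA0 mA ->]]] [A0' [A' [mA0' mA' ->]]].
exists (A0 `&` A0'), (fun k i => A k i `&` A' k i); split.
- exact: measurableI.
- by move=> k i; exact: measurableI.
- apply/seteqP; split => x.
    by move=> [[x0 hx] [x0' hx']]; split => // k i; split.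
  by move=> [[x0 x0'] h]; split; split => // k i; have [] := h k i.
Qed.

Lemma boxes_grid n k : (k <= 4 ^ n)%N ->
  measurable_fun [set: g_sigma_algebraType (boxes n)] (fun x : path => x (grid T n k)).
Proof.
elim: k => [_|k IH kn].
  rewrite grid0 => _ A mA; rewrite setTI; apply: sub_sigma_algebra.
  exists A, (fun _ _ => setT); split => //.
  by apply/seteqP; split => x //= [].
have {}IH := IH (ltnW kn).
apply/measurable_rVP => i.
rewrite (_ : (fun x => _) = (fun x : path => x (grid T n k) ord0 i +
    (x (grid T n k.+1) - x (grid T n k)) ord0 i)); last first.
  by apply/funext => x; rewrite !mxE [RHS]addrC subrK.
apply: measurable_funD; first by move/measurable_rVP : IH.
move=> _ A mA; rewrite setTI; apply: sub_sigma_algebra.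
exists setT, (fun k' i' => if (k' == Ordinal kn) && (i' == i) then A else setT); split => //.
  by move=> k' i'; case: ifP.
apply/seteqP; split => x /=.
  by move=> xA; split => // k' i'; case: ifP => // /andP[/eqP -> /eqP ->].
by move=> [_ /(_ (Ordinal kn) i)]; rewrite !eqxx.
Qed.

Lemma boxes_sub n : boxes n `<=` <<s boxes n.+1 >>.
Proof.
have ev k : (k <= 4 ^ n)%N -> measurable_fun [set: g_sigma_algebraType (boxes n.+1)]
    (fun x : path => x (grid T n k)).
  by move=> kn; rewrite gridS; apply: boxes_grid; rewrite expnS leq_mul2l.
move=> _ [A0 [A [mA0 mA ->]]].
suff : @measurable _ (g_sigma_algebraType (boxes n.+1)) (incr_box A0 A) by [].
apply: measurableI.
  rewrite -[X in measurable X]setTI; have := ev 0 (leq0n _).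
  by rewrite grid0; apply.
apply: measurable_forall => k; apply: measurable_forall => i.
have mi : measurable_fun [set: g_sigma_algebraType (boxes n.+1)]
    (fun x : path => x (grid T n k.+1) ord0 i - x (grid T n k) ord0 i).
  apply: measurable_funB.
    by move/measurable_rVP : (ev k.+1 (ltn_ord k)); apply.
  by move/measurable_rVP : (ev k (ltnW (ltn_ord k))); apply.
rewrite (_ : (fun x => _) = (fun x : path => x (grid T n k.+1) ord0 i - x (grid T n k) ord0 i) @^-1` A k i).
  by rewrite -[X in measurable X]setTI; exact: mi.
by apply/funext => x; rewrite /= !mxE.
Qed.

Lemma g_boxes_mono n m : (n <= m)%N -> <<s boxes n >> `<=` <<s boxes m >>.
Proof.
elim: m => [|m IH]; first by rewrite leqn0 => /eqP ->.
rewrite leq_eqVlt => /predU1P[->//|]; rewrite ltnS => /IH h.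
apply: subset_trans h _; apply: smallest_sub; last exact: boxes_sub.
exact: smallest_sigma_algebra.
Qed.

(** The sigma-algebras of the levels increase, so their union is a pi-system; it generates the Borel
    sets by [measurable_pathP]. *)
Definition all_boxes : set (set path) := [set A | exists n, <<s boxes n >> A].

Lemma all_boxesI : setI_closed all_boxes.
Proof.
move=> A B [n An] [m Bm]; exists (maxn n m).
have h1 := g_boxes_mono (leq_maxl n m) An; have h2 := g_boxes_mono (leq_maxr n m) Bm.
exact: (@measurableI _ (g_sigma_algebraType (boxes (maxn n m)))).
Qed.

Lemma boxes_measurable n : boxes n `<=` measurable.
Proof. by move=> _ [A0 [A [mA0 mA ->]]]; exact: measurable_incr_box. Qed.

Lemma all_boxes_measurable : all_boxes `<=` measurable.
Proof.
move=> A [n]; apply: smallest_sub A; last exact: boxes_measurable.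
exact: sigma_algebra_measurable.
Qed.

Lemma measurable_all_boxes (A : set path) : measurable A -> <<s all_boxes >> A.
Proof.
have mid : measurable_fun [set: g_sigma_algebraType all_boxes] (id : path -> path).
  apply: (measurable_pathP T0) => n k kn _ B mB.
  apply: sub_sigma_algebra; exists n.
  exact: (boxes_grid kn measurableT mB).
by move=> mA; have := mid measurableT A mA; rewrite setTI.
Qed.

(** Two pi-system arguments: boxes determine the law on each level, and the union of the levels
    determines it on Borel sets. All noises on all probability spaces thus share one law. *)
Lemma noise_path_law dS (S : measurableType dS) (PP : probability S R)
    (Z : S -> 'rV[R]_d) (B : {mfun S >-> path})
    dS' (S' : measurableType dS') (PP' : probability S' R)
    (Z' : S' -> 'rV[R]_d) (B' : {mfun S' >-> path}) (A : set path) :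
  initialised_bm PP Z B -> initialised_bm PP' Z' B' -> measurable A ->
  PP (noise_path Z B @^-1` A) = PP' (noise_path Z' B' @^-1` A).
Proof.
move=> ZB ZB' mA.
pose m1 := distribution PP (mfun_of (measurable_noise_path ZB)).
pose m2 := distribution PP' (mfun_of (measurable_noise_path ZB')).
suff : m1 A = m2 A by [].
have fin : (m1 setT < +oo)%E by rewrite /m1 probability_setT ltry.
have eqT : m1 setT = m2 setT by rewrite /m1 /m2 !probability_setT.
apply: (measure_eq_g_sigma all_boxes_measurable all_boxesI eqT fin).
  move=> U [n]; apply: (measure_eq_g_sigma (@boxes_measurable n) (@boxesI n) eqT fin).
  move=> _ [A0 [A' [mA0 mA' ->]]].
  rewrite /m1 /m2 /= /distribution /pushforward.
  by rewrite (noise_path_box ZB mA0 mA') (noise_path_box ZB' mA0 mA').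
exact: measurable_all_boxes.
Qed.

End initialised_brownian_motion.

Lemma ae_eq_preimage (R : realType) dS (S : measurableType dS) (PP : probability S R)
    (U V : set S) : measurable U -> measurable V ->
  {ae PP, forall w, U w <-> V w} -> PP U = PP V.
Proof.
have H (A B : set S) : measurable A -> measurable B ->
    {ae PP, forall w, A w <-> B w} -> (PP A <= PP B)%E.
  move=> mA mB [N [mN N0 AB]].
  apply: (@le_trans _ _ (PP (B `|` N))).
    apply: le_measure; rewrite ?inE//; first exact: measurableU.
    move=> w Aw; have [h|h] := pselect (A w <-> B w); first by left; apply/h.
    by right; apply: AB.
  by apply: le_trans (measureU2 _ mB mN) _; rewrite [X in (_ + X)%E]N0 adde0.
move=> mU mV h; apply/eqP; rewrite eq_le; apply/andP; split; apply: H => //.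
by apply: filterS h => w [].
Qed.

Lemma independent_pair (R : realType) dS (S : measurableType dS) (PP : probability S R)
    (F : bool -> set (set S)) :
  (forall A, F true (A true) -> F false (A false) ->
    PP (A true `&` A false) = (PP (A true) * PP (A false))%E) ->
  mutually_independent PP F.
Proof.
move=> H J A FA; rewrite big_mkcond big_bool/=.
have -> : \bigcap_(b in [set` J]) A b =
    (if true \in J then A true else setT) `&` (if false \in J then A false else setT).
  apply/seteqP; split => w /=.
    by move=> h; split; case: ifP => // bJ; exact: h.
  by move=> [h1 h2] [] /= bJ; [move: h1|move: h2]; rewrite bJ.
case: ifP => h1; case: ifP => h2.
- by apply: H; exact: FA.
- by rewrite setIT mule1.
- by rewrite setTI mul1e.
- by rewrite setTI probability_setT mule1.
Qed.

Section particle_noise.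
Context (R : realType) (d : nat) (T : R).
Hypothesis T0 : 0 < T.
Local Notation path := (cpath d T).
Variables (W : 'rV[R]_d -> R) (muin : probability 'rV[R]_d R).
Context dS (S : measurableType dS) (PP : probability S R) (n : nat).
Variables (B X : 'I_n.+1 -> {mfun S >-> path}).
Hypothesis PS : particle_system W PP muin B X.

Lemma particle_bm i : initialised_bm muin PP (fun w => X i w 0) (B i).
Proof.
have [hB hind hX _] := PS; split => //.
  by apply: measurable_path_eval; exact: measurable_funPT.
move=> A C mA mC.
pose D (k : 'I_n.+1 + 'I_n.+1) : set S :=
  match k with inl _ => (fun w => X i w 0) @^-1` A | inr _ => B i @^-1` C end.
have := hind [set inl i; inr i]%SET D; rewrite big_setU1/=; last by rewrite inE.
rewrite big_set1 => <-.
- congr (PP _); apply/seteqP; split => w /=.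
    by move=> [h1 h2] k; rewrite /= !inE => /orP[] /eqP ->.
  by move=> h; split; [apply: (h (inl i))|apply: (h (inr i))]; rewrite /= !inE eqxx ?orbT.
- move=> k; rewrite !inE => /orP[] /eqP -> /=.
    by exists A => //; rewrite setTI.
  by exists C => //; rewrite setTI.
Qed.

Definition particle_noise i : {mfun S >-> path} :=
  mfun_of (measurable_noise_path T0 (particle_bm i)).

(** Independence is assumed between all starts and all Brownian motions; for each particle,
    intersections of one event of each kind form a pi-system generating what its noise depends
    on. *)
Lemma particle_noise_indep (A : 'I_n.+1 -> set path) : (forall i, measurable (A i)) ->
  PP [set w | forall i, A i (particle_noise i w)] =
  (\prod_i PP (particle_noise i @^-1` A i))%E.
Proof.
move=> mA; have [hB hind hX _] := PS.
pose F i : set (set S) := [set U | exists C D, [/\ measurable C, measurable D &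
  U = (fun w => X i w 0) @^-1` C `&` B i @^-1` D]].
have mX i : measurable_fun setT (fun w => X i w 0).
  by apply: measurable_path_eval; exact: measurable_funPT.
apply: (indep_g_sigma (F := F) _ _ _ _ (A := fun i => particle_noise i @^-1` A i)).
- move=> i _ [C [D [mC mD ->]]]; apply: measurableI.
    by rewrite -[X in measurable X]setTI; exact: mX.
  by rewrite -[X in measurable X]setTI; exact: (measurable_funPT (B i)).
- move=> i _ _ [C [D [mC mD ->]]] [C' [D' [mC' mD' ->]]].
  exists (C `&` C'), (D `&` D'); split; [exact: measurableI|exact: measurableI|].
  by rewrite !preimage_setI setIACA.
- by move=> i; exists setT, setT; split => //; rewrite !preimage_setT setTI.
- move=> U FU.
  have [C hC] := choice FU; have [D hD] := choice hC.
  have mC i : measurable (C i) by have [] := hD i.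
  have mD i : measurable (D i) by have [] := hD i.
  have UE i : U i = (fun w => X i w 0) @^-1` C i `&` B i @^-1` D i by have [] := hD i.
  pose V (k : 'I_n.+1 + 'I_n.+1) : set S := match k with
    | inl i => (fun w => X i w 0) @^-1` C i | inr i => B i @^-1` D i end.
  have := hind finset.setT V.
  rewrite (_ : \bigcap_(i in _) _ = [set w | forall i, U i w]); last first.
    apply/seteqP; split => w /= h.
      move=> i; rewrite UE; split; [apply: (h (inl i))|apply: (h (inr i))];
        exact: finset.in_setT.
    by move=> [i|i] _ /=; have := h i; rewrite UE => -[].
  move=> ->; last first.
    move=> [i|i] _ /=; first by exists (C i) => //; rewrite setTI.
    by exists (D i) => //; rewrite setTI.
  rewrite (eq_bigl xpredT); last by move=> k; rewrite finset.in_setT.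
  rewrite big_sumType/= -big_split/=; apply: eq_bigr => i _.
  by rewrite UE; have [_ _ _ ->] := particle_bm i.
- move=> i.
  suff : measurable_fun [set: g_sigma_algebraType (F i)]
      (noise_path (fun w => X i w 0) (B i)).
    by move=> /(_ measurableT _ (mA i)); rewrite setTI.
  apply: (measurable_start_path T0 (S := g_sigma_algebraType (F i))).
    move=> _ C mC; rewrite setTI; apply: sub_sigma_algebra.
    by exists C, setT; split => //; rewrite preimage_setT setIT.
  move=> t _ _ C mC; rewrite setTI; apply: sub_sigma_algebra.
  exists setT, (at_time t @^-1` C); split => //; last by rewrite preimage_setT setTI.
  by rewrite -[X in measurable X]setTI; exact: measurable_at_time.
Qed.

End particle_noise.

(** * Strong solutions of the nonlinear equation *)

Section nonlinear_sde.
Context (R : realType) (d : nat) (T : R).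
Hypothesis T0 : 0 < T.
Variables (W : 'rV[R]_d -> R) (L : R).
Hypothesis L0 : 0 <= L.
Hypothesis gradL : forall x y, enorm (grad W x - grad W y) <= L * enorm (x - y).
Variable muin : probability 'rV[R]_d R.
Local Notation path := (cpath d T).
Local Notation prob1 := (prob1 d T).
Local Notation drift := (drift T0 L0 gradL).
Local Notation forward := (forward T0 L0 gradL).
Local Notation backward := (backward T0 L0 gradL).

Lemma drift0 P x : drift P x 0 = 0.
Proof.
rewrite driftE ?itv0T//; apply/rowP => i; rewrite !mxE /tint.
by rewrite set_itv1 Rintegral_set1.
Qed.

Lemma backward0 P y : backward P y 0 = y 0.
Proof.
by rewrite -[in RHS](backwardK T0 L0 gradL P y) forwardE pathDE drift0 addr0.
Qed.

Lemma sde_integralE (P : prob1) (x : path) t : 0 <= t <= T ->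
  \row_i (\int[lebesgue_measure]_(s in `[0%R, t])
     ((- conv_grad W (marginal P s) (x s)) ord0 i))%R = - drift P x t.
Proof.
move=> tT; rewrite driftE//; apply/rowP => i; rewrite !mxE.
have c := @mean_drift_tcts _ _ _ T0 _ _ L0 gradL P x i.
rewrite -(tintN c); last by case/andP: tT.
by apply: eq_Rintegral => s _; rewrite [LHS]mxE.
Qed.

Lemma stop_subproof (t : R) (x : path) : 0 <= t <= T ->
  {y : path | forall s, 0 <= s <= T -> y s = x (Num.min s t)}.
Proof.
move=> /andP[t0 tT].
have mT s : 0 <= s <= T -> 0 <= Num.min s t <= T.
  by move=> /andP[s0 sT]; rewrite le_min s0 t0 ge_min sT.
have c : {within `[0, T], continuous (fun s => x (Num.min s t))}.
  apply/within_enormP => s sT e e0; have [r r0 hr] := path_cts x (mT _ sT) e0.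
  exists r => // u uT us; apply: hr; first exact: mT.
  apply: le_lt_trans us; rewrite ler_norml; apply/andP.
  have := ler_norm (u - s); have := ler_norm (s - u); rewrite distrC => h1 h2.
  by case: (leP u t) => h3; case: (leP s t) => h4; split; lra.
by exists (mkpath c) => s; exact: mkpathE.
Qed.

Section existence.
Context dS (S : measurableType dS) (PP : probability S R).
Variables (Z : S -> 'rV[R]_d) (B : {mfun S >-> path}).
Hypothesis ZB : initialised_bm muin PP Z B.
Variable P : prob1.

Lemma measurable_solution : measurable_fun setT (backward P \o noise_path Z B).
Proof.
exact: (measurableT_comp (measurable_lipschitz_map (backward_lipschitz T0 L0 gradL P))
  (measurable_noise_path T0 ZB)).
Qed.

Definition solution : {mfun S >-> path} := mfun_of measurable_solution.

Lemma solution0 w : solution w 0 = Z w.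
Proof. by rewrite /= backward0 /noise_path start_path0. Qed.

(** By [forward_inj] up to time t, stopping the Brownian path at t does not change the solution at
    t, and the stopped path is measurable for the past. The event itself serves as C, with an empty
    exceptional set. *)
Lemma solution_adapted : strongly_adapted PP B solution.
Proof.
move=> t tT A mA; exists [set w | A (solution w t)]; last first.
  by rewrite setYK; exact: negligible_set0.
set F := _ `|` _.
suff mF : measurable_fun [set: g_sigma_algebraType F] (fun w => solution w t).
  by have := mF measurableT A mA; rewrite setTI.
pose stop x := sval (stop_subproof x tT).
have stopE x s : 0 <= s <= T -> stop x s = x (Num.min s t).
  by move=> sT; exact: (svalP (stop_subproof x tT) s sT).
pose Yt w := start_path (Z w) (stop (B w)).
have /andP[t0 tT'] := tT.
have E w : solution w t = backward P (Yt w) t.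
  apply: (@forward_inj _ _ _ T0 _ _ L0 gradL P _ _ t) => //; last by rewrite t0 lexx.
  move=> s /andP[s0 st]; rewrite /= !backwardK.
  have sT : 0 <= s <= T by rewrite s0 (le_trans st).
  rewrite /noise_path /Yt !start_pathE// !stopE ?itv0T//.
  by rewrite !min_l.
rewrite (_ : (fun w => _) = at_time t \o (backward P \o Yt)); last first.
  by apply/funext => w; rewrite E.
apply: measurableT_comp; first exact: measurable_at_time.
apply: measurableT_comp.
  exact: (measurable_lipschitz_map (backward_lipschitz T0 L0 gradL P)).
apply: (measurable_start_path T0 (S := g_sigma_algebraType F)).
  move=> _ C mC; rewrite setTI; apply: sub_sigma_algebra; left; exists C => //.
  by rewrite setTI; apply/funext => w; rewrite /= backward0 /noise_path start_path0.
move=> s sT.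
rewrite (_ : (fun w => _) = (fun w => B w (Num.min s t))); last first.
  by apply/funext => w; rewrite stopE.
move=> _ C mC; rewrite setTI; apply: sub_sigma_algebra; right.
exists (Num.min s t).
  by rewrite /= in_itv/= le_min t0 ge_min lexx orbT andbT; case/andP: sT => ->.
by exists C => //; rewrite setTI.
Qed.

Lemma solution_sde :
  solves_sde PP (fun t w => - conv_grad W (marginal P t) (solution w t)) B solution.
Proof.
have [_ _ [B0 _ _] _] := ZB; apply: filterS B0 => w Bw0 t tT.
rewrite sde_integralE// solution0.
have := congr1 (fun x : path => x t) (backwardK T0 L0 gradL P (noise_path Z B w)).
rewrite forwardE pathDE /noise_path start_pathE// Bw0 subr0.
by move=> /(canRL (addrK _)) ->; rewrite addrAC.
Qed.

Lemma solution_law_of : law_of_nonlinear_sde W muin P (distribution PP solution).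
Proof.
have [mZ Zlaw Bbm ZBind] := ZB.
have sol0 : (fun w => solution w 0) = Z by apply/funext => w; exact: solution0.
exists dS, S, PP, B, solution; split => //.
- apply: independent_pair => A; rewrite sol0 => -[U mU <-] [V mV <-].
  by rewrite !setTI; exact: ZBind.
- by rewrite sol0.
- by split; [exact: solution_sde|exact: solution_adapted].
Qed.

(** Along any solution [forward P] of the path is almost surely the noise, so the path is
    [backward P] of a noise whose law is the same on all probability spaces. *)
Lemma law_of_unique (Q : probability path R) (A : set path) :
  law_of_nonlinear_sde W muin P Q -> measurable A -> Q A = PP (solution @^-1` A).
Proof.
move=> [dS' [S' [PP' [B' [Z' [Bbm ind Zlaw [sde _] ZQ]]]]]] mA.
have mZ0 : measurable_fun setT (fun w => Z' w 0).
  by apply: measurable_path_eval; exact: measurable_funPT.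
have ZB' : initialised_bm muin PP' (fun w => Z' w 0) B'.
  split => // U V mU mV.
  have := ind finset.setT (fun b : bool => if b then (fun w => Z' w 0) @^-1` U else B' @^-1` V).
  rewrite (eq_bigl xpredT); last by move=> k; rewrite finset.in_setT.
  rewrite big_bool/= => <-.
    congr (PP' _); apply/seteqP; split => w /=.
      by move=> [h1 h2] [].
    move=> h; split; [apply: (h true)|apply: (h false)]; exact: finset.in_setT.
  by move=> [] _; [exists U => //|exists V => //]; rewrite setTI.
have mbA : measurable (backward P @^-1` A).
  rewrite -[X in measurable X]setTI.
  exact: (measurable_lipschitz_map (backward_lipschitz T0 L0 gradL P)).
rewrite -ZQ// (noise_path_law T0 ZB ZB' mbA).
apply: ae_eq_preimage.
- by rewrite -[X in measurable X]setTI; exact: (measurable_funPT Z').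
- by rewrite -[X in measurable X]setTI; exact: (measurable_noise_path T0 ZB').
have [_ _ [B0 _ _] _] := ZB'.
apply: filterS2 B0 sde => w Bw0 sdew.
suff E : backward P (noise_path (fun w => Z' w 0) B' w) = Z' w by rewrite /= E.
rewrite -[RHS](forwardK T0 L0 gradL P); congr (backward P _).
apply: path_eq => t tT; rewrite /noise_path start_pathE// Bw0 subr0.
by rewrite forwardE pathDE (sdew t tT) sde_integralE// addrAC subrK.
Qed.

Lemma Gamma_law (A : set path) : measurable A ->
  Gamma W muin P A = PP (solution @^-1` A).
Proof.
by apply: law_of_unique; apply: getPex; exists (distribution PP solution : probability path R); exact: solution_law_of.
Qed.

End existence.

End nonlinear_sde.

(** * Exponential moments of the noise *)

Section gaussian_moments.
Context (R : realType).
Local Notation mu := (@lebesgue_measure R).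

Lemma ge0_integral_normal_prob (m s : R) (f : R -> \bar R) :
  measurable_fun setT f -> (forall x, 0 <= f x)%E ->
  (\int[normal_prob m s]_x f x = \int[mu]_x (f x * (normal_pdf m s x)%:E))%E.
Proof.
move=> mf f0.
have dom := normal_prob_dominates m s.
rewrite -(Radon_Nikodym_SigmaFinite.change_of_variables dom f0)//.
have h := Radon_Nikodym_SigmaFinite.f_integrable dom.
have mp : measurable_fun setT (EFin \o normal_pdf m s).
  by apply/measurable_EFinP; exact: measurable_normal_pdf.
apply: ae_eq_integral => //.
- by apply: emeasurable_funM => //; exact: (measurable_int _ h).
- exact: emeasurable_funM.
- apply: ae_eqe_mul2l => /=; apply: integral_ae_eq => //.
  by move=> E _ mE; rewrite -Radon_Nikodym_SigmaFinite.f_integral.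
Qed.

(** Completing the square: tilting the centred density by exp (c x) gives a multiple of the density
    of mean c s^2. *)
Lemma normal_mgf (s c : R) : s != 0 ->
  (\int[normal_prob 0 s]_x (expR (c * x))%:E = (expR (c ^+ 2 * s ^+ 2 / 2))%:E)%E.
Proof.
move=> s0.
rewrite ge0_integral_normal_prob; last 2 first.
- apply/measurable_EFinP; apply: measurableT_comp => //; exact: mulrl_measurable.
- by move=> x; rewrite lee_fin expR_ge0.
have shift x : expR (c * x) * normal_pdf 0 s x =
    expR (c ^+ 2 * s ^+ 2 / 2) * normal_pdf (c * s ^+ 2) s x.
  rewrite !normal_pdfE// /= /normal_fun.
  rewrite ![expR _ * (normal_peak s * _)]mulrCA -!expRD.
  by congr (_ * expR _); field.
under eq_integral => x _ do rewrite -EFinM shift EFinM.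
rewrite ge0_integralZl_EFin ?expR_ge0//.
- by rewrite integral_normal_pdf mule1.
- by move=> x _; rewrite lee_fin normal_pdf_ge0.
- by apply/measurable_EFinP; exact: measurable_normal_pdf.
Qed.

End gaussian_moments.

Section exp_convexity.
Context (R : realType).
Implicit Types (a x : nat -> R).

Lemma expR_half_convex (u v : R) : expR ((u + v) / 2) <= (expR u + expR v) / 2.
Proof.
have e : (u + v) / 2 = u / 2 + v / 2 by rewrite mulrDl.
have h (w : R) : expR w = expR (w / 2) * expR (w / 2) by rewrite -expRD -splitr.
rewrite e expRD (h u) (h v).
have := sqr_ge0 (expR (u / 2) - expR (v / 2)); nra.
Qed.

(** Convexity of exp with weights 1/2, 1/4, and so on, the remaining mass 2 ^- n sitting at 0;
    induction from the midpoint inequality. *)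
Lemma expR_dyadic_sum n a :
  expR (\sum_(m < n) a m / 2 ^+ m.+1) <= \sum_(m < n) expR (a m) / 2 ^+ m.+1 + (2 ^+ n)^-1.
Proof.
elim: n a => [|n IH] a; first by rewrite !big_ord0 expR0 add0r expr0 invr1.
have half (f : nat -> R) : \sum_(m < n.+1) f m / 2 ^+ m.+1 =
    (f 0%N + \sum_(m < n) f m.+1 / 2 ^+ m.+1) / 2.
  rewrite big_ord_recl mulrDl mulr_suml expr1; congr (_ + _).
  by apply: eq_bigr => i _; rewrite lift0 [2 ^+ i.+2]exprS invfM mulrCA mulrC.
rewrite half (half (fun m => expR (a m))); apply: (le_trans (expR_half_convex _ _)).
rewrite [2 ^+ n.+1]exprS invfM [2^-1 * _]mulrC -mulrDl ler_pM2r ?invr_gt0//.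
by rewrite -addrA lerD2l (IH (fun m => a m.+1)).
Qed.

Lemma dyadic_sum_id n : \sum_(m < n) m%:R / 2 ^+ m.+1 <= 1 :> R.
Proof.
have -> : \sum_(m < n) m%:R / 2 ^+ m.+1 = 1 - n.+1%:R / 2 ^+ n :> R.
  elim: n => [|n IH]; first by rewrite big_ord0 expr0 divr1 subrr.
  rewrite big_ord_recr/= IH exprS -[n.+2%:R]natr1 -[n.+1%:R]natr1.
  by field; rewrite expf_neq0.
by rewrite gerBl divr_ge0// exprn_ge0.
Qed.

(** Before using the dyadic weights, 3 m is subtracted from the m-th term. What is subtracted sums
    to at most 3, and the factor exp (- 3 m) left behind beats the 4 ^ m increments of level m. *)
Lemma expR_chain n x :
  expR (\sum_(m < n) x m) <=
  expR 3 * (\sum_(m < n) expR (2 ^+ m.+1 * x m) / (expR (3 * m%:R) * 2 ^+ m.+1) + 1).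
Proof.
have -> : \sum_(m < n) x m = 3 * (\sum_(m < n) m%:R / 2 ^+ m.+1) +
    \sum_(m < n) (2 ^+ m.+1 * x m - 3 * m%:R) / 2 ^+ m.+1.
  rewrite mulr_sumr -big_split/=; apply: eq_bigr => i _.
  by field; rewrite expf_neq0.
rewrite expRD; apply: ler_pM; rewrite ?expR_ge0//.
  by rewrite ler_expR ler_piMr// dyadic_sum_id.
apply: (le_trans (expR_dyadic_sum n (fun m => 2 ^+ m.+1 * x m - 3 * m%:R))).
apply: lerD; last by rewrite invf_le1 ?exprn_gt0// exprn_ege1// ler1n.
apply: ler_sum => i _; rewrite expRD expRN invfM mulrA; exact: lexx.
Qed.

End exp_convexity.

(** * Chaining over the grids *)

Section chaining.
Context (R : realType) (d : nat) (T : R).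
Hypothesis T0 : 0 < T.
Local Notation path := (cpath d T).
Implicit Type x : path.

Definition increment n k x : 'rV[R]_d := x (grid T n k.+1) - x (grid T n k).

(** The sum stands for a maximum, since its logarithm bounds every increment of the level. The
    factor 3 counts the increments that may separate a grid point from the coarser grid, and 2 ^+
    n.+1 normalises the standard deviation. *)
Definition exp_increments (r : R) n x : R :=
  \sum_(k < 4 ^ n) expR (3 * r * 2 ^+ n.+1 * enorm (increment n k x)).

Lemma exp_increments_gt0 (r : R) n x : 0 < exp_increments r n x.
Proof.
rewrite /exp_increments.
have h : (0 < 4 ^ n)%N by rewrite expn_gt0.
rewrite (bigD1 (Ordinal h))//= ltr_pwDl ?expR_gt0//.
by apply: sumr_ge0 => i _; rewrite expR_ge0.
Qed.

Lemma increment_le (r : R) n k x : 0 < r -> (k < 4 ^ n)%N ->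
  3 * r * enorm (increment n k x) <= ln (exp_increments r n x) / 2 ^+ n.+1.
Proof.
move=> r0 kn; rewrite ler_pdivlMr ?exprn_gt0//.
rewrite -[leLHS]expRK ler_ln ?posrE ?expR_gt0 ?exp_increments_gt0//.
rewrite /exp_increments (bigD1 (Ordinal kn))//= mulrAC lerDl.
by apply: sumr_ge0 => i _; rewrite expR_ge0.
Qed.

(** A point of level n.+1 is joined to the preceding point of level n by k %% 4, hence at most 3,
    increments, each worth at most a third of the term of that level. *)
Lemma chain_le (r : R) x n k : 0 < r -> (k <= 4 ^ n)%N ->
  r * enorm (x (grid T n k) - x 0) <=
  \sum_(m < n.+1) ln (exp_increments r m x) / 2 ^+ m.+1.
Proof.
move=> r0; elim: n k => [|n IH] k kn.
  rewrite big_ord1; case: k kn => [_|[_|//]].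
    rewrite grid0 subrr enorm0 mulr0 divr_ge0 ?exprn_ge0//.
    rewrite ln_ge0// /exp_increments big_ord1 -[leLHS]expR0 ler_expR.
    by rewrite !mulr_ge0 ?exprn_ge0 ?enorm_ge0 ?(ltW r0).
  have := increment_le (n := 0) (k := 0) x r0 isT.
  rewrite /increment grid0; apply: le_trans.
  by rewrite ler_wpM2r ?enorm_ge0// ler_peMl ?(ltW r0)// ler1n.
set q := (k %/ 4)%N; have qn : (q <= 4 ^ n)%N.
  rewrite /q -[leqRHS](mulnK _ (isT : 0 < 4)%N) -expnSr; exact: leq_div2r.
have step j : (4 * q + j <= k)%N ->
    r * enorm (x (grid T n.+1 (4 * q + j)) - x (grid T n.+1 (4 * q))) <=
    j%:R / 3 * (ln (exp_increments r n.+1 x) / 2 ^+ n.+2).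
  elim: j => [_|j IHj jk]; first by rewrite addn0 subrr enorm0 mulr0 !mul0r.
  have jk' : (4 * q + j < 4 ^ n.+1)%N.
    by apply: leq_trans kn; apply: leq_trans jk; rewrite addnS.
  have := IHj (leq_trans (leq_add (leqnn _) (leqnSn j)) jk).
  have := increment_le x r0 jk'; rewrite /increment -addnS.
  have := enorm_triangle (x (grid T n.+1 (4 * q + j))) (x (grid T n.+1 (4 * q + j.+1)))
    (x (grid T n.+1 (4 * q))).
  rewrite -(ler_pM2l r0) mulrDr -[j.+1%:R]natr1.
  set L := ln _ / _; set E1 := enorm _; set E2 := enorm _; set E3 := enorm _.
  lra.
have kE : k = (4 * q + k %% 4)%N by rewrite mulnC -divn_eq.
rewrite big_ord_recr/= [in leLHS]kE.
apply: (@le_trans _ _ (r * enorm (x (grid T n q) - x 0) +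
    r * enorm (x (grid T n.+1 (4 * q + k %% 4)) - x (grid T n.+1 (4 * q))))).
  rewrite -mulrDr ler_pM2l// [leRHS]addrC [grid T n q]gridS.
  exact: enorm_triangle.
apply: lerD; first exact: IH.
have := step (k %% 4)%N; rewrite -kE => /(_ (leqnn _)) /le_trans; apply.
have S0 : 0 <= ln (exp_increments r n.+1 x) / 2 ^+ n.+2.
  have h : (0 < 4 ^ n.+1)%N by rewrite expn_gt0.
  apply: le_trans (increment_le x r0 h).
  by rewrite !mulr_ge0 ?enorm_ge0 ?(ltW r0).
rewrite ler_piMl// ler_pdivrMr// mul1r ler_nat -ltnS.
by rewrite ltn_mod.
Qed.

Lemma expR_chain_le (r : R) x n k : 0 < r -> (k <= 4 ^ n)%N ->
  expR (r * enorm (x (grid T n k) - x 0)) <= expR 3 *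
    (\sum_(m < n.+1) exp_increments r m x / (expR (3 * m%:R) * 2 ^+ m.+1) + 1).
Proof.
move=> r0 kn; apply: (@le_trans _ _ (expR (\sum_(m < n.+1)
    ln (exp_increments r m x) / 2 ^+ m.+1))).
  by rewrite ler_expR chain_le.
apply: (le_trans (expR_chain n.+1 (fun m => ln (exp_increments r m x) / 2 ^+ m.+1))).
rewrite ler_pM2l ?expR_gt0// lerD2r; apply: ler_sum => m _.
by rewrite [2 ^+ _ * _]mulrC divfK ?expf_neq0// lnK// posrE exp_increments_gt0.
Qed.

End chaining.

Section exponential_moments.
Context (R : realType) (d : nat) (T : R).
Hypothesis T0 : 0 < T.
Local Notation path := (cpath d T).
Variable Q : probability path R.
Hypothesis Qstart : forall r : R, 0 < r -> (\int[Q]_x (expR (r * enorm (x 0%R)))%:E < +oo)%E.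
Hypothesis Qincrement : forall n k i A, (k < 4 ^ n)%N -> measurable A ->
  Q [set x | A (increment n k x ord0 i)] = normal_prob 0 (Num.sqrt (mesh T n)) A.

(** The norm is at most d times the largest coordinate in absolute value, and each coordinate
    contributes its two signs to the sum; the 1 covers d = 0. *)
Lemma expR_enorm_le (l : R) (v : 'rV[R]_d) : 0 < l ->
  expR (l * enorm v) <=
  1 + \sum_i (expR (l * d%:R * v ord0 i) + expR (- (l * d%:R) * v ord0 i)).
Proof.
move=> l0; set S := 1 + _.
have S1 : 1 <= S.
  by rewrite lerDl sumr_ge0// => i _; rewrite addr_ge0 ?expR_ge0.
have S0 : 0 < S by exact: lt_le_trans S1.
rewrite -[S]lnK ?posrE// ler_expR.
have [d0|d0] := eqVneq d 0%N.
  have -> : v = 0 by apply/rowP => -[j jd]; exfalso; rewrite d0 in jd.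
  by rewrite enorm0 mulr0 ln_ge0.
have dpos : 0 < d%:R :> R by rewrite ltr0n lt0n.
have h i : `|v ord0 i| <= ln S / (l * d%:R).
  rewrite ler_pdivlMr ?mulr_gt0// mulrC -[leLHS]expRK ler_ln ?posrE ?expR_gt0//.
  rewrite /S (bigD1 i)//=.
  have rest : 0 <= \sum_(j | j != i)
     (expR (l * d%:R * v ord0 j) + expR (- (l * d%:R) * v ord0 j)).
    by rewrite sumr_ge0// => j _; rewrite addr_ge0 ?expR_ge0.
  have p1 := expR_ge0 (l * d%:R * v ord0 i).
  have p2 := expR_ge0 (- (l * d%:R) * v ord0 i).
  case: (ger0P (v ord0 i)) => v0; first lra.
  rewrite mulrN -mulNr; lra.
apply: (@le_trans _ _ (l * (d%:R * (ln S / (l * d%:R))))).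
  by rewrite ler_pM2l// enorm_le_coord.
by rewrite mulrA mulrC divfK// mulf_neq0 ?gt_eqF.
Qed.

Lemma measurable_exp_coord n k i (c : R) :
  measurable_fun setT (fun x : path => (expR (c * increment n k x ord0 i))%:E).
Proof.
apply/measurable_EFinP; apply: measurableT_comp => //.
apply: measurable_funM => //; exact: measurable_increment.
Qed.

Lemma exp_coord_moment n k i (c : R) : (k < 4 ^ n)%N ->
  (\int[Q]_x (expR (c * increment n k x ord0 i))%:E =
   (expR (c ^+ 2 * mesh T n / 2))%:E)%E.
Proof.
move=> kn; have m0 := mesh_gt0 T0 n.
have mi : measurable_fun setT (fun x : path => increment n k x ord0 i : measurableTypeR R).
  exact: measurable_increment.
pose Y := mfun_of mi.
have YQ : has_law Q Y (normal_prob 0 (Num.sqrt (mesh T n))).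
  by move=> A mA; exact: Qincrement.
have me : measurable_fun setT (fun y : measurableTypeR R => (expR (c * y))%:E).
  by apply/measurable_EFinP; apply: measurableT_comp => //; exact: mulrl_measurable.
have := has_law_integral YQ me (fun y => _ : (0 <= (expR (c * y))%:E)%E).
move=> ->; last by move=> y; rewrite lee_fin expR_ge0.
by rewrite normal_mgf ?gt_eqF ?sqrtr_gt0// sqr_sqrtr// ltW.
Qed.

Lemma measurable_exp_increment n k (c : R) :
  measurable_fun setT (fun x : path => expR (c * enorm (increment n k x))).
Proof.
apply: measurableT_comp => //; apply: measurable_funM => //.
by apply: measurable_enormB; apply: measurable_path_eval; exact: measurable_id.
Qed.

Lemma exp_increment_moment n k (l : R) : 0 < l -> (k < 4 ^ n)%N ->
  (\int[Q]_x (expR (l * enorm (increment n k x)))%:E <=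
   (1 + 2 * d%:R * expR ((l * d%:R) ^+ 2 * mesh T n / 2))%:E)%E.
Proof.
move=> l0 kn.
apply: (@le_trans _ _ (\int[Q]_x (1 + \sum_(i < d)
    ((expR (l * d%:R * increment n k x ord0 i))%:E +
     (expR (- (l * d%:R) * increment n k x ord0 i))%:E)))%E).
  apply: ge0_le_integral => //.
  - by apply/measurable_EFinP; exact: measurable_exp_increment.
  - apply: emeasurable_funD => //; apply: emeasurable_sum => i.
    by apply: emeasurable_funD; exact: measurable_exp_coord.
  - move=> x _; apply: le_trans (_ : (_ <= (1 + \sum_(i < d)
      (expR (l * d%:R * increment n k x ord0 i) +
       expR (- (l * d%:R) * increment n k x ord0 i)))%:E)%E) _.
      by rewrite lee_fin expR_enorm_le.
    by rewrite EFinD -sumEFin.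
rewrite ge0_integralD//; last 2 first.
- by move=> x _; apply: sume_ge0 => i _; rewrite -EFinD lee_fin addr_ge0 ?expR_ge0.
- apply: emeasurable_sum => i.
  by apply: emeasurable_funD; exact: measurable_exp_coord.
rewrite [X in (X + _)%E](_ : _ = 1%E); last by rewrite integral_cst//= probability_setT mule1.
rewrite ge0_integral_sum//; last 2 first.
- by move=> i; apply: emeasurable_funD; exact: measurable_exp_coord.
- by move=> i x _; rewrite -EFinD lee_fin addr_ge0 ?expR_ge0.
rewrite (eq_bigr (fun=> (2 * expR ((l * d%:R) ^+ 2 * mesh T n / 2))%:E)); last first.
  move=> i _; rewrite ge0_integralD//.
  - by rewrite !exp_coord_moment// sqrrN -EFinD mulr_natl mulr2n.
  - exact: measurable_exp_coord.
  - exact: measurable_exp_coord.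
rewrite sumEFin -EFinD sumr_const card_ord lee_fin -[_ *+ d]mulr_natl mulrA [d%:R * 2]mulrC.
exact: lexx.
Qed.

Variable r : R.
Hypothesis r0 : 0 < r.

(** 18 is 3^2 * 2^2 / 2: the Gaussian moment at 3 r 2 ^+ m.+1 d with variance T / 4 ^ m, from which
    the level m cancels. *)
Definition increment_bound : R := 1 + 2 * d%:R * expR (18 * r ^+ 2 * d%:R ^+ 2 * T).

(* There are 4 ^ m increments of level m, compensated by the factor expR (3 * m). *)
Definition chain_term m (x : path) : R :=
  exp_increments r m x / (expR (3 * m%:R) * 2 ^+ m.+1).

Lemma chain_term_ge0 m x : 0 <= chain_term m x.
Proof.
by rewrite divr_ge0 ?mulr_ge0 ?expR_ge0 ?exprn_ge0// ltW// exp_increments_gt0.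
Qed.

Lemma measurable_chain_term m : measurable_fun setT (chain_term m).
Proof.
apply: measurable_funM => //; apply: measurable_sum => k.
exact: measurable_exp_increment.
Qed.

Lemma integral_chain_term m :
  (\int[Q]_x (chain_term m x)%:E <= (increment_bound / 2 ^+ m.+1)%:E)%E.
Proof.
have l0 : 0 < 3 * r * 2 ^+ m.+1 by rewrite !mulr_gt0// exprn_gt0.
have b0 : 0 <= increment_bound by rewrite addr_ge0// !mulr_ge0 ?expR_ge0.
have c0 : 0 <= (expR (3 * m%:R) * 2 ^+ m.+1)^-1 :> R.
  by rewrite invr_ge0 mulr_ge0 ?expR_ge0 ?exprn_ge0.
have me k : measurable_fun setT (fun x : path =>
    (expR (3 * r * 2 ^+ m.+1 * enorm (increment m k x)))%:E).
  by apply/measurable_EFinP; exact: measurable_exp_increment.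
have pe k x : (0 <= (expR (3 * r * 2 ^+ m.+1 * enorm (increment m k x)))%:E)%E.
  by rewrite lee_fin expR_ge0.
under eq_integral => x _ do rewrite /chain_term mulrC EFinM /exp_increments -sumEFin.
rewrite ge0_integralZl_EFin//; last 2 first.
- by move=> x _; apply: sume_ge0.
- exact: emeasurable_sum.
rewrite ge0_integral_sum//.
have bound (k : 'I_(4 ^ m)) : (\int[Q]_x (expR (3 * r * 2 ^+ m.+1 * enorm (increment m k x)))%:E <=
    increment_bound%:E)%E.
  apply: le_trans (exp_increment_moment l0 (ltn_ord k)) _.
  rewrite lee_fin /increment_bound /mesh [X in expR X](_ : _ = 18 * r ^+ 2 * d%:R ^+ 2 * T)//.
  have -> : (4 ^ m)%:R = (2 ^+ m) ^+ 2 :> R.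
    by rewrite natrX -exprM mulnC exprM -[2 ^+ 2]natrX.
  rewrite [2 ^+ m.+1]exprS; field.
  by rewrite expf_neq0.
apply: (@le_trans _ _ (((expR (3 * m%:R) * 2 ^+ m.+1)^-1)%:E *
    \sum_(k < 4 ^ m) increment_bound%:E)%E).
  by apply: lee_wpmul2l; rewrite ?lee_fin//; apply: lee_sum => k _; exact: bound.
rewrite sumEFin sumr_const card_ord -EFinM lee_fin -[_ *+ _ ^ _]mulr_natl.
have e4 : (4 ^ m)%:R <= expR (3 * m%:R) :> R.
  by rewrite expRM_natr natrX lerXn2r ?nnegrE ?expR_ge0// (le_trans _ (expR_ge1Dx _))// -natr1 addrC.
have q0 : 0 < 2 ^+ m.+1 :> R by rewrite exprn_gt0.
rewrite ler_pdivrMl ?mulr_gt0 ?expR_gt0// [increment_bound / _]mulrC.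
by rewrite mulrA mulfK ?gt_eqF// ler_wpM2r.
Qed.

(** Start and increments are separated by exp ((p + q) / 2) <= (exp p + exp q) / 2, which is why r
    is halved. Where the series diverges the bound is trivial. *)
Lemma expR_supnorm_le (x : path) :
  ((expR (r / 2 * supnorm x))%:E <= (expR (r * enorm (x 0%R)))%:E +
   (expR 3)%:E * (\sum_(m <oo) (chain_term m x)%:E + 1))%E.
Proof.
have c0 m : (0 <= (chain_term m x)%:E)%E by rewrite lee_fin chain_term_ge0.
have s0 : (0 <= \sum_(m <oo) (chain_term m x)%:E)%E by exact: nneseries_ge0.
have [->|soo] := eqVneq (\sum_(m <oo) (chain_term m x)%:E)%E +oo%E.
  by rewrite addye// gt0_muley ?lte_fin ?expR_gt0// addey// leey.
have [u us] : exists u, (\sum_(m <oo) (chain_term m x)%:E = u%:E)%E.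
  by exists (fine (\sum_(m <oo) (chain_term m x)%:E)%E); rewrite fineK// ge0_fin_numE// ltey.
rewrite us -[X in (_ <= X)%E]/((expR (r * enorm (x 0)) + expR 3 * (u + 1))%:E) lee_fin.
have u0 : 0 <= u by rewrite -lee_fin -us.
set v := expR 3 * (u + 1).
have v1 : 1 <= v.
  rewrite -[leLHS]mulr1 /v; apply: ler_pM => //; last by rewrite lerDr.
  by rewrite -expR0 ler_expR.
have v0 : 0 < v by exact: lt_le_trans v1.
have hgrid n k : (k <= 4 ^ n)%N -> enorm (x (grid T n k) - x 0) <= ln v / r.
  move=> kn; rewrite ler_pdivlMr// mulrC -[leLHS]expRK ler_ln ?posrE ?expR_gt0//.
  have := expR_chain_le x r0 kn.
  move/le_trans; apply; rewrite /v ler_pM2l ?expR_gt0// lerD2r.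
  rewrite -lee_fin -us -sumEFin -(big_mkord xpredT (fun m => (chain_term m x)%:E)).
  exact: nneseries_lim_ge.
have xM : supnorm x <= enorm (x 0) + ln v / r.
  have lv0 : 0 <= ln v by exact: ln_ge0.
  apply: supnorm_le => //; first by rewrite addr_ge0 ?enorm_ge0 ?divr_ge0// ltW.
  apply: (grid_sup T0) => [t tT e e0|n k kn].
    have [a a0 ha] := path_cts x tT e0.
    exists a => // s sT st; rewrite -[x t](subrK (x s)) addrC.
    by apply: (le_trans (enormD _ _)); rewrite lerD2l enormB ltW// ha.
  rewrite -[x (grid T n k)](subrK (x 0)) addrC.
  by apply: (le_trans (enormD _ _)); rewrite lerD2l hgrid.
apply: (@le_trans _ _ (expR ((r * enorm (x 0) + ln v) / 2))).
  rewrite ler_expR mulrAC ler_pM2r ?invr_gt0//.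
  apply: le_trans (ler_wpM2l (ltW r0) xM) _.
  by rewrite mulrDr [r * (ln v / r)]mulrC divfK ?gt_eqF.
apply: (le_trans (expR_half_convex _ _)); rewrite lnK ?posrE//.
have := expR_ge0 (r * enorm (x 0)); lra.
Qed.

Lemma expR_half_supnorm_integrable : (\int[Q]_x (expR (r / 2 * supnorm x))%:E < +oo)%E.
Proof.
have c0 m x : (0 <= (chain_term m x)%:E)%E by rewrite lee_fin chain_term_ge0.
have mc m : measurable_fun setT (fun x => (chain_term m x)%:E).
  by apply/measurable_EFinP; exact: measurable_chain_term.
have ms : measurable_fun setT (fun x => \sum_(m <oo) (chain_term m x)%:E)%E.
  by apply: ge0_emeasurable_sum.
have b0 : 0 <= increment_bound by rewrite addr_ge0// !mulr_ge0 ?expR_ge0.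
have m1 : measurable_fun setT (fun x : path => (expR (r / 2 * supnorm x))%:E).
  apply/measurable_EFinP; apply: measurableT_comp => //.
  by apply: measurable_funM => //; exact: measurable_supnorm.
have m2 : measurable_fun setT (fun x : path => (expR (r * enorm (x 0)))%:E).
  apply/measurable_EFinP; apply: measurableT_comp => //.
  apply: measurable_funM => //.
  rewrite (_ : (fun x => _) = (fun x : path => enorm (x 0 - 0))); last first.
    by apply/funext => x; rewrite subr0.
  apply: measurable_enormB => //.
  by apply: measurable_path_eval; exact: measurable_id.
have m3 : measurable_fun setT (fun x : path =>
    (expR 3)%:E * (\sum_(m <oo) (chain_term m x)%:E + 1))%E.
  by apply: measurable_funeM; exact: emeasurable_funD.
have p3 x : (0 <= (expR 3)%:E * (\sum_(m <oo) (chain_term m x)%:E + 1))%E.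
  by rewrite mule_ge0 ?lee_fin ?expR_ge0// adde_ge0// nneseries_ge0.
have le_sum : (\int[Q]_x (\sum_(m <oo) (chain_term m x)%:E) <= increment_bound%:E)%E.
  rewrite integral_nneseries//.
  apply: lime_le; first by apply: is_cvg_nneseries => m _ _; exact: integral_ge0.
  apply: nearW => n.
  apply: (@le_trans _ _ (\sum_(0 <= m < n) (increment_bound / 2 ^+ m.+1)%:E)%E).
    by apply: lee_sum => m _; exact: integral_chain_term.
  rewrite sumEFin lee_fin -mulr_sumr ler_piMr//.
  have -> : \sum_(0 <= m < n) (2 ^+ m.+1)^-1 = 1 - (2 ^+ n)^-1 :> R.
    elim: n => [|n IH]; first by rewrite big_nil expr0 invr1 subrr.
    rewrite big_nat_recr//= IH exprS; field; rewrite expf_neq0//.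
  by rewrite gerBl invr_ge0 exprn_ge0.
apply: (@le_lt_trans _ _ (\int[Q]_x ((expR (r * enorm (x 0)))%:E +
    (expR 3)%:E * (\sum_(m <oo) (chain_term m x)%:E + 1)))%E).
  apply: ge0_le_integral => //.
  - exact: emeasurable_funD.
  - by move=> x _; exact: expR_supnorm_le.
rewrite ge0_integralD//.
apply: lte_add_pinfty; first exact: Qstart.
rewrite ge0_integralZl_EFin ?expR_ge0//; last 2 first.
- by move=> x _; rewrite adde_ge0// nneseries_ge0.
- exact: emeasurable_funD.
rewrite lte_mul_pinfty ?lee_fin ?expR_ge0// ge0_integralD//; last by move=> x _; exact: nneseries_ge0.
apply: lte_add_pinfty; first by rewrite (le_lt_trans le_sum)// ltry.
by rewrite integral_cst//= probability_setT mule1 ltry.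
Qed.

End exponential_moments.

Section noise_law.
Context (R : realType) (d : nat) (T : R).
Hypothesis T0 : 0 < T.
Local Notation path := (cpath d T).
Variable muin : probability 'rV[R]_d R.
Hypothesis muin_exp : forall r : R, 0 < r -> (\int[muin]_x (expR (r * enorm x))%:E < +oo)%E.
Context dS (S : measurableType dS) (PP : probability S R).
Variables (Z : S -> 'rV[R]_d) (B : {mfun S >-> path}).
Hypothesis ZB : initialised_bm muin PP Z B.

Definition noise_law : probability path R :=
  distribution PP (mfun_of (measurable_noise_path T0 ZB)).

Lemma noise_law_increment n k i A : (k < 4 ^ n)%N -> measurable A ->
  noise_law [set x | A (increment n k x ord0 i)] = normal_prob 0 (Num.sqrt (mesh T n)) A.
Proof.
move=> kn mA.
pose C (k' : 'I_(4 ^ n)) (i' : 'I_d) := if (k' == Ordinal kn) && (i' == i) then A else setT.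
have mC k' i' : measurable (C k' i') by rewrite /C; case: ifP.
have -> : [set x : path | A (increment n k x ord0 i)] = incr_box setT C.
  apply/seteqP; split => x /=.
    move=> Ax; split => // k' i'; rewrite /C; case: ifP => // /andP[/eqP -> /eqP ->].
    exact: Ax.
  by move=> [_ /(_ (Ordinal kn) i)]; rewrite /C !eqxx.
have Cki : C (Ordinal kn) i = A by rewrite /C !eqxx.
have := noise_path_box T0 ZB measurableT mC.
rewrite probability_setT mul1e (bigD1 (Ordinal kn))//= (bigD1 i)//= Cki.
rewrite !big1 ?mule1// => [k' /negbTE k'k|i' /negbTE i'i].
  by rewrite big1// => i' _; rewrite /C k'k probability_setT.
by rewrite /C i'i andbF probability_setT.
Qed.

Lemma noise_law_exp (l : R) : 0 < l -> (\int[noise_law]_x (expR (l * supnorm x))%:E < +oo)%E.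
Proof.
move=> l0.
have := @expR_half_supnorm_integrable R d T T0 noise_law _ noise_law_increment (l + l).
rewrite -mulr2n -[l *+ 2]mulr_natr mulfK//; apply; last by rewrite mulr_gt0.
move=> r r0.
have mr : measurable_fun setT (fun v : 'rV[R]_d => (expR (r * enorm v))%:E).
  apply/measurable_EFinP; apply: measurableT_comp => //; apply: measurable_funM => //.
  by apply: continuous_mx_measurable; exact: continuous_enorm.
have mr' : measurable_fun setT (fun x : path => (expR (r * enorm (x 0)))%:E).
  by apply: (measurableT_comp mr); exact: (@measurable_at_time R d T 0).
have p v : (0 <= (expR (r * enorm (v : 'rV[R]_d)))%:E)%E by rewrite lee_fin expR_ge0.
have [mZ Zmu _ _] := ZB.
have nl : has_law PP (mfun_of (measurable_noise_path T0 ZB)) noise_law by [].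
rewrite -(has_law_integral nl mr'); last by move=> x; exact: p.
rewrite (_ : (\int[_]_w _)%E = (\int[PP]_w (expR (r * enorm (Z w)))%:E)%E).
  have nZ : has_law PP (mfun_of mZ) muin by [].
  by rewrite (has_law_integral nZ mr p); exact: muin_exp.
by apply: eq_integral => w _ /=; rewrite start_path0.
Qed.

End noise_law.

(** * Large deviations of the particle system *)

Section empirical_drift.
Context (R : realType) (d : nat) (T : R) (n : nat).
Local Notation path := (cpath d T).

Lemma Rintegral_empirical (x : 'I_n.+1 -> path) (f : path -> R) : measurable_fun setT f ->
  \int[empirical x]_z f z = n.+1%:R^-1 * \sum_i f (x i).
Proof.
move=> mf.
have H (g : path -> R) : measurable_fun setT g -> (forall z, 0 <= g z) ->
    (empirical x).-integrable setT (EFin \o g) /\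
    \int[empirical x]_z g z = n.+1%:R^-1 * \sum_i g (x i).
  move=> mg g0; have e := integral_empirical x mg g0.
  split; last by rewrite /Rintegral e.
  apply/integrableP; split; first exact/measurable_EFinP.
  under eq_integral => z _ do rewrite /= ger0_norm//.
  by rewrite e ltry.
have mp : measurable_fun setT (fun z => Num.max (f z) 0) by exact: measurable_maxr.
have mn : measurable_fun setT (fun z => Num.max (- f z) 0).
  by apply: measurable_maxr => //; exact: measurableT_comp.
have [Ip Ep] := H _ mp (fun z => ltac:(by rewrite le_max lexx orbT)).
have [In En] := H _ mn (fun z => ltac:(by rewrite le_max lexx orbT)).
have fE z : f z = Num.max (f z) 0 - Num.max (- f z) 0.
  by case: (leP (f z) 0) => fz; case: (leP (- f z) 0) => fz'; lra.
under eq_Rintegral => z _ do rewrite fE.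
rewrite RintegralB// Ep En -mulrBr -sumrB; congr (_ * _).
by apply: eq_bigr => i _; rewrite -fE.
Qed.

End empirical_drift.

Section particle_noise_empirical.
Context (R : realType) (d : nat) (T : R).
Hypothesis T0 : 0 < T.
Variables (W : 'rV[R]_d -> R) (L : R).
Hypothesis L0 : 0 <= L.
Hypothesis gradL : forall x y, enorm (grad W x - grad W y) <= L * enorm (x - y).
Variable muin : probability 'rV[R]_d R.
Local Notation path := (cpath d T).
Local Notation prob1 := (prob1 d T).
Local Notation drift := (drift T0 L0 gradL).
Local Notation forward := (forward T0 L0 gradL).
Local Notation Phi := (Phi T0 L0 gradL).

Lemma conv_grad_empirical n (x : 'I_n.+1 -> path) (y : path) (s : R) :
  conv_grad W (marginal (empirical_prob1 x) s) (y s) =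
  n.+1%:R^-1 *: \sum_k grad W (y s - x k s).
Proof.
apply/rowP => i.
have -> : conv_grad W (marginal (empirical_prob1 x) s) (y s) ord0 i =
    \int[empirical x]_z grad W (y s - z s) ord0 i.
  exact: (mean_driftE L0 gradL (empirical_prob1 x) y s i).
rewrite Rintegral_empirical; first by rewrite [RHS]mxE summxE.
have I := integrable_grad_coord L0 gradL (PP := empirical_prob1 x) i (y s)
   (integrable_at_time (empirical_prob1 x) s).
by have /measurable_EFinP := measurable_int _ I.
Qed.

Context dS (S : measurableType dS) (PP : probability S R) (n : nat).
Variables (B X : 'I_n.+1 -> {mfun S >-> path}).
Hypothesis PS : particle_system W PP muin B X.

(** The interaction is the nonlinear drift taken at the empirical measure of the particles
    ([conv_grad_empirical]); the null sets of the finitely many particles are united. *)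
Lemma forward_particle : {ae PP, forall w i,
  forward (empirical_prob1 (fun k => X k w)) (X i w) = particle_noise T0 PS i w}.
Proof.
have [hB _ _ hX] := PS.
suff h i : {ae PP, forall w,
    forward (empirical_prob1 (fun k => X k w)) (X i w) = particle_noise T0 PS i w}.
  have := @filter_forall _ _ _ _ _ h.
  exact.
have [B0 _ _] := hB i.
apply: filterS2 B0 (hX i) => w Bw0 Xw.
apply: path_eq => t tT.
rewrite pathDE (_ : particle_noise T0 PS i w = start_path (X i w 0) (B i w))//.
rewrite start_pathE// Bw0 subr0 (Xw t tT).
have := sde_integralE T0 L0 gradL (empirical_prob1 (fun k => X k w)) (X i w) tT.
under eq_mx => k l do under eq_Rintegral => s _ do rewrite conv_grad_empirical.
move=> ->.
by rewrite addrAC subrK.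
Qed.

Lemma Phi_empirical_particles : {ae PP, forall w A, measurable A ->
  Phi (empirical_prob1 (fun k => X k w)) A = empirical (fun i => particle_noise T0 PS i w) A}.
Proof.
apply: filterS forward_particle => w Hw A mA.
set P := empirical_prob1 _.
rewrite (_ : Phi P A = P (forward P @^-1` A))// [LHS]empiricalE; last first.
  rewrite -[X in measurable X]setTI.
  exact: (measurable_lipschitz_map (forward_lipschitz T0 L0 gradL _)).
rewrite empiricalE//; congr ((_ * _)%:E); apply: eq_bigr => i _.
by rewrite -Hw.
Qed.

End particle_noise_empirical.

(** * Bounds on the logarithmic scale *)

Section limits.
Context (R : realType).
Implicit Type u : (\bar R)^nat.

Lemma limn_esup_le_near u (c : \bar R) :
  (\forall n \near \oo, (u n <= c)%E) -> (limn_esup u <= c)%E.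
Proof.
move=> uc; apply: (@le_trans _ _ (ereal_sup (u @` [set n | (u n <= c)%E]))).
  by apply: ereal_inf_lbound; exists [set n | (u n <= c)%E].
by apply: ge_ereal_sup => _ [n /= un <-].
Qed.

Lemma limn_einf_ge_near u (c : \bar R) :
  (\forall n \near \oo, (c <= u n)%E) -> (c <= limn_einf u)%E.
Proof.
move=> uc; rewrite /limn_einf leeNr; apply: limn_esup_le_near.
by apply: filterS uc => n cu; rewrite leeN2.
Qed.

Lemma lee_real_below (x y : \bar R) :
  (forall a : R, (a%:E < y)%E -> (a%:E <= x)%E) -> (y <= x)%E.
Proof.
move=> h; rewrite leNgt; apply/negP => xy.
case: y xy h => [y| |]//=; last by case: x => [x| |].
  case: x => [x| |]//=; last by move=> _ /(_ (y - 1)); rewrite lte_fin gtrBl ltr01 => /(_ isT).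
  rewrite lte_fin => xy /(_ ((x + y) / 2)); rewrite lte_fin lee_fin => h.
  have := h ltac:(lra); lra.
case: x => [x| |]//= _; last by move=> /(_ 0); rewrite ltry => /(_ isT).
by move=> /(_ (x + 1)); rewrite ltry lee_fin => /(_ isT); lra.
Qed.

Lemma lne_scale_le (n b : R) (p : \bar R) : 0 < n -> (0 <= p)%E ->
  (p <= (expR (n * b))%:E)%E -> ((n^-1)%:E * lne p <= b%:E)%E.
Proof.
move=> n0 p0 pe; rewrite lee_pdivrMl// -EFinM -[X in (_ <= X%:E)%E]expRK -lne_EFin ?expR_gt0//.
by rewrite lee_lne// in_itv/= leey ?lee_fin ?expR_ge0 ?p0.
Qed.

Lemma lne_scale_ge (n b : R) (p : \bar R) : 0 < n ->
  ((expR (n * b))%:E <= p)%E -> (b%:E <= (n^-1)%:E * lne p)%E.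
Proof.
move=> n0 pe; rewrite lee_pdivlMl// -EFinM -[X in (X%:E <= _)%E]expRK -lne_EFin ?expR_gt0//.
by rewrite lee_lne// in_itv/= leey ?(le_trans _ pe) ?lee_fin ?expR_ge0.
Qed.

(** The term of degree m.+1 of the exponential series alone beats the polynomial, using n.+2 <= 2 *
    n.+1. *)
Lemma expR_dominates_pow (e : R) m : 0 < e ->
  \forall n \near \oo, (n.+2%:R) ^+ m + 1 <= expR (n.+1%:R * e) :> R.
Proof.
move=> e0; near=> n.
have h : 2 ^+ m * m.+1`!%:R / e ^+ m.+1 < n%:R by near: n; exact: nbhs_infty_gtr.
set y : R := n.+1%:R.
have y1 : 1 <= y by rewrite ler1n.
have y0 : 0 < y by exact: lt_le_trans y1.
have hy : 2 ^+ m * m.+1`!%:R <= e ^+ m.+1 * y.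
  rewrite -ler_pdivrMl ?exprn_gt0// mulrC ltW// (lt_le_trans h)//.
  by rewrite ler_nat.
have ey : 0 <= y * e by rewrite mulr_ge0 ?ltW.
apply: le_trans (expR_ge1Dxn m ey); rewrite addrC lerD2l.
apply: (@le_trans _ _ ((2 * y) ^+ m)).
  by rewrite lerXn2r ?nnegrE ?mulr_ge0 ?(ltW y0)// -natr1 -/y; lra.
rewrite ler_pdivlMr ?ltr0n ?fact_gt0// !exprMn [y ^+ m.+1]exprS.
rewrite mulrAC [leRHS]mulrC mulrA ler_wpM2r ?exprn_ge0 ?(ltW y0)//.
Unshelve. all: by end_near. Qed.

End limits.

Section W1_laws.
Context (R : realType) (d : nat) (T : R).
Hypothesis T0 : 0 < T.
Local Notation path := (cpath d T).
Implicit Types P Q : probability path R.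

Lemma W1_ext P Q P' Q' : (forall A, measurable A -> P A = P' A) ->
  (forall A, measurable A -> Q A = Q' A) -> W1 P Q = W1 P' Q'.
Proof.
move=> PP' QQ'; congr ereal_inf; apply/seteqP; split => e
  [dS [S [PP [Y [Z [YP ZQ ->]]]]]]; exists dS, S, PP, Y, Z; split => // A mA.
- by rewrite YP// PP'.
- by rewrite ZQ// QQ'.
- by rewrite YP// PP'.
- by rewrite ZQ// QQ'.
Qed.

(** In a coupling, Y in A together with Z outside B forces a distance of at least e, an event
    bounded by Markov's inequality. *)
Lemma W1_enlargement P Q (A B : set path) (e : R) : 0 < e -> measurable A ->
  measurable B -> (forall x y, A x -> supdist x y < e -> B y) ->
  (P A <= Q B + e^-1%:E * W1 P Q)%E.
Proof.
move=> e0 mA mB AB; rewrite -leeBlDl ?fin_num_measure//.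
have ei0 : 0 < e^-1 by rewrite invr_gt0.
rewrite -lee_pdivrMl// invrK; apply: le_ereal_inf_tmp => _ [dS [S [PP [Y [Z [YP ZQ ->]]]]]].
have msd : measurable_fun setT (fun w => supdist (Y w) (Z w)).
  by apply: measurable_supdist => //; exact: measurable_funPT.
have mD : measurable [set w | e <= supdist (Y w) (Z w)].
  have := msd measurableT _ (measurable_itv `[e, +oo[); rewrite setTI.
  by congr measurable; apply/seteqP; split => w /=; rewrite in_itv/= andbT.
have mYA : measurable (Y @^-1` A) by rewrite -[X in measurable X]setTI; exact: measurable_funPT.
have mZB : measurable (Z @^-1` B) by rewrite -[X in measurable X]setTI; exact: measurable_funPT.
have markov : (e%:E * PP [set w | (e <= supdist (Y w) (Z w))%R] <=
    \int[PP]_w (supdist (Y w) (Z w))%:E)%E.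
  rewrite -[X in PP X]setIT -integral_indic// -ge0_integralZl_EFin ?(ltW e0)//; last first.
    by apply/measurable_EFinP; exact: measurable_indic.
  apply: ge0_le_integral => //.
  - by move=> w _; rewrite mule_ge0 ?lee_fin ?(ltW e0)// indicE.
  - apply: emeasurable_funM => //; apply/measurable_EFinP; exact: measurable_indic.
  - exact/measurable_EFinP.
  - move=> w _; rewrite -EFinM lee_fin indicE.
    case: (boolP (w \in _)) => [/set_mem/= h|_] /=; rewrite ?mulr1//.
    by rewrite mulr0 supdist_ge0.
apply: le_trans markov; rewrite lee_pmul2l ?lte_fin//.
rewrite leeBlDl ?fin_num_measure// -YP// -ZQ//.
apply: (@le_trans _ _ (PP (Z @^-1` B `|` [set w | e <= supdist (Y w) (Z w)]))).
  apply: le_measure; rewrite ?inE//; first exact: measurableU.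
  move=> w Aw; have [h|h] := ltP (supdist (Y w) (Z w)) e; last by right.
  by left; exact: AB Aw h.
exact: measureU2.
Qed.

(** An open set is the increasing union of the sets [F n] whose balls of radius 1 / n.+1 stay inside
    it, and open sets determine a law. Limits in [prob1] are identified only in this sense. *)
Lemma W1_0_law P Q (A : set path) : W1 P Q = 0%E -> measurable A -> P A = Q A.
Proof.
have H P' Q' (U : set path) : W1 P' Q' = 0%E -> open U -> (P' U <= Q' U)%E.
  move=> W0 oU.
  pose F n := [set x : path | forall y, supdist x y < n.+1%:R^-1 -> U y].
  have mU : measurable U by exact: sub_sigma_algebra.
  have mF n : measurable (F n).
    rewrite -[F n]setCK; apply: measurableC; apply: sub_sigma_algebra.
    rewrite openE => x /= /existsNP[y /not_implyP[xy yU]].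
    apply/nbhs_supdistP; exists (n.+1%:R^-1 - supdist x y); first by rewrite subr_gt0.
    move=> z xz /(_ y) zy; apply/yU/zy.
    by rewrite (le_lt_trans (supdist_triangle x _ _))// supdistC -ltrBrDr.
  have UF : U = \bigcup_n F n.
    apply/seteqP; split => [x Ux|x [n _ /(_ x)]]; last by rewrite supdistxx invr_gt0 ltr0n; apply.
    have /nbhs_supdistP[e e0 he] : nbhs x U by exact: open_nbhs_nbhs.
    have [n] := ltr_add_invr e0; rewrite add0r => ne; exists n => // y xy.
    by apply: he; exact: lt_trans ne.
  have ndF : nondecreasing_seq F.
    move=> n m nm; apply/subsetPset => x Fx y xy; apply: Fx; apply: (lt_le_trans xy).
    by rewrite lef_pV2 ?posrE ?ltr0n// ler_nat.
  have cF := nondecreasing_cvg_mu (mu := P') mF _ ndF.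
  rewrite UF in mU *; have {}cF := cF mU.
  rewrite -(cvg_lim _ cF)//; apply: lime_le; first by apply/cvg_ex; eexists; exact: cF.
  apply: nearW => n; have n0 : 0 < n.+1%:R^-1 :> R by rewrite invr_gt0.
  have := @W1_enlargement P' Q' (F n) (\bigcup_n F n) _ n0 (mF n) mU.
  by rewrite W0 mule0 adde0; apply => x y Fx xy; rewrite -UF; exact: Fx.
move=> W0 mA.
apply: (@measure_eq_g_sigma _ _ _ P Q open) => //.
- exact: sub_sigma_algebra.
- exact: openI.
- exact: (etrans (probability_setT P) (esym (probability_setT Q))).
- by apply: (@le_lt_trans _ _ 1%E); [exact: (probability_le1 P)|rewrite ltry].
- move=> U oU; apply/eqP; rewrite eq_le !H//.
  by rewrite W1_sym.
Qed.

End W1_laws.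

(** * Goodness of the rate function *)

Section rate_function.
Context (R : realType) (d : nat) (T : R).
Hypothesis T0 : 0 < T.
Variables (W : 'rV[R]_d -> R) (L : R).
Hypothesis L0 : 0 <= L.
Hypothesis gradL : forall x y, enorm (grad W x - grad W y) <= L * enorm (x - y).
Variable muin : probability 'rV[R]_d R.
Hypothesis muin_exp : forall r : R, 0 < r -> (\int[muin]_x (expR (r * enorm x))%:E < +oo)%E.
Local Notation path := (cpath d T).
Local Notation prob1 := (prob1 d T).
Local Notation Phi := (Phi T0 L0 gradL).
Local Notation forward := (forward T0 L0 gradL).
Local Notation backward := (backward T0 L0 gradL).
Context dS (S : measurableType dS) (PP : probability S R).
Variables (Z : S -> 'rV[R]_d) (B : {mfun S >-> path}).
Hypothesis ZB : initialised_bm muin PP Z B.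
Local Notation Q := (noise_law T0 ZB).
Local Notation Qexp := (noise_law_exp T0 muin_exp ZB).
Local Notation rate := (@rate R d T W muin).

(** Data processing along [forward P] and along [backward P], with P frozen in both maps: it acts
    there as a parameter, although it is also the law being transported. *)
Lemma rate_leP (P : prob1) (a : R) : (rate P <= a%:E)%E <-> entropy_le (Phi P) Q a.
Proof.
rewrite rate_rel_entropy rel_entropy_leP.
have mf A : measurable A -> measurable (forward P @^-1` A).
  move=> mA; rewrite -[X in measurable X]setTI.
  exact: (measurable_lipschitz_map (forward_lipschitz T0 L0 gradL P)).
have mb A : measurable A -> measurable (backward P @^-1` A).
  move=> mA; rewrite -[X in measurable X]setTI.
  exact: (measurable_lipschitz_map (backward_lipschitz T0 L0 gradL P)).
have fb A : backward P @^-1` (forward P @^-1` A) = A.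
  by apply/seteqP; split => x; rewrite /= backwardK.
have bf A : forward P @^-1` (backward P @^-1` A) = A.
  by apply/seteqP; split => x; rewrite /= forwardK.
have GQ A : measurable A -> Gamma W muin P A = Q (backward P @^-1` A).
  by move=> mA; rewrite (Gamma_law T0 L0 gradL ZB).
split.
  pose Y := mfun_of (measurable_lipschitz_map (forward_lipschitz T0 L0 gradL P)).
  apply: (entropy_le_map (Y := Y)); first by [].
  by move=> A mA; rewrite (_ : Y @^-1` A = forward P @^-1` A)// GQ ?fb//; exact: mf.
pose Y := mfun_of (measurable_lipschitz_map (backward_lipschitz T0 L0 gradL P)).
apply: (entropy_le_map (Y := Y)) => A mA; rewrite (_ : Y @^-1` A = backward P @^-1` A)//.
  by rewrite (_ : Phi P (backward P @^-1` A) = P (forward P @^-1` (backward P @^-1` A)))// bf.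
by rewrite GQ.
Qed.

Lemma entropy_W1_eq (P P' : prob1) a : W1 P P' = 0%E -> entropy_le P Q a -> entropy_le P' Q a.
Proof.
by move=> PP'; apply: entropy_le_ext => // A mA; exact: (W1_0_law T0 PP').
Qed.

Lemma rate_ge0 P : (0 <= rate P)%E.
Proof. by rewrite rate_rel_entropy rel_entropy_ge0. Qed.

(** The common core of compactness, lower semicontinuity and separation from closed sets: the laws
    p' of bounded rate have a limit, and the laws p, close to them after [Phi], share it by
    [Phi_expansive]. *)
Lemma rate_ultra_limit (X : Type) (p p' : X -> prob1) (a : R) (U : set_system X) :
  UltraFilter U -> U [set x | (rate (p' x) <= a%:E)%E] ->
  (forall e : R, 0 < e -> U [set x | (W1 (Phi (p x)) (Phi (p' x)) < e%:E)%E]) ->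
  exists2 P : prob1, (rate P <= a%:E)%E &
    forall e : R, 0 < e -> U [set x | (W1 P (p x) < e%:E)%E].
Proof.
move=> UU Up' close.
have UF : ProperFilter U := @ultra_proper _ _ UU.
have Uent : U [set x | entropy_le (Phi (p' x)) Q a].
  by apply: filterS Up' => x /=; rewrite rate_leP.
have [Q0 Q0a Q0lim] := ultra_W1_limit T0 Qexp UU Uent.
have [P PQ0] := Phi_surj T0 L0 gradL Q0.
exists P; first by rewrite rate_leP; apply: entropy_le_ext Q0a => // A mA; rewrite PQ0.
move=> e e0; set C := 4 * expR (lam d L * T).
have C0 : 0 < C by rewrite mulr_gt0// expR_gt0.
have e2 : 0 < e / C / 2 by rewrite !divr_gt0.
apply: filterS2 (close _ e2) (Q0lim _ e2) => x /= h1 h2.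
apply: le_lt_trans (Phi_expansive T0 L0 gradL P (p x)) _.
rewrite -/C -lte_pdivlMl//.
rewrite (@W1_ext _ _ _ (Phi P) _ Q0 (Phi (p x)))//.
apply: le_lt_trans (W1_triangle T0 (Q := Phi (p' x)) _ _ (@prob1_moment _ _ _ (Phi (p' x)))) _.
rewrite -EFinM mulrC [e / C]splitr EFinD; apply: lteD; rewrite W1_sym //.
Qed.

Lemma rate_sublevel_compact (a : R) : compact [set P | (rate P <= a%:E)%E].
Proof.
rewrite compact_ultra => F FU Fa.
have [|P Pa PF] := @rate_ultra_limit prob1 id id a F FU Fa.
  by move=> e e0; apply: filterE => P /=; rewrite W1_eq0// lte_fin.
exists P; split => // V /(nbhs_W1P T0)[e e0 eV].
by apply: filterS (PF e e0) => x /=; exact: eV.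
Qed.

Lemma W1_eq0_of_lt (P Q' : prob1) : (forall e : R, 0 < e -> (W1 P Q' < e%:E)%E) -> W1 P Q' = 0%E.
Proof.
move=> h; apply/eqP; rewrite eq_le W1_ge0 andbT; apply/lee_addgt0Pr => e e0.
by rewrite add0e ltW// h.
Qed.

(** A sequence of rate at most a approaching P produces a limit P' in the sublevel set, at distance
    0 from P but possibly distinct from it; the bound returns to P because the dual entropy only
    sees Borel sets. *)
Lemma rate_lsc : lower_semicontinuous rate.
Proof.
apply/lower_semicontinuousP => a; apply/W1_openP => P /= aP.
apply: contrapT => /forall2NP noball.
have /choice[p' p'P] : forall n, exists Q' : prob1,
    (W1 P Q' < (n.+1%:R^-1)%:E)%E /\ (rate Q' <= a%:E)%E.
  move=> n; have [|/existsNP[Q' /not_implyP[PQ' aQ']]] := noball n.+1%:R^-1.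
    by rewrite invr_gt0 ltr0n.
  exists Q'; split; first exact: PQ'.
  by rewrite leNgt; apply/negP; exact: aQ'.
have [U [UU oU]] := @ultraFilterLemma nat \oo _.
have UF : ProperFilter U := @ultra_proper _ _ UU.
have [||P' P'a P'P] := @rate_ultra_limit nat (fun=> P) p' a U UU.
- by apply: filterE => n; have [] := p'P n.
- move=> e e0; apply: oU; set C := 1 + 2 * expR (lam d L * T).
  have C0 : 0 < C by rewrite ltr_wpDr// mulr_ge0// expR_ge0.
  have [N] := ltr_add_invr (divr_gt0 e0 C0); rewrite add0r => Ne.
  exists N => // n /= Nn; apply: le_lt_trans (Phi_lip T0 L0 gradL P (p' n)) _.
  rewrite -/C -lte_pdivlMl// (lt_trans (p'P n).1)// -EFinM lte_fin mulrC (le_lt_trans _ Ne)//.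
  by rewrite lef_pV2 ?posrE ?ltr0n// ler_nat.
have {}P'P : W1 P' P = 0%E.
  by apply: W1_eq0_of_lt => e /P'P /filter_ex[].
move: aP; rewrite ltNge => /negP; apply; rewrite rate_leP.
have Phi0 : W1 (Phi P') (Phi P) = 0%E.
  apply/eqP; rewrite eq_le W1_ge0 andbT.
  by apply: le_trans (Phi_lip T0 L0 gradL P' P) _; rewrite P'P mule0.
by apply: (entropy_W1_eq Phi0); rewrite -rate_leP.
Qed.

Lemma rate_good : good_rate_function rate.
Proof.
split; [exact: rate_ge0|exact: rate_lsc|exact: rate_sublevel_compact].
Qed.

(** A closed set and a compact sublevel set that are disjoint lie at positive distance. It is
    measured after [Phi], the form in which [sanov_upper] takes it. *)
Lemma rate_sublevel_separated (F : set prob1) (a : R) : closed F ->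
  (forall P, F P -> (a%:E < rate P)%E) ->
  exists2 e : R, 0 < e & forall P P', F P -> (rate P' <= a%:E)%E ->
    (e%:E <= W1 (Phi P) (Phi P'))%E.
Proof.
move=> cF Fa; apply: contrapT => /forall2NP h.
have /choice[p pP] : forall n, exists q : prob1 * prob1, [/\ F q.1,
    (rate q.2 <= a%:E)%E & (W1 (Phi q.1) (Phi q.2) < (n.+1%:R^-1)%:E)%E].
  move=> n; have [|/existsNP[P /existsNP[P' /not_implyP[FP /not_implyP[P'a PP']]]]] :=
    h n.+1%:R^-1; first by rewrite invr_gt0 ltr0n.
  exists (P, P'); split; [exact: FP|exact: P'a|].
  by rewrite ltNge; apply/negP; exact: PP'.
have [U [UU oU]] := @ultraFilterLemma nat \oo _.
have UF : ProperFilter U := @ultra_proper _ _ UU.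
have [||P Pa PU] := @rate_ultra_limit nat (fun n => (p n).1) (fun n => (p n).2) a U UU.
- by apply: filterE => n; have [] := pP n.
- move=> e e0; apply: oU.
  have [N] := ltr_add_invr e0; rewrite add0r => Ne.
  exists N => // n /= Nn; have [_ _ /lt_le_trans] := pP n; apply.
  rewrite lee_fin (le_trans _ (ltW Ne))//.
  by rewrite lef_pV2 ?posrE ?ltr0n// ler_nat.
have nFP : ~ F P by move=> /Fa; rewrite ltNge Pa.
have /W1_openP /(_ P nFP)[e e0 eF] : open (~` F) by exact: closed_openC.
have /filter_ex[n /= /eF] := PU e e0; apply.
by have [] := pP n.
Qed.

End rate_function.

Section large_deviations.
Context (R : realType) (d : nat) (T : R).
Hypothesis T0 : 0 < T.
Variables (W : 'rV[R]_d -> R) (L : R).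
Hypothesis L0 : 0 <= L.
Hypothesis gradL : forall x y, enorm (grad W x - grad W y) <= L * enorm (x - y).
Variable muin : probability 'rV[R]_d R.
Hypothesis muin_exp : forall r : R, 0 < r -> (\int[muin]_x (expR (r * enorm x))%:E < +oo)%E.
Local Notation path := (cpath d T).
Local Notation prob1 := (prob1 d T).
Local Notation Phi := (Phi T0 L0 gradL).
Local Notation rate := (@rate R d T W muin).
Context (dS : nat -> measure_display) (S : forall n, measurableType (dS n)).
Variables (PP : forall n, probability (S n) R).
Variables (B X : forall n, 'I_n.+1 -> {mfun S n >-> path}).
Hypothesis PS : forall n, particle_system W (PP n) muin (@B n) (@X n).
(** The reference noise is that of the only particle of the first system; by [noise_path_law] every
    particle of every system has the same noise law. *)
Let ZB := particle_bm (PS 0%N) ord0.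
Local Notation Q := (noise_law T0 ZB).
Let Qexp l (l0 : 0 < l) := noise_law_exp T0 muin_exp ZB l0.
Let rateP := rate_leP T0 L0 gradL ZB.

Local Notation emp n := (fun w : S n => empirical_prob1 (fun i => X i w)).
Local Notation noise n := (particle_noise T0 (PS n)).

Lemma noise_iid n : iid Q (PP n) (noise n).
Proof.
move=> A mA; rewrite particle_noise_indep//; apply: eq_bigr => i _.
exact: (noise_path_law T0 (particle_bm (PS n) i) ZB).
Qed.

Lemma exceptional_set n : exists N : set (S n), [/\ measurable N, PP n N = 0%E &
  forall w, ~ N w -> forall P : probability path R,
    W1 (empirical (fun i => noise n i w)) P = W1 (Phi (emp n w)) P].
Proof.
have [N [mN N0 hN]] := Phi_empirical_particles T0 L0 gradL (PS n).
exists N; split => // w Nw P; apply: W1_ext => // A mA; apply/esym.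
by move: A mA; apply: contrapT => h; apply/Nw/hN.
Qed.

Lemma measurable_emp n U : open U -> measurable [set w | U (emp n w)].
Proof. exact: measurable_empirical. Qed.

Lemma rate_upper_bound (F : set prob1) : closed F ->
  (limn_esup (fun n => (n.+1%:R^-1)%:E * lne (PP n [set w | F (emp n w)])) <=
   - ereal_inf [set rate x | x in F])%E.
Proof.
move=> cF; rewrite leeNr; apply: lee_real_below => b bi.
rewrite leeNr -EFinN; apply: limn_esup_le_near.
have mF n : measurable [set w | F (emp n w)].
  rewrite (_ : [set w | _] = ~` [set w | (~` F) (emp n w)]); last first.
    by apply/seteqP; split => w /=; rewrite notK.
  by apply/measurableC/measurable_emp/closed_openC.
suff : \forall n \near \oo, (PP n [set w | F (emp n w)] <= (expR (n.+1%:R * - b))%:E)%E.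
  apply: filterS => n hn; apply: lne_scale_le => //; exact: measure_ge0.
(* For b < 0 the claim only says that a probability is at most 1; otherwise the level a below is
   nonnegative, as [sanov_upper] asks. *)
have [b0|b0] := ltP b 0.
  apply: filterE => n; apply: le_trans (probability_le1 _ (mF n)) _.
  by rewrite lee_fin -[leLHS]expR0 ler_expR mulr_ge0// oppr_ge0 ltW.
(* The margin a - b absorbs the polynomial factor of [sanov_upper]. *)
have [a [ba ai]] : exists a : R, b < a /\ (a%:E < ereal_inf [set rate x | x in F])%E.
  case: (ereal_inf _) bi => [i| |]//; last by exists (b + 1); rewrite ltrDl ltry.
  by rewrite lte_fin => bi; exists ((b + i) / 2); rewrite lte_fin; split; lra.
have a0 : 0 <= a by rewrite (le_trans b0)// ltW.
have Fa P : F P -> (a%:E < rate P)%E.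
  by move=> FP; apply: lt_le_trans ai _; apply: ereal_inf_lbound; exists P.
have [e e0 he] := rate_sublevel_separated T0 L0 gradL muin_exp ZB cF Fa.
have [m hm] := sanov_upper T0 Qexp a0 e0.
have ab0 : 0 < a - b by rewrite subr_gt0.
have := expR_dominates_pow m ab0; apply: filterS => n hn.
have [N [mN N0 hN]] := exceptional_set n.
have mFN : measurable ([set w | F (emp n w)] `\` N) by exact: measurableD.
apply: (@le_trans _ _ (PP n ([set w | F (emp n w)] `\` N) + PP n N)%E).
  apply: (@le_trans _ _ (PP n (([set w | F (emp n w)] `\` N) `|` N))); last exact: measureU2.
  apply: le_measure; rewrite ?inE//; first exact: measurableU.
  by move=> w Fw; have [Nw|Nw] := pselect (N w); [right|left].
rewrite N0 adde0.
have := hm n _ _ _ _ (@noise_iid n) _ mFN; move/(_ _)/le_trans; apply.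
  move=> w [Fw Nw] P Pa; rewrite hN//.
  (* [sanov_upper] ranges over laws of the noise and the separation over laws of the particles;
     surjectivity of [Phi] links the two. *)
  have [P' P'P] := Phi_surj T0 L0 gradL P.
  rewrite (@W1_ext _ _ _ _ P (Phi (emp n w)) (Phi P'))//; last first.
    by move=> A mA; rewrite P'P.
  apply: he => //; rewrite (rateP P' a); apply: entropy_le_ext Pa => // A mA.
  by rewrite P'P.
rewrite lee_fin; apply: (@le_trans _ _ (expR (n.+1%:R * (a - b)) * expR (- (n.+1%:R * a)))).
  by rewrite ler_wpM2r ?expR_ge0.
by rewrite -expRD mulrBr addrAC subrr add0r mulrN.
Qed.

Lemma rate_lower_bound (G : set prob1) : open G ->
  (- ereal_inf [set rate x | x in G] <=
   limn_einf (fun n => (n.+1%:R^-1)%:E * lne (PP n [set w | G (emp n w)])))%E.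
Proof.
move=> oG; rewrite leeNl; apply: le_ereal_inf_tmp => _ [P GP <-]; rewrite leeNl.
have r0 := rate_ge0 W muin P.
have [->|Poo] := eqVneq (rate P) +oo%E; first exact: leNye.
have [a Pa] : exists a : R, rate P = a%:E.
  by exists (fine (rate P)); rewrite fineK// ge0_fin_numE// ltey.
rewrite Pa -EFinN; apply: lee_real_below => b; rewrite lte_fin => ba.
apply: limn_einf_ge_near.
have f0 : 0 < - a - b by rewrite subr_gt0.
have /W1_openP /(_ P GP)[r rp hr] := oG.
set C := 4 * expR (lam d L * T).
have C0 : 0 < C by rewrite mulr_gt0// expR_gt0.
(* By [Phi_expansive], laws whose image lies within r / C of [Phi P] lie within r of P, hence in
   G. *)
have e0 : 0 < r / C by rewrite divr_gt0.
have Pent : entropy_le (Phi P) Q a by rewrite -rateP Pa.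
have := sanov_lower T0 Qexp Pent e0 f0; apply: filterS => n hn.
have [N [mN N0 hN]] := exceptional_set n.
have mG : measurable [set w | G (emp n w)] by exact: measurable_emp.
have mGN : measurable ([set w | G (emp n w)] `|` N) by exact: measurableU.
apply: lne_scale_ge => //.
apply: (@le_trans _ _ (PP n ([set w | G (emp n w)] `|` N))); last first.
  apply: (@le_trans _ _ (PP n [set w | G (emp n w)] + PP n N)%E).
    exact: measureU2.
  by rewrite N0 adde0.
have := hn _ _ _ _ (@noise_iid n) _ mGN; move/(_ _)/(le_trans _); apply.
  by rewrite lee_fin ler_expR -mulrN ler_pM2l ?ltr0n//; lra.
move=> w Pw; have [Nw|Nw] := pselect (N w); [by right|left].
apply: hr; apply: le_lt_trans (Phi_expansive T0 L0 gradL P (emp n w)) _.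
rewrite -/C -lte_pdivlMl// -EFinM mulrC W1_sym -hN//.
Qed.

End large_deviations.

Theorem theorem1p1 (R : realType) (d : nat) (T : R)
  (W : 'rV[R]_d -> R) (muin mufin : probability 'rV[R]_d R)
  (dS : nat -> measure_display)
  (S : forall n, measurableType (dS n))
  (PP : forall n, probability (S n) R)
  (B X : forall n, 'I_n.+1 -> {mfun S n >-> cpath d T}) :
  (1 <= d)%N -> 0 < T ->
  classC2 W ->
  (forall z, W z = W (- z)) ->
  (ereal_sup [set (`| (v *m hessian W z *m v^T) ord0 ord0 |)%:E |
      z in [set: 'rV[R]_d] & v in [set v : 'rV[R]_d | enorm v = 1%R]]
    < +oo)%E ->
  (\int[muin]_x (enorm x ^+ 2)%:E < +oo)%E ->
  (\int[mufin]_x (enorm x ^+ 2)%:E < +oo)%E ->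
  (free_energy W muin < +oo)%E ->
  (free_energy W mufin < +oo)%E ->
  (forall r : R, 0 < r -> (\int[muin]_x (expR (r * enorm x))%:E < +oo)%E) ->
  (forall n, particle_system W (PP n) muin (@B n) (@X n)) ->
  ldp (fun n => n.+1%:R) PP
    (fun n w => empirical_prob1 (fun i => X n i w)) (rate W muin)
  /\ good_rate_function (@rate R d T W muin).
Proof.
move=> _ T0 WC2 _ hess _ _ _ _ muin_exp PS.
have [L L0 gradL] := grad_lipschitz_of_hessian WC2 hess.
split; last exact: (rate_good T0 L0 gradL muin_exp (particle_bm (PS 0%N) ord0)).
split.
- by move=> n U oU; exact: measurable_empirical.
- by move=> F; exact: (rate_upper_bound T0 L0 gradL muin_exp PS).
- by move=> G; exact: (rate_lower_bound T0 L0 gradL muin_exp PS).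
Qed.
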